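(* Let $\rho=\{\rho_N\}$ be an appropriate sequence of probability measures ($\rho_N$ on $\mathbb{GT}_N$) with limit functions $F_\rho,Q_\rho$. Fix reals $0<a_1\le a_2\le\dots\le a_n=1$. For signatures $\lambda\in\mathbb{GT}_{k_1}$, $\mu\in\mathbb{GT}_{k_2}$, $k_1\ge k_2$, define nonnegative coefficients $\mathrm{pr}_{k_1\to k_2}(\lambda\to\mu)$ by $$\frac{s_\lambda(x_1,\dots,x_{k_2},1^{k_1-k_2})}{s_\lambda(1^{k_1})}=\sum_{\mu\in\mathbb{GT}_{k_2}}\mathrm{pr}_{k_1\to k_2}(\lambda\to\mu)\frac{s_\mu(x_1,\dots,x_{k_2})}{s_\mu(1^{k_2})}.$$ Consider the random tuple $(\lambda^{(1)},\dots,\lambda^{(n)})\in\mathbb{GT}_{[a_1N]}\times\dots\times\mathbb{GT}_{[a_nN]}$ with $$\mathrm{Prob}(\lambda^{(1)},\dots,\lambda^{(n)})=\rho_N(\lambda^{(n)})\prod_{i=1}^{n-1}\mathrm{pr}_{[a_{i+1}N]\to[a_iN]}(\lambda^{(i+1)}\to\lambda^{(i)}),$$ and set $p_k^{[a_tN]}=\sum_{i=1}^{[a_tN]}(\lambda^{(t)}_i+[a_tN]-i)^k$. Then the collection $\{N^{-k}(p_k^{[a_tN]}-\mathbf E p_k^{[a_tN]})\}_{t=1,\dots,n;\,k\ge1}$ converges, as $N\to\infty$, in the sense of moments to a centered Gaussian vector with covariance, for $1\le t_1\le t_2\le n$, $$\lim_{N\to\infty}\frac{\mathrm{cov}(p_{k_1}^{[a_{t_1}N]},p_{k_2}^{[a_{t_2}N]})}{N^{k_1+k_2}}=\frac{a_{t_1}^{k_1}a_{t_2}^{k_2}}{(2\pi\mathbf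 i)^2}\oint_{|z|=\epsilon}\oint_{|w|=2\epsilon}\Big(\frac1z+1+\frac{(1+z)F_\rho(1+z)}{a_{t_1}}\Big)^{k_1}\Big(\frac1w+1+\frac{(1+w)F_\rho(1+w)}{a_{t_2}}\Big)^{k_2}Q_\rho(z,w)\,dz\,dw,$$ with counter-clockwise contours and $\epsilon>0$ small.
   Context: A signature of length $N$ is $\lambda=(\lambda_1\ge\dots\ge\lambda_N)\in\mathbb Z^N$; $\mathbb{GT}_N$ is the set of these; $s_\lambda$ denotes the Schur function $\det[x_i^{\lambda_j+N-j}]/\prod_{i<j}(x_i-x_j)$; $[\cdot]$ is the integer part. Schur generating function of a probability measure $\rho$ on $\mathbb{GT}_N$: $S_\rho(x)=\sum_\lambda\rho(\lambda)s_\lambda(x)/s_\lambda(1^N)$, assumed uniformly convergent near $(1^N)$. A sequence of symmetric functions $\{F_N\}$ is appropriate if there are reals $c_k,d_{k,l}$ with: $\log F_N$ holomorphic near $(1^N)$; $\lim N^{-1}\partial_i^k\log F_N|_{(1^N)}=c_k$ for fixed $i$; $\lim\partial_i^k\partial_j^l\log F_N|_{(1^N)}=d_{k,l}$ for fixed distinct $i,j$; $\lim\partial_{i_1}\cdots\partial_{i_s}\log F_N|_{(1^N)}=0$ whenever the fixed indices $i_1,\dots,i_s$ contain at least three distinct values; and $\sum_k\frac{c_k}{(k-1)!}(x-1)^{k-1}$, $\sum_{k,l}\frac{d_{k,l}}{(k-1)!(l-1)!}(x-1)^{k-1}(y-1)^{l-1}$ converge near $1$, $(1,1)$. A sequence of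 measures is appropriate if its Schur generating functions are; then $F_\rho(x)=\sum_k\frac{c_k}{(k-1)!}(x-1)^{k-1}$, $G_\rho(x,y)=\sum_{k,l}\frac{d_{k,l}}{(k-1)!(l-1)!}(x-1)^{k-1}(y-1)^{l-1}$, $Q_\rho(x,y)=G_\rho(1+x,1+y)+(x-y)^{-2}$. *)

(* Defs.v *)
From Stdlib Require Import Reals ZArith List ClassicalEpsilon.
From Coquelicot Require Import Coquelicot.
Import ListNotations.

Open Scope R_scope.

Definition isGT (N : nat) (l : list Z) : Prop :=
  length l = N /\
  (forall i, (S i < N)%nat -> (nth (S i) l 0%Z <= nth i l 0%Z)%Z).

Definition sumR {T} (F : list T) (f : T -> R) : R :=
  fold_right (fun x acc => f x + acc) 0 F.

Definition sumC {T} (F : list T) (f : T -> C) : C :=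
  fold_right (fun x acc => (f x + acc)%C) (RtoC 0) F.

Definition sumCn (n : nat) (f : nat -> C) : C := sumC (List.seq 0 n) f.
Definition prodR {T} (F : list T) (f : T -> R) : R :=
  fold_right (fun x acc => f x * acc) 1 F.
Definition prodC {T} (F : list T) (f : T -> C) : C :=
  fold_right (fun x acc => (f x * acc)%C) (RtoC 1) F.

Definition has_sum_on {T} (P : T -> Prop) (f : T -> R) (v : R) : Prop :=
  forall eps, 0 < eps ->
    exists F0 : list T, NoDup F0 /\ List.Forall P F0 /\
      forall F1 : list T, NoDup F1 -> List.Forall P F1 -> List.incl F0 F1 ->
        Rabs (sumR F1 f - v) < eps.

(* The value of such a sum (meaningful when it converges). *)
Definition sum_on {T} (P : T -> Prop) (f : T -> R) : R :=
  epsilon (inhabits 0) (has_sum_on P f).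

Definition Cpowz (x : C) (z : Z) : C :=
  match z with
  | Zneg p => Cinv (Cpow x (Pos.to_nat p))
  | _ => Cpow x (Z.to_nat z)
  end.

Definition Cexp (z : C) : C :=
  (RtoC (exp (Re z)) * (cos (Im z), sin (Im z)))%C.

(* the point (1,1,1,...) ; coordinates are indexed 0,1,2,... *)
Definition ones : nat -> C := fun _ => RtoC 1.

Definition pad (k : nat) (x : nat -> C) : nat -> C :=
  fun i => if (i <? k)%nat then x i else RtoC 1.

Definition upd (x : nat -> C) (i : nat) (z : C) : nat -> C :=
  fun j => if Nat.eqb j i then z else x j.

Definition minor0 (j : nat) (M : nat -> nat -> C) : nat -> nat -> C :=
  fun r c => M (S r) (if (c <? j)%nat then c else S c).

Fixpoint det (n : nat) (M : nat -> nat -> C) : C :=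
  match n with
  | O => RtoC 1
  | S n' => sumCn n (fun j =>
        (RtoC ((-1) ^ j) * M 0%nat j * det n' (minor0 j M))%C)
  end.

(* det[x_i^{l_j + N - j}] / prod_{i<j} (x_i - x_j), N = length l,
   indices 1-based in the paper, 0-based here *)
Definition schur_ratio (l : list Z) (x : nat -> C) : C :=
  let N := length l in
  (det N (fun i j => Cpowz (x i) (nth j l 0%Z + Z.of_nat N - Z.of_nat (S j))%Z)
   / prodC (List.seq 0 N) (fun i =>
        prodC (List.seq (S i) (N - S i)) (fun j => (x i - x j)%C)))%C.

(* The Schur function s_l at x: the ratio above, understood as the
   (Laurent) polynomial it defines, i.e. its limit at x along points with
   pairwise distinct nonzero coordinates. *)
Definition schur_lim (l : list Z) (x : nat -> C) (v : C) : Prop :=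
  let N := length l in
  forall eps, 0 < eps -> exists delta, 0 < delta /\
    forall y : nat -> C,
      (forall i, (i < N)%nat -> Cmod (y i - x i) < delta) ->
      (forall i, (i < N)%nat -> y i <> RtoC 0) ->
      (forall i j, (i < j < N)%nat -> y i <> y j) ->
      Cmod (schur_ratio l y - v) < eps.

Definition schur (l : list Z) (x : nat -> C) : C :=
  epsilon (inhabits (RtoC 0)) (schur_lim l x).

Definition is_prob_GT (N : nat) (rho : list Z -> R) : Prop :=
  (forall l, isGT N l -> 0 <= rho l) /\ has_sum_on (isGT N) rho 1.

Definition nearN (N : nat) (r : R) (x : nat -> C) : Prop :=
  forall i, (i < N)%nat -> Cmod (x i - RtoC 1) < r.

Definition is_SGF (N : nat) (rho : list Z -> R) (S : (nat -> C) -> C) : Prop :=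
  exists r, 0 < r /\
    forall eps, 0 < eps ->
      exists F0 : list (list Z), NoDup F0 /\ List.Forall (isGT N) F0 /\
        forall F1, NoDup F1 -> List.Forall (isGT N) F1 -> List.incl F0 F1 ->
          forall x, nearN N r x ->
            Cmod (sumC F1 (fun l => (RtoC (rho l) * schur l x / schur l ones)%C)
                  - S x) < eps.

Definition ballN (N : nat) (r : R) (x : nat -> C) : Prop :=
  nearN N r x /\ forall i, (N <= i)%nat -> x i = RtoC 1.

(* f is holomorphic in the variables x_1..x_N on the polydisc ballN N r:
   continuous there and complex differentiable in each variable separately
   (Osgood's lemma: this is holomorphy). *)
Definition holo_on (N : nat) (r : R) (f : (nat -> C) -> C) : Prop :=
  forall x, ballN N r x ->
    (forall eps, 0 < eps -> exists delta, 0 < delta /\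
       forall y, ballN N r y -> (forall i, (i < N)%nat -> Cmod (y i - x i) < delta) ->
         Cmod (f y - f x) < eps) /\
    (forall i, (i < N)%nat -> exists l : C,
        @is_derive C_AbsRing C_NormedModule (fun z => f (upd x i z)) (x i) l).

Definition cpart (i : nat) (f : (nat -> C) -> C) : (nat -> C) -> C :=
  fun x => epsilon (inhabits (RtoC 0))
    (fun l => @is_derive C_AbsRing C_NormedModule (fun z => f (upd x i z)) (x i) l).

Fixpoint dpart (idx : list nat) (f : (nat -> C) -> C) : (nat -> C) -> C :=
  match idx with
  | [] => f
  | i :: idx' => cpart i (dpart idx' f)
  end.

Definition cv_C (u : nat -> C) (l : C) : Prop :=
  forall eps, 0 < eps -> exists N0, forall N, (N0 <= N)%nat -> Cmod (u N - l) < eps.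

Definition three_distinct (idx : list nat) : Prop :=
  exists i j k, In i idx /\ In j idx /\ In k idx /\ i <> j /\ j <> k /\ i <> k.

(* the coefficient of (x-1)^j in sum_{k>=1} c_k/(k-1)! (x-1)^{k-1} *)
Definition Fterm (c : nat -> R) (x : C) (j : nat) : C :=
  (RtoC (c (S j) / INR (fact j)) * Cpow (x - RtoC 1) j)%C.

Definition Gterm (d : nat -> nat -> R) (x y : C) (j l : nat) : C :=
  (RtoC (d (S j) (S l) / (INR (fact j) * INR (fact l)))
     * Cpow (x - RtoC 1) j * Cpow (y - RtoC 1) l)%C.

Definition appropriate (F : nat -> (nat -> C) -> C) (c : nat -> R)
    (d : nat -> nat -> R) : Prop :=
  exists L : nat -> (nat -> C) -> C,
    (forall N, exists r, 0 < r /\ holo_on N r (L N) /\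
        forall x, ballN N r x -> Cexp (L N x) = F N x) /\
    (forall i k, (1 <= k)%nat ->
        cv_C (fun N => (RtoC (/ INR N) * dpart (repeat i k) (L N) ones)%C)
             (RtoC (c k))) /\
    (forall i j k l, i <> j -> (1 <= k)%nat -> (1 <= l)%nat ->
        cv_C (fun N => dpart (repeat i k ++ repeat j l) (L N) ones)
             (RtoC (d k l))) /\
    (forall idx, three_distinct idx ->
        cv_C (fun N => dpart idx (L N) ones) (RtoC 0)) /\
    (exists r, 0 < r /\ forall x : C, Cmod (x - RtoC 1) < r ->
        ex_series (Fterm c x)) /\
    (exists r, 0 < r /\ forall x y : C,
        Cmod (x - RtoC 1) < r -> Cmod (y - RtoC 1) < r ->
        (forall j, ex_series (fun l => Cmod (Gterm d x y j l))) /\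
        ex_series (fun j => Series (fun l => Cmod (Gterm d x y j l)))).

Definition Csum_series (a : nat -> C) : C :=
  epsilon (inhabits (RtoC 0)) (fun v => is_series a v).

Definition F_rho (c : nat -> R) (x : C) : C := Csum_series (Fterm c x).

Definition G_rho (d : nat -> nat -> R) (x y : C) : C :=
  Csum_series (fun j => Csum_series (fun l => Gterm d x y j l)).

Definition Q_rho (d : nat -> nat -> R) (z w : C) : C :=
  (G_rho d (RtoC 1 + z) (RtoC 1 + w) + Cinv (Cpow (z - w) 2))%C.

Definition CRInt (f : R -> C) (a b : R) : C :=
  (RtoC (RInt (fun t => Re (f t)) a b) + Ci * RtoC (RInt (fun t => Im (f t)) a b))%C.

Definition circle_int (r : R) (g : C -> C) : C :=
  CRInt (fun th => let z := (RtoC r * (cos th, sin th))%C in (g z * (Ci * z))%C)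
        0 (2 * PI).

Definition lvl (a : nat -> R) (N t : nat) : nat :=
  Z.to_nat (Int_part (a t * INR N)).

Definition lev (Lam : list (list Z)) (t : nat) : list Z := nth (t - 1) Lam [].

Definition valid_tuple (n : nat) (a : nat -> R) (N : nat) (Lam : list (list Z)) : Prop :=
  length Lam = n /\ forall t, (1 <= t <= n)%nat -> isGT (lvl a N t) (lev Lam t).

Definition tuple_prob (n : nat) (a : nat -> R) (N : nat) (rho : nat -> list Z -> R)
    (pr : nat -> nat -> list Z -> list Z -> R) (Lam : list (list Z)) : R :=
  rho N (lev Lam n) *
  prodR (List.seq 1 (n - 1)) (fun i =>
     pr (lvl a N (S i)) (lvl a N i) (lev Lam (S i)) (lev Lam i)).

Definition psum (k : nat) (l : list Z) : R :=
  let m := length l in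
  sumR (List.seq 0 m) (fun i => (IZR (nth i l 0%Z) + INR m - INR (S i)) ^ k).

Definition Etup n a N rho pr (f : list (list Z) -> R) : R :=
  sum_on (valid_tuple n a N) (fun Lam => tuple_prob n a N rho pr Lam * f Lam).

Definition Xnorm n a N rho pr (t k : nat) (Lam : list (list Z)) : R :=
  / (INR N ^ k) *
  (psum k (lev Lam t) - Etup n a N rho pr (fun L' => psum k (lev L' t))).

Definition pr_spec (pr : nat -> nat -> list Z -> list Z -> R) : Prop :=
  forall k1 k2 l, (k2 <= k1)%nat -> isGT k1 l ->
    exists S : list (list Z), NoDup S /\ List.Forall (isGT k2) S /\
      (forall mu, isGT k2 mu -> ~ In mu S -> pr k1 k2 l mu = 0) /\
      forall x : nat -> C, (forall i, (i < k2)%nat -> x i <> RtoC 0) ->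
        (schur l (pad k2 x) / schur l ones)%C =
        sumC S (fun mu => (RtoC (pr k1 k2 l mu) * schur mu x / schur mu ones)%C).

Definition remove_nth {T} (j : nat) (l : list T) : list T :=
  firstn j l ++ skipn (S j) l.

(* sum over perfect matchings of the list of products of covariances *)
Fixpoint wick_aux (fuel : nat) (cv : nat * nat -> nat * nat -> R)
    (J : list (nat * nat)) : R :=
  match J with
  | [] => 1
  | x :: rest =>
    match fuel with
    | O => 0
    | S f => sumR (List.seq 0 (length rest)) (fun j =>
               cv x (nth j rest (0%nat, 0%nat)) * wick_aux f cv (remove_nth j rest))
    end
  end.

Definition wick (cv : nat * nat -> nat * nat -> R) (J : list (nat * nat)) : R :=
  wick_aux (length J) cv J.

Definition cov_formula (a : nat -> R) (c : nat -> R) (d : nat -> nat -> R)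
    (t1 k1 t2 k2 : nat) (eps : R) : C :=
  (RtoC (a t1 ^ k1 * a t2 ^ k2) / Cpow (RtoC 2 * RtoC PI * Ci) 2 *
   circle_int eps (fun z =>
     circle_int (2 * eps) (fun w =>
       Cpow (Cinv z + RtoC 1 + (RtoC 1 + z) * F_rho c (RtoC 1 + z) / RtoC (a t1)) k1 *
       Cpow (Cinv w + RtoC 1 + (RtoC 1 + w) * F_rho c (RtoC 1 + w) / RtoC (a t2)) k2 *
       Q_rho d z w)))%C.

(* Main.v *)
(* Multiplied by the Vandermonde product, a Schur function is an eigenvector of
  [sum_i x_i^k d_i^k], the eigenvalue being the falling power sum of the shifted
  parts.  Applying these operators, conjugated by the Vandermonde product, to the
  germ at (1,...,1) of the generating function therefore produces the joint
  moments; a lower level is reached by setting the last variables to 1, because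
  the coefficients [pr] describe exactly this restriction of Schur functions.
  In the power sums of the [x_i - 1] the germ is [exp] of a series whose
  coefficients converge by appropriateness.  In these variables each operator,
  centred and divided by [N^k], converges to
  [sum_b lin_b X_b + sum_b psi_b d/dX_b], and products of such operators evaluated
  at 0 satisfy the recursion over perfect matchings.  The covariance is thus an
  explicit polynomial in finitely many Taylor coefficients of [F] and [G]; it
  equals the double contour integral by truncating the two series, which turns
  the integrand into a Laurent polynomial. *)
From Stdlib Require Reals ZArith List Lia Lra ClassicalEpsilon FunctionalExtensionality Permutation.
From Coquelicot Require Coquelicot.
Require Defs.
From HB Require structures.
From mathcomp Require all_boot all_order all_algebra fingroup perm Rstruct mpoly.
From mathcomp Require ring lra zify.

(** All germs are polynomials in [x_i - 1] known up to a fixed order; an operator of degree [k]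
    costs [k] orders, and the Vandermonde factor is homogeneous, so it can be divided out exactly.
    The order is fixed in advance as twice the total degree of the moment plus 2: summing a moment
    over tuples requires absolute convergence, obtained by comparing [|y|] with [1 + y^2], so the
    doubled word has to be within reach. A signature may have negative parts; it is encoded by
    naturals [a] and a shift [m], and [x^(a-m)] is expanded with a truncated inverse of [x]. The
    sums over signatures are infinite. Convergence of the generating function at [(t,1,...,1)] and
    [(1/t,1,...,1)] with [t > 1] bounds exponential moments of the largest absolute part, and this
    single estimate justifies all termwise differentiations and the finiteness of all moments.
    Ordinary powers are combined from falling powers with Stirling numbers; only the leading one
    survives the scaling. In the kernel, [1/(z-w)^2] comes from the Vandermonde product, the other
    part from the logarithm of the germ. *)

Module Germs.
Import structures all_boot all_order all_algebra fingroup perm mpoly.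
Import mathcomp.algebra_tactics.ring mathcomp.algebra_tactics.lra mathcomp.zify.zify.
Import Order.TTheory GRing.Theory Num.Theory.
Set Implicit Arguments. Unset Strict Implicit. Unset Printing Implicit Defensive.
Local Open Scope ring_scope.

Ltac bigr := apply: eq_bigr.

(** * Polynomials modulo an order of vanishing at the origin *)

Section Vanish.
Variables (K : numFieldType) (n : nat).
Implicit Types p q : {mpoly K[n]}.

(** Membership in the [d]-th power of the ideal of the origin; [eqm] is the congruence modulo it.
    The order stays a parameter of the relation, because differential operators lower it. *)
Definition vanish (d : nat) p := forall m, (mdeg m < d)%N -> p@_m = 0.
Definition eqm d p q := vanish d (p - q).

Lemma vanish0 d : vanish d 0. by move=> m _; rewrite mcoeff0. Qed.
Lemma vanish00 p : vanish 0 p. by []. Qed.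
Lemma vanishD d p q : vanish d p -> vanish d q -> vanish d (p + q).
by move=> hp hq m hm; rewrite mcoeffD hp // hq // addr0. Qed.
Lemma vanishN d p : vanish d p -> vanish d (- p).
by move=> hp m hm; rewrite mcoeffN hp // oppr0. Qed.
Lemma vanishW d e p : (e <= d)%N -> vanish d p -> vanish e p.
by move=> h hp m hm; apply: hp; apply: leq_trans h. Qed.
Lemma vanish_sum d (I : Type) (r : seq I) (P : pred I) (F : I -> {mpoly K[n]}) :
 (forall i, P i -> vanish d (F i)) -> vanish d (\sum_(i <- r | P i) F i).
move=> h; elim/big_rec: _ => [|i x Pi hx]; first exact: vanish0.
by apply: vanishD => //; apply: h.
Qed.
Lemma vanishM d e p q : vanish d p -> vanish e q -> vanish (d + e) (p * q).
move=> hp hq m hm; rewrite mcoeffM big1 // => k /eqP km.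
have gen (a b : 'X_{1..n}) : m = (a + b)%MM -> p@_a * q@_b = 0; last exact: gen.
move=> mab; have [h|h] := ltnP (mdeg a) d; first by rewrite hp // mul0r.
rewrite hq ?mulr0 //; move: hm; rewrite mab mdegD => hm. lia.
Qed.
Lemma vanishMl d p q : vanish d q -> vanish d (p * q).
by move=> h; rewrite -[d]add0n; apply: vanishM. Qed.
Lemma vanishMr d p q : vanish d p -> vanish d (p * q).
by rewrite mulrC; apply: vanishMl. Qed.
Lemma vanishZ d (c : K) p : vanish d p -> vanish d (c *: p).
by rewrite -mul_mpolyC; apply: vanishMl. Qed.
Lemma vanishMn d p k : vanish d p -> vanish d (p *+ k).
rewrite -mulr_natl; apply: vanishMl. Qed.
Lemma vanish_exp d p k : vanish d p -> vanish (k * d) (p ^+ k).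
move=> h; elim: k => [|k IH]; first exact: vanish00.
by rewrite exprS; apply: vanishM.
Qed.
Lemma vanish_deriv d p i : vanish d.+1 p -> vanish d p^`M(i).
move=> h m hm; rewrite mcoeff_deriv h ?mul0rn //.
by rewrite mdegD mdeg1 addn1.
Qed.
Lemma vanishX d i : (d <= 1)%N -> vanish d ('X_i : {mpoly K[n]}).
case: d => [|[|//]] _ m //; rewrite ltnS => /eqP h.
rewrite mcoeffX; case: eqP => // e; by move: h; rewrite -e mdeg1.
Qed.
(** A coefficient of positive degree is seen, up to a positive integer factor, in the partial
    derivative along any variable that occurs in its monomial; characteristic 0 removes the
    factor. *)
Lemma vanish_derivs d p : p@_0%MM = 0 -> (forall i, vanish d p^`M(i)) -> vanish d.+1 p.
move=> h0 h m hm; case: (boolP (m == 0%MM)) => [/eqP->//|].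
rewrite -mdeg_eq0 => hd.
have [i hi] : exists i, (0 < m i)%N.
 apply/existsP; apply: contraR hd; rewrite negb_exists => /forallP hall.
 rewrite mdegE big1 // => i _; by move: (hall i); rewrite -eqn0Ngt => /eqP.
have hU : (m = (m - U_(i)) + U_(i))%MM.
 by rewrite submK //; apply/mnm_lepP => j; rewrite mnm1E; case: eqP => // <-.
have := h i (m - U_(i))%MM; rewrite mcoeff_deriv -hU => /(_ _)/eqP.
rewrite -mulr_natr mulf_eq0 pnatr_eq0 orbF => hh; apply/eqP/hh.
by move: hm; rewrite {1}hU mdegD mdeg1 addn1.
Qed.

Lemma eqm_refl d p : eqm d p p. by rewrite /eqm subrr; apply: vanish0. Qed.
Lemma eqm_sym d p q : eqm d p q -> eqm d q p.
by rewrite /eqm -opprB => h; rewrite -[_ - _]opprK; apply: vanishN. Qed.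
Lemma eqm_trans d q p r : eqm d p q -> eqm d q r -> eqm d p r.
by move=> h1 h2; rewrite /eqm -(subrK q p) -addrA; apply: vanishD. Qed.
Lemma eqmW d e p q : (e <= d)%N -> eqm d p q -> eqm e p q.
apply: vanishW. Qed.
Lemma eqmD d p p' q q' : eqm d p p' -> eqm d q q' -> eqm d (p + q) (p' + q').
rewrite /eqm opprD addrACA; apply: vanishD. Qed.
Lemma eqmN d p p' : eqm d p p' -> eqm d (- p) (- p').
rewrite /eqm -opprD; apply: vanishN. Qed.
Lemma eqmB d p p' q q' : eqm d p p' -> eqm d q q' -> eqm d (p - q) (p' - q').
by move=> h1 h2; apply: eqmD => //; apply: eqmN. Qed.
Lemma eqmM d p p' q q' : eqm d p p' -> eqm d q q' -> eqm d (p * q) (p' * q').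
move=> h1 h2; rewrite /eqm.
have -> : p * q - p' * q' = (p - p') * q + p' * (q - q') by ring.
by apply: vanishD; [apply: vanishMr|apply: vanishMl].
Qed.
Lemma eqmMl d p q q' : eqm d q q' -> eqm d (p * q) (p * q').
apply: eqmM => //; apply: eqm_refl. Qed.
Lemma eqmMr d p q q' : eqm d q q' -> eqm d (q * p) (q' * p).
by move=> h; apply: eqmM => //; apply: eqm_refl. Qed.
Lemma eqmZ d c p q : eqm d p q -> eqm d (c *: p) (c *: q).
by rewrite /eqm -scalerBr; apply: vanishZ. Qed.
Lemma eqmMn d p q k : eqm d p q -> eqm d (p *+ k) (q *+ k).
by rewrite /eqm -mulrnBl; apply: vanishMn. Qed.
Lemma eqm_deriv d p q i : eqm d.+1 p q -> eqm d p^`M(i) q^`M(i).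
by rewrite /eqm -mderivB; apply: vanish_deriv. Qed.
Lemma eqm_sum d (I : Type) (r : seq I) (P : pred I) (F G : I -> {mpoly K[n]}) :
 (forall i, P i -> eqm d (F i) (G i)) ->
 eqm d (\sum_(i <- r | P i) F i) (\sum_(i <- r | P i) G i).
rewrite /eqm -sumrB; apply: vanish_sum. Qed.
Lemma eqm_coef d p q m : eqm d p q -> (mdeg m < d)%N -> p@_m = q@_m.
by move=> h /h; rewrite mcoeffB => /eqP; rewrite subr_eq0 => /eqP. Qed.
Lemma eqm_eq d p q : p = q -> eqm d p q. by move=> ->; apply: eqm_refl. Qed.

Lemma mcoeff_pihomog e p m : (pihomog mdeg e p)@_m = if mdeg m == e then p@_m else 0.
rewrite raddf_sum /=.
have [me|me] := eqVneq (mdeg m) e; last first.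
 rewrite big1 // => m' /eqP me'; rewrite mcoeffZ mcoeffX.
 by have [e1|_] := eqVneq m' m; [move: me; rewrite -e1 me' eqxx|rewrite mulr0].
have [hm|hm] := boolP (m \in msupp p).
 rewrite (big_rem m) //= -me eqxx mcoeffZ mcoeffX eqxx mulr1.
 rewrite big_seq_cond big1 ?addr0 // => m' /andP[hm' _]; rewrite mcoeffZ mcoeffX.
 by move: hm'; rewrite (mem_rem_uniq m (msupp_uniq p)) => /andP[/negPf-> _]; rewrite mulr0.
rewrite (memN_msupp_eq0 hm) big_seq_cond big1 // => m' /andP[hm' _]; rewrite mcoeffZ mcoeffX.
by case: eqP hm' hm => [-> ->|]; rewrite ?mulr0.
Qed.

(** Multiplication by a homogeneous [V] carries the component of degree [e] to the one of degree
    [v + e], and there are no zero divisors. This is how the Vandermonde factor is divided out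
    without loss of order. *)
Lemma vanish_cancel (v d : nat) (V p : {mpoly K[n]}) :
 V \is v.-homog -> V != 0 -> vanish (d + v) (V * p) -> vanish d p.
move=> hV V0 h m hm; set e := mdeg m.
suff h0 : pihomog mdeg e p = 0 by have := mcoeff_pihomog e p m; rewrite h0 eqxx mcoeff0.
apply: (mulfI V0); rewrite mulr0.
have -> : V * pihomog mdeg e p = pihomog mdeg (v + e) (V * p).
 set k := maxn (mmeasure mdeg p) e.+1.
 have hp : p = \sum_(d < k) pihomog mdeg d p by apply: pihomog_partitionE; apply: leq_maxl.
 rewrite [in RHS]hp [V * \sum__ _]mulr_sumr.
 rewrite (raddf_sum (pihomog mdeg (v + e))).
 have ek : (e < k)%N by rewrite leq_maxr.
 rewrite (bigD1 (Ordinal ek)) //= (@pihomog_dE _ _ _ _ (V * _)); last first.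
  by apply: (dhomogM hV); apply: pihomogP.
 rewrite big1 ?addr0 // => i ie.
 rewrite (@pihomog_ne0 _ _ _ (v + i)%N) //; last exact: dhomogM hV (pihomogP _ _ _).
 by rewrite eqn_add2l; apply: contraNneq ie => ie; apply/eqP/val_inj.
apply/mpolyP => m'; rewrite mcoeff_pihomog mcoeff0; case: eqP => // hm'.
by apply: h; rewrite hm' addnC ltn_add2r.
Qed.
End Vanish.

(** * Partial fractions of the derivatives of a polynomial with simple roots *)

Lemma derivn_XsubC_mul (R : comNzRingType) (a : R) (p : {poly R}) m :
 (('X - a%:P) * p)^`(m.+1) = ('X - a%:P) * p^`(m.+1) + p^`(m) *+ m.+1.
elim: m => [|m IH]; first by rewrite derivn1 derivM derivXsubC mul1r addrC.
rewrite derivnS IH derivD derivM derivXsubC mul1r derivMn.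
by rewrite addrAC addrC addrC.
Qed.

(* [kk p m n] is the coefficient of [z^(-n-1)] in [Pi^(m+1)/Pi], where
  [Pi = prod_i (z - y_i)] has power sums [p]. *)
Fixpoint kk (R : pzRingType) (p : nat -> R) (m n : nat) : R :=
 if m is m'.+1 then \sum_(b < n) kk p m' b * p (n.-1 - b)%N - (kk p m' n.-1) *+ n
 else p n.

Section Lagrange.
Variables (F : fieldType) (M : nat) (y : 'I_M -> F).
Hypothesis y_inj : injective y.

Definition nodepoly : {poly F} := \prod_(i < M) ('X - (y i)%:P).
Definition copoly (i : 'I_M) : {poly F} := \prod_(k < M | k != i) ('X - (y k)%:P).

Lemma nodepolyE i : nodepoly = ('X - (y i)%:P) * copoly i.
by rewrite /nodepoly (bigD1 i). Qed.

Lemma copoly_neq0 i : (copoly i).[y i] != 0.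
rewrite horner_prod; apply/prodf_neq0 => k ki.
by rewrite hornerXsubC subr_eq0; apply: contra ki => /eqP/y_inj->.
Qed.

Lemma copoly_eq0 i j : j != i -> (copoly i).[y j] = 0.
by move=> ji; rewrite /copoly (bigD1 j) //= hornerM hornerXsubC subrr mul0r. Qed.

Lemma size_copoly i : size (copoly i) = M.
rewrite /copoly -big_filter size_prod_XsubC -cardE.
by have := cardC1 i; rewrite card_ord => ->; case: (M) i => [[]|].
Qed.

Lemma deriv_nodepoly i : nodepoly^`().[y i] = (copoly i).[y i].
by rewrite (nodepolyE i) derivM derivXsubC mul1r hornerD hornerM hornerXsubC subrr mul0r addr0.
Qed.

Lemma lagrange_interp (p : {poly F}) : (size p <= M)%N ->
 p = \sum_(i < M) (p.[y i] / nodepoly^`().[y i]) *: copoly i.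
move=> sp; apply/eqP; rewrite -subr_eq0; apply/eqP.
apply: (@roots_geq_poly_eq0 _ _ (codom y)).
- apply/allP => x /codomP[j ->]; rewrite /root hornerD hornerN horner_sum (bigD1 j) //=.
 rewrite big1 ?addr0 => [|i ij]; rewrite hornerZ.
  by rewrite deriv_nodepoly divfK ?copoly_neq0 // subrr.
 by rewrite copoly_eq0 ?mulr0 // eq_sym.
- by rewrite map_inj_uniq // enum_uniq.
rewrite size_codom card_ord (leq_trans (size_polyD _ _)) // geq_max sp size_polyN.
apply: (leq_trans (size_sum _ _ _)); apply/bigmax_leqP => i _.
by rewrite (leq_trans (size_scale_leq _ _)) // size_copoly.
Qed.

Lemma deriv_prod_log (I : finType) (P : pred I) (f : I -> {poly F}) (x : F) :
 (forall i, P i -> (f i).[x] != 0) ->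
 (\prod_(i | P i) f i)^`().[x] =
 (\prod_(i | P i) f i).[x] * \sum_(i | P i) (f i)^`().[x] / (f i).[x].
move=> h; suff [//] : (\prod_(i | P i) f i)^`().[x] =
 (\prod_(i | P i) f i).[x] * \sum_(i | P i) (f i)^`().[x] / (f i).[x] /\
 (\prod_(i | P i) f i).[x] != 0.
elim/big_ind2: _ => [|a s b t [ha a0] [hb b0]|i Pi].
- by rewrite derivC !hornerC mulr0 oner_eq0.
- rewrite derivM hornerD !hornerM ha hb mulf_neq0 //; split => //; ring.
- by rewrite mulrCA divff ?mulr1 ?h.
Qed.

(** The [r i] are the residues of [p / Pi]. Differentiating the interpolation formula at [y_j], the
    term [i = j] contributes [r j] times the sum of the inverse differences, and each other term
    contributes its own [r i / (y_j - y_i)]. *)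
Lemma lagrange_deriv (p : {poly F}) (j : 'I_M) : (size p <= M)%N ->
 let r i := p.[y i] / nodepoly^`().[y i] in
 p^`().[y j] / nodepoly^`().[y j] = \sum_(i < M | i != j) (r i + r j) / (y j - y i).
move=> sp r.
have yij i : i != j -> y j - y i != 0.
 by move=> ij; rewrite subr_eq0; apply: contra ij => /eqP/y_inj->.
have d0 := copoly_neq0 j.
rewrite (lagrange_interp sp) raddf_sum horner_sum mulr_suml (bigD1 j) //= -/(r j) derivZ hornerZ deriv_nodepoly.
have -> : (copoly j)^`().[y j] = (copoly j).[y j] * \sum_(i < M | i != j) (y j - y i)^-1.
 rewrite /copoly deriv_prod_log => [|k kj].
  congr (_ * _); bigr => i ij.
  by rewrite derivXsubC hornerC hornerXsubC mul1r.
 by rewrite hornerXsubC yij.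
rewrite mulrA mulrAC // mulr_sumr -big_split /=.
bigr => i ij; rewrite -/(r i) derivZ hornerZ.
have -> : (copoly i)^`().[y j] = (copoly j).[y j] / (y j - y i).
 have ji : j != i by rewrite eq_sym.
 rewrite /copoly (bigD1 j) //= derivM derivXsubC mul1r hornerD hornerM hornerXsubC subrr mul0r addr0.
 rewrite /copoly [X in _ = X.[_] / _](bigD1 i) //= hornerM hornerXsubC mulrAC divff ?yij // mul1r.
 by congr (_.[_]); apply: eq_bigl => k; rewrite andbC.
have yj := yij i ij; field; apply/andP; split=> //.
Qed.

(** Induction on [k]: symmetrising [lagrange_deriv] in [i] and [j] produces
    [(y_i^n - y_j^n)/(y_i - y_j)], a sum of [n] monomials. Adding the diagonal [i = j] completes it
    to products of sums, and the diagonal taken away again is the second term in the recursion of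
    [kk]. *)
Lemma kk_residues k n :
 kk (fun m => \sum_(i < M) y i ^+ m) k n =
 \sum_(i < M) y i ^+ n * (nodepoly^`(k.+1).[y i] / nodepoly^`().[y i]).
pose r k i := nodepoly^`(k.+1).[y i] / nodepoly^`().[y i].
have sP k' : (size nodepoly^`(k'.+1) <= M)%N.
 have sP0 : (size nodepoly <= M.+1)%N by rewrite /nodepoly -big_enum size_prod_XsubC -cardE card_ord.
 elim: k' => [|k' IH].
  have [->|P0] := eqVneq nodepoly 0; first by rewrite derivn1 deriv0 size_poly0.
  by rewrite -ltnS (leq_trans (lt_size_deriv P0)).
 by rewrite (leq_trans (size_poly _ _)) // (leq_trans (leq_pred _)).
have yij i j : j != i -> y i - y j != 0.
 by move=> ij; rewrite subr_eq0; apply: contra ij => /eqP/y_inj->.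
elim: k n => [|k IH] n.
 bigr => i _; rewrite /r divff ?mulr1 //.
 by rewrite deriv_nodepoly copoly_neq0.
have rS i : r k.+1 i = \sum_(j < M | j != i) (r k j + r k i) / (y i - y j).
 by rewrite /r derivnS; apply: lagrange_deriv.
rewrite /= IH; under eq_bigr => b _ do rewrite IH.
have -> : \sum_(i < M) y i ^+ n * r k.+1 i =
 \sum_(i < M) \sum_(j < M | j != i) r k i * ((y i ^+ n - y j ^+ n) / (y i - y j)).
 transitivity (\sum_(i < M) \sum_(j < M | j != i) (r k i * (y i ^+ n / (y i - y j)))
   + \sum_(i < M) \sum_(j < M | j != i) (r k j * (y i ^+ n / (y i - y j)))).
  rewrite -big_split; bigr => i _; rewrite rS mulr_sumr -big_split.
  by bigr => j _; rewrite mulrDl mulrDr addrC !(mulrCA (y i ^+ n)).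
 rewrite [X in _ + X](exchange_big_dep predT) //=.
 rewrite -big_split /=; bigr => i _.
 rewrite [X in _ + X](eq_bigl (fun j => j != i)) => [|j]; last by rewrite eq_sym.
 rewrite -big_split /=; bigr => j ij.
 rewrite -mulrDr; congr _; rewrite mulrBl; congr _.
 by rewrite -(opprB (y i)) invrN mulrN.
transitivity (\sum_(i < M) \sum_(j < M | j != i) \sum_(b < n)
  r k i * (y i ^+ b * y j ^+ (n.-1 - b))); last first.
 bigr => i _; bigr => j ij; rewrite -mulr_sumr; congr (_ * _).
 rewrite subrXX mulrAC divff ?yij // mul1r.
 case: n => [|n]; first by rewrite !big_ord0.
 rewrite (reindex_inj rev_ord_inj) /=; bigr => b _.
 congr (_ * _ ^+ _); have := ltn_ord b; lia.
apply/eqP; rewrite subr_eq; apply/eqP.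
rewrite -sumrMnl -big_split.
under eq_bigr => b _ do rewrite big_distrlr.
rewrite exchange_big; bigr => i _.
rewrite exchange_big (bigD1 i) //= addrC; congr (_ + _).
 bigr => j _; bigr => b _.
 by rewrite [RHS]mulrA (mulrC (r k i)).
transitivity (\sum_(b < n) y i ^+ n.-1 * r k i).
 bigr => b _; rewrite mulrAC -exprD.
 by congr (_ ^+ _ * _); have := ltn_ord b; lia.
by rewrite sumr_const card_ord.
Qed.
End Lagrange.

(** * Derivatives of the Vandermonde product *)

Section Vandermonde.
Variables (K : numFieldType) (N : nat).
Notation A := {mpoly K[N.+1]}.

(** This is [x_i - 1]. Indices are naturals sent through [inord], so that all levels [M <= N.+1]
    live in one ring. *)
Definition Y (i : nat) : A := 'X_(inord i).
Definition dY (i : nat) : A -> A := mderiv (inord i).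
Definition VM (M : nat) : A := \prod_(i < M) \prod_(j < M | (i < j)%N) (Y i - Y j).
Definition psY (M : nat) (n : nat) : A := \sum_(i < M) Y i ^+ n.

Lemma dYM i p q : dY i (p * q) = dY i p * q + p * dY i q.
exact: mderivM. Qed.
HB.instance Definition _ i := GRing.Linear.copy (dY i) (mderiv (inord i)).
Lemma dYY i j : (i <= N)%N -> (j <= N)%N -> dY i (Y j) = (i == j)%:R.
move=> hi hj; rewrite /dY mderivX mnm1E -val_eqE /= !inordK // eq_sym.
case: eqP => [->|_]; rewrite ?scale0r //.
have -> : (U_(inord j) - U_(inord j))%MM = 0%MM :> 'X_{1..N.+1} by apply/mnmP => k; rewrite mnmBE subnn mnm0E.
by rewrite mpolyX0 scale1r.
Qed.
Lemma dYX i (p : A) n : dY i (p ^+ n) = (p ^+ n.-1 * dY i p) *+ n.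
case: n => [|n]; first by rewrite /dY mderivC.
elim: n => [|n IH]; first by rewrite mul1r.
by rewrite exprS dYM IH mulrnAr mulrA -exprS mulrC.
Qed.
Lemma dY1 i : dY i 1 = 0. exact: mderivC. Qed.
Lemma dY_prod0 i (I : Type) (r : seq I) (P : pred I) (f : I -> A) :
 (forall j, P j -> dY i (f j) = 0) -> dY i (\prod_(j <- r | P j) f j) = 0.
move=> h; elim/big_rec: _ => [|j x Pj hx]; first exact: dY1.
by rewrite dYM h // hx mul0r mulr0 addr0.
Qed.

(** For polynomials of this kind in an auxiliary variable, evaluation at [Y i] turns [dY i] into the
    formal derivative; see [dfree_horner]. *)
Definition dfree i (p : {poly A}) := forall k, dY i p`_k = 0.
Lemma dfreeM i p q : dfree i p -> dfree i q -> dfree i (p * q).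
move=> hp hq k; rewrite coefM raddf_sum /= big1 // => j _.
by rewrite dYM hp hq mul0r mulr0 addr0.
Qed.
Lemma dfree_deriv i p : dfree i p -> dfree i p^`().
by move=> hp k; rewrite coef_deriv raddfMn /= hp mul0rn. Qed.
Lemma dfree_derivn i p m : dfree i p -> dfree i p^`(m).
by move=> hp; elim: m => // m IH; apply: dfree_deriv. Qed.
Lemma dfree_horner i p : (i <= N)%N -> dfree i p -> dY i p.[Y i] = p^`().[Y i].
move=> hi; elim/poly_ind: p => [|p c IH] hp.
 by rewrite deriv0 !horner0 /dY mderiv0.
have hc : dY i c = 0 by have := hp 0%N; rewrite coefD coefMX coefC add0r.
have {}hp : dfree i p by move=> k; have := hp k.+1; rewrite coefD coefMX coefC addr0.
rewrite derivD derivM derivX derivC addr0 mulr1 hornerD hornerM hornerX hornerC.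
by rewrite raddfD /= dYM IH // hc dYY // eqxx mulr1 addr0 hornerD hornerM hornerX.
Qed.

Lemma iter_dY_free i c p m : (i <= N)%N -> dfree i p -> dY i c = 0 ->
 iter m (dY i) (c * p.[Y i]) = c * p^`(m).[Y i].
move=> hi hp hc; elim: m => // m IH.
rewrite iterS IH dYM hc mul0r add0r dfree_horner //; exact: dfree_derivn.
Qed.

Definition othersY (M i : nat) : {poly A} := \prod_(j < M | (j : nat) != i) ('X - (Y j)%:P).

Lemma dfree_XsubY i j : (i <= N)%N -> (j <= N)%N -> j != i -> dfree i ('X - (Y j)%:P).
move=> hi hj ji [|[|k]]; rewrite coefB coefX coefC.
- by rewrite sub0r raddfN /= dYY // eq_sym (negPf ji) oppr0.
- by rewrite subr0; apply: dY1.
- by rewrite subr0; apply: mderiv0.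
Qed.

Lemma dfree_othersY M i : (M <= N.+1)%N -> (i < M)%N -> dfree i (othersY M i).
move=> hM hi; rewrite /othersY; elim/big_rec: _ => [|j p ji hp].
 by move=> k; rewrite coefC; case: eqP => _; [apply: dY1|apply: mderiv0].
by apply: dfreeM => //; apply: dfree_XsubY => //; rewrite -ltnS; apply: leq_trans hM.
Qed.

(** A pair containing [i] contributes [Y i - Y j] up to sign; the signs and the pairs without [i]
    form a factor that [dY i] kills. *)
Lemma VM_split M i : (M <= N.+1)%N -> (i < M)%N ->
 exists2 c, dY i c = 0 & VM M = c * (othersY M i).[Y i].
move=> hM hi; set io := Ordinal hi.
have yN (j : 'I_M) : (j <= N)%N by rewrite -ltnS (leq_trans (ltn_ord j)).
have iN : (i <= N)%N := yN io.
pose c1 : A := \prod_(a < M | a != io) (if (a < i)%N then -1 else 1).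
pose c2 : A := \prod_(a < M | a != io) \prod_(b < M | (a < b)%N && (b != io)) (Y a - Y b).
exists (c1 * c2).
 rewrite dYM [dY i c1]dY_prod0 ?[dY i c2]dY_prod0 ?mulr0 ?mul0r ?addr0 //.
  move=> a ai; apply: dY_prod0 => b /andP[_ bi].
  rewrite raddfB /= !dYY //; move: ai bi; rewrite -!val_eqE /= ![_ == i]eq_sym.
  by move=> /negPf-> /negPf->; rewrite subrr.
 by move=> a _; case: ifP => _; rewrite ?raddfN /= dY1 ?oppr0.
have -> : (othersY M i).[Y i] = \prod_(a < M | a != io) (Y i - Y a).
 rewrite horner_prod; apply: eq_big => [a|a _]; first by [].
 by rewrite hornerXsubC.
rewrite /VM (bigD1 io) //= mulrAC -big_split /= big_mkcond /=.
rewrite [X in _ = X * _]big_mkcond [X in _ = _ * X]big_mkcond /=.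
have -> : \prod_(a < M | a != io) \prod_(b < M | (a < b)%N) (Y a - Y b) =
 (\prod_(a < M | (a < i)%N) (Y a - Y i)) * c2.
 rewrite /c2 big_mkcond [X in _ = X * _]big_mkcond [X in _ = _ * X]big_mkcond -big_split /=.
 bigr => a _; case: (boolP (a == io)) => [/eqP->|ai] /=; first by rewrite ltnn mulr1.
 case: ifP => hai; last first.
  rewrite mul1r; apply: eq_bigl => b; case: (eqVneq b) => [->|]; rewrite ?andbF ?andbT //=.
 by rewrite (bigD1 io).
rewrite -[X in _ = _ * X]big_mkcond -/c2 mulrA; congr (_ * _).
rewrite -!big_mkcond /=.
rewrite [X in X * _]big_mkcond [X in _ * X]big_mkcond [RHS]big_mkcond -big_split /=.
bigr => a _; rewrite -val_eqE /=.
case: ltngtP => h; rewrite ?mulr1 ?mul1r //=; last by rewrite mulN1r opprB.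
Qed.

Lemma Y_inj M : (M <= N.+1)%N -> injective (fun i : 'I_M => Y i).
move=> hM i j /(congr1 (dY i)).
have yN (k : 'I_M) : (k <= N)%N by rewrite -ltnS (leq_trans (ltn_ord k)).
rewrite !dYY // eqxx; case: eqP => [/val_inj//|_] /eqP; by rewrite oner_eq0.
Qed.

Lemma VM_neq0 M : (M <= N.+1)%N -> VM M != 0.
move=> hM; apply/prodf_neq0 => i _; apply/prodf_neq0 => j ij.
rewrite subr_eq0; apply: contraTN ij => /eqP/(Y_inj hM)->; lia.
Qed.

(* Derivatives of the Vandermonde product are resummed through the partial
  fraction expansion of [Pi^(m+1)/Pi]. *)
Lemma vandermonde_deriv_sum M m n : (M <= N.+1)%N ->
 (\sum_(i < M) Y i ^+ n * iter m (dY i) (VM M)) *+ m.+1 = VM M * kk (psY M) m n.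
move=> hM; pose F := {fraction A}.
have yN (k : 'I_M) : (k <= N)%N by rewrite -ltnS (leq_trans (ltn_ord k)).
pose y (i : 'I_M) : F := tofrac (Y i).
have y_inj : injective y by move=> i j /eqP; rewrite tofrac_eq => /eqP/(Y_inj hM).
pose P := nodepoly y.
pose r k i := P^`(k.+1).[y i] / P^`().[y i].
have cop i : copoly y i = map_poly (@tofrac A) (othersY M i).
 rewrite rmorph_prod; apply: eq_big => [k|k _]; first by [].
 by rewrite rmorphB /= map_polyX map_polyC.
(* Leibniz on [X - y_i] times the copolynomial gives [Pi^(k+1)(y_i) = (k+1) copoly^(k)(y_i)], which
   up to the factor free of [Y i] is the [k]-th derivative of the Vandermonde product. *)
have rV k i : tofrac (VM M) * r k i = tofrac (iter k (dY i) (VM M) *+ k.+1).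
 have [c hc VE] := VM_split hM (ltn_ord i).
 rewrite /r deriv_nodepoly /P (nodepolyE y i) derivn_XsubC_mul.
 rewrite hornerD hornerM hornerXsubC subrr mul0r add0r hornerMn.
 rewrite VE iter_dY_free //; last exact: dfree_othersY.
 have e q : tofrac q.[Y i] = (map_poly (@tofrac A) q).[y i] by rewrite horner_map.
 rewrite rmorphMn !rmorphM /= !e -derivn_map -cop mulrnAl.
 have := copoly_neq0 y_inj i; set a := (copoly _ _).[_]; move=> a0.
 by rewrite mulrnAr; congr _; rewrite -mulrA [a * _]mulrC divfK.
have kE k n' : tofrac (kk (psY M) k n') = \sum_(i < M) y i ^+ n' * r k i.
 rewrite -kk_residues //.
 have pE n1 : tofrac (psY M n1) = \sum_(i < M) y i ^+ n1.
  by rewrite rmorph_sum; bigr => i _; rewrite rmorphXn.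
 elim: k n' => [|k IH] n'; first exact: pE.
 rewrite rmorphB rmorphMn rmorph_sum /= IH; congr (_ - _).
 by bigr => b _; rewrite rmorphM /= IH pE.
apply/eqP; rewrite -tofrac_eq rmorphM /= kE mulr_sumr rmorphMn rmorph_sum -sumrMnl.
apply/eqP; bigr => i _.
by rewrite mulrCA rV rmorphM rmorphXn rmorphMn mulrnAr.
Qed.

Lemma VM_homog M : (M <= N.+1)%N -> exists v, VM M \is v.-homog.
move=> hM.
have h I s (P : pred I) f :
 (forall i, P i -> exists v, f i \is v.-homog) -> exists v, \prod_(i <- s | P i) f i \is v.-homog.
 move=> hf; elim/big_rec: _ => [|i x Pi [v hv]]; first by exists 0%N; apply: dhomog1.
 by have [w hw] := hf i Pi; exists (w + v)%N; apply: dhomogM.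
apply: (h) => i _; apply: (h) => j _; exists 1%N.
by apply: rpredB; rewrite dhomogX /= mdeg1.
Qed.
End Vandermonde.

Lemma mpoly_alg_ind (K : comNzRingType) n (P : {mpoly K[n]} -> Prop) :
 (forall c, P c%:MP) -> (forall i, P 'X_i) ->
 (forall p q, P p -> P q -> P (p + q)) -> (forall p q, P p -> P q -> P (p * q)) ->
 forall p, P p.
move=> hC hX hD hM p; rewrite [p]mpolyE; elim/big_rec: _ => [|m x _ hx].
 by rewrite -mpolyC0.
apply: (hD) => //; rewrite -mul_mpolyC; apply: (hM) => //.
rewrite mpolyXE_id; elim/big_rec: _ => [|i y _ hy]; first by rewrite -mpolyC1.
apply: (hM _) => //; elim: (m i) => [|k IH]; first by rewrite expr0 -mpolyC1.
by rewrite exprS; apply: (hM).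
Qed.

(** * The differential operators in power-sum variables *)

Section Intertwine.
Variables (K : numFieldType) (N D : nat).
Notation A := {mpoly K[N.+1]}.
Notation B := {mpoly K[D]}.
Notation Y := (Y K N).
Notation psY := (psY K N).
Notation VM := (VM K N).

(** The operator [sum_i x_i^k d_i^k] in the coordinates [x_i = 1 + Y i]; on monomials it acts
    through falling factorials of the exponents. *)
Definition DD (M k : nat) (f : A) : A := \sum_(i < M) (1 + Y i) ^+ k * iter k (dY i) f.

(** The variable ['X_i] of [B] stands for the power sum of degree [i + 1] of the first [M]
    variables. The ring [B] depends neither on [N] nor on [M], so limits can be taken in it. *)
Definition phi (M : nat) : B -> A := comp_mpoly [tuple psY M i.+1 | i < D].
HB.instance Definition _ M := GRing.RMorphism.copy (phi M) (comp_mpoly [tuple psY M i.+1 | i < D]).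

Lemma phiX M (i : 'I_D) : phi M 'X_i = psY M i.+1.
by rewrite /phi comp_mpolyXU -tnth_nth tnth_mktuple. Qed.
Lemma phiC M c : phi M c%:MP = c%:MP.
exact: comp_mpolyC. Qed.
Lemma phiZ M c p : phi M (c *: p) = c *: phi M p.
by rewrite -!mul_mpolyC rmorphM /= phiC. Qed.

Lemma dY_psY M i n : (M <= N.+1)%N -> (i < M)%N -> dY i (psY M n) = (Y i ^+ n.-1) *+ n.
move=> hM hi; have iN : (i <= N)%N by rewrite -ltnS (leq_trans hi).
rewrite raddf_sum (bigD1 (Ordinal hi)) //= dYX dYY // eqxx mulr1 big1 ?addr0 // => j; rewrite -val_eqE => ji.
have jN : (j <= N)%N by rewrite -ltnS (leq_trans (ltn_ord j)).
by rewrite dYX dYY // eq_sym (negPf ji) mulr0 mul0rn.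
Qed.

Lemma dY_phi M i (P : B) : (M <= N.+1)%N -> (i < M)%N ->
 dY i (phi M P) = \sum_(b < D) (Y i ^+ b * phi M P^`M(b)) *+ b.+1.
move=> hM hi; elim/mpoly_alg_ind: P => [c|j|p q hp hq|p q hp hq].
- rewrite phiC /dY mderivC big1 // => b _; by rewrite mderivC rmorph0 mulr0 mul0rn.
- rewrite phiX dY_psY // (bigD1 j) //= big1 ?addr0 => [|b bj].
  by rewrite mderivX mnm1E eqxx scale1r (_ : (_ - _)%MM = 0%MM) ?mpolyX0 ?rmorph1 ?mulr1 //;
   apply/mnmP => k; rewrite mnmBE subnn mnm0E.
 by rewrite mderivX mnm1E eq_sym (negPf bj) scale0r rmorph0 mulr0 mul0rn.
- rewrite rmorphD raddfD /= hp hq -big_split; bigr => b _.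
 by rewrite mderivD rmorphD mulrDr mulrnDl.
- rewrite rmorphM dYM hp hq mulr_suml mulr_sumr -big_split /=; bigr => b _.
 rewrite mderivM rmorphD !rmorphM mulrnAl mulrnAr -mulrnDl; congr _.
 by rewrite mulrDr !mulrA [phi M p * Y _ ^+ _]mulrC.
Qed.

(** The power sum of degree [a] as an element of [B]: in degree 0 it is [al], the number of
    variables, and beyond degree [D] it is 0, which is correct modulo order [D.+1]. *)
Definition qv (al : B) (a : nat) : B :=
 if a is a'.+1 then (if insub a' is Some i then 'X_i else 0) else al.

Lemma vanish_Y i d : (d <= 1)%N -> vanish d (Y i).
exact: vanishX. Qed.
Lemma vanish_psY M a : vanish a (psY M a).
apply: vanish_sum => i _; rewrite -{1}[a]muln1; apply: vanish_exp.
exact: vanish_Y.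
Qed.

Lemma phi_qv M a : eqm D.+1 (phi M (qv M%:R a)) (psY M a).
case: a => [|a] /=.
 apply: eqm_eq; rewrite rmorph_nat /psY.
 by under eq_bigr => i _ do rewrite expr0; rewrite sumr_const card_ord.
case: insubP => [i _ <-|]; first by apply: eqm_eq; rewrite phiX.
rewrite -leqNgt => h; rewrite rmorph0; apply: eqm_sym; rewrite /eqm subr0.
by apply: (@vanishW _ _ a.+1) => //; apply: vanish_psY.
Qed.

Lemma phi_kk M m n : eqm D.+1 (phi M (kk (qv M%:R) m n)) (kk (psY M) m n).
elim: m n => [|m IH] n; first exact: phi_qv.
rewrite rmorphB rmorph_sum rmorphMn; apply: eqmB; last by apply: eqmMn; apply: IH.
by apply: eqm_sum => b _; rewrite rmorphM /=; apply: eqmM => //; apply: phi_qv.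
Qed.

(** A polynomial over [B] represents a function of [Y i] and of the power sums. This is its total
    derivative along [Y i]: the power sum of degree [b.+1] has derivative [b.+1] times the [b]-th
    power. *)
Definition Der (p : {poly B}) : {poly B} :=
 p^`() + \sum_(b < D) ('X^b * map_poly (mderiv b) p) *+ b.+1.

Lemma map_mderiv_MXaddC (b : 'I_D) (p : {poly B}) (c : B) :
 map_poly (mderiv b) (p * 'X + c%:P) = map_poly (mderiv b) p * 'X + (c^`M(b))%:P.
apply/polyP => k.
have hc q j : (map_poly (mderiv b) q)`_j = (q`_j : B)^`M(b).
 apply: coef_map_id0.
 apply: mderiv0.
rewrite hc [in LHS]coefD.
rewrite coefMX coefC coefD coefMX coefC.
case: k => [|k].
rewrite  !add0r.
by [].
by rewrite !addr0.
Qed.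

Lemma Der_MXaddC (p : {poly B}) (c : B) :
 Der (p * 'X + c%:P) = Der p * 'X + p + \sum_(b < D) ('X^b * (c^`M(b))%:P) *+ b.+1.
rewrite /Der derivD derivM derivX derivC addr0 mulr1 mulrDl -!addrA; congr (_ + _).
rewrite addrCA; congr (_ + _); rewrite mulr_suml -big_split; bigr => b _.
by rewrite map_mderiv_MXaddC mulrDr mulrA mulrnDl mulrnAl.
Qed.

(* [(gg L h n)] is [(d/dz + sum_b b z^(b-1) (d/dq_b + dL/dq_b))^n h]. *)
Fixpoint gg (L h : B) (n : nat) : {poly B} :=
 if n is n'.+1 then Der (gg L h n') + \sum_(b < D) ('X^b * ((L^`M(b))%:P * gg L h n')) *+ b.+1
 else h%:P.

Lemma size_gg L h n : (size (gg L h n) <= (n * D).+1)%N.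
elim: n => [|n IH]; first by rewrite size_polyC; case: (h == 0).
have hs (p : {poly B}) (b : 'I_D) : (size p <= (n * D).+1)%N -> (size ('X^b * p)%R <= (n.+1 * D).+1)%N.
 move=> hp; rewrite (leq_trans (size_polyMleq _ _)) // size_polyXn /=.
 by rewrite -addnS; apply: leq_add => //; apply: ltnW.
have hn (p : {poly B}) k : (size (p *+ k)%R <= size p)%N.
 by rewrite -scaler_nat size_scale_leq.
have hsum (F : 'I_D -> {poly B}) : (forall b, size (F b) <= (n * D).+1)%N ->
  (size (\sum_(b < D) ('X^b * F b) *+ b.+1)%R <= (n.+1 * D).+1)%N.
 move=> hF; apply: (leq_trans (size_sum _ _ _)); apply/bigmax_leqP => b _.
 by apply: leq_trans (hn _ _) _; apply: hs.
have hD (p q : {poly B}) s : (size p <= s)%N -> (size q <= s)%N -> (size (p + q)%R <= s)%N.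
 by move=> hp hq; rewrite (leq_trans (size_polyD _ _)) // geq_max hp.
rewrite /=; apply: (hD); first apply: hD.
- rewrite (leq_trans (size_poly _ _)) // (leq_trans (leq_pred _)) // (leq_trans IH) //.
 lia.
- by apply: hsum => b; apply: leq_trans (size_poly _ _) IH.
- apply: hsum => b; rewrite mul_polyC; exact: leq_trans (size_scale_leq _ _) IH.
Qed.

Lemma dY_horner_phi M i (p : {poly B}) : (M <= N.+1)%N -> (i < M)%N ->
 dY i (map_poly (phi M) p).[Y i] = (map_poly (phi M) (Der p)).[Y i].
move=> hM hi; have iN : (i <= N)%N by rewrite -ltnS (leq_trans hi).
elim/poly_ind: p => [|p c IH].
 rewrite /Der big1 ?addr0 ?raddf0 ?horner0 /dY ?mderiv0 // => b _.
 by rewrite raddf0 mulr0 mul0rn.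
rewrite Der_MXaddC !rmorphD !rmorphM /= !map_polyX !map_polyC !hornerD !hornerM !hornerX hornerC.
rewrite raddfD /= dYM IH dYY // eqxx mulr1 dY_phi //; congr (_ + _).
rewrite rmorph_sum horner_sum; bigr => b _.
by rewrite rmorphMn hornerMn rmorphM /= map_polyC map_polyXn hornerM hornerC hornerXn.
Qed.

(** [E] behaves like [exp L] under one derivative only modulo order [D], and every further
    derivative loses one order; hence the precision [D.+1 - n]. *)
Lemma iter_dY_conj M (E L h : B) i n : (M <= N.+1)%N -> (i < M)%N -> (n <= D.+1)%N ->
 eqm D (dY i (phi M E)) (phi M E * \sum_(b < D) (Y i ^+ b * phi M L^`M(b)) *+ b.+1) ->
 eqm (D.+1 - n) (iter n (dY i) (phi M (E * h))) (phi M E * (map_poly (phi M) (gg L h n)).[Y i]).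
move=> hM hi hn hE; elim: n hn => [|n IH] hn.
 by apply: eqm_eq; rewrite map_polyC hornerC rmorphM.
rewrite subSS; apply: (@eqm_trans _ _ _ (dY i (phi M E * (map_poly (phi M) (gg L h n)).[Y i]))).
 by apply: eqm_deriv; rewrite -subSn //; apply: IH; apply: ltnW.
rewrite dYM dY_horner_phi //.
have -> : map_poly (phi M) (gg L h n.+1) = map_poly (phi M) (Der (gg L h n)) +
  map_poly (phi M) (\sum_(b < D) ('X^b * ((L^`M(b))%:P * gg L h n)) *+ b.+1) by exact: rmorphD.
rewrite hornerD mulrDr.
rewrite addrC; apply: eqmD; first exact: eqm_refl.
rewrite rmorph_sum horner_sum.
have -> : \sum_(b < D) (map_poly (phi M) ('X^b * ((L^`M(b))%:P * gg L h n) *+ b.+1)).[Y i] =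
 (\sum_(b < D) (Y i ^+ b * phi M L^`M(b)) *+ b.+1) * (map_poly (phi M) (gg L h n)).[Y i].
 rewrite mulr_suml; bigr => b _.
 rewrite rmorphMn hornerMn !rmorphM /= map_polyC map_polyXn !hornerM hornerC hornerXn.
 by rewrite mulrnAl mulrA.
by rewrite mulrA; apply: eqmMr; apply: (eqmW _ hE); rewrite leq_subr.
Qed.

(** [DD] conjugated by the Vandermonde product and by [E], written in power sums. The index [m]
    counts the derivatives falling on the Vandermonde product, [e] expands [(1 + Y i)^k], and [c]
    runs over the powers of [Y i] in [gg], bounded by [size_gg]; the sum over [i] is then [kk]
    divided by [m.+1]. *)
Definition CC (al : B) (k : nat) (L h : B) : B :=
 \sum_(m < k.+1) ('C(k, m)%:R / m.+1%:R : K) *: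
  \sum_(e < k.+1) (\sum_(c < (k * D).+1) (gg L h (k - m))`_c * kk (qv al) m (c + e)) *+ 'C(k, e).

Lemma iter_dYM i k (p q : A) :
 iter k (dY i) (p * q) = \sum_(m < k.+1) (iter m (dY i) p * iter (k - m) (dY i) q) *+ 'C(k, m).
elim: k => [|k IH]; first by rewrite big_ord1.
rewrite iterS IH raddf_sum.
have -> : \sum_(m < k.+1) dY i (iter m (dY i) p * iter (k - m) (dY i) q *+ 'C(k, m)) =
 \sum_(m < k.+1) (iter m.+1 (dY i) p * iter (k - m) (dY i) q) *+ 'C(k, m) +
 \sum_(m < k.+1) (iter m (dY i) p * iter (k - m).+1 (dY i) q) *+ 'C(k, m).
 by rewrite -big_split; bigr => m _; rewrite raddfMn /= dYM mulrnDl.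
rewrite [RHS]big_ord_recl.
have -> : \sum_(m < k.+1) (iter (bump 0 m) (dY i) p * iter (k.+1 - bump 0 m) (dY i) q) *+ 'C(k.+1, bump 0 m)
 = \sum_(m < k.+1) (iter m.+1 (dY i) p * iter (k - m) (dY i) q) *+ 'C(k, m) +
 \sum_(m < k.+1) (iter m.+1 (dY i) p * iter (k - m) (dY i) q) *+ 'C(k, m.+1).
 rewrite -big_split; bigr => m _.
 by rewrite mulrnDr addrC.
rewrite addrCA; congr (_ + _); rewrite big_ord_recl !bin0 !subn0; congr (_ + _).
rewrite big_ord_recr /= bin_small ?addr0 //; bigr => m _.
by rewrite -(subnSK (ltn_ord m)).
Qed.

Lemma vanish_iter_dY i k d (p : A) : vanish d p -> vanish (d - k) (iter k (dY i) p).
elim: k => [|k IH] h; first by rewrite subn0.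
rewrite subnS; case E : (d - k)%N => [|e] //=.
by apply: vanish_deriv; rewrite -E; apply: IH.
Qed.

Lemma vanish_homog v (p : A) : p \is v.-homog -> vanish v p.
move=> /dhomogP h m hm; apply/eqP; apply: contraTT hm => hp.
by rewrite -leqNgt -(h m) // mcoeff_msupp.
Qed.

Lemma DD_vanish M k d p : vanish d p -> vanish (d - k) (DD M k p).
by move=> h; apply: vanish_sum => i _; apply: vanishMl; apply: vanish_iter_dY. Qed.

Lemma DDD M k p q : DD M k (p + q) = DD M k p + DD M k q.
rewrite -big_split /=; bigr => i _; rewrite -mulrDr; congr (_ * _).
by elim: k => //= k ->; rewrite raddfD.
Qed.
Lemma DDZ M k c p : DD M k (c *: p) = c *: DD M k p.
rewrite scaler_sumr; bigr => i _; rewrite scalerAr; congr (_ * _).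
by elim: k => //= k ->; rewrite linearZ.
Qed.
Lemma DD_eqm M k d p q : eqm d p q -> eqm (d - k) (DD M k p) (DD M k q).
by rewrite /eqm => /(@DD_vanish M k); rewrite DDD -scaleN1r DDZ scaleN1r.
Qed.

Lemma DD_intertwine M v k (E L h : B) : (M <= N.+1)%N -> (k <= D.+1)%N ->
 VM M \is v.-homog ->
 (forall i, (i < M)%N ->
  eqm D (dY i (phi M E)) (phi M E * \sum_(b < D) (Y i ^+ b * phi M L^`M(b)) *+ b.+1)) ->
 eqm (D.+1 - k + v) (DD M k (VM M * phi M (E * h)))
   (VM M * (phi M E * phi M (CC M%:R k L h))).
move=> hM hk hv hE.
pose G n : {poly A} := map_poly (phi M) (gg L h n).
have sG n : (n <= k)%N -> (size (G n) <= (k * D).+1)%N.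
 move=> nk; apply: leq_trans (size_poly _ _) (leq_trans (size_gg _ _ _) _).
 by rewrite ltnS leq_mul2r nk orbT.
pose S1 := \sum_(i < M) (1 + Y i) ^+ k * \sum_(m < k.+1)
 (iter m (dY i) (VM M) * (phi M E * (G (k - m)%N).[Y i])) *+ 'C(k, m).
apply: (@eqm_trans _ _ _ S1).
 apply: eqm_sum => i _; apply: eqmMl; rewrite iter_dYM; apply: eqm_sum => m _; apply: eqmMn.
 (* The [m]-th derivative of the Vandermonde product still vanishes to order [v - m], and the other
    factor is known to order [D.+1 - (k - m)]; the two orders add up to the claimed one. *)
 rewrite /eqm -mulrBr; apply: (@vanishW _ _ ((v - m) + (D.+1 - (k - m)))%N).
  by have := ltn_ord m; lia.
 apply: vanishM; first by apply: vanish_iter_dY; apply: vanish_homog.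
 apply: (iter_dY_conj _ hM (ltn_ord i)); last exact: hE.
 lia.
pose S2 := \sum_(m < k.+1) (\sum_(e < k.+1) \sum_(c < (k * D).+1)
  ((phi M E * (G (k - m)%N)`_c) * \sum_(i < M) Y i ^+ (c + e) * iter m (dY i) (VM M)) *+ 'C(k, e)) *+ 'C(k, m).
have -> : S1 = S2.
 rewrite /S1.
 under eq_bigr => i _ do rewrite mulr_sumr.
 rewrite exchange_big; bigr => m _.
 under eq_bigr => i _ do rewrite mulrnAr addrC exprDn mulr_suml.
 rewrite sumrMnl; congr (_ *+ _); rewrite exchange_big.
 have km : (k - m <= k)%N by apply: leq_subr.
 rewrite (reindex_inj rev_ord_inj); bigr => e _.
 have ek : (e <= k)%N by rewrite -ltnS.
 under eq_bigr => i _ do rewrite expr1n mulr1 subKn // mulrnAl (horner_coef_wide _ (sG _ km)) bin_sub //.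
 rewrite !sumrMnl; congr (_ *+ _).
 under eq_bigr => i _ do rewrite !mulr_sumr.
 rewrite exchange_big; bigr => c _.
 have gen (R : comNzRingType) (a w u g b : R) : a * (w * (u * (g * b))) = u * g * (b * a * w) by ring.
 by rewrite mulr_sumr; bigr => i _; rewrite exprD gen.
have star m n : \sum_(i < M) Y i ^+ n * iter m (dY i) (VM M) =
  (m.+1%:R)^-1 *: (VM M * kk (psY M) m n).
 rewrite -vandermonde_deriv_sum // -scaler_nat scalerA mulVf ?scale1r //.
 by rewrite pnatr_eq0.
rewrite rmorph_sum /= mulr_sumr mulr_sumr.
apply: eqm_sum => m _.
apply: (@eqm_trans _ _ _ ((\sum_(e < k.+1) \sum_(c < (k * D).+1)
  ((m.+1%:R)^-1 *: (VM M * (phi M E * phi M ((gg L h (k - m))`_c * kk (qv M%:R) m (c + e)))))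
   *+ 'C(k, e)) *+ 'C(k, m))).
 apply: eqmMn; apply: eqm_sum => e _; apply: eqm_sum => c _; apply: eqmMn.
 rewrite star -scalerAr; apply: eqmZ.
 rewrite mulrCA /eqm -mulrBr addnC; apply: vanishM; first exact: vanish_homog.
 rewrite rmorphM mulrA coef_map -mulrBr; apply: vanishMl.
 apply: (@eqmW _ _ D.+1); first lia.
 by apply: eqm_sym; apply: phi_kk.
apply: eqm_eq; rewrite phiZ -!scalerAr -scalerA scaler_nat; congr (_ *+ _).
rewrite rmorph_sum !mulr_sumr scaler_sumr; bigr => e _.
rewrite rmorphMn rmorph_sum sumrMnl !mulrnAr !mulr_sumr -scalerMnr scaler_sumr.
by [].
Qed.

(* One step of the moment computation: [f] is the germ at (1,...,1) of the
  generating function, [f'] the germ after applying the operator. *)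
Theorem step_germ M v k (E L h : B) (f f' : A) d : (M <= N.+1)%N -> (k <= d)%N -> (d <= D.+1)%N ->
 VM M \is v.-homog ->
 (forall i, (i < M)%N ->
  eqm D (dY i (phi M E)) (phi M E * \sum_(b < D) (Y i ^+ b * phi M L^`M(b)) *+ b.+1)) ->
 eqm d f (phi M E * phi M h) ->
 eqm (d - k + v) (VM M * f') (DD M k (VM M * f)) ->
 eqm (d - k) f' (phi M E * phi M (CC M%:R k L h)).
move=> hM kd dD hv hE hf hf'.
apply: (@vanish_cancel _ _ v _ (VM M)) => //; first exact: VM_neq0.
rewrite mulrBr; apply: (eqm_trans hf').
have h1 : eqm (d - k + v) (DD M k (VM M * f)) (DD M k (VM M * phi M (E * h))).
 apply: (@eqmW _ _ (d + v - k)); first lia.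
 apply: DD_eqm; rewrite /eqm -mulrBr addnC; apply: vanishM; first exact: vanish_homog.
 by rewrite rmorphM.
apply: (eqm_trans h1); apply: (eqmW _ (DD_intertwine h hM _ hv hE)); lia.
Qed.
End Intertwine.

(** * Gelfand-Tsetlin patterns and the bialternant formula *)

Section Branching.

Fixpoint prodseq (rs : seq (seq nat)) : seq (seq nat) :=
 if rs is r :: rs' then [seq m :: ms | m <- r, ms <- prodseq rs'] else [:: [::]].

(** Signatures are encoded by strictly decreasing shifted parts, for which interlacing with the row
    below reads [l_(j+1) <= m_j < l_j]. *)
Fixpoint ranges (l : seq nat) : seq (seq nat) :=
 if l is a :: l' then (if l' is b :: _ then iota b (a - b) :: ranges l' else [::]) else [::].

Definition below (l : seq nat) := prodseq (ranges l).

(** The weights of the Gelfand-Tsetlin patterns with top row [l], with multiplicity. The exponent of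
    the last variable is the difference of the sums of two consecutive rows; [M'] corrects for the
    shifts, which differ by one in each of the [M'] common positions. *)
Fixpoint gts (M : nat) (l : seq nat) : seq (seq nat) :=
 if M is M'.+1 then
  flatten [seq [seq rcons w (sumn l - sumn m - M')%N | w <- gts M' m] | m <- below l]
 else [:: [::]].

Lemma prod_sum_seq (R : comNzRingType) (rs : seq (seq nat)) (g : nat -> nat -> R) :
 \prod_(j < size rs) \sum_(m <- nth [::] rs j) g j m =
 \sum_(ms <- prodseq rs) \prod_(j < size rs) g j (nth 0%N ms j).
elim: rs g => [|r rs IH] g; first by rewrite big_ord0 big_seq1 big_ord0.
rewrite big_ord_recl (IH (fun j => g j.+1)) big_distrlr big_allpairs_dep.
by bigr => m _; bigr => ms _; rewrite big_ord_recl.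
Qed.

Lemma big_iota_ord (R : nmodType) (F : nat -> R) a d :
 \sum_(m <- iota a d) F m = \sum_(k < d) F (a + k)%N.
rewrite -(big_mkord xpredT (fun k => F (a + k)%N)) /index_iota subn0.
by rewrite -(big_map (addn a) xpredT F) -iotaDl addn0.
Qed.

Lemma size_ranges l : size (ranges l) = (size l).-1.
by elim: l => [|a [|b l] IH] //=; rewrite IH. Qed.

Lemma nth_ranges l j : (j.+1 < size l)%N ->
 nth [::] (ranges l) j = iota (nth 0%N l j.+1) (nth 0%N l j - nth 0%N l j.+1).
elim: l j => [|a [|b l] IH] [|j] //= h.
by rewrite IH.
Qed.

Lemma size_prodseq rs ms : ms \in prodseq rs -> size ms = size rs.
elim: rs ms => [|r rs IH] ms; first by rewrite inE => /eqP->.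
by move=> /allpairsP[[m ms'] /= [_ /IH <- ->]].
Qed.

Lemma prodseq_nth rs ms j : ms \in prodseq rs -> (j < size rs)%N ->
 nth 0%N ms j \in nth [::] rs j.
elim: rs ms j => [|r rs IH] ms j //.
move=> /allpairsP[[m ms'] [hm /IH h ->]]; case: j => [|j] //=; exact: h.
Qed.

Lemma size_below l (ms : seq nat) : ms \in below l -> size ms = (size l).-1.
by move/size_prodseq ->; rewrite size_ranges. Qed.

Lemma below_nth l (ms : seq nat) j : ms \in below l -> (j.+1 < size l)%N ->
 (nth 0 l j.+1 <= nth 0 ms j < nth 0 l j)%N.
move=> /prodseq_nth h hj; have := h j; rewrite size_ranges nth_ranges // mem_iota.
lia.
Qed.

Definition sdec (l : seq nat) := sorted gtn l.

Lemma sdec_nth l i j : sdec l -> (i < j < size l)%N -> (nth 0 l j < nth 0 l i)%N.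
move=> hl /andP[ij jl].
have tr : transitive gtn by move=> a b c h1 h2; apply: ltn_trans h2 h1.
exact: (sorted_ltn_nth tr 0%N hl i j (ltn_trans ij jl) jl ij).
Qed.

Lemma sdecP l : (forall j, (j.+1 < size l)%N -> (nth 0 l j.+1 < nth 0 l j)%N) -> sdec l.
by move=> h; apply/sortedP => i hi; apply: h.
Qed.

Lemma below_sdec l (ms : seq nat) : ms \in below l -> sdec ms.
move=> h; have sz := size_below h; apply: sdecP => j hj.
have /andP[_ h2] : (nth 0%N l j.+2 <= nth 0%N ms j.+1 < nth 0%N l j.+1)%N by apply: below_nth => //; lia.
have /andP[h1 _] : (nth 0%N l j.+1 <= nth 0%N ms j < nth 0%N l j)%N by apply: below_nth => //; lia.
exact: leq_trans h2 h1.
Qed.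

Variables (R : comNzRingType) (x : nat -> R).

(** The Schur polynomial as a sum over patterns, which makes sense where coordinates coincide as
    well. *)
Definition gtsum (M : nat) (l : seq nat) : R :=
 \sum_(w <- gts M l) \prod_(i < M) x i ^+ nth 0%N w i.

Definition altdet (M : nat) (l : seq nat) : R :=
 \det (\matrix_(i < M, j < M) x i ^+ nth 0%N l j).

Lemma size_gts M l w : w \in gts M l -> size w = M.
elim: M l w => [|M IH] l w; first by rewrite inE => /eqP->.
by move=> /flatten_mapP[m _ /mapP[w' /IH h ->]]; rewrite size_rcons h.
Qed.

Lemma gtsumS M l :
 gtsum M.+1 l = \sum_(m <- below l) gtsum M m * x M ^+ (sumn l - sumn m - M).
rewrite /gtsum big_flatten big_map; bigr => m _.
rewrite big_map mulr_suml; apply: eq_big_seq => w /size_gts hw.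
rewrite big_ord_recr /= nth_rcons hw ltnn eqxx; congr (_ * _).
by bigr => i _; rewrite nth_rcons hw ltn_ord.
Qed.

Lemma sum_below_iota l ms n : size l = n.+1 -> sdec l -> ms \in below l ->
 (\sum_(j < n) (nth 0 l j - (nth 0 ms j).+1) + nth 0 l n = sumn l - sumn ms - n)%N.
move=> sl hl h; have sm := size_below h; rewrite sl in sm.
have e1 : sumn l = (\sum_(j < n) nth 0 l j + nth 0 l n)%N.
 by rewrite sumnE (big_nth 0%N) sl big_nat_recr //= big_mkord.
have e2 : sumn ms = (\sum_(j < n) nth 0 ms j)%N.
 by rewrite sumnE (big_nth 0%N) sm big_mkord.
have e3 : (\sum_(j < n) (nth 0 l j - (nth 0 ms j).+1) + \sum_(j < n) nth 0 ms j + n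
  = \sum_(j < n) nth 0 l j)%N.
 rewrite -[X in (_ + X)%N](card_ord n) -sum1_card -!big_split /=; bigr => j _.
 by have := below_nth (j := j) h; have := ltn_ord j; lia.
lia.
Qed.

(** Subtract from each column the next one times the power of [t = x_n] that cancels the last row.
    The remaining minor has rows divisible by [x_i - t]; the quotients are geometric sums over the
    interlacing intervals, and multilinearity expands the determinant over the rows below [l]. *)
Lemma altdet_branch n l : size l = n.+1 -> sdec l ->
 altdet n.+1 l = (\prod_(i < n) (x i - x n)) *
  \sum_(m <- below l) x n ^+ (sumn l - sumn m - n) * altdet n m.
move=> sl hl; set t := x n.
pose U : 'M[R]_n.+1 := \matrix_(i, j)
 (if i == j then 1 else if (i == j.+1 :> nat) then - t ^+ (nth 0%N l j - nth 0%N l j.+1) else 0).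
have detU : \det U = 1.
 rewrite det_trig; first by rewrite big1 // => i _; rewrite mxE eqxx.
 apply/is_trig_mxP => i j ij; rewrite mxE; case: eqP => [e|_]; first by move: ij; rewrite e ltnn.
 by case: eqP => // e; move: ij; rewrite e ltnNge leqnSn.
pose A : 'M[R]_n.+1 := \matrix_(i, j) x i ^+ nth 0%N l j.
have AU i j : (A *m U) i j =
  if (j < n)%N then x i ^+ nth 0%N l j - x i ^+ nth 0%N l j.+1 * t ^+ (nth 0%N l j - nth 0%N l j.+1)
  else x i ^+ nth 0%N l j.
 rewrite mxE (bigD1 j) //= !mxE eqxx mulr1; case: ifP => hj; last first.
  rewrite big1 ?addr0 // => k kj; rewrite !mxE (negPf kj).
  by case: eqP => [e|_]; rewrite ?mulr0 //; have := ltn_ord k; lia.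
 have hj' : (j.+1 < n.+1)%N by [].
 rewrite (bigD1 (Ordinal hj')) /=; last by rewrite -val_eqE /=; lia.
 rewrite !mxE -val_eqE gtn_eqF // eqxx mulrN big1 ?addr0 // => k /andP[kj kj'].
 rewrite !mxE (negPf kj); case: eqP => [e|_]; rewrite ?mulr0 //.
 by case/eqP: kj'; apply: val_inj.
have -> : altdet n.+1 l = \det (A *m U) by rewrite det_mulmx detU mulr1.
rewrite (expand_det_row _ ord_max) (bigD1 ord_max) //= AU ltnn big1 ?addr0 => [|j jn]; last first.
 have hj : (j < n)%N by move: jn; rewrite -val_eqE /=; have := ltn_ord j; lia.
 rewrite AU hj -exprD subnKC ?subrr ?mul0r //.
 by apply: ltnW; apply: sdec_nth => //; rewrite sl ltnSn.
rewrite /cofactor addnn -signr_odd odd_double mul1r.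
have -> : row' ord_max (col' ord_max (A *m U)) =
  diag_mx (\row_(i < n) (x i - t)) *m \matrix_(i < n, j < n)
  \sum_(m <- nth [::] (ranges l) j) t ^+ (nth 0%N l j - m.+1) * x i ^+ m.
 apply/matrixP => i j; rewrite mul_diag_mx !mxE.
 rewrite -/(\sum_(m <- nth [::] (ranges l) j) t ^+ (nth 0%N l j - m.+1) * x i ^+ m).
 have := AU (lift ord_max i) (lift ord_max j); rewrite mxE => ->.
 rewrite !lift_max ltn_ord nth_ranges; last by rewrite sl ltnS.
 have lt : (nth 0 l j.+1 < nth 0 l j)%N by apply: sdec_nth => //; rewrite sl ltnSn /= ltnS.
 set a := nth 0%N l j.+1 in lt *; set b := nth 0%N l j in lt *.
 have -> : x i ^+ b = x i ^+ a * x i ^+ (b - a) by rewrite -exprD subnKC // ltnW.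
 rewrite -mulrBr subrXX mulrCA; congr (_ * _).
 rewrite big_iota_ord mulr_sumr (reindex_inj rev_ord_inj) /=.
 bigr => k _; rewrite mulrA -exprD mulrC; have := ltn_ord k => hk.
 by congr (t ^+ _ * x i ^+ _); lia.
rewrite det_mulmx det_diag mulrCA; congr (_ * _); first by bigr => i _; rewrite mxE.
rewrite -det_tr /determinant.
pose c ms := \prod_(j < n) t ^+ (nth 0%N l j - (nth 0%N ms j).+1).
have -> : \sum_(s : 'S_n) (-1) ^+ s * \prod_(i < n) (\matrix_(i, j) \sum_(m <- nth [::] (ranges l) j) t ^+ (nth 0%N l j - m.+1) * x i ^+ m)^T i (s i)
 = \sum_(ms <- below l) c ms * altdet n ms.
 rewrite /altdet; under [RHS]eq_bigr => ms _ do rewrite -det_tr mulr_sumr.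
 rewrite exchange_big; bigr => s _.
 (* [prod_sum_seq] takes functions of a natural index, so the permutation is extended by the default
    0 outside its domain. *)
 transitivity ((-1) ^+ s * \prod_(j < size (ranges l)) \sum_(m <- nth [::] (ranges l) j)
   (t ^+ (nth 0%N l j - m.+1) * x (if insub (j : nat) is Some j' then s j' else 0%N) ^+ m)).
  rewrite size_ranges sl; congr (_ * _); bigr => j _; rewrite !mxE.
  by bigr => m _; rewrite insubT // => h; congr (_ * x (s _) ^+ _); apply: val_inj.
 rewrite (prod_sum_seq _ (fun j m => t ^+ (nth 0%N l j - m.+1) * x (if insub j is Some j' then s j' else 0%N) ^+ m)).
 rewrite mulr_sumr size_ranges sl; bigr => ms _; rewrite mulrCA big_split.
 congr (_ * (_ * _)); bigr => j _; rewrite !mxE insubT // => h.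
 by congr (x (s _) ^+ _); apply: val_inj.
rewrite mulr_sumr; apply: eq_big_seq => ms hms; rewrite mulrA; congr _.
by rewrite -(sum_below_iota sl hl hms) /c prodrXr -exprD addnC.
Qed.

(** Bialternant formula: both sides obey the same recursion in the number of variables. *)
Theorem gtsum_altdet n l : size l = n -> sdec l ->
 (\prod_(i < n) \prod_(j < n | (i < j)%N) (x i - x j)) * gtsum n l = altdet n l.
elim: n l => [|n IH] l sl hl.
 by rewrite big_ord0 mul1r /gtsum big_seq1 big_ord0 /altdet det_mx00.
rewrite altdet_branch // gtsumS.
have -> : \prod_(i < n.+1) \prod_(j < n.+1 | (i < j)%N) (x i - x j) =
 (\prod_(i < n) (x i - x n)) * \prod_(i < n) \prod_(j < n | (i < j)%N) (x i - x j).
 rewrite big_ord_recr /= [X in _ * X]big1 ?mulr1 => [|j]; last by rewrite ltnNge -ltnS ltn_ord.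
 rewrite -big_split /=; bigr => i _.
 by rewrite big_mkcond big_ord_recr ltn_ord -big_mkcond mulrC.
rewrite -mulrA; congr (_ * _); rewrite mulr_sumr; apply: eq_big_seq => m hm.
rewrite mulrA mulrC IH //; first by rewrite (size_below hm) sl.
exact: below_sdec hm.
Qed.
End Branching.

(** * Schur functions as truncated germs at (1,...,1) *)

Definition ff (K : pzRingType) (l : K) (k : nat) : K := \prod_(j < k) (l - j%:R).

Section Germs.
Variables (K : numFieldType) (N Q : nat).
Notation A := {mpoly K[N.+1]}.
Notation Y := (Y K N).
Notation VM := (VM K N).

(** The inverse of [1 + Y i] up to order [Q]; it makes negative exponents available in a polynomial
    ring. *)
Definition iota1 (i : nat) : A := \sum_(j < Q.+1) (- Y i) ^+ j.
(* The germ at 1 of [x_i ^ (a - m)], up to order Q. *)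
Definition T (m i a : nat) : A := iota1 i ^+ m * (1 + Y i) ^+ a.

Lemma iota1E i : (1 + Y i) * iota1 i = 1 - (- Y i) ^+ Q.+1.
by rewrite -opprB subrX1 -mulNr opprB opprK. Qed.

Lemma dY_pow_other i (p : A) n : dY i p = 0 -> dY i (p ^+ n) = 0.
by move=> h; rewrite dYX h mulr0 mul0rn. Qed.

Lemma dY_T_other m i j a : (i <= N)%N -> (j <= N)%N -> i != j -> dY i (T m j a) = 0.
move=> hi hj ij; have h0 : dY i (Y j) = 0 by rewrite dYY // (negPf ij).
rewrite dYM !dY_pow_other ?mulr0 ?mul0r ?addr0 //; first by rewrite raddfD /= dY1 add0r.
by rewrite raddf_sum big1 // => k _; apply: dY_pow_other => //; rewrite raddfN /= h0 oppr0.
Qed.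

(** The Euler operator [x d/dx] multiplies [x^(a-m)] by [a - m]; the truncated inverse satisfies the
    equation of the true inverse up to order [Q]. *)
Lemma dY_T m i a : (i <= N)%N ->
 eqm Q ((1 + Y i) * dY i (T m i a)) ((a%:R - m%:R : K) *: T m i a).
move=> hi; set x : A := 1 + Y i; set u := iota1 i.
have dx : dY i x = 1 by rewrite raddfD /= dY1 add0r dYY // eqxx.
have hu : eqm Q (x * dY i u) (- u).
 have : vanish Q (dY i (x * u)).
  rewrite iota1E raddfB /= dY1 sub0r; apply: vanishN; apply: vanish_deriv.
  rewrite -{1}[Q.+1]muln1; apply: vanish_exp; apply: vanishN; exact: vanish_Y.
 by rewrite dYM dx mul1r /eqm opprK addrC.
rewrite /T dYM mulrDr scalerBl addrC !scaler_nat; apply: eqmD.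
 apply: eqm_eq; rewrite dYX dx mulr1 mulrCA mulrnAr mulrnAr.
 by case: a => [|a]; rewrite //= -exprS.
rewrite dYX; case: m => [|m]; first by rewrite mul0r mulr0 oppr0; exact: eqm_refl.
rewrite mulrA mulrnAr mulrCA -mulNrn mulrnAl; apply: eqmMn.
rewrite exprSr -mulNr; apply: eqmMr; rewrite -mulrN; exact: eqmMl.
Qed.

Lemma iter_dY_T m i a k : (i <= N)%N ->
 eqm (Q.+1 - k) ((1 + Y i) ^+ k * iter k (dY i) (T m i a)) (ff (a%:R - m%:R) k *: T m i a).
move=> hi; set x : A := 1 + Y i; set l : K := _ - _.
have dx : dY i x = 1 by rewrite raddfD /= dY1 add0r dYY // eqxx.
elim: k => [|k IH]; first by rewrite mul1r /ff big_ord0 scale1r; apply: eqm_refl.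
rewrite subSS; have [kQ|kQ] := leqP k Q; last first.
 have -> : (Q - k = 0)%N by lia.
 exact: vanish00.
have h1 : eqm (Q - k) (x * dY i (x ^+ k * iter k (dY i) (T m i a))) (x * dY i (ff l k *: T m i a)).
 by apply: eqmMl; apply: eqm_deriv; rewrite -subSn.
rewrite /ff big_ord_recr /= -/ff [ff l k * _]mulrC -scalerA scalerBl.
have -> : x ^+ k.+1 * iter k.+1 (dY i) (T m i a) =
  x * dY i (x ^+ k * iter k (dY i) (T m i a)) - (x ^+ k * iter k (dY i) (T m i a)) *+ k.
 rewrite dYM dYX dx mulr1 mulrDr; set it := iter k _ _.
 have -> : x * (x ^+ k.-1 *+ k * it) = (x ^+ k * it) *+ k.
  case: (k) => [|k']; first by rewrite mul0r mulr0.
  by rewrite mulrnAl mulrnAr mulrA -exprS.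
 by rewrite addrAC subrr add0r mulrA -exprS.
apply: eqmB; last first.
 by rewrite scaler_nat; apply: eqmMn; apply: (eqmW _ IH); rewrite leq_sub2r.
apply: (eqm_trans h1); rewrite linearZ -scalerAr scalerA [l * _]mulrC -scalerA; apply: eqmZ.
by apply: (eqmW _ (dY_T _ _ hi)); rewrite leq_subr.
Qed.

Definition mono (M m : nat) (a : nat -> nat) : A := \prod_(j < M) T m j (a j).

Lemma DD_mono M m a k : (M <= N.+1)%N ->
 eqm (Q.+1 - k) (DD M k (mono M m a)) ((\sum_(j < M) ff ((a j)%:R - m%:R) k) *: mono M m a).
move=> hM; rewrite scaler_suml; apply: eqm_sum => i _.
have yN (j : 'I_M) : (j <= N)%N by rewrite -ltnS (leq_trans (ltn_ord j)).
rewrite /mono (bigD1 i) //=; set W := \prod_(_ < _ | _) _.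
have hW : dY i W = 0.
 by apply: dY_prod0 => j ji; apply: dY_T_other => //; rewrite eq_sym.
have -> : iter k (dY i) (T m i (a i) * W) = iter k (dY i) (T m i (a i)) * W.
 by elim: k => //= k ->; rewrite dYM hW mulr0 addr0.
by rewrite mulrA scalerAl; apply: eqmMr; apply: iter_dY_T.
Qed.

Definition detT (M m : nat) (l : seq nat) : A :=
 \det (\matrix_(i < M, j < M) T m i (nth 0%N l j)).
Definition TS (M m : nat) (l : seq nat) : A :=
 \sum_(w <- gts M l) mono M m (nth 0%N w).

(** The eigenvalue of [DD]: the falling power sum of the true shifted parts [a - m]. *)
Definition pff (m : nat) (l : seq nat) (k : nat) : K := \sum_(a <- l) ff (a%:R - m%:R) k.

Lemma pffE M m l k : size l = M -> pff m l k = \sum_(j < M) ff ((nth 0%N l j)%:R - m%:R) k.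
by move=> sl; rewrite /pff (big_nth 0%N) sl big_mkord. Qed.

Lemma DD_sum M k (I : Type) (r : seq I) (F : I -> A) :
 DD M k (\sum_(i <- r) F i) = \sum_(i <- r) DD M k (F i).
elim: r => [|i r IH]; last by rewrite !big_cons DDD IH.
by rewrite !big_nil -(scale0r (0 : A)) DDZ !scale0r.
Qed.

Lemma DD_detT M m l k : (M <= N.+1)%N -> size l = M ->
 eqm (Q.+1 - k) (DD M k (detT M m l)) (pff m l k *: detT M m l).
move=> hM sl; rewrite DD_sum scaler_sumr; apply: eqm_sum => s _.
have -> : (-1) ^+ s * \prod_(i < M) (\matrix_(i, j) T m i (nth 0%N l j)) i (s i) =
  ((-1) ^+ s : K) *: mono M m (fun i => if insub i is Some i' then nth 0%N l (s i') else 0%N).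
 rewrite -signr_odd -[in RHS]signr_odd; set b := odd _.
 have -> : ((-1) ^+ b : A) = ((-1) ^+ b : K) *: (1 : A).
  by case: b; rewrite ?scale1r // scaleN1r.
 rewrite -scalerAl mul1r; congr (_ *: _); bigr => i _; rewrite mxE.
 by rewrite insubT // => h; congr (T m _ (nth 0%N l (s _))); apply: val_inj.
rewrite DDZ scalerA mulrC -scalerA; apply: eqmZ.
apply: (eqm_trans (@DD_mono M m _ k hM)); apply: eqm_eq; congr (_ *: _).
rewrite (pffE _ _ sl) [RHS](reindex_inj (@perm_inj _ s)); bigr => j _.
by rewrite insubT // => h; congr (ff ((nth 0%N l (s _))%:R - _) _); apply: val_inj.
Qed.

Lemma VM_TS M m l : size l = M -> sdec l -> VM M * TS M m l = detT M m l.
move=> sl hl.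
have -> : TS M m l = (\prod_(i < M) iota1 i ^+ m) * gtsum (fun i => 1 + Y i) M l.
 rewrite mulr_sumr; bigr => w _.
 by rewrite -big_split.
have -> : detT M m l = (\prod_(i < M) iota1 i ^+ m) * altdet (fun i => 1 + Y i) M l.
 rewrite /detT.
 have -> : \matrix_(i < M, j < M) T m i (nth 0%N l j) =
   diag_mx (\row_(i < M) iota1 i ^+ m) *m \matrix_(i < M, j < M) (1 + Y i) ^+ nth 0%N l j.
  by apply/matrixP => i j; rewrite mul_diag_mx !mxE.
 by rewrite det_mulmx det_diag; congr (_ * _); bigr => i _; rewrite mxE.
rewrite -gtsum_altdet // mulrCA; congr (_ * (_ * _)); rewrite /VM.
bigr => i _; bigr => j _.
by rewrite opprD addrACA subrr add0r.
Qed.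

Lemma TS_eigen M m l k : (M <= N.+1)%N -> size l = M -> sdec l ->
 eqm (Q.+1 - k) (VM M * (pff m l k *: TS M m l)) (DD M k (VM M * TS M m l)).
move=> hM sl hl; rewrite -scalerAr VM_TS //; apply: eqm_sym; exact: DD_detT.
Qed.

(** In the coordinates [Y], setting the higher variables [x_i] to 1 is substitution of 0, which does
    not lower orders of vanishing. *)
Definition res (M : nat) : A -> A :=
 comp_mpoly [tuple (if (i < M)%N then 'X_i else 0) | i < N.+1].
HB.instance Definition _ M := GRing.RMorphism.copy (res M)
 (comp_mpoly [tuple (if (i < M)%N then 'X_i else 0) | i < N.+1]).

Lemma resC M c : res M c%:MP = c%:MP. exact: comp_mpolyC. Qed.
Lemma resZ M c p : res M (c *: p) = c *: res M p.
by rewrite -!mul_mpolyC rmorphM /= resC. Qed.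

Lemma res_Y M i : (i <= N)%N -> res M (Y i) = if (i < M)%N then Y i else 0.
by move=> hi; rewrite /res comp_mpolyXU -tnth_nth tnth_mktuple inordK.
Qed.

Lemma res_T M m i a : (i <= N)%N -> res M (T m i a) = if (i < M)%N then T m i a else 1.
move=> hi; rewrite rmorphM !rmorphXn rmorphD rmorph1 /= res_Y // rmorph_sum.
under eq_bigr => j _ do rewrite rmorphXn rmorphN /= res_Y //.
case: ifP => _ //; rewrite addr0 expr1n mulr1.
rewrite big_ord_recl big1 => [|j _]; first by rewrite addr0 expr1n.
by rewrite oppr0 expr0n.
Qed.

(** Branching rule: the factor of the removed variable becomes 1, so the patterns are grouped by the
    row below the top. *)
Lemma res_TS M m l : (M <= N)%N -> res M (TS M.+1 m l) = \sum_(ms <- below l) TS M m ms.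
move=> hM; rewrite /TS rmorph_sum big_flatten big_map; bigr => ms _.
rewrite big_map; apply: eq_big_seq => w /size_gts hw.
have yN (j : 'I_M) : (j <= N)%N by apply: leq_trans hM; apply: ltnW.
rewrite rmorph_prod big_ord_recr /= res_T // ltnn mulr1.
by bigr => j _; rewrite res_T // nth_rcons hw ltn_ord.
Qed.

Lemma res_vanish M d p : vanish d p -> vanish d (res M p).
move=> h; rewrite [p]mpolyE rmorph_sum /=; apply: vanish_sum => m _; rewrite resZ.
have [hm|hm] := ltnP (mdeg m) d; first by rewrite h // scale0r; apply: vanish0.
apply: vanishZ; apply: (vanishW hm); rewrite mpolyXE_id rmorph_prod mdegE.
elim/big_ind2: _ => [|a u b w|i _]; first exact: vanish00.
 exact: vanishM.
rewrite rmorphXn /= -{1}[m i]muln1; apply: vanish_exp.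
rewrite /res comp_mpolyXU -tnth_nth tnth_mktuple.
by case: ifP => _; [apply: vanishX|apply: vanish0].
Qed.

Lemma res_eqm M d p q : eqm d p q -> eqm d (res M p) (res M q).
by rewrite /eqm -rmorphB; apply: res_vanish. Qed.

Lemma res_phi D M M' (P : {mpoly K[D]}) : (M <= M')%N -> (M' <= N.+1)%N ->
 res M (phi N M' P) = phi N M P.
move=> h h'; elim/mpoly_alg_ind: P => [c|j|p q hp hq|p q hp hq].
- by rewrite !phiC resC.
- rewrite !phiX rmorph_sum.
 rewrite -(big_mkord xpredT (fun i => res M (Y i ^+ j.+1))) (big_cat_nat (n := M)) //=.
 rewrite [X in _ + X]big_nat_cond [X in _ + X]big1 ?addr0 => [|i /andP[/andP[h1 h2] _]]; last first.
  rewrite rmorphXn /= res_Y; first by rewrite ltnNge h1 expr0n.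
  lia.
 rewrite !big_mkord; bigr => i _; rewrite rmorphXn /= res_Y ?ltn_ord //.
 by rewrite -ltnS (leq_trans (ltn_ord i)) // (leq_trans h).
- by rewrite !rmorphD /= hp hq.
- by rewrite !rmorphM /= hp hq.
Qed.
End Germs.

(** * Symmetric polynomials in terms of power sums *)

Section Symmetric.
Variables (K : numFieldType) (N D : nat).
Notation A := {mpoly K[N.+1]}.
Notation B := {mpoly K[D]}.
Notation Y := (Y K N).
Notation phi := (@phi K N D).
Notation I1 := 'I_N.+1.

(** Augmented monomial symmetric functions: the exponents of [s] are placed at pairwise distinct
    indices of [S]. *)
Fixpoint augm (S : {set I1}) (s : seq nat) : A :=
 if s is a :: s' then \sum_(j in S) 'X_j ^+ a * augm (S :\ j) s' else 1.

Definition incr (s : seq nat) (t a : nat) := set_nth 0%N s t (nth 0%N s t + a)%N.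

Lemma augm_swap (S : {set I1}) a b s : augm S (a :: b :: s) = augm S (b :: a :: s).
rewrite /=; under eq_bigr => i _ do rewrite mulr_sumr.
under [RHS]eq_bigr => i _ do rewrite mulr_sumr.
rewrite (exchange_big_dep (mem S)) /=; last by move=> i j _; rewrite !inE => /andP[].
bigr => j jS; apply: eq_big => [i|lia].
 by rewrite !inE jS andbT eq_sym andbC.
rewrite !inE => ij; rewrite mulrCA; congr _.
by rewrite !setDDl setUC.
Qed.

(** In a product with a power sum, the new index either differs from all indices in use or coincides
    with one of them, whose exponent then grows by [a]. *)
Lemma augm_mul (S : {set I1}) a s : (\sum_(j in S) 'X_j ^+ a) * augm S s =
 augm S (a :: s) + \sum_(t < size s) augm S (incr s t a).
elim: s S => [|b s IH] S.
 rewrite mulr1 big_ord0 addr0; bigr => j _; by rewrite mulr1.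
rewrite augm_swap big_ord_recl addrA [X in X + _]addrC -addrA mulr_sumr.
have -> : \sum_(i < size s) augm S (incr (b :: s) (bump 0 i) a) =
  \sum_(j in S) 'X_j ^+ b * \sum_(t < size s) augm (S :\ j) (incr s t a).
 rewrite /incr.
 by rewrite exchange_big; bigr => j _; rewrite mulr_sumr.
rewrite -!big_split /=; bigr => j jS.
rewrite -mulrDr -IH (big_setD1 j) //= mulrDl; congr (_ + _).
 by rewrite mulrA -exprD addnC.
by rewrite mulrCA.
Qed.

(** The identity [augm_mul] solved for its first term and read as a recursion in power sums. The
    argument [n] is fuel, equal to the length of the list in every use. *)
Fixpoint augq (n : nat) (s : seq nat) : B :=
 if n is n'.+1 then if s is a :: s' then
  qv 0 a * augq n' s' - \sum_(t < size s') augq n' (incr s' t a) else 1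
 else 1.

Lemma size_incr s t a : (t < size s)%N -> size (incr s t a) = size s.
rewrite size_set_nth; apply/maxn_idPr. Qed.

Lemma phi_augq n s : size s = n -> all (leq 1) s ->
 eqm D.+1 (phi N.+1 (augq n s)) (augm setT s).
elim: n s => [|n IH] [|a s] //=; first by move=> _ _; rewrite rmorph1; apply: eqm_refl.
move=> [sn] /andP[a0 hs].
have -> : \sum_(j in setT) 'X_j ^+ a * augm (setT :\ j) s =
  (\sum_(j in setT) 'X_j ^+ a) * augm setT s - \sum_(t < size s) augm setT (incr s t a).
 by rewrite augm_mul addrK.
rewrite rmorphB rmorphM rmorph_sum; apply: eqmB.
 apply: eqmM; last by apply: IH.
 have -> : qv 0 a = qv (N.+1%:R) a :> B by case: a a0.
 apply: (eqm_trans (phi_qv _ _ _)); apply: eqm_eq.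
 by apply: eq_big => [j|j _]; rewrite ?inE // /Y inord_val.
apply: eqm_sum => t _; apply: IH; first by rewrite size_incr.
apply/(all_nthP 0%N) => i; rewrite size_incr // => hi; rewrite nth_set_nth /=.
case: eqP => [_|_]; last exact: all_nthP.
lia.
Qed.

Fixpoint lsum (V : nmodType) (r : nat) (f : seq nat -> V) : V :=
 if r is r'.+1 then \sum_(b < D) lsum r' (fun s => f (b.+1 :: s)) else f [::].

Lemma lsum_ext (V : nmodType) r (f g : seq nat -> V) :
 (forall s, size s = r -> all (leq 1) s -> f s = g s) -> lsum r f = lsum r g.
elim: r f g => [|r IH] f g h; first exact: h.
by bigr => b _; apply: IH => s ss hs; apply: h => //=; rewrite ss.
Qed.

Lemma lsum_sum (V : nmodType) (J : finType) (P : pred J) r (f : J -> seq nat -> V) :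
 lsum r (fun s => \sum_(j | P j) f j s) = \sum_(j | P j) lsum r (f j).
elim: r f => [|r IH] f //=; rewrite exchange_big; bigr => b _.
by [].
Qed.

Lemma lsum_mul r (x : A) (f : seq nat -> A) : lsum r (fun s => x * f s) = x * lsum r f.
elim: r f => [|r IH] f //=; rewrite mulr_sumr; bigr => b _.
by [].
Qed.

Lemma lsum_eqm d r (f g : seq nat -> A) :
 (forall s, size s = r -> all (leq 1) s -> eqm d (f s) (g s)) -> eqm d (lsum r f) (lsum r g).
elim: r f g => [|r IH] f g h; first exact: h.
by apply: eqm_sum => b _; apply: IH => s ss hs; apply: h => //=; rewrite ss.
Qed.

Lemma lsum_phi M r (f : seq nat -> B) : phi M (lsum r f) = lsum r (fun s => phi M (f s)).
elim: r f => [|r IH] f //=; rewrite rmorph_sum; bigr => b _; exact: IH.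
Qed.

Fixpoint mk (js : seq I1) (s : seq nat) : 'X_{1..N.+1} :=
 match js, s with j :: js', a :: s' => (U_(j) *+ a + mk js' s')%MM | _, _ => 0%MM end.

Definition msupp1 (m : 'X_{1..N.+1}) : {set I1} := [set j | m j != 0%N].

Definition augtot S r (c : seq nat -> K) : A := lsum r (fun s => c s *: augm S s).

Lemma augtotS S r c : augtot S r.+1 c =
 \sum_(j in S) \sum_(b < D) 'X_j ^+ b.+1 * augtot (S :\ j) r (fun s => c (b.+1 :: s)).
rewrite exchange_big; bigr => b _.
under [RHS]eq_bigr => j _ do rewrite -lsum_mul.
rewrite -lsum_sum; apply: lsum_ext => s _ _.
by rewrite scaler_sumr; bigr => j _; rewrite scalerAr.
Qed.

Lemma mcoeffMX_if (q : A) m1 k :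
 (q * 'X_[m1])@_k = if (m1 <= k)%MM then q@_(k - m1) else 0.
case: ifP => h; first by rewrite -{1}(submK h) addmC mcoeffMX.
rewrite mcoeffM big1 // => -[k1 k2] /eqP e; rewrite mcoeffX.
case: eqP => [e2|_]; rewrite ?mulr0 //; case/negP: h; rewrite e e2.
exact: lem_addl.
Qed.

Variable p : A.

(** A monomial whose support has exactly [r] elements arises once for each ordering of the support,
    hence [r!]. The offset [m'] collects the variables already removed in the induction. *)
Lemma total_coef r (S : {set I1}) c (m' m : 'X_{1..N.+1}) :
 (forall ks s, uniq ks -> {subset ks <= S} -> size ks = r -> size s = r ->
   c s = p@_(m' + mk ks s)) ->
 (forall j, m j <= D)%N ->
 (augtot S r c)@_m = if (msupp1 m \subset S) && (#|msupp1 m| == r) then p@_(m' + m) *+ r`! else 0.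
elim: r S c m' m => [|r IH] S c m' m hc hm.
 rewrite /augtot /= (hc [::]) //= -mul_mpolyC mulr1 mcoeffC.
 case: eqVneq => [->|m0]; last first.
  rewrite mulr0; case: ifP => // /andP[_ /eqP/cards0_eq h].
  case/eqP: m0; apply/mnmP => j; rewrite mnm0E; apply/eqP.
  by move/setP: h => /(_ j); rewrite !inE => /negbFE.
 have -> : msupp1 0%MM = set0 by apply/setP => j; rewrite !inE mnm0E.
 by rewrite sub0set cards0 addm0 mulr1.
rewrite augtotS raddf_sum.
have term j : j \in S -> (\sum_(b < D) 'X_j ^+ b.+1 * augtot (S :\ j) r (fun s => c (b.+1 :: s)))@_m =
  if (m j != 0%N) && (msupp1 m \subset S) && (#|msupp1 m| == r.+1) then p@_(m' + m) *+ r`! else 0.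
 move=> jS; rewrite raddf_sum /=.
 have tc b : ('X_j ^+ b.+1 * augtot (S :\ j) r (fun s => c (b.+1 :: s)))@_m =
   if (b.+1 <= m j)%N then (augtot (S :\ j) r (fun s => c (b.+1 :: s)))@_(m - U_(j) *+ b.+1) else 0.
  rewrite mpolyXn mulrC mcoeffMX_if; congr (if _ then _ else _).
  apply/mnm_lepP/idP => [/(_ j)|h i]; rewrite mulmnE mnm1E ?eqxx ?mul1n //.
  by case: eqP => [<-|_]; rewrite ?mul1n.
 have hc' b ks s : uniq ks -> {subset ks <= S :\ j} -> size ks = r -> size s = r ->
   c (b :: s) = p@_(m' + U_(j) *+ b + mk ks s).
  move=> uk sk szk szs; rewrite (hc (j :: ks) (b :: s)) /= ?szk ?szs ?uk ?andbT //.
  - by rewrite addmA.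
  - by apply/negP => /sk; rewrite !inE eqxx.
  - by move=> i; rewrite inE => /orP[/eqP->//|/sk]; rewrite !inE => /andP[].
 have hm' b i : ((m - U_(j) *+ b)%MM i <= D)%N.
  by rewrite mnmBE (leq_trans (leq_subr _ _)).
 have tc2 b : (augtot (S :\ j) r (fun s => c (b :: s)))@_(m - U_(j) *+ b) =
   if (msupp1 (m - U_(j) *+ b) \subset S :\ j) && (#|msupp1 (m - U_(j) *+ b)| == r)
   then p@_(m' + U_(j) *+ b + (m - U_(j) *+ b)) *+ r`! else 0.
  by apply: IH => //; apply: hc'.
 have [mj|mj] := eqVneq (m j) 0%N.
  by rewrite big1 // => b _; rewrite tc mj.
 have mjD : ((m j).-1 < D)%N by apply: leq_trans (hm j); case: (m j) mj.
 (* Only [b.+1 = m j] contributes: a smaller exponent leaves [j] in the support of the remainder, a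
    larger one does not divide the monomial. *)
 rewrite (bigD1 (Ordinal mjD)) //= big1 ?addr0 => [|b bj]; last first.
  rewrite tc tc2; case: ifP => // h1; case: ifP => // /andP[/subsetP/(_ j)].
  rewrite !inE mnmBE mulmnE mnm1E eqxx mul1n => h.
  have : (m j - b.+1 != 0)%N.
   by move: bj h1; rewrite -val_eqE /=; move: (m j) mj => [|k] _; lia.
  lia; move: (h h').
 have e1 : (m j).-1.+1 = m j by case: (m j) mj.
 rewrite tc e1 leqnn tc2.
 have le1 : (U_(j) *+ m j <= m)%MM.
  by apply/mnm_lepP => i; rewrite mulmnE mnm1E; case: eqP => [<-|_]; rewrite ?mul1n.
 rewrite -addmA [(U_(j) *+ m j + _)%MM]addmC submK //.
 have -> : msupp1 (m - U_(j) *+ m j) = msupp1 m :\ j.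
  apply/setP => i; rewrite !inE mnmBE mulmnE mnm1E.
  by case: (eqVneq j) => [->|_]; rewrite ?mul1n ?subnn // subn0.
 have jm : j \in msupp1 m by rewrite inE.
 congr (if _ then _ else _); congr (_ && _); last by rewrite (cardsD1 j (msupp1 m)) jm.
 apply/idP/idP => h; last exact: setSD.
 by rewrite -(setD1K jm) subUset sub1set jS (subset_trans h) // subD1set.
rewrite (eq_bigr _ term).
case: (boolP ((msupp1 m \subset S) && (#|msupp1 m| == r.+1))) => [/andP[h1 h2]|h]; last first.
 by rewrite big1 // => j _; rewrite -andbA (negPf h) andbF.
rewrite -big_mkcondr factS mulnC mulrnA (eq_bigl (fun j => j \in msupp1 m)) => [|j].
 by rewrite sumr_const (eqP h2).
rewrite h1 h2 !andbT inE; case: (boolP (m j != 0%N)); rewrite ?andbF // andbT => hj.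
by apply: (subsetP h1); rewrite inE.
Qed.

Lemma perm_extend (js ks : seq I1) : uniq js -> uniq ks -> size js = size ks ->
 exists s : 'S_N.+1, map s js = ks.
elim: js ks => [|j js IH] [|k ks] //=; first by exists 1%g.
move=> /andP[jjs ujs] /andP[kks uks] [sz].
have [s sE] := IH ks ujs uks sz.
exists (s * tperm (s j) k)%g; rewrite permM tpermL; congr (_ :: _).
rewrite -{}sE in kks *; apply/eq_in_map => i ijs; rewrite permM tpermD //.
 by rewrite (inj_eq perm_inj); apply: contraNneq jjs => ->.
by apply: contraNneq kks => ->; apply: map_f.
Qed.

Definition first (r : nat) : seq I1 := map inord (iota 0 r).

(** For symmetric [p] the coefficient depends on the exponents alone, so it can be read at the first
    variables. *)
Definition scoef (s : seq nat) : K := p@_(mk (first (size s)) s).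

Hypothesis p_sym : p \is symmetric.

Lemma mk_perm (s : 'S_N.+1) ks a i : (mk (map s ks) a) (s i) = (mk ks a) i.
elim: ks a => [|k ks IH] [|b a]; rewrite ?mnm0E // !mnmDE !mulmnE !mnm1E IH.
by rewrite (inj_eq perm_inj).
Qed.

Lemma scoef_sym ks s : uniq ks -> size ks = size s -> (size s <= N.+1)%N ->
 scoef s = p@_(mk ks s).
move=> uk sz sN.
have uf : uniq (first (size s)).
 rewrite map_inj_in_uniq ?iota_uniq // => i j; rewrite !mem_iota => hi hj.
 move/(congr1 val); rewrite /= !inordK //; exact: leq_trans sN.
have szf : size (first (size s)) = size s by rewrite size_map size_iota.
have [sg sgE] := perm_extend uk uf (etrans sz (esym szf)).
have /issymP/(_ sg) hs := p_sym.
rewrite /scoef -[in LHS]hs mcoeff_sym -sgE; congr mcoeff; apply/mnmP => i.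
by rewrite mnmE mk_perm.
Qed.

Hypothesis p0 : p@_0 = 0.
Hypothesis DN : (D <= N.+1)%N.

Definition LLr (r : nat) : B := lsum r (fun s => scoef s *: augq (size s) s).
Definition LL : B := \sum_(r < D) ((r.+1)`!%:R)^-1 *: LLr r.+1.

(** Monomials are grouped by the size [r] of their support, and division by [r!] undoes the
    overcounting in [total_coef]. Below order [D.+1] at most [D] variables occur in a monomial, and
    [D <= N.+1] provides that many. *)
Lemma sym_expand : eqm D.+1 p (phi N.+1 LL).
have h : eqm D.+1 p (\sum_(r < D) ((r.+1)`!%:R)^-1 *: augtot setT r.+1 scoef).
 rewrite /eqm => m hm; rewrite mcoeffB raddf_sum /=; apply/eqP; rewrite subr_eq0.
 have sm : (#|msupp1 m| <= mdeg m)%N.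
  rewrite mdegE -sum1_card big_mkcond; apply: leq_sum => i _.
  by rewrite inE; case: (m i).
 have mjD j : (m j <= D)%N.
  by rewrite -ltnS (leq_ltn_trans _ hm) // mdegE (bigD1 j) //= leq_addr.
 have tc (r : 'I_D) : (augtot setT r.+1 scoef)@_m =
   if (#|msupp1 m| == r.+1) then p@_m *+ (r.+1)`! else 0.
  rewrite (@total_coef r.+1 setT scoef 0%MM) ?subsetT ?add0m // => ks s uk _ szk szs.
  rewrite add0m; apply: scoef_sym => //; first by rewrite szk.
  by rewrite szs (leq_trans _ DN).
 under eq_bigr => r _ do rewrite mcoeffZ tc.
 have [m0|m0] := eqVneq (#|msupp1 m|) 0%N.
  have -> : m = 0%MM.
   apply/mnmP => j; rewrite mnm0E; apply/eqP; move/cards0_eq/setP: m0 => /(_ j).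
   by rewrite !inE => /negbFE.
  rewrite p0 big1 // => r _; by case: ifP => _; rewrite ?mul0rn mulr0.
 have hD : (#|msupp1 m|.-1 < D)%N by move: m0 sm hm; lia.
 have e1 : #|msupp1 m|.-1.+1 = #|msupp1 m| by case: (#|msupp1 m|) m0.
 rewrite (bigD1 (Ordinal hD)) //= e1 eqxx big1 ?addr0 => [|r hr]; last first.
  case: eqP => [e|_]; rewrite ?mulr0 //; case/eqP: hr; apply: val_inj => /=; lia.
 by rewrite -[p@_m *+ _]mulr_natl mulrA mulVf ?mul1r // pnatr_eq0 -lt0n fact_gt0.
apply: (eqm_trans h); rewrite rmorph_sum; apply: eqm_sum => r _.
rewrite /= phiZ; apply: eqmZ; rewrite lsum_phi; apply: lsum_eqm => s _ hs.
by rewrite phiZ; apply: eqmZ; apply: eqm_sym; apply: phi_augq.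
Qed.
End Symmetric.

(** * Truncated logarithm and exponential of a germ *)

Section Truncation.
Variables (K : numFieldType) (n : nat).
Implicit Type p : {mpoly K[n]}.

Definition truncp (d : nat) p : {mpoly K[n]} := \sum_(m : 'X_{1..n < d}) p@_m *: 'X_[m].

Lemma truncpE d p m : (truncp d p)@_m = if (mdeg m < d)%N then p@_m else 0.
case: ifP => h; first exact: (mcoeff_mpoly (fun m => p@_m)).
rewrite raddf_sum big1 // => m' _ /=; rewrite mcoeffZ mcoeffX.
by case: eqP => [e|_]; rewrite ?mulr0 //; move: h; rewrite -e bmdeg.
Qed.

Lemma truncp_sym d p : (forall (s : 'S_n) m, (mdeg m < d)%N -> (msym s p)@_m = p@_m) -> truncp d p \is symmetric.
move=> h; apply/issymP => s; apply/mpolyP => m; rewrite mcoeff_sym !truncpE mdeg_mperm.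
by case: ifP => // hm; rewrite -(h s m hm) mcoeff_sym.
Qed.
End Truncation.

Lemma eqm_truncp (K : numFieldType) (N d : nat) (p : {mpoly K[N.+1]}) : eqm d p (truncp d p).
by move=> m hm; rewrite mcoeffB truncpE hm subrr. Qed.

Section LogExp.
Variables (K : numFieldType) (N D : nat).
Notation A := {mpoly K[N.+1]}.
Notation B := {mpoly K[D]}.
Notation Y := (Y K N).
Notation phi := (@phi K N D).

Definition logs (f : A) : A := \sum_(n < D) ((-1) ^+ n / n.+1%:R : K) *: (f - 1) ^+ n.+1.
(** The second truncation makes every coefficient above degree [D] equal to 0, so that limits of
    coefficients exist in all degrees. *)
Definition logt (f : A) : A := truncp D.+1 (logs f).
Definition expt (L : B) : B := \sum_(n < D.+1) (n`!%:R : K)^-1 *: L ^+ n.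

Lemma dY_logt (f : A) i : vanish 1 (f - 1) -> eqm D (f * dY i (logt f)) (dY i f).
move=> hf; have hl : eqm D (f * dY i (logt f)) (f * dY i (logs f)).
 by apply: eqmMl; apply: eqm_deriv; apply: eqm_sym; apply: eqm_truncp.
apply: (eqm_trans hl) => {hl}.
have -> : dY i (logs f) = dY i f * \sum_(n < D) (1 - f) ^+ n.
 rewrite raddf_sum mulr_sumr; bigr => n _.
 rewrite /= linearZ /= dYX raddfB /= dY1 subr0 -scaler_nat scalerA divfK ?pnatr_eq0 //.
 have -> : 1 - f = (-1 : K) *: (f - 1) by rewrite scaleN1r opprB.
 by rewrite exprZn -scalerAr mulrC.
rewrite mulrCA -{2}[dY i f]mulr1; apply: eqmMl.
have -> : f * \sum_(n < D) (1 - f) ^+ n = 1 - (1 - f) ^+ D.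
 by rewrite -[RHS]opprB subrX1 -mulNr opprB; congr (_ * _); rewrite opprB addrC subrK.
rewrite /eqm addrAC subrr add0r -{1}[D]muln1; apply: vanishN; apply: vanish_exp.
by rewrite -opprB; apply: vanishN.
Qed.

Lemma dY_expt M L i : (M <= N.+1)%N -> (i < M)%N -> vanish 1 (phi M L) ->
 eqm D (dY i (phi M (expt L)))
  (phi M (expt L) * \sum_(b < D) (Y i ^+ b * phi M L^`M(b)) *+ b.+1).
move=> hM hi hL; rewrite -dY_phi //.
have hE : phi M (expt L) = \sum_(n < D.+1) (n`!%:R : K)^-1 *: phi M L ^+ n.
 by rewrite rmorph_sum; bigr => n _; rewrite /= phiZ rmorphXn.
have hd : dY i (phi M (expt L)) =
  (\sum_(n < D) (n`!%:R : K)^-1 *: phi M L ^+ n) * dY i (phi M L).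
 rewrite hE raddf_sum big_ord_recl /= linearZ /= dY1 scaler0 add0r mulr_suml.
 bigr => n _; rewrite linearZ /= dYX.
 rewrite -scaler_nat scalerA -scalerAl; congr _.
 by rewrite natrM invfM mulrAC mulVf ?mul1r // pnatr_eq0.
rewrite hd hE big_ord_recr mulrDl -[X in eqm _ X _]addr0; apply: eqmD; first exact: eqm_refl.
apply: eqm_sym; rewrite /eqm subr0; apply: vanishMr; apply: vanishZ.
by rewrite -{1}[D]muln1; apply: vanish_exp.
Qed.

(** The difference solves the same linear system with value 0 at the origin, so its order of
    vanishing grows by one at each step. *)
Lemma ode_unique (F G L : A) : F@_0 = G@_0 ->
 (forall i, (i <= N)%N -> eqm D (dY i F) (F * dY i L)) ->
 (forall i, (i <= N)%N -> eqm D (dY i G) (G * dY i L)) -> eqm D.+1 F G.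
move=> h0 hF hG; move: (leqnn D.+1); move: {-2}(D.+1) => d.
elim: d => [|d IH] hd; first exact: vanish00.
apply: vanish_derivs; first by rewrite mcoeffB h0 subrr.
move=> i; rewrite -(inord_val i) -/(dY i (F - G)).
have iN : (i <= N)%N by rewrite -ltnS.
have h : eqm D (dY i (F - G)) ((F - G) * dY i L).
 by rewrite raddfB mulrBl; apply: eqmB; [apply: hF|apply: hG].
have h2 : vanish d ((F - G) * dY i L) by apply: vanishMr; apply: IH; apply: ltnW.
by rewrite -[dY _ _](subrK ((F - G) * dY i L)); apply: vanishD => //; apply: (@vanishW _ _ D).
Qed.

Lemma logt_symmetric (f : A) : f \is symmetric -> logt f \is symmetric.
move=> fs; have /issymP h : logs f \is symmetric.
 by apply: rpred_sum => n _; apply: rpredZ; apply: rpredX; apply: rpredB => //; apply: rpred1.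
by apply: truncp_sym => s m _; rewrite h.
Qed.

Lemma vanish_logt (f : A) : vanish 1 (f - 1) -> vanish 1 (logt f).
move=> hf m hm; rewrite truncpE; case: ifP => // _.
suff : vanish 1 (logs f) by apply.
apply: vanish_sum => n _; apply: vanishZ; apply: (@vanishW _ _ (n.+1 * 1)) => //.
exact: vanish_exp.
Qed.

(** Both sides solve [dF = F dL] with value 1 at the origin. This avoids composing a truncated
    exponential with a truncated logarithm. *)
Theorem symmetric_germ_exp (f : A) : f \is symmetric -> f@_0 = 1 -> (D <= N.+1)%N ->
 eqm D.+1 f (phi N.+1 (expt (LL D (logt f)))).
move=> fs f0 DN.
have hf : vanish 1 (f - 1).
 move=> m; rewrite ltnS leqn0 mdeg_eq0 => /eqP->.
 by rewrite mcoeffB f0 mcoeff1 eqxx subrr.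
have ls := logt_symmetric fs.
have vl := vanish_logt hf.
have l0 : (logt f)@_0 = 0 by apply: vl; rewrite mdeg0.
have hL := sym_expand ls l0 DN.
apply: ode_unique.
- rewrite /expt big_ord_recl rmorphD rmorph_sum mcoeffD invr1 scale1r rmorph1.
 rewrite mcoeff1 eqxx raddf_sum big1 ?addr0 // => n _; rewrite /= phiZ mcoeffZ rmorphXn.
 have h1 : vanish 1 (phi N.+1 (LL D (logt f))).
  by rewrite -[phi _ _](subrK (logt f)); apply: vanishD => //; apply: (@vanishW _ _ D.+1) => //; apply: eqm_sym.
 by rewrite (@vanish_exp _ _ 1 _ n.+1) ?mulr0 // mdeg0.
- by move=> i _; apply: eqm_sym; apply: dY_logt.
- move=> i iN.
 have h1 : vanish 1 (phi N.+1 (LL D (logt f))).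
  by rewrite -[phi _ _](subrK (logt f)); apply: vanishD => //; apply: (@vanishW _ _ D.+1) => //; apply: eqm_sym.
 apply: (eqm_trans (dY_expt (leqnn _) iN h1)) => //; apply: eqmMl; rewrite -dY_phi //.
 by apply: eqm_deriv; apply: eqm_sym.
Qed.
End LogExp.

(** * Jets of a germ *)

Fixpoint splits (T : Type) (s : seq T) : seq (seq T * seq T) :=
 if s is x :: s' then
  [seq (x :: p.1, p.2) | p <- splits s'] ++ [seq (p.1, x :: p.2) | p <- splits s']
 else [:: ([::], [::])].

Section Jets.
Variables (K : numFieldType) (N Q : nat).
Notation A := {mpoly K[N.+1]}.
Notation Y := (Y K N).
Notation VM := (VM K N).
Notation T := (@T K N Q).
Notation TS := (@TS K N Q).
Notation detT := (@detT K N Q).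

Lemma msym_Y (s : 'S_N.+1) (i : 'I_N.+1) : msym s (Y i) = Y (s i).
rewrite /Y !inord_val msymX; congr mpolyX; apply/mnmP => j.
rewrite mnmE !mnm1E; congr nat_of_bool; apply/eqP/eqP => [->|<-]; by rewrite ?permKV ?permK.
Qed.

Lemma VM_sym (s : 'S_N.+1) : msym s (VM N.+1) = (-1) ^+ s * VM N.+1.
pose c : A := \prod_(i < N.+1) \prod_(j < N.+1 | (i < j)%N) (-1).
have VE : VM N.+1 = c * \det (Vandermonde N.+1 (\row_(i < N.+1) Y i)).
 rewrite det_Vandermonde -big_split; bigr => i _.
 by rewrite -big_split /=; bigr => j _; rewrite !mxE mulN1r opprB.
have sc : msym s c = c.
 rewrite rmorph_prod; bigr => i _; rewrite rmorph_prod.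
 by bigr => j _; rewrite rmorphN1.
rewrite VE rmorphM /= sc mulrCA; congr (_ * _); rewrite -det_map_mx.
have -> : map_mx (msym s) (Vandermonde N.+1 (\row_(i < N.+1) Y i)) =
  col_perm s (Vandermonde N.+1 (\row_(i < N.+1) Y i)).
 by apply/matrixP => i j; rewrite !mxE rmorphXn /= msym_Y.
by rewrite col_permE det_mulmx det_perm mulrC odd_permV.
Qed.

Lemma detT_sym m l (s : 'S_N.+1) : msym s (detT N.+1 m l) = (-1) ^+ s * detT N.+1 m l.
rewrite -det_map_mx.
have -> : map_mx (msym s) (\matrix_(i < N.+1, j < N.+1) T m i (nth 0%N l j)) =
  row_perm s (\matrix_(i < N.+1, j < N.+1) T m i (nth 0%N l j)).
 apply/matrixP => i j; rewrite !mxE rmorphM !rmorphXn rmorphD rmorph1 rmorph_sum /=.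
 rewrite msym_Y; congr (_ ^+ _ * _); bigr => k _.
 by rewrite rmorphXn rmorphN /= msym_Y.
by rewrite row_permE det_mulmx det_perm.
Qed.

Lemma TS_symmetric m l : size l = N.+1 -> sdec l -> TS N.+1 m l \is symmetric.
move=> sl hl; apply/issymP => s; apply: (mulfI (VM_neq0 K (leqnn N.+1))).
have h := congr1 (msym s) (@VM_TS K N Q _ m _ sl hl); move: h.
rewrite rmorphM /= VM_sym detT_sym -(@VM_TS K N Q _ m _ sl hl) -mulrA => h.
have s0 : (-1 : A) ^+ s != 0 by rewrite signr_eq0.
exact: (mulfI s0).
Qed.

(** The offset [m] varies with the variable, because a derivative replaces [x_j^(a-m)] by a multiple
    of [x_j^(a-m-1)] and so raises [m j]. *)
Definition mono2 (M : nat) (m a : nat -> nat) : A := \prod_(j < M) T (m j) j (a j).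

Lemma T0 m i a : (T m i a)@_0 = 1.
have y0 : (Y i)@_0 = 0 :> K by rewrite mcoeffX; case: eqP => // /(congr1 (@mdeg _)); rewrite mdeg1 mdeg0.
have -> : (T m i a)@_0 = (mcoeff 0%MM (iota1 K N Q i)) ^+ m * (mcoeff 0%MM (1 + Y i)) ^+ a.
 by rewrite rmorphM !rmorphXn.
rewrite mcoeffD mcoeff1 eqxx y0 addr0 expr1n mulr1 raddf_sum big_ord_recl /= mcoeff1 eqxx big1 ?addr0 ?expr1n // => j _; rewrite -/(mcoeff 0%MM) rmorphXn /= mcoeffN y0 oppr0.
by rewrite expr0n.
Qed.

Lemma mono2_0 M m a : (mono2 M m a)@_0 = 1.
rewrite -/(mcoeff 0%MM) rmorph_prod big1 // => j _; exact: T0.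
Qed.

Lemma dY_T1 m i a : (i <= N)%N ->
 eqm Q (dY i (T m i a)) ((a%:R - m%:R : K) *: T m.+1 i a).
move=> hi; set u := iota1 K N Q i; set x : A := 1 + Y i.
have h1 : eqm Q (u * x) 1.
 rewrite mulrC iota1E /eqm addrAC subrr add0r; apply: vanishN.
 by apply: (@vanishW _ _ (Q.+1 * 1)); [lia|apply: vanish_exp; apply: vanishN; exact: vanish_Y].
apply: (@eqm_trans _ _ _ (u * (x * dY i (T m i a)))).
 by rewrite mulrA -{1}[dY _ _]mul1r; apply: eqmMr; apply: eqm_sym.
have -> : (a%:R - m%:R : K) *: T m.+1 i a = u * ((a%:R - m%:R : K) *: T m i a).
 by rewrite -scalerAr; congr _; rewrite /T exprS mulrA.
by apply: eqmMl; apply: dY_T.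
Qed.

Lemma dY_mono2 M m a i : (M <= N.+1)%N -> (i < M)%N ->
 eqm Q (dY i (mono2 M m a))
  (((a i)%:R - (m i)%:R : K) *: mono2 M (fun j => m j + (j == i))%N a).
move=> hM hi; have yN (j : 'I_M) : (j <= N)%N by rewrite -ltnS (leq_trans (ltn_ord j)).
rewrite /mono2 (bigD1 (Ordinal hi)) //= [X in eqm _ _ (_ *: X)](bigD1 (Ordinal hi)) //= eqxx addn1 dYM dY_prod0 ?mulr0 ?addr0 => [|j ji]; last first.
 by apply: dY_T_other => //; [lia|rewrite eq_sym].
have -> : \prod_(i0 < M | i0 != Ordinal hi) T (m i0 + (i0 == i :> nat))%N i0 (a i0) =
 \prod_(i0 < M | i0 != Ordinal hi) T (m i0) i0 (a i0).
 by bigr => j; rewrite -val_eqE => /negPf->; rewrite addn0.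
by rewrite scalerAl; apply: eqmMr; apply: dY_T1; apply: (yN (Ordinal hi)).
Qed.

Lemma ffS (l : K) k : ff l k.+1 = ff l k * (l - k%:R).
by rewrite /ff big_ord_recr. Qed.

Lemma foldr_dY_mono2 M m a idx : (M <= N.+1)%N -> all (fun i => i < M)%N idx ->
 eqm (Q.+1 - size idx) (foldr (@dY K N) (mono2 M m a) idx)
  ((\prod_(j < M) ff ((a j)%:R - (m j)%:R) (count_mem (j : nat) idx)) *:
   mono2 M (fun j => m j + count_mem j idx)%N a).
move=> hM; elim: idx => [|i idx IH].
 move=> _; apply: eqm_eq; rewrite big1 => [|j _]; last by rewrite /ff big_ord0.
 by rewrite scale1r; bigr => j _; rewrite addn0.
move=> /andP[hi hidx].
have [hs|hs] := leqP (size idx) Q; last first.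
 have -> : (Q.+1 - (size idx).+1 = 0)%N by lia.
 exact: vanish00.
apply: (@eqm_trans _ _ _ (dY i ((\prod_(j < M) ff ((a j)%:R - (m j)%:R) (count_mem (j : nat) idx)) *:
   mono2 M (fun j => m j + count_mem j idx)%N a))).
 by apply: eqm_deriv; rewrite -subSn //; apply: IH.
rewrite linearZ.
have -> : \prod_(j < M) ff ((a j)%:R - (m j)%:R) ((i == j) + count_mem (j : nat) idx)%N =
 (\prod_(j < M) ff ((a j)%:R - (m j)%:R) (count_mem (j : nat) idx)) *
  ((a i)%:R - (m i + count_mem i idx)%:R) :> K.
 rewrite (bigD1 (Ordinal hi)) //= [in RHS](bigD1 (Ordinal hi)) //= eqxx ffS natrD opprD addrA.
 rewrite [RHS]mulrAC; congr (_ * _); bigr => j; rewrite -val_eqE eq_sym => /negPf->.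
 by [].
rewrite -scalerA; apply: eqmZ.
have -> : mono2 M (fun j => m j + ((i == j) + count_mem j idx))%N a =
 mono2 M (fun j => m j + count_mem j idx + (j == i))%N a.
 by bigr => j _; rewrite eq_sym addnCA addnC.
apply: (@eqmW _ _ Q); first by rewrite subSS leq_subr.
exact: dY_mono2.
Qed.

(** Algebraic counterpart of an iterated partial derivative at (1,...,1); it is matched with [dpart]
    index list by index list. *)
Definition djet (idx : seq nat) (p : A) : K := (foldr (@dY K N) p idx)@_0.

Lemma djet_mono M m a idx : (M <= N.+1)%N -> all (fun i => i < M)%N idx -> (size idx <= Q)%N ->
 djet idx (mono K N Q M m a) = \prod_(j < M) ff ((a j)%:R - m%:R) (count_mem (j : nat) idx).
move=> hM hi hs.
have := eqm_coef (m := 0%MM) (foldr_dY_mono2 (fun=> m) a hM hi).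
rewrite mdeg0 subn_gt0 => /(_ hs); rewrite mcoeffZ mono2_0 mulr1; exact.
Qed.

Lemma foldr_dY_linear idx c (p q : A) :
 foldr (@dY K N) (c *: p + q) idx = c *: foldr (@dY K N) p idx + foldr (@dY K N) q idx.
by elim: idx => //= i idx ->; rewrite linearP. Qed.

Lemma foldr_dY_vanish idx d (p : A) : vanish d p -> vanish (d - size idx) (foldr (@dY K N) p idx).
move=> h; elim: idx => [|i idx IH]; first by rewrite subn0.
rewrite subnS; case E : (d - size idx)%N => [|e] //=.
by apply: vanish_deriv; rewrite -E.
Qed.

Lemma djet_eqm idx d (p q : A) : (size idx < d)%N -> eqm d p q -> djet idx p = djet idx q.
move=> hs h; apply/eqP; rewrite -subr_eq0 -mcoeffB.
have := foldr_dY_vanish (idx := idx) h => /(_ 0%MM); rewrite mdeg0 subn_gt0 => /(_ hs).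
have -> : p - q = (-1) *: q + p by rewrite scaleN1r addrC.
by rewrite foldr_dY_linear scaleN1r addrC => ->.
Qed.

Lemma foldr_dY_splits idx (p q : A) :
 foldr (@dY K N) (p * q) idx =
 \sum_(t <- splits idx) foldr (@dY K N) p t.1 * foldr (@dY K N) q t.2.
elim: idx => [|i idx IH] /=; first by rewrite big_seq1.
rewrite IH raddf_sum big_cat /= !big_map -big_split; bigr => t _.
by rewrite dYM.
Qed.

(** Leibniz applied to [f * d_j log f = d_j f]. The analytic logarithm obeys the same recursion
    ([dpart_log]), and the term carrying all of [idx] on the logarithm determines its jet. *)
Lemma djet_log D (f : A) idx j : vanish 1 (f - 1) -> (size idx < D)%N ->
 \sum_(t <- splits idx) djet t.1 f * djet (rcons t.2 j) (logt D f) = djet (rcons idx j) f.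
move=> hf hs; rewrite /djet -cats1 foldr_cat.
have := djet_eqm hs (dY_logt (D := D) j hf); rewrite /djet => <-.
rewrite foldr_dY_splits raddf_sum /=; bigr => t _.
by rewrite -cats1 foldr_cat rmorphM.
Qed.

Fixpoint jetidx (k : nat) (s : seq nat) : seq nat :=
 if s is a :: s' then nseq a k ++ jetidx k.+1 s' else [::].

Lemma mcoeff_iter_dY i a (p : A) (m : 'X_{1..N.+1}) : m (inord i) = 0%N ->
 (iter a (dY i) p)@_m = p@_(m + U_(inord i) *+ a) *+ a`!.
elim: a p => [|a IH] p hm; first by rewrite addm0.
rewrite iterSr IH // mcoeff_deriv -mulrnA mnmDE hm mulmnE mnm1E eqxx mul1n.
by rewrite -addmA mulmSr.
Qed.

Lemma djet_scoef s (p : A) : (size s <= N.+1)%N ->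
 djet (jetidx 0 s) p = scoef p s *+ (\prod_(a <- s) a`!).
move=> hs.
have gen k (m : 'X_{1..N.+1}) : (k + size s <= N.+1)%N -> (forall j, (k <= j <= N)%N -> m (inord j) = 0%N) ->
  (foldr (@dY K N) p (jetidx k s))@_m =
   p@_(m + mk (map inord (iota k (size s))) s) *+ (\prod_(a <- s) a`!).
 elim: s k m {hs} => [|a s IH] k m hk hm; first by rewrite big_nil addm0.
 rewrite foldr_cat.
 have -> q : foldr (@dY K N) q (nseq a k) = iter a (dY k) q by elim: a {hk} => //= a ->.
 rewrite addnS in hk.
 have kN : (k <= N)%N by lia.
 rewrite mcoeff_iter_dY ?hm ?leqnn // IH //; last first.
  move=> j /andP[kj jN]; rewrite mnmDE mulmnE mnm1E hm 1?ltnW //.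
  by rewrite -val_eqE /= !inordK // ltn_eqF.
 by rewrite -mulrnA big_cons addmA mulnC.
rewrite /djet gen; last by move=> j _; rewrite mnm0E.
 by rewrite add0m.
by [].
Qed.
End Jets.

(** * First-order expansion of the operators, for an abstract notion of limit *)

Record limit_rel (K : numFieldType) (cv : (nat -> K) -> K -> Prop) : Prop := {
 lim_const : forall c, cv (fun=> c) c;
 lim_add : forall u v a b, cv u a -> cv v b -> cv (fun N => u N + v N) (a + b);
 lim_mul : forall u v a b, cv u a -> cv v b -> cv (fun N => u N * v N) (a * b);
 lim_ext : forall u v a, (forall N, u N = v N) -> cv u a -> cv v a }.

Section Limits.
Variables (K : numFieldType) (D : nat).
Notation B := {mpoly K[D]}.
Variable cv : (nat -> K) -> K -> Prop.
Hypothesis hcv : limit_rel cv.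
Let cv_const := lim_const hcv.
Let cv_add := lim_add hcv.
Let cv_mul := lim_mul hcv.
Let cv_ext := lim_ext hcv.

Lemma cv_sum (I : Type) (r : seq I) (P : pred I) (F : I -> nat -> K) (G : I -> K) :
 (forall i, P i -> cv (F i) (G i)) ->
 cv (fun N => \sum_(i <- r | P i) F i N) (\sum_(i <- r | P i) G i).
move=> h; elim: r => [|i r IH].
 by rewrite big_nil; apply: cv_ext (cv_const 0) => N; rewrite big_nil.
rewrite big_cons; case E : P.
 by apply: cv_ext (cv_add (h i E) IH) => N; rewrite big_cons E.
by apply: cv_ext IH => N; rewrite big_cons E.
Qed.

Lemma cv_exp u a n : cv u a -> cv (fun N => u N ^+ n) (a ^+ n).
move=> h; elim: n => [|n IH].
 by apply: cv_ext (cv_const 1) => N.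
by rewrite exprS; apply: cv_ext (cv_mul h IH) => N; rewrite exprS.
Qed.

Lemma cv_opp u a : cv u a -> cv (fun N => - u N) (- a).
by move=> h; rewrite -mulN1r; apply: cv_ext (cv_mul (cv_const (-1)) h) => N; rewrite mulN1r. Qed.

Lemma cv_mulrn u a n : cv u a -> cv (fun N => u N *+ n) (a *+ n).
by move=> h; rewrite -mulr_natr; apply: cv_ext (cv_mul h (cv_const n%:R)) => N; rewrite mulr_natr. Qed.

(** Coefficientwise convergence is enough: each coefficient of a sum, product or derivative involves
    only finitely many coefficients of the arguments. *)
Definition cvB (P : nat -> B) (Q : B) := forall m, cv (fun N => (P N)@_m) Q@_m.

Lemma cvB_ext P P' Q : (forall N, P N = P' N) -> cvB P Q -> cvB P' Q.
by move=> e h m; apply: cv_ext (h m) => N; rewrite e. Qed.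
Lemma cvB_cong P P' Q Q' : (forall N, P' N = P N) -> Q' = Q -> cvB P Q -> cvB P' Q'.
by move=> e -> h; apply: cvB_ext h => N. Qed.
Lemma cvB_const Q : cvB (fun=> Q) Q. by []. Qed.
Lemma cvBD P P' Q Q' : cvB P Q -> cvB P' Q' -> cvB (fun N => P N + P' N) (Q + Q').
by move=> h h' m; rewrite mcoeffD; apply: cv_ext (cv_add (h m) (h' m)) => N; rewrite mcoeffD. Qed.
Lemma cvBN P Q : cvB P Q -> cvB (fun N => - P N) (- Q).
by move=> h m; rewrite mcoeffN; apply: cv_ext (cv_opp (h m)) => N; rewrite mcoeffN. Qed.
Lemma cvBB P P' Q Q' : cvB P Q -> cvB P' Q' -> cvB (fun N => P N - P' N) (Q - Q').
by move=> h h'; apply: cvBD => //; apply: cvBN. Qed.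
Lemma cvBM P P' Q Q' : cvB P Q -> cvB P' Q' -> cvB (fun N => P N * P' N) (Q * Q').
move=> h h' m; rewrite mcoeffM.
apply: (@cv_ext (fun N => \sum_(k : 'X_{1..D < (mdeg m).+1, (mdeg m).+1} | m == (k.1 + k.2)%MM) (P N)@_k.1 * (P' N)@_k.2)).
 by move=> N; rewrite mcoeffM.
by apply: cv_sum => k _; apply: cv_mul.
Qed.
Lemma cvBZ c l P Q : cv c l -> cvB P Q -> cvB (fun N => c N *: P N) (l *: Q).
by move=> hc h m; rewrite mcoeffZ; apply: cv_ext (cv_mul hc (h m)) => N; rewrite mcoeffZ. Qed.
Lemma cvBMn P Q n : cvB P Q -> cvB (fun N => P N *+ n) (Q *+ n).
by move=> h m; rewrite mcoeffMn; apply: cv_ext (cv_mulrn n (h m)) => N; rewrite mcoeffMn. Qed.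
Lemma cvB_deriv P Q b : cvB P Q -> cvB (fun N => (P N)^`M(b)) Q^`M(b).
by move=> h m; rewrite mcoeff_deriv; apply: cv_ext (cv_mulrn _ (h _)) => N; rewrite mcoeff_deriv. Qed.
Lemma cvB_sum (I : Type) (r : seq I) (P : pred I) (F : I -> nat -> B) (G : I -> B) :
 (forall i, P i -> cvB (F i) (G i)) ->
 cvB (fun N => \sum_(i <- r | P i) F i N) (\sum_(i <- r | P i) G i).
move=> h m; rewrite raddf_sum; apply: (@cv_ext (fun N => \sum_(i <- r | P i) (F i N)@_m)).
 by move=> N; rewrite raddf_sum.
by apply: cv_sum => i Pi; apply: h.
Qed.

Definition cvP (p : nat -> {poly B}) (q : {poly B}) := forall c, cvB (fun N => (p N)`_c) q`_c.

Lemma cvP_ext P P' Q : (forall N, P N = P' N) -> cvP P Q -> cvP P' Q.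
by move=> e h m; apply: cvB_ext (h m) => N; rewrite e. Qed.
Lemma cvP_cong P P' Q Q' : (forall N, P' N = P N) -> Q' = Q -> cvP P Q -> cvP P' Q'.
by move=> e -> h; apply: cvP_ext h => N. Qed.
Lemma cvPD P P' Q Q' : cvP P Q -> cvP P' Q' -> cvP (fun N => P N + P' N) (Q + Q').
by move=> h h' m; rewrite coefD; apply: cvB_ext (cvBD (h m) (h' m)) => N; rewrite coefD. Qed.
Lemma cvPM P P' Q Q' : cvP P Q -> cvP P' Q' -> cvP (fun N => P N * P' N) (Q * Q').
move=> h h' m; rewrite coefM; apply: (@cvB_ext (fun N => \sum_(j < m.+1) (P N)`_j * (P' N)`_(m - j))).
 by move=> N; rewrite coefM.
by apply: cvB_sum => k _; apply: cvBM.
Qed.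
Lemma cvPMn P Q n : cvP P Q -> cvP (fun N => P N *+ n) (Q *+ n).
by move=> h m; rewrite coefMn; apply: cvB_ext (cvBMn n (h m)) => N; rewrite coefMn. Qed.
Lemma cvP_const Q : cvP (fun=> Q) Q. by move=> m. Qed.
Lemma cvP_polyC P Q : cvB P Q -> cvP (fun N => (P N)%:P) Q%:P.
move=> h c; apply: (@cvB_cong (fun N => if c == 0%N then P N else 0) _ (if c == 0%N then Q else 0)).
- by move=> N; exact: coefC.
- exact: coefC.
by case: c => [|c] //=.
Qed.
Lemma cvP_sum (I : Type) (r : seq I) (P : pred I) (F : I -> nat -> {poly B}) (G : I -> {poly B}) :
 (forall i, P i -> cvP (F i) (G i)) ->
 cvP (fun N => \sum_(i <- r | P i) F i N) (\sum_(i <- r | P i) G i).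
move=> h m; rewrite coef_sum; apply: (@cvB_ext (fun N => \sum_(i <- r | P i) (F i N)`_m)).
 by move=> N; rewrite coef_sum.
by apply: cvB_sum => i Pi; apply: h.
Qed.
Lemma coef_map_mderiv (b : 'I_D) (p : {poly B}) c : (map_poly (mderiv b) p)`_c = (p`_c : B)^`M(b).
by apply: coef_map_id0; apply: mderiv0. Qed.

Lemma cvP_Der P Q : cvP P Q -> cvP (fun N => Der (P N)) (Der Q).
move=> h; apply: cvPD.
 move=> c; rewrite coef_deriv; apply: cvB_ext (cvBMn _ (h c.+1)) => N; by rewrite coef_deriv.
apply: cvP_sum => b _; apply: cvPMn; apply: cvPM; first exact: cvP_const.
move=> c; rewrite coef_map_mderiv.
by apply: cvB_ext (cvB_deriv b (h c)) => N; rewrite coef_map_mderiv.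
Qed.

Definition pK (q : {poly K}) : {poly B} := map_poly (@mpolyC D K) q.
HB.instance Definition _ := GRing.RMorphism.copy pK (map_poly (@mpolyC D K)).
Lemma coef_pK (q : {poly K}) c : (pK q)`_c = (q`_c)%:MP.
by apply: coef_map_id0. Qed.
Lemma cvP_pK (p : nat -> {poly K}) (q : {poly K}) : (forall c, cv (fun N => (p N)`_c) q`_c) -> cvP (fun N => pK (p N)) (pK q).
move=> h c m; rewrite coef_map mcoeffC.
apply: (@cv_ext (fun N => (p N)`_c * (m == 0%MM)%:R)); last by apply: cv_mul.
by move=> N; rewrite coef_map mcoeffC.
Qed.

(** The part of one step of [gg] that stays bounded and acts on [h]: the linear, divergent part of
    the logarithm and [d/dz] are left out. *)
Definition XJ (L2 h : B) : {poly B} :=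
 \sum_(b < D) ('X^b * (h^`M(b) + L2^`M(b) * h)%:P) *+ b.+1.

Variables (u w : nat -> K).
Hypothesis uw : forall N, u N * w N = 1.
Hypothesis cvu : cv u 0.
Variables (l1 : nat -> 'I_D -> K) (lam : 'I_D -> K) (L2 : nat -> B) (L2i : B).
Hypothesis cvl1 : forall b, cv (fun N => l1 N b) (lam b).
Hypothesis cvL2 : cvB L2 L2i.

(** The shape of the logarithm of the germ: a linear part of size [w N], where [w] is the inverse of
    [u], plus a convergent remainder. *)
Definition Lseq N : B := \sum_(b < D) (w N * l1 N b) *: 'X_b + L2 N.
(** What one derivative along [Y i] produces from the linear part. With [l b = c_(b+1)/(b+1)!] it is
    the Taylor polynomial of [F_rho(1+z)]. *)
Definition Lam (l : 'I_D -> K) : {poly K} := \sum_(b < D) (l b *+ b.+1) *: 'X^b.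

Lemma mderiv_Lseq N (b : 'I_D) : (Lseq N)^`M(b) = (w N * l1 N b)%:MP + (L2 N)^`M(b).
rewrite mderivD; congr _.
rewrite raddf_sum (bigD1 b) //= big1 ?addr0 => [|j jb]; rewrite mderivZ mderivX mnm1E.
 have -> : (U_(b) - U_(b))%MM = 0%MM :> 'X_{1..D} by apply/mnmP => k; rewrite mnmBE subnn mnm0E.
 by rewrite eqxx scale1r mpolyX0 -mul_mpolyC mulr1.
by rewrite (negPf jb) scale0r scaler0.
Qed.

Definition kz (c : K) : {poly B} := pK c%:P.
Lemma kzE c : kz c = (c%:MP)%:P. by rewrite /kz /pK map_polyC. Qed.
Lemma kz0 : kz 0 = 0. by rewrite kzE. Qed.
Lemma kz1 : kz 1 = 1. by rewrite kzE. Qed.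
Lemma kzM a b : kz (a * b) = kz a * kz b.
by rewrite !kzE mpolyCM polyCM. Qed.
Lemma kzMn a n : kz (a *+ n) = kz a *+ n.
by rewrite !kzE mpolyCMn polyCMn. Qed.
Lemma cvP_kz c l : cv c l -> cvP (fun N => kz (c N)) (kz l).
move=> h; rewrite kzE; apply: (@cvP_ext (fun N => ((c N)%:MP)%:P)); first by move=> N; rewrite kzE.
apply: cvP_polyC => m; rewrite mcoeffC; apply: (@cv_ext (fun N => c N * (m == 0%MM)%:R)).
 by move=> N; rewrite mcoeffC.
by apply: cv_mul.
Qed.
Lemma Der_kz c (p : {poly B}) : Der (kz c * p) = kz c * Der p.
rewrite /Der mulrDr derivM kzE derivC mul0r add0r; congr (_ + _).
rewrite mulr_sumr; bigr => b _; rewrite mulrnAr; congr _.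
have -> : map_poly (mderiv b) ((c%:MP)%:P * p) = (c%:MP)%:P * map_poly (mderiv b) p.
 apply/polyP => i; rewrite coef_map_mderiv !coefCM mderivM mderivC mul0r add0r.
 by rewrite coef_map_mderiv.
by rewrite mulrCA.
Qed.

Lemma Der_pK (r : {poly K}) (h : B) :
 Der (pK r * h%:P) = pK r^`() * h%:P + pK r * \sum_(b < D) ('X^b * (h^`M(b))%:P) *+ b.+1.
rewrite /Der derivM derivC mulr0 addr0 deriv_map; congr (_ + _).
rewrite mulr_sumr; bigr => b _; rewrite mulrnAr; congr (_ *+ _).
rewrite mulrCA; congr (_ * _); apply/polyP => i.
rewrite coef_map_mderiv [in LHS](coefMC _ (pK r)) (coefMC _ (pK r)) coef_pK.
by rewrite mderivM mderivC mul0r add0r.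
Qed.

Lemma pK_XJ (r : {poly K}) (M h : B) :
 pK r * XJ M h = pK r * (\sum_(b < D) ('X^b * (h^`M(b))%:P) *+ b.+1) +
  \sum_(b < D) ('X^b * ((M^`M(b))%:P * (pK r * h%:P))) *+ b.+1.
rewrite [LHS]mulr_sumr mulr_sumr -big_split; bigr => b _.
have gen (R : comNzRingType) (p x c a e : R) k :
 p * ((x * (c + a * e)) *+ k) = p * ((x * c) *+ k) + (x * (a * (p * e))) *+ k.
 ring.
by rewrite polyCD polyCM; exact: gen.
Qed.

Lemma pK_ZXn c n : pK (c *: 'X^n) = kz c * 'X^n.
by rewrite -mul_polyC rmorphM; congr (_ * _); exact: map_polyXn. Qed.

Lemma Lseq_sum N (p : {poly B}) :
 \sum_(b < D) ('X^b * (((Lseq N)^`M(b))%:P * p)) *+ b.+1 =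
 kz (w N) * pK (Lam (l1 N)) * p + \sum_(b < D) ('X^b * (((L2 N)^`M(b))%:P * p)) *+ b.+1.
have -> : pK (Lam (l1 N)) = \sum_(b < D) (kz (l1 N b) *+ b.+1) * 'X^b.
 by rewrite rmorph_sum; bigr => b _; rewrite -kzMn; exact: pK_ZXn.
rewrite mulr_sumr mulr_suml -big_split; bigr => b _.
rewrite mderiv_Lseq polyCD -kzE kzM.
have gen (R : comNzRingType) (x kw kl a q : R) k :
  (x * ((kw * kl + a) * q)) *+ k = kw * ((kl *+ k) * x) * q + (x * (a * q)) *+ k.
 by rewrite mulrnAl; congr _; ring.
exact: gen.
Qed.

Lemma scal_sum (M : B) (k p : {poly B}) :
 \sum_(b < D) ('X^b * ((M^`M(b))%:P * (k * p))) *+ b.+1 =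
 k * \sum_(b < D) ('X^b * ((M^`M(b))%:P * p)) *+ b.+1.
rewrite mulr_sumr; bigr => b _.
have gen (R : comNzRingType) (x a y z : R) n : (x * (a * (y * z))) *+ n = y * ((x * (a * z)) *+ n).
 congr _; ring.
exact: gen.
Qed.

Lemma lim_alg (R : comNzRingType) (P P' X h S1 S2 La Pm t : R) n :
 P * X = P * S1 + S2 -> La * (Pm *+ n) = P *+ n ->
 (P *+ n.+1) * X + (P' + La * t) * h = (P' * h + P * S1 + S2) + La * ((Pm *+ n) * X + t * h).
by move=> e1 e2; rewrite mulrDr mulrA e2 mulrS mulrDl e1; ring. Qed.

Lemma step_alg (R : comNzRingType) (kw ku kun d0 g0 s0 p1 pn hN : R) :
 kw * ku = 1 ->
 kun * d0 + kun * s0 + p1 * (kw * (kun * g0 - pn * hN)) =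
 kw * (kun * ku * (d0 + (kw * p1 * g0 + s0)) - p1 * pn * hN).
move=> e.
have -> : kw * (kun * ku * (d0 + (kw * p1 * g0 + s0)) - p1 * pn * hN) =
  kun * (kw * ku) * (d0 + (kw * p1 * g0 + s0)) - kw * p1 * pn * hN by ring.
by rewrite e; ring.
Qed.

Lemma cvLam n' : forall c, cv (fun N => (Lam (l1 N) ^+ n')`_c) (Lam lam ^+ n')`_c.
 elim: n' => [|n' IH] c.
  by apply: cv_ext (cv_const _) => N.
 rewrite exprS coefM; apply: (@cv_ext (fun N => \sum_(j < c.+1) (Lam (l1 N))`_j * (Lam (l1 N) ^+ n')`_(c - j))).
  by move=> N; rewrite exprS coefM.
 apply: cv_sum => j _; apply: cv_mul => //.
 rewrite coef_sum; apply: (@cv_ext (fun N => \sum_(b < D) ((l1 N b *+ b.+1) *: 'X^b)`_j)).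
  by move=> N; rewrite coef_sum.
 apply: cv_sum => b _; rewrite coefZ; apply: (@cv_ext (fun N => (l1 N b *+ b.+1) * ('X^b)`_j)).
  by move=> N; rewrite coefZ.
 by apply: cv_mul => //; apply: cv_mulrn.
Qed.

(** In a product of [n] factors, multiplication by [w Lam] dominates. At relative order [u], one
    factor is replaced by the derivation [XJ], or a power of [Lam] is differentiated; the latter is
    multiplication by [tau], which is the same for all [h]. *)
Lemma cvP_gg n : exists tau : {poly K}, forall h hi, cvB h hi ->
 cvP (fun N => kz (w N) * (kz (u N ^+ n) * gg (Lseq N) (h N) n - pK (Lam (l1 N) ^+ n) * (h N)%:P))
   (pK (Lam lam ^+ n.-1 *+ n) * XJ L2i hi + pK tau * hi%:P).
elim: n => [|n [tau IH]].
 exists 0 => h hi hh.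
 rewrite !rmorph0 !mul0r addr0.
 apply: cvP_ext; last exact: cvP_const.
 by move=> N; rewrite subrr mulr0.
exists ((Lam lam ^+ n)^`() + Lam lam * tau) => h hi hh.
have {}IH := IH h hi hh.
pose g N := kz (u N ^+ n) * gg (Lseq N) (h N) n.
have cvg : cvP g (pK (Lam lam ^+ n) * hi%:P).
 have hc := cvPD (cvPM (cvP_pK (cvLam n)) (cvP_polyC hh)) (cvPM (cvP_kz cvu) IH).
 have e1 (X Z : {poly B}) : X + kz 0 * Z = X by rewrite kz0 mul0r addr0.
 have e2 N (X Z : {poly B}) : X + kz (u N) * (kz (w N) * (Z - X)) = Z.
  by rewrite mulrA -kzM uw kz1 mul1r addrC subrK.
 by apply: (cvP_cong _ _ hc) => [N|]; [rewrite e2|rewrite e1].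
have lim : pK (Lam lam ^+ n *+ n.+1) * XJ L2i hi + pK ((Lam lam ^+ n)^`() + Lam lam * tau) * hi%:P =
 (Der (pK (Lam lam ^+ n) * hi%:P) +
  \sum_(b < D) ('X^b * ((L2i^`M(b))%:P * (pK (Lam lam ^+ n) * hi%:P))) *+ b.+1) +
 pK (Lam lam) * (pK (Lam lam ^+ n.-1 *+ n) * XJ L2i hi + pK tau * hi%:P).
 rewrite Der_pK.
 have -> : pK (Lam lam ^+ n *+ n.+1) = pK (Lam lam ^+ n) *+ n.+1 by exact: rmorphMn.
 have -> : pK (Lam lam ^+ n.-1 *+ n) = pK (Lam lam ^+ n.-1) *+ n by exact: rmorphMn.
 have -> : pK ((Lam lam ^+ n)^`() + Lam lam * tau) = pK (Lam lam ^+ n)^`() + pK (Lam lam) * pK tau.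
  by rewrite rmorphD rmorphM.
 have e2 : pK (Lam lam) * (pK (Lam lam ^+ n.-1) *+ n) = pK (Lam lam ^+ n) *+ n.
  case: (n) => [|n']; first by rewrite mulr0.
  by rewrite mulrnAr -rmorphM -exprS.
 exact: lim_alg (pK_XJ _ _ _) e2.
rewrite lim; pose s N := \sum_(b < D) ('X^b * (((L2 N)^`M(b))%:P * g N)) *+ b.+1.
have cvs : cvP s (\sum_(b < D) ('X^b * ((L2i^`M(b))%:P * (pK (Lam lam ^+ n) * hi%:P))) *+ b.+1).
 apply: cvP_sum => b _; apply: cvPMn; apply: cvPM; first exact: cvP_const.
 by apply: cvPM => //; apply: cvP_polyC; apply: cvB_deriv.
apply: cvP_ext (cvPD (cvPD (cvP_Der cvg) cvs) (cvPM (cvP_pK (fun c => cvLam 1%N c)) IH)) => N.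
rewrite Der_kz /s /= (Lseq_sum N (gg (Lseq N) (h N) n)).
rewrite (scal_sum (L2 N) (kz (u N ^+ n)) (gg (Lseq N) (h N) n)).
have -> : kz (u N ^+ n.+1) = kz (u N ^+ n) * kz (u N) by rewrite exprSr kzM.
have wu : kz (w N) * kz (u N) = 1 by rewrite -kzM mulrC uw kz1.
have -> : pK (Lam (l1 N) ^+ n.+1) = pK (Lam (l1 N)) * pK (Lam (l1 N) ^+ n) by rewrite exprS rmorphM.
exact: step_alg.
Qed.

Variables (al : nat -> K) (alpha : K).
Hypothesis cval : cv (fun N => u N * al N) alpha.

Definition kkN N m n : B := kk (qv ((al N)%:MP : B)) m n.

(** Here [p_0] has size [w]. The leading term needs every factor to be [p_0], which forces [n = m];
    at the next order one factor is the power sum of degree [n - m]. For [n <= m] the subtraction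
    gives 0 and [qv 0 0] is 0. *)
Lemma cvB_kk m : exists t : nat -> K, forall n, cvB
 (fun N => w N *: (u N ^+ m.+1 *: kkN N m n - ((u N * al N) ^+ m.+1 *+ (n == m))%:MP))
 ((alpha ^+ m *+ m.+1) *: qv 0 (n - m) + (t n)%:MP).
have wu N : w N * u N = 1 by rewrite mulrC.
elim: m => [|m [t IH]].
 exists (fun=> 0) => n; rewrite addr0 scale1r.
 case: n => [|n].
  apply: cvB_ext; last exact: cvB_const.
  by move=> N; rewrite mpolyCM mul_mpolyC subrr scaler0.
 apply: cvB_ext; last exact: cvB_const.
 by move=> N; rewrite subr0 scalerA wu scale1r.
have cvk n : cvB (fun N => u N ^+ m.+1 *: kkN N m n) (alpha ^+ m.+1 *+ (n == m))%:MP.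
 have h1 : cvB (fun N => ((u N * al N) ^+ m.+1 *+ (n == m))%:MP : B) (alpha ^+ m.+1 *+ (n == m))%:MP.
  move=> k; rewrite mcoeffC; apply: (@cv_ext (fun N => ((u N * al N) ^+ m.+1 *+ (n == m)) * (k == 0%MM)%:R)).
   by move=> N; rewrite mcoeffC.
  by apply: cv_mul => //; apply: cv_mulrn; apply: cv_exp.
 have h2 := cvBD h1 (cvBZ cvu (IH n)).
 apply: (cvB_cong _ _ h2); last by rewrite scale0r addr0.
 by move=> N; rewrite scalerA uw scale1r addrC subrK.
exists (fun n => if n is n'.+1 then alpha * t n' - (alpha ^+ m.+1 *+ (n' == m)) *+ n else 0) => n.
case: n => [|n].
 apply: cvB_cong; last exact: cvB_const.
  by move=> N; rewrite /kkN /= !(big_ord0, mulr0n, subr0, scaler0, mpolyC0).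
 by rewrite addr0 scaler0.
have h1 := cvBZ cval (IH n).
have h2 : cvB (fun N => \sum_(b < n) (u N ^+ m.+1 *: kkN N m b) * qv 0 (n - b)%N)
  (\sum_(b < n) (alpha ^+ m.+1 *+ ((b : nat) == m))%:MP * qv 0 (n - b)%N).
 by apply: cvB_sum => b _; apply: cvBM => //.
have h3 := cvBMn n.+1 (cvk n).
apply: (cvB_cong _ _ (cvBB (cvBD h1 h2) h3)) => [N|].
 rewrite /kkN /= big_ord_recr subnn.
 have -> : \sum_(b < n) kk (qv ((al N)%:MP : B)) m b * qv ((al N)%:MP : B) (n - b) =
   \sum_(b < n) kkN N m b * qv 0 (n - b)%N.
  by bigr => b _; case E : (n - b)%N => [|j] //; have := ltn_ord b; lia.
 have -> : \sum_(b < n) (u N ^+ m.+1 *: kkN N m b) * qv 0 (n - b)%N =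
   u N ^+ m.+1 *: \sum_(b < n) kkN N m b * qv 0 (n - b)%N.
  by rewrite scaler_sumr; bigr => b _; rewrite scalerAl.
 rewrite -/kkN -!mul_mpolyC.
 have -> : (((u N * al N) ^+ m.+2 *+ (n == m))%:MP : B) =
    (u N)%:MP * (al N)%:MP * ((u N * al N) ^+ m.+1 *+ (n == m))%:MP.
  by rewrite -!mpolyCM -mulrnAr.
 have -> : ((u N ^+ m.+2)%:MP : B) = (u N)%:MP * (u N ^+ m.+1)%:MP by rewrite -mpolyCM.
 rewrite mpolyCM.
 have e1 : (w N)%:MP * (u N)%:MP = 1 :> B by rewrite -mpolyCM wu.
 have gen (R : comNzRingType) (W U Um S k AL dl : R) j : W * U = 1 ->
   W * (U * Um * (S + k * AL - k *+ j) - U * AL * dl) =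
   U * AL * (W * (Um * k - dl)) + Um * S - (Um * k) *+ j.
  move=> e; rewrite -[k *+ j]mulr_natr.
  have -> : W * (U * Um * (S + k * AL - k * j%:R) - U * AL * dl) =
   (W * U) * (Um * (S + k * AL - k * j%:R) - AL * dl) by ring.
  have -> : U * AL * (W * (Um * k - dl)) = (W * U) * (AL * (Um * k - dl)) by ring.
  by rewrite e; ring.
 exact: gen.
rewrite subSS scalerDr scalerA.
case: (ltnP m n) => hmn; last first.
 have -> : (n - m = 0)%N by apply/eqP.
 rewrite !scaler0 !add0r big1 ?addr0 => [|b _].
  by rewrite mpolyCB mpolyCMn -mul_mpolyC mpolyCM.
 have -> : ((b : nat) == m) = false by apply/negbTE; rewrite neq_ltn (leq_trans (ltn_ord b) hmn).
 by rewrite mul0r.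
have -> : (n == m) = false by apply/negbTE; rewrite neq_ltn hmn orbT.
rewrite (bigD1 (Ordinal hmn)) //= big1 ?addr0 => [|b]; last first.
 by rewrite -val_eqE => /negPf->; rewrite mul0r.
rewrite eqxx !mul0rn !subr0 mul_mpolyC addrAC -scalerDl.
congr (_ *: _ + _); last by rewrite -mul_mpolyC -mpolyCM.
by rewrite mulrnAr -exprS -mulrSr.
Qed.

(* [resc F G]: up to a multiple of the identity that may diverge, the
  operators [F N] converge to [G]. *)
Definition resc (F : nat -> B -> B) (G : B -> B) := exists (t : K) (s : nat -> K),
 forall h hi, cvB h hi -> cvB (fun N => F N (h N) - (w N * s N) *: h N) (G hi + t *: hi).

Lemma resc_ext F F' G G' : (forall N h, F' N h = F N h) -> (forall h, G' h = G h) -> resc F G -> resc F' G'.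
move=> e e' [t [s h]]; exists t, s => hh hi cvh.
by apply: (cvB_cong _ _ (h _ _ cvh)) => [N|]; rewrite ?e ?e'.
Qed.
Lemma resc0 : resc (fun _ _ => 0) (fun=> 0).
exists 0, (fun=> 0) => h hi _; apply: cvB_cong; last exact: cvB_const.
 by move=> N; rewrite mulr0 scale0r subr0.
by rewrite scale0r addr0.
Qed.
Lemma rescD F G F' G' : resc F G -> resc F' G' -> resc (fun N h => F N h + F' N h) (fun h => G h + G' h).
move=> [t [s hF]] [t' [s' hF']]; exists (t + t'), (fun N => s N + s' N) => h hi cvh.
apply: (cvB_cong _ _ (cvBD (hF _ _ cvh) (hF' _ _ cvh))) => [N|].
 by rewrite mulrDr scalerDl opprD addrACA.
by rewrite scalerDl addrACA.
Qed.
Lemma rescZ c F G : resc F G -> resc (fun N h => c *: F N h) (fun h => c *: G h).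
move=> [t [s hF]]; exists (c * t), (fun N => c * s N) => h hi cvh.
apply: (cvB_cong _ _ (cvBZ (cv_const c) (hF _ _ cvh))) => [N|].
 by rewrite scalerBr scalerA mulrCA.
by rewrite scalerDr scalerA.
Qed.
Lemma resc_sum (I : Type) (r : seq I) (F : I -> nat -> B -> B) (G : I -> B -> B) :
 (forall i, resc (F i) (G i)) ->
 resc (fun N h => \sum_(i <- r) F i N h) (fun h => \sum_(i <- r) G i h).
move=> H; elim: r => [|i r IH].
 by apply: resc_ext resc0 => *; rewrite big_nil.
by apply: resc_ext (rescD (H i) IH) => *; rewrite big_cons.
Qed.

Definition termlim (m e c n : nat) (h : B) : B :=
 ((alpha ^+ m *+ m.+1 * (Lam lam ^+ n)`_c) *: qv 0 (c + e - m)) * h +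
 (alpha ^+ m.+1 *+ (c + e == m)%N) *: (pK (Lam lam ^+ n.-1 *+ n) * XJ L2i h)`_c.

(** Multiply the two first-order expansions: the product of the leading terms is the divergent
    multiple of the identity, the two mixed products give the limit, and the last product still
    carries a factor [u]. *)
Lemma resc_term m e c n : resc
 (fun N h => (u N ^+ n *: (gg (Lseq N) h n)`_c) * (u N ^+ m *: kkN N m (c + e)))
 (termlim m e c n).
have wu N : w N * u N = 1 by rewrite mulrC.
have [tau htau] := cvP_gg n; have [t ht] := cvB_kk m.
pose A N := (Lam (l1 N) ^+ n)`_c; pose a N := (u N * al N) ^+ m.+1 *+ (c + e == m)%N.
exists ((Lam lam ^+ n)`_c * t (c + e)%N + tau`_c * (alpha ^+ m.+1 *+ (c + e == m)%N)),
 (fun N => A N * a N) => h hi cvh.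
have cvA : cv A (Lam lam ^+ n)`_c by exact: cvLam.
have cva : cv a (alpha ^+ m.+1 *+ (c + e == m)%N) by apply: cv_mulrn; apply: cv_exp.
pose P1 N := w N *: (u N ^+ n *: (gg (Lseq N) (h N) n)`_c - A N *: h N).
pose P1i := (pK (Lam lam ^+ n.-1 *+ n) * XJ L2i hi)`_c + tau`_c *: hi.
have cvP1 : cvB P1 P1i.
 apply: (cvB_cong _ _ (htau h hi cvh c)) => [N|].
  rewrite kzE coefCM mul_mpolyC coefB; congr (_ *: (_ - _)).
   by rewrite kzE coefCM mul_mpolyC.
  by rewrite coefMC coef_pK mul_mpolyC.
 by rewrite coefD; congr _; rewrite coefMC coef_pK mul_mpolyC.
pose k1 N := w N *: (u N ^+ m.+1 *: kkN N m (c + e) - (a N)%:MP).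
pose k1i : B := (alpha ^+ m *+ m.+1) *: qv 0 (c + e - m) + (t (c + e)%N)%:MP.
have cvk1 : cvB k1 k1i by exact: ht.
have cvl := cvBD (cvBD (cvBZ cvA (cvBM cvh cvk1)) (cvBZ cva cvP1)) (cvBZ cvu (cvBM cvP1 cvk1)).
apply: (cvB_cong _ _ cvl) => [N|].
 have eP : u N ^+ n *: (gg (Lseq N) (h N) n)`_c = A N *: h N + u N *: P1 N.
  by rewrite scalerA uw scale1r addrC subrK.
 have ek : u N ^+ m *: kkN N m (c + e) = (w N * a N)%:MP + k1 N.
  rewrite /k1 scalerBr scalerA exprS mulrA wu mul1r mpolyCM mul_mpolyC.
  by rewrite addrC subrK.
 rewrite eP ek -!mul_mpolyC !mpolyCM.
 have e1 : (w N)%:MP * (u N)%:MP = 1 :> B by rewrite -mpolyCM wu.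
 have gen (R : comNzRingType) (A' h' u' w' a' p k : R) : w' * u' = 1 ->
  (A' * h' + u' * p) * (w' * a' + k) - w' * (A' * a') * h' =
  A' * (h' * k) + a' * p + u' * (p * k).
  move=> e'; have -> : a' * p = (w' * u') * a' * p by rewrite e' mul1r.
  ring.
 exact: gen.
rewrite /termlim /P1i /k1i scale0r addr0 -!mul_mpolyC !mpolyCD !mpolyCM.
have gen (R : comNzRingType) (a' A' h' q T' X' tau' d : R) :
 (a' * A' * q) * h' + d * X' + (A' * T' + tau' * d) * h' =
 A' * (h' * (a' * q + T')) + d * (X' + tau' * h') by ring.
exact: gen.
Qed.

Definition Xlim (k : nat) (h : B) : B :=
 \sum_(m < k.+1) ('C(k, m)%:R / m.+1%:R : K) *:
  \sum_(e < k.+1) ('C(k, e)%:R : K) *: \sum_(c < (k * D).+1) termlim m e c (k - m) h.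

Lemma resc_CC k : resc (fun N h => u N ^+ k *: CC ((al N)%:MP) k (Lseq N) h) (Xlim k).
apply: (@resc_ext (fun N h => \sum_(m < k.+1) ('C(k, m)%:R / m.+1%:R : K) *:
  \sum_(e < k.+1) ('C(k, e)%:R : K) *: \sum_(c < (k * D).+1)
   (u N ^+ (k - m) *: (gg (Lseq N) h (k - m))`_c) * (u N ^+ m *: kkN N m (c + e)))
  _ (Xlim k)) => //; last first.
 apply: resc_sum => m; apply: rescZ; apply: resc_sum => e; apply: rescZ; apply: resc_sum => c.
 exact: resc_term.
move=> N h; rewrite scaler_sumr; bigr => m _.
rewrite scalerA mulrC -scalerA; congr (_ *: _); rewrite scaler_sumr; bigr => e _.
rewrite scaler_nat -scalerMnr; congr (_ *+ _); rewrite scaler_sumr; bigr => c _.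
have km : (m <= k)%N by rewrite -ltnS.
by rewrite -{1}(subnK km) exprD -scalerAr -scalerAl scalerA mulrC -scalerA.
Qed.

(* Centring removes the divergent multiple of the identity, and the lower
  falling moments are negligible. *)
Theorem cvB_centred k (sc : 'I_k.+1 -> K) : sc ord_max = 1 ->
 exists t : K, forall h hi, cvB h hi ->
 let F N g := u N ^+ k *: \sum_(j < k.+1) sc j *: CC ((al N)%:MP) j (Lseq N) g in
 cvB (fun N => F N (h N) - ((F N 1)@_0) *: h N) (Xlim k hi + t *: hi).
move=> sc1.
pose op j N g := u N ^+ (k - j) *: (u N ^+ j *: CC ((al N)%:MP) j (Lseq N) g).
have FE N g : u N ^+ k *: \sum_(j < k.+1) sc j *: CC ((al N)%:MP) j (Lseq N) g =
  \sum_(j < k.+1) sc j *: op j N g.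
 rewrite scaler_sumr; bigr => j _; rewrite /op [u N ^+ (k - j) *: _]scalerA -exprD subnK; last by rewrite -ltnS.
 by rewrite !scalerA mulrC.
have cen j : exists t : K, forall h hi, cvB h hi ->
  cvB (fun N => u N ^+ j *: CC ((al N)%:MP) j (Lseq N) (h N) -
     ((u N ^+ j *: CC ((al N)%:MP) j (Lseq N) 1)@_0) *: h N) (Xlim j hi + t *: hi).
 have [t [s hs]] := resc_CC j; exists (- (Xlim j 1)@_0) => h hi cvh.
 have h1 := hs _ _ cvh; have h2 := hs _ _ (cvB_const 1) 0%MM.
 have eA c : (c%:A : B)@_0 = c by rewrite mcoeffZ mcoeff1 eqxx mulr1.
 apply: (cvB_cong _ _ (cvBB h1 (cvBZ h2 cvh))) => [N|].
  by rewrite mcoeffB eA scalerBl opprB addrA subrK.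
 by rewrite mcoeffD eA scalerDl opprD addrACA subrr addr0 scaleNr.
have cvcen (j : 'I_k.+1) : exists t : K, forall h hi, cvB h hi ->
  cvB (fun N => op j N (h N) - ((op j N 1)@_0) *: h N)
   ((if j == ord_max then Xlim k hi else 0) + t *: hi).
 have [t ht] := cen j; exists (if j == ord_max then t else 0) => h hi cvh.
 have h1 := cvBZ (cv_exp (k - j) cvu) (ht _ _ cvh).
 apply: (cvB_cong _ _ h1) => [N|]; first by rewrite scalerBr; congr (_ - _); rewrite [RHS]scalerA; congr (_ *: _); exact: mcoeffZ.
 have [->|jk] := eqVneq j ord_max; first by rewrite subnn scale1r.
 have kj : (0 < k - j)%N by move: jk; rewrite -val_eqE /=; have := ltn_ord j; lia.
 by rewrite expr0n gtn_eqF // scale0r addr0 scale0r.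
have [t ht] := fin_all_exists cvcen.
exists (\sum_(j < k.+1) sc j * t j) => h hi cvh F.
have hl : cvB (fun N => \sum_(j < k.+1) sc j *: (op j N (h N) - ((op j N 1)@_0) *: h N))
  (\sum_(j < k.+1) sc j *: ((if j == ord_max then Xlim k hi else 0) + t j *: hi)).
 by apply: cvB_sum => j _; apply: cvBZ => //; apply: ht.
apply: (cvB_cong _ _ hl) => [N|].
 rewrite /F !FE raddf_sum scaler_suml -sumrB; bigr => j _.
 by rewrite scalerBr; congr (_ - _); rewrite [RHS]scalerA; congr (_ *: _); exact: mcoeffZ.
under [RHS]eq_bigr => j _ do rewrite scalerDr scalerA.
rewrite big_split -scaler_suml; congr (_ + _).
rewrite (bigD1 ord_max) //= eqxx sc1 scale1r big1 ?addr0 // => j /negPf->.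
by rewrite scaler0.
Qed.
End Limits.

(** * Closed form of the limit operator *)

Section BinCoef.
Variable K : numFieldType.

(** The double sum is the convolution for a coefficient of [(1 + X)^k P]; the hypothesis ensures
    that the range of [c] cuts off nothing. *)
Lemma bincoef (P : {poly K}) k n s : (size P <= s)%N \/ (n < s)%N ->
 \sum_(e < k.+1) ('C(k, e)%:R : K) * \sum_(c < s) P`_c *+ ((c + e)%N == n) =
 ((1 + 'X) ^+ k * P)`_n.
move=> hs.
have -> : (1 + 'X : {poly K}) ^+ k = \sum_(e < k.+1) 'C(k, e)%:R *: 'X^e.
 rewrite addrC exprDn.
 rewrite (reindex_inj rev_ord_inj); bigr => e _.
 have ek : (e <= k)%N by rewrite -ltnS.
 by rewrite subKn // expr1n mulr1 bin_sub // scaler_nat.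
rewrite mulr_suml coef_sum; bigr => e _.
rewrite -scalerAl coefZ coefXnM; congr _.
have [ne|en] := ltnP n e.
 by rewrite big1 // => c _; case: eqP => // h; move: ne; rewrite -h ltnNge leq_addl.
have [hns|hns] := ltnP (n - e) s.
 rewrite (bigD1 (Ordinal hns)) //= subnK // eqxx big1 ?addr0 // => c hc.
 case: eqP => // h; case/negP: hc; apply/eqP; apply: val_inj; rewrite /=; lia.
rewrite big1 => [|c _]; last first.
 by case: eqP => // h; have := ltn_ord c; move: hns; rewrite -h addnK ltnNge => ->.
case: hs => [hs|hs]; last by move: hs hns; lia.
by rewrite nth_default // (leq_trans hs).
Qed.
End BinCoef.

Section Xlim.
Variables (K : numFieldType) (D : nat).
Notation B := {mpoly K[D]}.
Variables (alpha : K) (lam : 'I_D -> K) (L2i : B).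

(** [Wp / (alpha z)] is the factor [1/z + 1 + (1+z) F_rho(1+z) / alpha] of the contour integral,
    with [F_rho] truncated. *)
Definition Wp : {poly K} := (1 + 'X) * (alpha%:P + 'X * Lam lam).
(** Laurent coefficients of [(Wp / z)^k]: the one of [z^(a+1)] here, and [b.+1] times the one of
    [z^(-b-1)] in [psi]. *)
Definition omega k a : K := (Wp ^+ k)`_(a.+1 + k).
Definition psi k b : K := ('X^b * Wp ^+ k)`_k.-1 *+ b.+1.

Lemma size_Lam n : (size (Lam lam ^+ n) <= (n * D).+1)%N.
have h : (size (Lam lam) <= D)%N.
 apply: leq_trans (size_sum _ _ _) _; apply/bigmax_leqP => b _.
 by apply: leq_trans (size_scale_leq _ _) _; rewrite size_polyXn.
elim: n => [|n IH]; first by rewrite size_polyC oner_eq0.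
rewrite exprS; apply: leq_trans (size_polyMleq _ _) _; lia.
Qed.

Lemma Wp_exp k : Wp ^+ k = \sum_(m < k.+1) (alpha ^+ m *+ 'C(k, m)) *: ('X^(k - m) * ((1 + 'X) ^+ k * Lam lam ^+ (k - m))).
rewrite exprMn [alpha%:P + _]addrC [(_ + alpha%:P) ^+ k]exprDn mulr_sumr; bigr => m _.
rewrite -polyC_exp exprMn -[LHS]mul1r -mul_polyC polyCMn.
have gen (R : comNzRingType) (y x l a : R) n : 1 * (y * (x * l * a *+ n)) = (a *+ n) * (x * (y * l)).
 by rewrite mul1r; congr _; ring.
exact: gen.
Qed.

Lemma omega_sum k a :
 \sum_(m < k.+1) ('C(k, m)%:R / m.+1%:R : K) * \sum_(e < k.+1) 'C(k, e)%:R *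
  \sum_(c < (k * D).+1) (alpha ^+ m *+ m.+1 * (Lam lam ^+ (k - m))`_c) *+ ((c + e - m)%N == a.+1) =
 omega k a.
rewrite /omega Wp_exp coef_sum; bigr => m _.
have mk : (m <= k)%N by rewrite -ltnS.
rewrite coefZ coefXnM ifF; last lia.
have -> : (a.+1 + k - (k - m) = a.+1 + m)%N by lia.
rewrite -(@bincoef _ _ _ _ (k * D).+1); last first.
 left; apply: leq_trans (size_Lam _) _; rewrite ltnS leq_mul2r leq_subr orbT //.
rewrite !mulr_sumr; bigr => e _; rewrite !mulr_sumr; bigr => c _.
have -> : ((c + e - m)%N == a.+1) = ((c + e)%N == (a.+1 + m)%N) by apply/eqP/eqP; lia.
rewrite ?mulr0 // -[alpha ^+ m *+ m.+1]mulr_natr -mulr_natr.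
have h : (m.+1%:R : K) != 0 by rewrite pnatr_eq0.
by move: (m.+1%:R : K) h => x h; field.
Qed.

(** The factor [n = k - m] in [n Lam^(n-1)] turns [C(k,m)/(m+1)] into [C(k,m+1)], so the sum is the
    expansion of [Wp^k] with its index shifted by one; the term of index 0 there is divisible by
    [z^k] and does not reach degree [k - 1]. *)
Lemma psi_sum k (b : 'I_D) : (0 < k)%N ->
 \sum_(m < k.+1) ('C(k, m)%:R / m.+1%:R : K) * \sum_(e < k.+1) 'C(k, e)%:R *
  \sum_(c < (k * D).+1) (alpha ^+ m.+1 *+ ((c + e)%N == m)) *
    (('X^b * (Lam lam ^+ (k - m).-1 *+ (k - m)))`_c *+ b.+1) =
 psi k b.
move=> k0.
have D0 : (0 < D)%N by apply: leq_ltn_trans (ltn_ord b).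
rewrite /psi Wp_exp mulr_sumr coef_sum -sumrMnl big_ord_recr /= subnn [X in _ + _ * X]big1 ?mulr0 => [|e _]; last first.
 by rewrite big1 ?mulr0 // => c _; rewrite coef0 mul0rn mulr0.
rewrite addr0 big_ord_recl.
have -> : ('X^b * ((alpha ^+ 0 *+ 'C(k, 0)) *: ('X^(k - 0) * ((1 + 'X) ^+ k * Lam lam ^+ (k - 0)))) : {poly K})`_k.-1 = 0.
 by rewrite -scalerAr mulrCA coefZ coefXnM ifT ?mulr0 //; lia.
rewrite mul0rn add0r; bigr => m _.
have mk := ltn_ord m.
rewrite /bump.
have -> : ('X^b * ((alpha ^+ m.+1 *+ 'C(k, m.+1)) *: ('X^(k - m.+1) * ((1 + 'X) ^+ k * Lam lam ^+ (k - m.+1)))) : {poly K}) =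
 (alpha ^+ m.+1 *+ 'C(k, m.+1)) *: ('X^(k - m.+1) * ((1 + 'X) ^+ k * ('X^b * Lam lam ^+ (k - m.+1)))).
 rewrite -scalerAr; congr (_ *: _).
 have gen (R : comNzRingType) (y x l a : R) : y * (x * (l * a)) = x * (l * (y * a)) by ring.
 exact: gen.
rewrite coefZ coefXnM ifF; last lia.
have -> : (k.-1 - (k - m.+1) = m)%N by lia.
rewrite -(@bincoef _ _ _ _ (k * D).+1); last by right; nia.
rewrite -mulrnAr !mulr_sumr -sumrMnl mulr_sumr; bigr => e _.
rewrite -mulrnAr -sumrMnl !mulr_sumr; bigr => c _.
case: eqP => _; rewrite ?mul0r ?mul0rn ?mulr0 //.
rewrite !mulr1n subnS mulrnAr coefMn.
have hb : ('C(k, m)%:R * (k - m)%:R / m.+1%:R : K) = 'C(k, m.+1)%:R.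
 have h : (m.+1%:R : K) != 0 by rewrite pnatr_eq0.
 apply: (mulIf h); rewrite mulfVK // -!natrM; congr (_%:R).
 by rewrite [RHS]mulnC mul_bin_left mulnC.
rewrite -[alpha ^+ _ *+ _]mulr_natr -hb -[in LHS](mulr_natr _ (k - m)).
have gen (R : comNzRingType) (a n iv z e' x : R) j : a * iv * (e' * (z * ((x * n) *+ j))) = z * (a * n * iv) * (e' * (x *+ j)).
 by rewrite -mulr_natr -mulr_natr; ring.
exact: gen.
Qed.

Lemma qvE n : qv 0 n = \sum_(a < D) ((n == a.+1)%:R : K) *: ('X_a : B).
case: n => [|n] /=; first by rewrite big1 // => a _; rewrite scale0r.
case: insubP => [i _ <-|].
 rewrite (bigD1 i) //= eqxx scale1r big1 ?addr0 // => a; rewrite -val_eqE eqSS eq_sym => /negPf->.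
 by rewrite scale0r.
rewrite -leqNgt => h; rewrite big1 // => a _.
by rewrite eqSS gtn_eqF ?scale0r // (leq_trans (ltn_ord a)).
Qed.

Lemma Xlim_eq k h : (0 < k)%N -> Xlim lam L2i alpha k h =
 (\sum_(a < D) omega k a *: 'X_a) * h +
 \sum_(b < D) psi k b *: (h^`M(b) + L2i^`M(b) * h).
move=> k0; pose J b : B := h^`M(b) + L2i^`M(b) * h.
have XJc r c : (pK D r * XJ L2i h)`_c = \sum_(b < D) (('X^b * r)`_c *+ b.+1) *: J b.
 rewrite mulr_sumr coef_sum; bigr => b _.
 rewrite mulrnAr coefMn.
 have -> : (pK D r * ('X^b * (J b)%:P))`_c = ('X^b * r)`_c *: J b.
  have -> : pK D r * ('X^b * (J b)%:P) = 'X^b * (pK D r * (J b)%:P) by rewrite mulrCA.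
  rewrite coefXnM coefXnM; case: ifP => _; first by rewrite scale0r.
  by rewrite coefMC coef_pK mul_mpolyC.
 by rewrite scalerMnl.
have e1 : (\sum_(a < D) omega k a *: 'X_a) * h =
 \sum_(m < k.+1) ('C(k, m)%:R / m.+1%:R : K) *: \sum_(e < k.+1) ('C(k, e)%:R : K) *:
  \sum_(c < (k * D).+1) ((alpha ^+ m *+ m.+1 * (Lam lam ^+ (k - m))`_c) *: qv 0 (c + e - m)) * h.
 have -> : \sum_(a < D) omega k a *: ('X_a : B) =
   \sum_(m < k.+1) ('C(k, m)%:R / m.+1%:R : K) *: \sum_(e < k.+1) ('C(k, e)%:R : K) *:
  \sum_(c < (k * D).+1) ((alpha ^+ m *+ m.+1 * (Lam lam ^+ (k - m))`_c) *: (qv 0 (c + e - m) : B)).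
  under eq_bigr => a _ do rewrite -omega_sum scaler_suml.
  rewrite exchange_big; bigr => m _.
  under eq_bigr => a _ do rewrite -scalerA scaler_suml.
  rewrite -scaler_sumr exchange_big; congr (_ *: _); bigr => e _.
  under eq_bigr => a _ do rewrite -scalerA scaler_suml.
  rewrite -scaler_sumr exchange_big; congr (_ *: _); bigr => c _.
  rewrite qvE scaler_sumr; bigr => a _; rewrite scalerA; congr _.
  by case: eqP => _; rewrite ?mulr1 ?mulr0.
 rewrite mulr_suml; bigr => m _; rewrite -scalerAl mulr_suml; congr (_ *: _).
 by bigr => e _; rewrite -scalerAl mulr_suml.
have e2 : \sum_(b < D) psi k b *: J b =
 \sum_(m < k.+1) ('C(k, m)%:R / m.+1%:R : K) *: \sum_(e < k.+1) ('C(k, e)%:R : K) *: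
  \sum_(c < (k * D).+1) (alpha ^+ m.+1 *+ (c + e == m)%N) *: (pK D (Lam lam ^+ (k - m).-1 *+ (k - m)) * XJ L2i h)`_c.
 under eq_bigr => b _ do rewrite -psi_sum // scaler_suml.
 rewrite exchange_big; bigr => m _.
 under eq_bigr => a _ do rewrite -scalerA scaler_suml.
 rewrite -scaler_sumr exchange_big; congr (_ *: _); bigr => e _.
 under eq_bigr => a _ do rewrite -scalerA scaler_suml.
 rewrite -scaler_sumr exchange_big; congr (_ *: _); bigr => c _.
 rewrite XJc scaler_sumr; bigr => a _; by rewrite scalerA.
rewrite e1 -/J e2 -big_split; bigr => m _ /=.
rewrite -scalerDr -big_split; congr (_ *: _); bigr => e _ /=.
by rewrite -scalerDr -big_split.
Qed.
End Xlim.

(** * Wick's recursion for multiplication and derivation operators *)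

Definition dropnth (T : Type) (j : nat) (s : seq T) := take j s ++ drop j.+1 s.

Section Wick.
Variables (K : numFieldType) (D : nat) (X : Type).
Notation B := {mpoly K[D]}.
Variables (lin : X -> 'I_D -> K) (psi : X -> 'I_D -> K).

Definition ell (x : X) : B := \sum_(a < D) lin x a *: 'X_a.
Definition dl (x : X) (h : B) : B := \sum_(b < D) psi x b *: h^`M(b).
(** A creation part, multiplication by a linear form, plus an annihilation part, a derivation with
    constant coefficients. The commutator of the annihilation part of [x] with the creation part of
    [y] is the scalar [cc x y]. *)
Definition Op (x : X) (h : B) : B := ell x * h + dl x h.
Definition cc (x y : X) : K := \sum_(b < D) psi x b * lin y b.

Lemma mderiv_X (a b : 'I_D) : ('X_a : B)^`M(b) = ((a == b)%:R : K)%:MP.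
rewrite mderivX mnm1E; case: eqP => [->|_]; last by rewrite scale0r.
have -> : (U_(b) - U_(b))%MM = 0%MM :> 'X_{1..D} by apply/mnmP => k; rewrite mnmBE subnn mnm0E.
by rewrite mpolyX0 scale1r.
Qed.

Lemma md_sum (b : 'I_D) (I : Type) (r : seq I) (F : I -> B) :
 (\sum_(i <- r) F i)^`M(b) = \sum_(i <- r) (F i)^`M(b).
exact: raddf_sum. Qed.

Lemma mderiv_ell x b : (ell x)^`M(b) = (lin x b)%:MP.
rewrite raddf_sum (bigD1 b) //= mderivZ mderiv_X eqxx big1 ?addr0 => [|a /negPf ab].
 by rewrite -mul_mpolyC mulr1.
by rewrite mderivZ mderiv_X ab scaler0.
Qed.

Lemma ell0 x : (ell x)@_0 = 0.
rewrite raddf_sum big1 // => a _; rewrite /= mcoeffZ mcoeffX.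
by case: eqP => [/(congr1 (@mdeg _))|]; rewrite ?mdeg1 ?mdeg0 ?mulr0.
Qed.

Lemma dlD x g h : dl x (g + h) = dl x g + dl x h.
by rewrite -big_split; bigr => b _; rewrite mderivD scalerDr. Qed.

Lemma dl_ell x y h : dl x (ell y * h) = cc x y *: h + ell y * dl x h.
rewrite scaler_suml mulr_sumr -big_split; bigr => b _.
by rewrite mderivM mderiv_ell scalerDr mul_mpolyC scalerA -scalerAr.
Qed.

Lemma dl_comm x y h : dl x (dl y h) = dl y (dl x h).
rewrite /dl; under eq_bigr => b _ do rewrite md_sum scaler_sumr.
rewrite exchange_big; bigr => b _; rewrite md_sum [RHS]scaler_sumr; bigr => a _.
by rewrite !mderivZ mderiv_comm !scalerA mulrC.
Qed.

Lemma Op_sum x (I : Type) (r : seq I) (F : I -> B) : Op x (\sum_(i <- r) F i) = \sum_(i <- r) Op x (F i).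
elim: r => [|i r IH].
 by rewrite !big_nil /Op mulr0 add0r /dl big1 // => b _; rewrite mderiv0 scaler0.
by rewrite !big_cons -IH /Op dlD mulrDr addrACA.
Qed.

Lemma OpZ x c h : Op x (c *: h) = c *: Op x h.
rewrite /Op scalerDr -scalerAr; congr (_ + _); rewrite scaler_sumr; bigr => b _.
by rewrite mderivZ !scalerA mulrC.
Qed.

Lemma dl_Op x y h : dl x (Op y h) = cc x y *: h + Op y (dl x h).
by rewrite dlD dl_ell dl_comm addrA. Qed.

(** The derivation is moved to the right through the word until it kills 1; each operator it passes
    leaves one contraction. *)
Lemma dl_ops x0 x s : dl x (foldr Op 1 s) =
 \sum_(j < size s) cc x (nth x0 s j) *: foldr Op 1 (dropnth j s).
elim: s => [|y s IH].
 by rewrite big_ord0 /dl big1 // => b _; rewrite mderivC scaler0.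
rewrite dl_Op IH Op_sum big_ord_recl /dropnth /= ?drop0; congr (_ + _).
by bigr => j _; rewrite OpZ.
Qed.

(* Wick's recursion: the last operator contracts with one of the others. *)
Lemma ev_ops x0 x s : (foldr Op 1 (x :: s))@_0 =
 \sum_(j < size s) cc x (nth x0 s j) * (foldr Op 1 (dropnth j s))@_0.
rewrite mcoeffD.
have -> : (ell x * foldr Op 1 s)@_0 = 0.
 by rewrite -/(mcoeff 0%MM) rmorphM /= ell0 mul0r.
rewrite add0r (dl_ops x0) raddf_sum; bigr => j _; exact: mcoeffZ.
Qed.
End Wick.

(** * Limits of centred operators and of their products *)

Section LimitOps.
Variables (K : numFieldType) (D : nat).
Notation B := {mpoly K[D]}.
Variable cv : (nat -> K) -> K -> Prop.
Hypothesis hcv : limit_rel cv.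
Hypothesis cv_uniq : forall u a b, cv u a -> cv u b -> a = b.
Variables (u w : nat -> K).
Hypothesis uw : forall N, u N * w N = 1.
Hypothesis cvu : cv u 0.
Variables (l1 : nat -> 'I_D -> K) (lam : 'I_D -> K) (L2 : nat -> B) (beta : 'I_D -> 'I_D -> K).
Hypothesis beta_sym : forall a b, beta a b = beta b a.
(** The limit of the nonlinear part of the logarithm. Subtracting the power sum of degree
    [a + b + 2] removes the diagonal from a product of two power sums, so that [beta] weighs pairs
    of distinct variables. *)
Definition L2lim : B := 2^-1 *: \sum_(a < D) \sum_(b < D) beta a b *: ('X_a * 'X_b - qv 0 (a.+1 + b.+1)).
Hypothesis cvl1 : forall b, cv (fun N => l1 N b) (lam b).
Hypothesis cvL2 : cvB cv L2 L2lim.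

Lemma mderiv_qv0 n b : exists c : K, (qv 0 n : B)^`M(b) = c%:MP.
case: n => [|n] /=; first by exists 0; rewrite mderiv0.
case: insub => [i|]; last by exists 0; rewrite mderiv0.
by exists (i == b)%:R; apply: mderiv_X.
Qed.

(** The subtracted power sums are linear, so they contribute only a constant to the derivative, and
    centring will absorb it. *)
Lemma mderiv_L2lim b : exists s : K, L2lim^`M(b) = \sum_(a < D) beta b a *: 'X_a + s%:MP.
have h2 : (2 : K) != 0 by rewrite pnatr_eq0.
pose S : B := \sum_(a < D) \sum_(b < D) beta a b *: qv 0 (a.+1 + b.+1).
have [s hs] : exists s : K, S^`M(b) = s%:MP.
 rewrite /S; elim/big_rec: _ => [|a x _ [s hs]]; first by exists 0; rewrite mderiv0.
 have [s' hs'] : exists s : K, (\sum_(b < D) beta a b *: (qv 0 (a.+1 + b.+1) : B))^`M(b) = s%:MP.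
  elim/big_rec: _ => [|a' x' _ [s' hs']]; first by exists 0; rewrite mderiv0.
  have [c hc] := mderiv_qv0 (a.+1 + a'.+1) b.
  by exists (beta a a' * c + s'); rewrite mderivD mderivZ hc hs' mpolyCD mpolyCM mul_mpolyC.
 by exists (s' + s); rewrite mderivD hs hs' mpolyCD.
exists (- (2^-1 * s)).
have -> : L2lim = 2^-1 *: (\sum_(a < D) \sum_(b < D) beta a b *: ('X_a * 'X_b)) - 2^-1 *: S.
 rewrite -scalerBr; congr (_ *: _); rewrite -sumrB; bigr => a _.
 by rewrite -sumrB; bigr => b' _; rewrite -scalerBr.
rewrite mderivB !mderivZ hs mpolyCN mpolyCM mul_mpolyC; congr _.
rewrite md_sum.
have -> : \sum_(a < D) (\sum_(b' < D) beta a b' *: ('X_a * 'X_b'))^`M(b) =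
  \sum_(a < D) (beta b a *: ('X_a : B)) + \sum_(a < D) (beta a b *: ('X_a : B)).
 have e a : (\sum_(b' < D) beta a b' *: (('X_a : B) * 'X_b'))^`M(b) =
   (a == b)%:R *: \sum_(b' < D) beta a b' *: 'X_b' + beta a b *: 'X_a.
  rewrite md_sum.
  have e2 b' : (beta a b' *: (('X_a : B) * 'X_b'))^`M(b) = (a == b)%:R *: (beta a b' *: 'X_b') + (b' == b)%:R *: (beta a b *: 'X_a).
   rewrite mderivZ mderivM !mderiv_X scalerDr mul_mpolyC mulrC mul_mpolyC !scalerA.
   by congr (_ + _); case: eqP => [->|]; rewrite ?mulr1 ?mul1r ?mulr0 ?mul0r.
  under eq_bigr => b' _ do rewrite e2.
  rewrite big_split -scaler_sumr; congr (_ + _).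
  rewrite (bigD1 b) //= eqxx scale1r big1 ?addr0 // => b' /negPf->; by rewrite scale0r.
 under eq_bigr => a _ do rewrite e.
 rewrite big_split; congr (_ + _).
 rewrite (bigD1 b) //= eqxx scale1r [X in _ + X]big1 ?addr0 // => b' /negPf->; by rewrite scale0r.
have -> : \sum_(a < D) beta a b *: 'X_a = \sum_(a < D) beta b a *: ('X_a : B).
 by bigr => a _; rewrite beta_sym.
by rewrite -mulr2n -scaler_nat scalerA mulVf ?scale1r.
Qed.

Definition cen (al : nat -> K) k (sc : 'I_k.+1 -> K) N (h : B) : B :=
 let F g := u N ^+ k *: \sum_(j < k.+1) sc j *: CC ((al N)%:MP) j (Lseq w l1 L2 N) g in
 F h - ((F 1)@_0) *: h.

Definition limlin alpha k (a : 'I_D) : K := omega alpha lam k a + \sum_(b < D) psi alpha lam k b * beta b a.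

(** The multiple of the identity left open by [cvB_centred] is 0: applied to 1, the centred operator
    has constant term 0 for every [N], and limits are unique. *)
Lemma cvB_cen (al : nat -> K) alpha k sc h hi :
 cv (fun N => u N * al N) alpha -> (0 < k)%N -> sc ord_max = 1 -> cvB cv h hi ->
 cvB cv (fun N => cen al (k := k) sc N (h N))
  (\sum_(a < D) limlin alpha k a *: 'X_a * hi + \sum_(b < D) psi alpha lam k b *: hi^`M(b)).
move=> cval k0 sc1 cvh.
have [t ht] := cvB_centred hcv uw cvu cvl1 cvL2 cval sc1.
have [s hs] : exists s : 'I_D -> K, forall b, L2lim^`M(b) = \sum_(a < D) beta b a *: 'X_a + (s b)%:MP.
 have : forall n, exists s : 'I_D -> K, forall b : 'I_D, (b < n)%N -> L2lim^`M(b) = \sum_(a < D) beta b a *: 'X_a + (s b)%:MP.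
  elim=> [|n [s hs]]; first by exists (fun=> 0).
  have [nD|Dn] := ltnP n D; last by exists s => b _; apply: hs; apply: leq_trans.
  have [s' hs'] := mderiv_L2lim (Ordinal nD).
  exists (fun b : 'I_D => if (b : nat) == n then s' else s b) => b; rewrite ltnS leq_eqVlt.
  case: eqP => [bn _|_ bn]; last exact: hs.
  by have -> : b = Ordinal nD by apply: val_inj.
 by move=> /(_ D) [s hs]; exists s => b; apply: hs.
pose t' := t + \sum_(b < D) psi alpha lam k b * s b.
have E g : Xlim lam L2lim alpha k g + t *: g =
 \sum_(a < D) limlin alpha k a *: 'X_a * g + \sum_(b < D) psi alpha lam k b *: g^`M(b) + t' *: g.
 rewrite Xlim_eq // scalerDl.
 have -> : \sum_(b < D) psi alpha lam k b *: (g^`M(b) + L2lim^`M(b) * g) =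
  \sum_(b < D) psi alpha lam k b *: g^`M(b) +
  (\sum_(b < D) psi alpha lam k b *: (\sum_(a < D) beta b a *: 'X_a)) * g +
  (\sum_(b < D) psi alpha lam k b * s b) *: g.
  rewrite mulr_suml scaler_suml -!big_split; bigr => b _.
  rewrite hs mulrDl !scalerDr addrA mul_mpolyC scalerA scalerAl; congr _.
 have -> : \sum_(a < D) limlin alpha k a *: 'X_a * g =
   (\sum_(a < D) omega alpha lam k a *: 'X_a) * g +
   (\sum_(b < D) psi alpha lam k b *: (\sum_(a < D) beta b a *: 'X_a)) * g.
  rewrite -mulr_suml -mulrDl; congr (_ * _).
  have -> : \sum_(b < D) psi alpha lam k b *: (\sum_(a < D) beta b a *: ('X_a : B)) =
   \sum_(a < D) (\sum_(b < D) psi alpha lam k b * beta b a) *: 'X_a.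
   under eq_bigr => b _ do rewrite scaler_sumr.
   rewrite exchange_big; bigr => a _; rewrite scaler_suml; bigr => b _.
   by rewrite scalerA.
  by rewrite -big_split; bigr => a _; rewrite scalerDl.
 set P1 := _ * g; set P2 := \sum_(b < D) _; set P3 := _ * g; set P4 := _ *: g; set P5 := _ *: g.
 by rewrite [P2 + P3]addrC [P5 + P4]addrC !addrA.
have t0 : t' = 0.
 have h1 := ht _ _ (cvB_const hcv 1) 0%MM.
 have cvz := lim_const hcv 0.
 have eA c : (c%:A : B)@_0 = c by rewrite mcoeffZ mcoeff1 eqxx mulr1.
 move: h1; set Z := mcoeff _ _ => h1.
 have Z0 : Z = 0 by apply: cv_uniq (lim_ext hcv _ h1) cvz => N; rewrite mcoeffB eA subrr.
 move: Z0; rewrite /Z E !mcoeffD eA.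
 have -> : (\sum_(a < D) limlin alpha k a *: 'X_a * 1 : B)@_0 = 0.
  by rewrite -mulr_suml mulr1; apply: ell0.
 have -> : (\sum_(b < D) psi alpha lam k b *: (1 : B)^`M(b))@_0 = 0.
  by rewrite raddf_sum big1 // => b _; rewrite /= mderivC scaler0 mcoeff0.
 by rewrite !add0r.
apply: (cvB_cong hcv _ _ (ht _ _ cvh)) => //.
by rewrite E t0 scale0r addr0.
Qed.

Theorem cvB_chain (X : Type) (al : X -> nat -> K) (alpha : X -> K) (k : X -> nat)
  (sc : forall x, 'I_(k x).+1 -> K) (s : seq X) :
 (forall x, cv (fun N => u N * al x N) (alpha x)) ->
 (forall x, (0 < k x)%N) -> (forall x, sc x ord_max = 1) ->
 cvB cv (fun N => foldr (fun x h => cen (al x) (sc x) N h) 1 s)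
  (foldr (Op (fun x => limlin (alpha x) (k x)) (fun x => psi (alpha x) lam (k x))) 1 s).
move=> hal k0 hsc; elim: s => [|x s IH]; first exact: cvB_const.
have := cvB_cen (hal x) (k0 x) (hsc x) IH.
by rewrite -mulr_suml.
Qed.
End LimitOps.

(** * Asymptotics of the logarithm of the germ *)

Section LogAsymptotics.
Variables (K : numFieldType) (D0 : nat).
Notation D := D0.+2.
Notation B := {mpoly K[D]}.
Variable cv : (nat -> K) -> K -> Prop.
Hypothesis hcv : limit_rel cv.
Variables (u w : nat -> K).
Hypothesis uw : forall N, u N * w N = 1.
Variable p : forall N, {mpoly K[N.+1]}.
Variables (lam : 'I_D -> K) (beta : 'I_D -> 'I_D -> K).
Hypothesis h1 : forall b : 'I_D, cv (fun N => u N * scoef (p N) [:: b.+1]) (lam b).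
Hypothesis h2 : forall a b : 'I_D, cv (fun N => scoef (p N) [:: a.+1; b.+1]) (beta a b).
Hypothesis h3 : forall s, (2 < size s)%N -> all (leq 1) s -> cv (fun N => scoef (p N) s) 0.

Definition logl1 N (b : 'I_D) : K := u N * scoef (p N) [:: b.+1].
(** All terms with at least two distinct variables; the shape [D0.+2] of [D] leaves room for the
    linear and the quadratic term. *)
Definition logL2 N : B := \sum_(r < D0.+1) ((r.+2)`!%:R)^-1 *: LLr D (p N) r.+2.

Lemma LL_Lseq N : LL D (p N) = Lseq w logl1 logL2 N.
rewrite /LL big_ord_recl; congr (_ + _).
rewrite invr1 scale1r /LLr /=; bigr => b _; rewrite big_ord0 subr0 mulr1.
by rewrite valK mulrA [w N * _]mulrC uw mul1r.
Qed.

Lemma cvB_lsum r (f : nat -> seq nat -> B) g :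
 (forall s, size s = r -> all (leq 1) s -> cvB cv (fun N => f N s) (g s)) ->
 cvB cv (fun N => lsum D r (f N)) (lsum D r g).
elim: r f g => [|r IH] f g h; first exact: h.
apply: cvB_sum => // b _; apply: (IH (fun N s => f N (b.+1 :: s)) (fun s => g (b.+1 :: s))) => s ss hs.
by apply: h => //=; rewrite ss.
Qed.

Lemma lsum0 (V : nmodType) r : lsum D r (fun _ => 0 : V) = 0.
by elim: r => //= r IH; rewrite big1 // => b _. Qed.

(** Coefficients with three or more distinct variables tend to 0, so only the term [r = 0],
    quadratic in the variables, survives. *)
Lemma cvB_logL2 : cvB cv logL2 (L2lim beta).
have -> : L2lim beta = \sum_(r < D0.+1) (if (r : nat) == 0%N then L2lim beta else 0).
 by rewrite big_ord_recl big1 ?addr0 // => i _.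
apply: cvB_sum => // -[[|r] hr] _; last first.
 rewrite -(scaler0 _ (((r.+3)`!)%:R^-1 : K)); apply: (cvBZ hcv (lim_const hcv _)).
 rewrite -(lsum0 B r.+3); apply: cvB_lsum => s ss hs.
 have hc : cv (fun N => scoef (p N) s) 0 by apply: h3 => //; rewrite ss.
 have hq : cvB cv (fun=> augq K D (size s) s) (augq K D (size s) s) by exact: cvB_const.
 by have := cvBZ hcv hc hq; rewrite scale0r.
apply: (cvBZ hcv (lim_const hcv _)).
rewrite /LLr /=; apply: cvB_sum => // a _; apply: cvB_sum => // b _.
pose q : B := 'X_a * 'X_b - qv 0 (a.+1 + b.+1).
have hq : cvB cv (fun=> q) q by exact: cvB_const.
apply: (cvB_ext hcv _ (cvBZ hcv (h2 a b) hq)) => N.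
by rewrite big_ord1 /q /= !big_ord0 !subr0 !mulr1 !valK !addnS addnC.
Qed.
End LogAsymptotics.

(** * Moments as constant terms of expected germs *)

Section Rep.
Variables (K : numFieldType) (N : nat) (La : Type) (ok : La -> Prop).
Notation A := {mpoly K[N.+1]}.
(* [S f v]: the weighted sum of [f] over the set [ok] converges to [v]. *)
Variable S : (La -> K) -> K -> Prop.
Hypothesis S_ext : forall f g v, (forall l, ok l -> f l = g l) -> S f v -> S g v.
Hypothesis S_add : forall f g a b, S f a -> S g b -> S (fun l => f l + g l) (a + b).
Hypothesis S_scale : forall c f a, S f a -> S (fun l => c * f l) (c * a).
Hypothesis S_zero : S (fun=> 0) 0.
Hypothesis S_uniq : forall f a b, S f a -> S f b -> a = b.

(** The expectation of a random germ, taken separately in each of the finitely many coefficients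
    below order [d]. *)
Definition rep (d : nat) (G : La -> A) (f : A) := forall m, (mdeg m < d)%N -> S (fun l => (G l)@_m) f@_m.

Lemma S_sum (I : Type) (r : seq I) (F : I -> La -> K) (v : I -> K) :
 (forall i, S (F i) (v i)) -> S (fun l => \sum_(i <- r) F i l) (\sum_(i <- r) v i).
move=> h; elim: r => [|i r IH].
 by rewrite big_nil; apply: S_ext S_zero => l _; rewrite big_nil.
by rewrite big_cons; apply: S_ext (S_add (h i) IH) => l _; rewrite big_cons.
Qed.

Lemma trunc_eqm d (p : A) : eqm d p (\sum_(m : 'X_{1..N.+1 < d}) p@_m *: 'X_[m]).
by move=> m hm; rewrite mcoeffB (mcoeff_mpoly (fun m => p@_m)) // subrr. Qed.

(** Below order [e] the value of [T] depends on finitely many coefficients of its argument, so [T]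
    commutes with an infinite sum. *)
Lemma rep_op d e G f (T : {linear A -> A}) : (forall p, vanish d p -> vanish e (T p)) ->
 rep d G f -> rep e (fun l => T (G l)) (T f).
move=> hT h m hm.
have E p : (T p)@_m = \sum_(k : 'X_{1..N.+1 < d}) (T 'X_[k])@_m * p@_k.
 have h1 : eqm e (T p) (T (\sum_(m : 'X_{1..N.+1 < d}) p@_m *: 'X_[m])).
  by rewrite /eqm -linearB; apply: hT; apply: trunc_eqm.
 rewrite (eqm_coef h1 hm) linear_sum raddf_sum; bigr => k _ /=.
 by rewrite linearZ mcoeffZ mulrC.
rewrite E; apply: (@S_ext (fun l => \sum_(k : 'X_{1..N.+1 < d}) (T 'X_[k])@_m * (G l)@_k)).
 by [].
by apply: S_sum => k; apply: S_scale; apply: h; rewrite bmdeg.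
Qed.

Lemma rep_ex d G : (forall m, (mdeg m < d)%N -> exists v, S (fun l => (G l)@_m) v) -> exists f, rep d G f.
move=> h.
have h' (m : 'X_{1..N.+1 < d}) : exists v, S (fun l => (G l)@_m) v by apply: h; rewrite bmdeg.
have [v hv] := fin_all_exists h'.
pose v' m := if (insub m : option 'X_{1..N.+1 < d}) is Some k then v k else 0.
exists (\sum_(m : 'X_{1..N.+1 < d}) v' m *: 'X_[m]) => m hm.
by rewrite mcoeff_mpoly // /v' insubT; have := hv (Sub m hm).
Qed.

Lemma rep_uniq d G f f' : rep d G f -> rep d G f' -> eqm d f f'.
by move=> h h' m hm; apply/eqP; rewrite mcoeffB subr_eq0; apply/eqP; apply: S_uniq (h m hm) (h' m hm).
Qed.

Lemma rep_eqm d G G' f : (forall l, ok l -> eqm d (G l) (G' l)) -> rep d G f -> rep d G' f.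
by move=> h hf m hm; apply: S_ext (hf m hm) => l hl; apply: eqm_coef (h l hl) hm. Qed.

Lemma repW d e G f : (e <= d)%N -> rep d G f -> rep e G f.
by move=> h hf m hm; apply: hf; apply: leq_trans h. Qed.

Lemma repD d G G' f f' : rep d G f -> rep d G' f' -> rep d (fun l => G l + G' l) (f + f').
move=> h h' m hm; rewrite mcoeffD; apply: S_ext (S_add (h m hm) (h' m hm)) => l _.
by rewrite mcoeffD.
Qed.
Lemma repZ d c G f : rep d G f -> rep d (fun l => c *: G l) (c *: f).
move=> h m hm; rewrite mcoeffZ; apply: S_ext (S_scale c (h m hm)) => l _.
by rewrite mcoeffZ.
Qed.
Lemma rep_sum d (I : Type) (r : seq I) (G : I -> La -> A) f :
 (forall i, rep d (G i) (f i)) -> rep d (fun l => \sum_(i <- r) G i l) (\sum_(i <- r) f i).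
move=> h m hm; rewrite raddf_sum; apply: (@S_ext (fun l => \sum_(i <- r) (G i l)@_m)).
 by move=> l _; rewrite raddf_sum.
by apply: S_sum => i; apply: h.
Qed.

Variables (D Q : nat).
Notation B := {mpoly K[D]}.
Notation VM := (VM K N).
Notation TS := (@TS K N Q).
Hypothesis DN : (D <= N.+1)%N.
Hypothesis HQ : forall M, (M <= N.+1)%N -> exists v, VM M \is v.-homog /\ (D + v <= Q)%N.

(** A finitely supported weighting of the signatures of one level; repetitions in the list carry
    multiplicities. *)
Definition wstate := seq (K * seq nat).
Definition wfst M (st : wstate) := all (fun x : K * seq nat => (size x.2 == M) && sdec x.2) st.
Definition GS M m (st : wstate) : A := \sum_(x <- st) x.1 *: TS M m x.2.
Definition obs (g : seq nat -> K) (st : wstate) : wstate := [seq (x.1 * g x.2, x.2) | x <- st].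
Definition down (st : wstate) : wstate := flatten [seq [seq (x.1, ms) | ms <- below x.2] | x <- st].

Lemma wf_obs M g st : wfst M (obs g st) = wfst M st.
by rewrite /wfst all_map. Qed.

Lemma wf_down M st : wfst M.+1 st -> wfst M (down st).
move=> /allP h; apply/allP => y /flattenP [t /mapP[x hx ->] /mapP [ms hms ->]].
have /andP[/eqP s1 _] := h x hx.
by rewrite (size_below hms) s1 eqxx (below_sdec hms).
Qed.

Lemma GS_down M m st : (M <= N)%N -> res M (GS M.+1 m st) = GS M m (down st).
move=> hM; rewrite /GS rmorph_sum big_flatten big_map; bigr => x _ /=.
by rewrite resZ res_TS // scaler_sumr big_map.
Qed.

Lemma GS_obs_eigen M m st k : (M <= N.+1)%N -> wfst M st ->
 eqm (Q.+1 - k) (VM M * GS M m (obs (fun l => pff K m l k) st)) (DD M k (VM M * GS M m st)).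
move=> hM /allP h; rewrite /GS big_map !mulr_sumr DD_sum big_seq big_seq.
apply: eqm_sum => x /h /andP[/eqP s1 s2].
rewrite -scalerA -!scalerAr DDZ; apply: eqmZ; rewrite scalerAr; exact: TS_eigen.
Qed.

Lemma GS_obsZ M m c g st : GS M m (obs (fun l => c * g l) st) = c *: GS M m (obs g st).
rewrite /GS !big_map scaler_sumr; bigr => x _.
by rewrite scalerA mulrCA.
Qed.
Lemma GS_obs_sum M m (I : Type) (r : seq I) (g : I -> seq nat -> K) st :
 GS M m (obs (fun l => \sum_(i <- r) g i l) st) = \sum_(i <- r) GS M m (obs (g i) st).
rewrite /GS; under [RHS]eq_bigr => i _ do rewrite big_map.
rewrite exchange_big big_map; bigr => x _.
by rewrite mulr_sumr scaler_suml.
Qed.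
Lemma GS_obsD M m g g' st :
 GS M m (obs (fun l => g l + g' l) st) = GS M m (obs g st) + GS M m (obs g' st).
by rewrite /GS !big_map -big_split; bigr => x _; rewrite mulrDr scalerDl.
Qed.
Lemma GS_obs1 M m c st : GS M m (obs (fun=> c) st) = c *: GS M m st.
by rewrite /GS big_map scaler_sumr; bigr => x _; rewrite scalerA mulrC.
Qed.

Lemma phi0 M (p : B) : (phi N M p)@_0 = p@_0.
elim/mpoly_alg_ind: p => [c|j|p q hp hq|p q hp hq].
- by rewrite phiC !mcoeffC !eqxx.
- rewrite phiX raddf_sum big1 => [|i _].
  by rewrite mcoeffX; case: eqP => // /(congr1 (@mdeg _)); rewrite mdeg1 mdeg0.
 rewrite -[LHS]/(mcoeff 0%MM _) rmorphXn /= mcoeffX.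
 by case: eqP => [/(congr1 (@mdeg _))|]; rewrite ?mdeg1 ?mdeg0 ?expr0n.
- by rewrite rmorphD !mcoeffD hp hq.
rewrite rmorphM.
have e n' R (p1 p2 : {mpoly R[n']}) : (p1 * p2)@_0 = p1@_0 * p2@_0.
 by rewrite -/(mcoeff 0%MM) rmorphM.
by rewrite !e hp hq.
Qed.

Variables (sh : La -> nat) (sg : La -> seq nat) (wt : La -> K).
Hypothesis sg_ok : forall l, ok l -> size (sg l) = N.+1 /\ sdec (sg l).

Variables (X : Type) (lv kx : X -> nat) (sc : X -> nat -> K) (u : K).

(** The rescaled and centred observable; [sc] expresses a power by falling powers. *)
Definition gobs (c : X -> K) x m (l : seq nat) : K :=
 u ^+ kx x * \sum_(j < (kx x).+1) sc x j * pff K m l j + - c x.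

Definition lev (s : seq X) := if s is x :: _ then lv x else N.+1.

(** The head of the list is the lowest level and acts last: the state descends from the top
    signature and is multiplied by an observable whenever its level is reached. *)
Fixpoint state (c : X -> K) (s : seq X) (l : La) : wstate :=
 if s is x :: s' then
  obs (gobs c x (sh l)) (iter (lev s' - lv x) down (state c s' l))
 else [:: (wt l, sg l)].

Fixpoint lvok (s : seq X) : bool :=
 if s is x :: s' then (lv x <= lev s')%N && lvok s' else true.

Lemma lvok_lev s : lvok s -> (lev s <= N.+1)%N.
by elim: s => //= x s IH /andP[h /IH]; apply: leq_trans. Qed.

Definition summable c := forall s x j m, lvok (x :: s) -> (mdeg m <= D)%N ->
 exists v, S (fun l => (GS (lv x) (sh l) (obs (fun a => pff K (sh l) a j)
   (iter (lev s - lv x) down (state c s l))))@_m) v.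

Lemma iter_down M st i : (i <= M)%N -> wfst M st -> wfst (M - i)%N (iter i down st).
elim: i => [|i IH] hi h; first by rewrite subn0.
by apply: wf_down; rewrite -subSn //; apply: IH => //; apply: ltnW.
Qed.

Lemma wf_state c s l : ok l -> lvok s -> wfst (lev s) (state c s l).
move=> hl; elim: s => [_|x s IH /= /andP[h1 h2]].
 by rewrite /=; have [-> ->] := sg_ok hl; rewrite eqxx.
by rewrite wf_obs -{1}(subKn h1); apply: iter_down (leq_subr _ _) (IH h2).
Qed.

Variable f0 : A.
Hypothesis f0_rep : rep D.+1 (fun l => GS N.+1 (sh l) (state (fun=> 0) [::] l)) f0.
Hypothesis f0_sym : f0 \is symmetric.
Hypothesis f00 : f0@_0 = 1.

Definition LLN : B := LL D (logt D f0).
Let E := expt LLN.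

(** The same word acting in [B]. Descending to a lower level leaves no trace here, because [res]
    maps [phi] of the upper level to [phi] of the lower one. *)
Fixpoint hop (c : X -> K) (s : seq X) : B :=
 if s is x :: s' then
  u ^+ kx x *: (\sum_(j < (kx x).+1) sc x j *: CC ((lv x)%:R) j LLN (hop c s')) - c x *: hop c s'
 else 1.

Lemma f0_exp : eqm D.+1 f0 (phi N N.+1 E).
exact: symmetric_germ_exp. Qed.

Lemma E0 : E@_0 = 1.
by rewrite -(phi0 N.+1) -(eqm_coef f0_exp) // mdeg0. Qed.

Lemma LLN0 : LLN@_0 = 0.
have hf : vanish 1 (f0 - 1).
 by move=> m; rewrite ltnS leqn0 mdeg_eq0 => /eqP->; rewrite mcoeffB mcoeff1 eqxx f00 subrr.
have lf0 : (logt D f0)@_0 = 0 by apply: (vanish_logt _ hf); rewrite mdeg0.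
have lsym := logt_symmetric D f0_sym.
by rewrite -(phi0 N.+1) -(eqm_coef (sym_expand lsym lf0 DN)) ?mdeg0.
Qed.

Lemma E_ode M i : (M <= N.+1)%N -> (i < M)%N ->
 eqm D (dY i (phi N M E)) (phi N M E * \sum_(b < D) (Y K N i ^+ b * phi N M LLN^`M(b)) *+ b.+1).
move=> hM hi; apply: dY_expt => // m; rewrite ltnS leqn0 mdeg_eq0 => /eqP->.
by rewrite phi0 LLN0.
Qed.

Definition hasrep d M (G : La -> A) (h : B) := exists f, rep d G f /\ eqm d f (phi N M E * phi N M h).

Lemma hasrep_down d M c s h i : lvok s -> (i <= lev s)%N -> M = (lev s - i)%N ->
 hasrep d (lev s) (fun l => GS (lev s) (sh l) (state c s l)) h ->
 hasrep d M (fun l => GS M (sh l) (iter i down (state c s l))) h.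
move=> hs hi -> h0; elim: i hi => [|i IH] hi; first by rewrite subn0.
have [f [hf he]] := IH (ltnW hi).
have e : (lev s - i = (lev s - i.+1).+1)%N by lia.
have hN : (lev s - i.+1 <= N)%N by have := lvok_lev hs; lia.
exists (res (lev s - i.+1) f); split.
 have hr : rep d (fun l => res (lev s - i.+1) (GS (lev s - i) (sh l) (iter i down (state c s l)))) (res (lev s - i.+1) f).
  have rl : linear (@res K N (lev s - i.+1)).
   by move=> a p q; rewrite rmorphD /= resZ.
  apply: rep_op hf => p hp; exact: res_vanish.
 apply: rep_eqm hr => l _; apply: eqm_eq; rewrite e GS_down //.
apply: eqm_trans (res_eqm (lev s - i.+1) he) _; apply: eqm_eq.
by rewrite rmorphM /= !res_phi //; lia.
Qed.

(** The expectation [f'] of the observed germs exists by hypothesis. The eigenvalue relation holds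
    for each signature, uniqueness of sums transfers it to [f] and [f'], and [step_germ] identifies
    [f']. *)
Lemma rep_obs d M k G G' f h : (M <= N.+1)%N -> (k <= d)%N -> (d <= D.+1)%N ->
 (forall l, ok l -> eqm (Q.+1 - k) (VM M * G' l) (DD M k (VM M * G l))) ->
 (forall m, (mdeg m <= D)%N -> exists v, S (fun l => (G' l)@_m) v) ->
 rep d G f -> eqm d f (phi N M E * phi N M h) ->
 hasrep (d - k) M G' (CC M%:R k LLN h).
move=> hM hk hd hGG hsum hf he.
have [v [hv hvQ]] := HQ hM.
have [f' hf'] : exists f', rep (d - k) G' f'.
 by apply: rep_ex => m hm; apply: hsum; lia.
exists f'; split => //.
apply: (@step_germ K N D M v k E LLN h f f') => //; first by move=> i hi; apply: E_ode.
have VMlin : linear (fun p : A => VM M * p).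
 by move=> a p q; rewrite mulrDr scalerAr.
pose T1 : {linear A -> A} := HB.pack (fun p : A => VM M * p) (GRing.isLinear.Build _ _ _ _ _ VMlin).
have DDlin : linear (fun p : A => DD M k (VM M * p)).
 by move=> a p q; rewrite VMlin DDD DDZ.
pose T2 : {linear A -> A} := HB.pack (fun p : A => DD M k (VM M * p)) (GRing.isLinear.Build _ _ _ _ _ DDlin).
have r1 : rep (d - k + v) (fun l => VM M * G' l) (VM M * f').
 apply: (rep_op (T := T1)) hf' => p hp; rewrite addnC; apply: vanishM => //; exact: vanish_homog.
have r2 : rep (d - k + v) (fun l => DD M k (VM M * G l)) (DD M k (VM M * f)).
 apply: (rep_op (T := T2)) hf => p hp.
 have h1 : vanish (v + d) (VM M * p) by apply: vanishM => //; apply: vanish_homog.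
 by apply: vanishW (DD_vanish M (k := k) h1); lia.
apply: rep_uniq r2; apply: rep_eqm r1 => l hl; apply: eqmW (hGG l hl); lia.
Qed.

(** Each observable consumes as many of the [D.+1] orders as its degree, so a positive order is left
    as long as the total degree does not exceed [D]. *)
Theorem state_hasrep c s : summable c -> lvok s -> (\sum_(x <- s) kx x <= D)%N ->
 hasrep (D.+1 - \sum_(x <- s) kx x) (lev s) (fun l => GS (lev s) (sh l) (state c s l)) (hop c s).
move=> hsum; elim: s => [_ _|x s IH].
 rewrite big_nil; exists f0; split; first exact: f0_rep.
 by rewrite rmorph1 mulr1; apply: f0_exp.
move=> hxs; have /andP[hx hs] := hxs; rewrite big_cons => hD.
set d := (D.+1 - \sum_(j <- s) kx j)%N.
have M1 := lvok_lev hs.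
have hM : (lv x <= N.+1)%N by apply: leq_trans hx M1.
have Ms : lv x = (lev s - (lev s - lv x))%N by rewrite subKn.
have [f [hf he]] := hasrep_down hs (leq_subr _ _) Ms (IH hs (leq_trans (leq_addl _ _) hD)).
pose st l := iter (lev s - lv x) down (state c s l).
have wst l : ok l -> wfst (lv x) (st l).
 by move=> hl; rewrite Ms; apply: iter_down (leq_subr _ _) (wf_state c hl hs).
have dk : (kx x <= d)%N by rewrite /d; lia.
have hj (j : 'I_(kx x).+1) : hasrep (d - kx x) (lv x) (fun l => GS (lv x) (sh l) (obs (fun a => pff K (sh l) a j) (st l)))
  (CC (lv x)%:R j LLN (hop c s)).
 have jk : (j <= kx x)%N by rewrite -ltnS.
 have [g [hg hge]] := @rep_obs d (lv x) j (fun l => GS (lv x) (sh l) (st l)) (fun l => GS (lv x) (sh l) (obs (fun a => pff K (sh l) a j) (st l)))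
  f (hop c s) hM (leq_trans jk dk) (leq_subr _ _) (fun l hl => GS_obs_eigen (k := j) (sh l) hM (wst l hl))
  (fun m hm => hsum s x j m hxs hm) hf he.
 exists g; split; first by apply: repW hg; lia.
 by apply: eqmW hge; lia.
have [g hg] := @fin_all_exists _ (fun=> A) _ hj.
have -> : (D.+1 - (kx x + \sum_(j <- s) kx j) = d - kx x)%N by rewrite /d; lia.
exists (u ^+ kx x *: (\sum_(j < (kx x).+1) sc x j *: g j) + (- c x) *: f); split.
 have hr : rep (d - kx x) (fun l => u ^+ kx x *: (\sum_(j < (kx x).+1) sc x j *: GS (lv x) (sh l) (obs (fun a => pff K (sh l) a j) (st l)))
   + (- c x) *: GS (lv x) (sh l) (st l)) (u ^+ kx x *: (\sum_(j < (kx x).+1) sc x j *: g j) + (- c x) *: f).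
  apply: repD; last by apply: repZ; apply: repW hf; rewrite leq_subr.
  by apply: repZ; apply: rep_sum => j; apply: repZ; have [] := hg j.
 apply: rep_eqm hr => l hl; apply: eqm_eq.
 rewrite GS_obsD GS_obsZ GS_obs_sum GS_obs1; congr (_ *: _ + _).
 by bigr => j _; rewrite GS_obsZ.
rewrite rmorphB /= !phiZ [phi N _ (\sum_(j < (kx x).+1) _)]rmorph_sum mulrBr /= scaleNr; apply: eqmB; last first.
 by rewrite -scalerAr; apply: eqmZ; apply: (eqmW _ he); rewrite leq_subr.
rewrite -scalerAr; apply: eqmZ; rewrite mulr_sumr; apply: eqm_sum => j _.
by rewrite phiZ -scalerAr; apply: eqmZ; have [] := hg j.
Qed.

(** The value at (1,...,1) of the generating function of the state: there a Schur function counts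
    its patterns. *)
Definition total (st : wstate) : K := \sum_(x <- st) x.1 * (size (gts (size x.2) x.2))%:R.

Lemma TS0 M m l : (TS M m l)@_0 = (size (gts M l))%:R.
rewrite raddf_sum /= (eq_bigr (fun=> 1)); last first.
 move=> w _; rewrite -/(mcoeff 0%MM) rmorph_prod big1 // => j _.
 have y0 : (Y K N j)@_0 = 0 by rewrite mcoeffX; case: eqP => // /(congr1 (@mdeg _)); rewrite mdeg1 mdeg0.
 rewrite -/(mcoeff 0%MM) rmorphM !rmorphXn /= mcoeffD mcoeff1 eqxx y0 addr0 expr1n mulr1.
 rewrite /iota1 big_ord_recl mcoeffD mcoeff1 eqxx raddf_sum big1 ?addr0 ?expr1n // => i _.
 by rewrite -[LHS]/(mcoeff 0%MM _) rmorphXn /= mcoeffN y0 oppr0 expr0n.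
by elim: gts => [|y s IH]; rewrite ?big_nil ?big_cons // IH -natr1 addrC.
Qed.

Theorem state_moment c s : summable c -> lvok s -> (\sum_(x <- s) kx x <= D)%N ->
 S (fun l => total (state c s l)) (hop c s)@_0.
move=> hsum hs hD; have [f [hf he]] := state_hasrep hsum hs hD.
have d0 : (mdeg (0%MM : 'X_{1..N.+1}) < D.+1 - \sum_(x <- s) kx x)%N by rewrite mdeg0; lia.
have := hf _ d0; rewrite (eqm_coef he d0).
have -> : (phi N (lev s) E * phi N (lev s) (hop c s))@_0 = (hop c s)@_0.
 by rewrite -/(mcoeff 0%MM) rmorphM /= !phi0 E0 mul1r.
apply: S_ext => l hl; rewrite raddf_sum /total; apply: eq_big_seq => x hx.
have /allP/(_ x hx)/andP[/eqP-> _] := wf_state c hl hs.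
by rewrite /= mcoeffZ TS0.
Qed.
End Rep.

(** * Descendants of a signature and the number of its patterns *)

Definition desc (j : nat) (l : seq nat) : seq (seq nat) :=
 iter j (fun s => flatten (map below s)) [:: l].
Definition dimn (l : seq nat) : nat := size (gts (size l) l).
Definition rg (lo hi : nat) (l : seq nat) := all (fun a => lo <= a <= hi)%N l.

Lemma desc_flatten j (s : seq (seq nat)) :
 iter j (fun s => flatten (map below s)) s = flatten (map (desc j) s).
elim: j s => [|j IH] s; first by rewrite /desc; elim: s => //= a s <-.
rewrite iterSr IH; elim: s => //= a s IHs.
rewrite map_cat flatten_cat IHs; congr (_ ++ _).
rewrite -/(flatten (map (desc j) (below a))).
by rewrite -/(iter j.+1 (fun s => flatten (map below s)) [:: a]) iterSr /= cats0.
Qed.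

Lemma descS j l : desc j.+1 l = flatten (map (desc j) (below l)).
by rewrite /desc iterSr /= cats0 desc_flatten. Qed.

Lemma descSr j l : desc j.+1 l = flatten (map below (desc j l)). by []. Qed.

Lemma rg_nth lo hi l j : rg lo hi l -> (j < size l)%N -> (lo <= nth 0 l j <= hi)%N.
by move=> /allP h hj; apply: h; apply: mem_nth. Qed.

Lemma below_rg lo hi l ms : ms \in below l -> rg lo hi l -> rg lo hi ms.
move=> hm hl; apply/(all_nthP 0%N) => j hj.
have sz := size_below hm; have hj' : (j.+1 < size l)%N by move: hj; lia.
have /andP[h1 h2] := below_nth hm hj'.
have /andP[h3 h4] := rg_nth hl hj'.
have /andP[h5 h6] := rg_nth hl (ltnW hj').
lia.
Qed.

Lemma desc_spec lo hi j l ms : ms \in desc j l -> sdec l -> rg lo hi l ->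
 [/\ size ms = (size l - j)%N, sdec ms & rg lo hi ms].
elim: j ms => [|j IH] ms; first by rewrite inE => /eqP-> h h'; rewrite subn0.
rewrite descSr => /flatten_mapP[m hm hms] h h'.
have [h1 h2 h3] := IH m hm h h'.
split; [by rewrite (size_below hms) h1 subnS|exact: below_sdec hms|exact: below_rg hms h3].
Qed.

Lemma sumn_below l ms M : size l = M.+1 -> ms \in below l ->
 (nth 0 l M + sumn ms + M <= sumn l)%N /\ (sumn l <= nth 0 l 0 + sumn ms)%N.
move=> sl hm; have sm := size_below hm; rewrite sl in sm.
rewrite !sumnE (big_nth 0%N) sm big_mkord (big_nth 0%N) sl big_mkord; split.
 rewrite big_ord_recr.
 have : (\sum_(i < M) (nth 0 ms i).+1 <= \sum_(i < M) nth 0 l i)%N.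
  apply: leq_sum => i _.
  by have /andP[_ ->] : (nth 0 l i.+1 <= nth 0 ms i < nth 0 l i)%N by apply: below_nth => //; rewrite sl ltnS.
 have -> : (\sum_(i < M) (nth 0 ms i).+1 = \sum_(i < M) nth 0 ms i + M)%N.
  under eq_bigr => i _ do rewrite -addn1; rewrite big_split sum_nat_const card_ord muln1 //.
 by move=> h; rewrite -addnA addnC leq_add2r.
rewrite big_ord_recl leq_add2l; apply: leq_sum => i _.
by have /andP[->] : (nth 0 l i.+1 <= nth 0 ms i < nth 0 l i)%N by apply: below_nth => //; rewrite sl ltnS.
Qed.

(** For interlacing rows the difference of the sums, corrected by the shift, lies between the last
    and the first part of the upper row; lower rows stay within the same range. *)
Lemma gts_rg lo hi M l w : size l = M -> rg lo hi l -> w \in gts M l -> rg lo hi w.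
elim: M l w => [|M IH] l w sl hl; first by rewrite inE => /eqP->.
move=> /flatten_mapP[m hm /mapP[w' hw' ->]].
rewrite /rg all_rcons; apply/andP; split; last first.
 by apply: IH hw'; [rewrite (size_below hm) sl|exact: below_rg hm hl].
have [h1 h2] := sumn_below sl hm.
have /andP[h3 _] : (lo <= nth 0 l M <= hi)%N by apply: rg_nth => //; rewrite sl.
have /andP[_ h4] : (lo <= nth 0 l 0 <= hi)%N by apply: rg_nth => //; rewrite sl.
lia.
Qed.

Lemma prodseq_neq0 rs : all (fun r : seq nat => r != [::]) rs -> prodseq rs != [::].
elim: rs => //= r rs IH /andP[hr /IH]; case: r hr => // a r _.
by case: prodseq.
Qed.

Lemma below_neq0 l : sdec l -> below l != [::].
move=> hl; apply: prodseq_neq0; apply/(all_nthP [::]) => j; rewrite size_ranges => hj.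
have hj' : (j.+1 < size l)%N by lia.
rewrite nth_ranges // -size_eq0 size_iota -lt0n subn_gt0.
by apply: sdec_nth => //; rewrite ltnSn.
Qed.

Lemma gts_gt0 M l : sdec l -> (0 < size (gts M l))%N.
elim: M l => //= M IH l hl; have := below_neq0 hl; case E : below => [|] // _.
rewrite size_cat size_map; apply: leq_trans (leq_addr _ _).
by apply: IH; apply: (@below_sdec l); rewrite E mem_head.
Qed.

Lemma dimn_gt0 l : sdec l -> (0 < dimn l)%N. exact: gts_gt0. Qed.

Lemma dimn_below l : (\sum_(ms <- below l) dimn ms = dimn l)%N.
case: l => [|a l]; first by rewrite big_seq1.
rewrite /dimn size_flatten sumnE !big_map; apply: eq_big_seq => m hm.
by rewrite size_map (size_below hm).
Qed.

Section GTSum.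
Variable (R : comNzRingType).

Lemma gtsum_ext (x y : nat -> R) M l : (forall i, (i < M)%N -> x i = y i) -> gtsum x M l = gtsum y M l.
by move=> h; bigr => w _; bigr => i _; rewrite h. Qed.

Lemma gtsum_pad (x : nat -> R) j k l : (forall i, (k <= i < k + j)%N -> x i = 1) -> size l = (k + j)%N ->
 gtsum x (k + j) l = \sum_(ms <- desc j l) gtsum x k ms.
elim: j l => [|j IH] l h sl; first by rewrite addn0 big_seq1.
rewrite addnS gtsumS descS big_flatten big_map; apply: eq_big_seq => ms hms.
rewrite h ?expr1n ?mulr1; last lia.
apply: IH => [i hi|]; first by apply: h; lia.
by rewrite (size_below hms) sl addnS.
Qed.

End GTSum.

(** * Linear independence of Schur polynomials on positive points *)

Section Independence.
Variable K : numFieldType.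
Implicit Types (x : nat -> K) (l : seq nat).

(** Summing over the doubling of one coordinate defines an operator with all alternants as
    eigenvectors, the eigenvalue being the sum of the [2^(l_j)]; it preserves positive points. *)
Definition dbl x (i : nat) : nat -> K := fun j => if j == i then 2 * x j else x j.
Definition pow2 l : nat := (\sum_(a <- l) 2 ^ a)%N.

Lemma altdet_dbl x M l : size l = M ->
 \sum_(i < M) altdet (dbl x i) M l = (pow2 l)%:R * altdet x M l.
move=> sl; rewrite exchange_big mulr_sumr; bigr => s _.
have e (i : 'I_M) : (-1) ^+ s * \prod_(j < M) (\matrix_(i0, j0) dbl x i i0 ^+ nth 0%N l j0) j (s j) =
 2 ^+ nth 0%N l (s i) * ((-1) ^+ s * \prod_(j < M) (\matrix_(i0, j0) x i0 ^+ nth 0%N l j0) j (s j)).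
 rewrite mulrCA; congr (_ * _); rewrite (bigD1 i) //= [in RHS](bigD1 i) //= !mxE /dbl eqxx exprMn mulrA; congr (_ * _).
 by bigr => j ji; rewrite !mxE; move: ji; rewrite -val_eqE => /negPf->.
under eq_bigr => i _ do rewrite e.
rewrite -mulr_suml; congr (_ * _).
rewrite natr_sum (big_nth 0%N) sl big_mkord [RHS](reindex_inj (@perm_inj _ s)).
by bigr => i _; rewrite natrX.
Qed.

Lemma pow2_cons a l : pow2 (a :: l) = (2 ^ a + pow2 l)%N.
by rewrite /pow2 big_cons. Qed.

Lemma pow2_lt a l : sdec (a :: l) -> (pow2 l < 2 ^ a)%N.
elim: l a => [|b l IH] a; first by rewrite /pow2 big_nil expn_gt0.
rewrite /sdec => /andP[ab hb]; rewrite pow2_cons.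
have h := IH b hb; have h2 : (2 ^ b.+1 <= 2 ^ a)%N by rewrite leq_exp2l.
by move: h2; rewrite expnS; lia.
Qed.

(** Uniqueness of binary expansions: the first part is the exponent of the leading power of 2. *)
Lemma pow2_inj l l' : sdec l -> sdec l' -> pow2 l = pow2 l' -> l = l'.
have p0 a l0 : (0 < pow2 (a :: l0))%N by rewrite pow2_cons ltn_addr // expn_gt0.
elim: l l' => [|a l IH] [|b l'] // h h' e.
- by have := p0 b l'; rewrite -e /pow2 big_nil.
- by have := p0 a l; rewrite e /pow2 big_nil.
have tl c s : sdec (c :: s) -> sdec s by case: s => //= d s /andP[].
have ha := pow2_lt h; have hb := pow2_lt h'.
have ab : a = b.
 move: e; rewrite !pow2_cons => e.
 have [ab|ba|//] := ltngtP a b.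
  have : (2 ^ a.+1 <= 2 ^ b)%N by rewrite leq_exp2l.
  by rewrite expnS; lia.
 have : (2 ^ b.+1 <= 2 ^ a)%N by rewrite leq_exp2l.
 by rewrite expnS; lia.
subst b; congr (_ :: _); apply: IH; [exact: tl h|exact: tl h'|].
by move: e; rewrite !pow2_cons => /addnI.
Qed.

(** Eigenvectors with distinct eigenvalues: applying the operator minus the eigenvalue of the head
    removes the head from the relation. The head is then excluded at the point [x_i = i + 1], where
    its alternant is not 0. *)
Lemma altdet_indep M (ls : seq (seq nat)) (a : seq nat -> K) :
 uniq ls -> (forall l, l \in ls -> size l = M /\ sdec l) ->
 (forall x, (forall i, (i < M)%N -> 0 < x i) -> \sum_(l <- ls) a l * altdet x M l = 0) ->
 forall l, l \in ls -> a l = 0.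
elim: ls a => [|l0 ls IH] a //= /andP[l0ls uls] hls h0.
have [s0 d0] := hls l0 (mem_head _ _).
have hls' l : l \in ls -> size l = M /\ sdec l by move=> hl; apply: hls; rewrite inE hl orbT.
have hz : forall l, l \in ls -> a l * ((pow2 l)%:R - (pow2 l0)%:R) = 0.
 apply: (IH (fun l => a l * ((pow2 l)%:R - (pow2 l0)%:R))) => // x hx.
 have h1 : \sum_(i < M) \sum_(l <- l0 :: ls) a l * altdet (dbl x i) M l = 0.
  rewrite big1 // => i _; apply: h0 => j hj; rewrite /dbl; case: eqP => _; last exact: hx.
  by rewrite mulr_gt0 // hx.
 have h2 : \sum_(l <- l0 :: ls) a l * ((pow2 l)%:R * altdet x M l) = 0.
  rewrite -[RHS]h1 exchange_big; apply: eq_big_seq => l hl.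
  by rewrite -mulr_sumr altdet_dbl; have [] := hls l hl.
 have h3 := h0 x hx.
 have : \sum_(l <- l0 :: ls) a l * ((pow2 l)%:R * altdet x M l) - (pow2 l0)%:R * \sum_(l <- l0 :: ls) a l * altdet x M l = 0.
  by rewrite h2 h3 mulr0 subrr.
 rewrite mulr_sumr -sumrB big_cons.
 have -> : a l0 * ((pow2 l0)%:R * altdet x M l0) - (pow2 l0)%:R * (a l0 * altdet x M l0) = 0 by ring.
 rewrite add0r => e; rewrite -[RHS]e; bigr => l _; ring.
have als l : l \in ls -> a l = 0.
 move=> hl; have /eqP := hz l hl; rewrite mulf_eq0 => /orP[/eqP//|].
 rewrite subr_eq0 eqr_nat => /eqP e; have [sl dl] := hls' l hl.
 by case/negP: l0ls; rewrite -(pow2_inj dl d0).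
move=> l; rewrite inE => /predU1P[->|]; last exact: als.
pose x i : K := i.+1%:R.
have := h0 x (fun i _ => ltr0Sn K i); rewrite big_cons big_seq big1 ?addr0 => [|l' hl']; last by rewrite als ?mul0r.
move=> /eqP; rewrite mulf_eq0 => /orP[/eqP//|].
rewrite -(gtsum_altdet x s0 d0) mulf_eq0 => /orP[|/eqP h].
 move=> /prodf_eq0 [i _ /prodf_eq0 [j ij]].
 rewrite subr_eq0 eqr_nat => /eqP [e]; lia; rewrite e ltnn.
have : 0 < gtsum x M l0.
 rewrite /gtsum; have := gts_gt0 M d0; case: gts => // w s _.
 rewrite big_cons; apply: ltr_wpDr.
  by apply: sumr_ge0 => w' _; apply: prodr_ge0 => i _; apply: exprn_ge0.
 by apply: prodr_gt0 => i _; apply: exprn_gt0.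
by rewrite h ltxx.
Qed.

Theorem gtsum_indep M (ls : seq (seq nat)) (a : seq nat -> K) :
 uniq ls -> (forall l, l \in ls -> size l = M /\ sdec l) ->
 (forall x, (forall i, (i < M)%N -> 0 < x i) -> \sum_(l <- ls) a l * gtsum x M l = 0) ->
 forall l, l \in ls -> a l = 0.
move=> u hls h; apply: (altdet_indep u hls) => x hx.
transitivity ((\prod_(i < M) \prod_(j < M | (i < j)%N) (x i - x j)) * \sum_(l <- ls) a l * gtsum x M l); last first.
 by rewrite h // mulr0.
rewrite mulr_sumr; apply: eq_big_seq => l hl; have [sl dl] := hls l hl.
by rewrite mulrCA gtsum_altdet.
Qed.
End Independence.

Lemma leq_exp2r_le (a b k : nat) : (a <= b)%N -> (a ^ k <= b ^ k)%N.
by move=> h; elim: k => // k IH; rewrite !expnS leq_mul. Qed.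

(** * The transposed process, from the lowest level upwards *)

Section Pairing.
Variable K : numFieldType.

Definition pair (st : wstate K) (h : seq nat -> K) : K := \sum_(x <- st) x.1 * h x.2.
(** The transpose of [down] for [pair]; it fixes [dimK]. *)
Definition dn (h : seq nat -> K) (l : seq nat) : K := \sum_(ms <- below l) h ms.
Definition dimK (l : seq nat) : K := (dimn l)%:R.

Lemma pair_obs g st h : pair (obs g st) h = pair st (fun l => g l * h l).
by rewrite /pair big_map; bigr => x _; rewrite mulrA. Qed.

Lemma pair_down st h : pair (down st) h = pair st (dn h).
rewrite /pair big_flatten big_map; bigr => x _.
by rewrite big_map mulr_sumr.
Qed.

Lemma pair_downs j st h : pair (iter j (@down K) st) h = pair st (iter j dn h).
by elim: j h => //= j IH h; rewrite pair_down IH -iterSr. Qed.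

Lemma dn_desc j h l : iter j dn h l = \sum_(ms <- desc j l) h ms.
elim: j l => [|j IH] l; first by rewrite big_seq1.
by rewrite descS big_flatten big_map; bigr => ms _; rewrite -IH.
Qed.

Lemma dn_dim l : dn dimK l = dimK l.
by rewrite /dimK -dimn_below natr_sum. Qed.

Lemma eq_dn h h' : (forall l, h l = h' l) -> forall l, dn h l = dn h' l.
by move=> e l; bigr => ms _. Qed.

Lemma eq_dns j h h' : (forall l, h l = h' l) -> forall l, iter j dn h l = iter j dn h' l.
by move=> e; elim: j => //= j IH l; apply: eq_dn. Qed.

Lemma dns_dim j l : iter j dn dimK l = dimK l.
by elim: j l => //= j IH l; rewrite -dn_dim; apply: eq_dn => m. Qed.

Lemma total_pair st : total st = pair st dimK. by []. Qed.
End Pairing.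

Section Pull.
Variables (K : numFieldType) (N : nat) (La : Type) (sh : La -> nat) (sg : La -> seq nat) (wt : La -> K).
Variables (X : Type) (lv kx : X -> nat) (sc : X -> nat -> K) (u : K) (c : X -> K).
Notation state := (state N sh sg wt lv kx sc u c).
Notation lev := (lev N lv).
Notation dn := (@dn K).

(** The transpose of [state]. It meets the observables from the lowest level upwards, which is the
    order in which chains of signatures are summed. *)
Fixpoint pull (m : nat) (s : seq X) (h : seq nat -> K) : seq nat -> K :=
 if s is x :: s' then
  pull m s' (iter (lev s' - lv x) dn (fun l => gobs kx sc u c x m l * h l))
 else h.

Lemma eq_pull m s h h' : (forall l, h l = h' l) -> forall l, pull m s h l = pull m s h' l.
elim: s h h' => //= x s IH h h' e; apply: IH => l; apply: eq_dns => l'.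
by rewrite e.
Qed.

Lemma pair_state s l h : pair (state s l) h = wt l * pull (sh l) s h (sg l).
elim: s h => [|x s IH] h; first by rewrite /pair big_seq1.
by rewrite /= pair_obs pair_downs.
Qed.

(* Levels [M 1 <= ... <= M n], [n = t + j]: the observables of [s], whose
  times are [tm], are multiplied in when the functional passes their level. *)
Variables (M : nat -> nat) (tm : X -> nat).
Hypothesis lvM : forall x, lv x = M (tm x).

Definition gat (m t : nat) (s : seq X) (l : seq nat) : K :=
 \prod_(x <- s | tm x == t) gobs kx sc u c x m l.

Fixpoint climb (m : nat) (s : seq X) (t j : nat) (h : seq nat -> K) : seq nat -> K :=
 if j is j'.+1 then climb m s t.+1 j' (iter (M t.+1 - M t) dn (fun l => gat m t s l * h l))
 else fun l => gat m t s l * h l.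

Lemma eq_climb m s t j h h' : (forall l, h l = h' l) -> forall l, climb m s t j h l = climb m s t j h' l.
elim: j t h h' => [|j IH] t h h' e l /=; first by rewrite e.
by apply: IH => l'; apply: eq_dns => l''; rewrite e.
Qed.

Lemma gat_late m t s l : all (fun x => t < tm x)%N s -> gat m t s l = 1.
elim: s => [_|x s IH /andP[hx hs]]; first by rewrite /gat big_nil.
by rewrite /gat big_cons gtn_eqF //; apply: IH.
Qed.

Lemma climb_late m s s' t j h : (forall t', (t <= t')%N -> forall l, gat m t' s l = gat m t' s' l) ->
 forall l, climb m s t j h l = climb m s' t j h l.
elim: j t h => [|j IH] t h e l /=; first by rewrite e.
rewrite IH => [|t' ht' l']; last by apply: e; apply: ltnW.
by apply: eq_climb => l'; apply: eq_dns => l''; rewrite e.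
Qed.

(** [pull] moves only between levels named in [s], [climb] visits every level. Levels without
    observables contribute the factor 1, consecutive descents compose, and observables of equal time
    are multiplied together. *)
Lemma pull_climb m s t j h : {homo M : a b / (a <= b)%N} -> M (t + j) = N.+1 ->
 all (fun x => t <= tm x <= t + j)%N s -> sorted (fun x y => tm x <= tm y)%N s ->
 forall l, pull m s (iter (lev s - M t) dn h) l = climb m s t j h l.
move=> hM; elim: j t s h => [|j IHj] t s h Mt hs ss l.
 rewrite addn0 in Mt hs; elim: s h hs ss => [|x s IH] h /= hs ss.
  by rewrite Mt subnn /gat big_nil mul1r.
 move: hs => /andP[hx hs].
 have tx : tm x = t by lia.
 have ss' : sorted (fun x y => tm x <= tm y)%N s by case: (s) ss => //= y s' /andP[].
 have := IH (fun l => gobs kx sc u c x m l * h l) hs ss'; rewrite lvM tx subnn => e.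
 rewrite e /= /gat big_cons tx eqxx; ring.
elim: s h hs ss => [|x s IH] h hs ss.
 have := IHj t.+1 [::] (iter (M t.+1 - M t) dn h).
 rewrite addSnnS Mt => /(_ erefl isT isT) e.
 have -> : (N.+1 - M t = (N.+1 - M t.+1) + (M t.+1 - M t))%N.
  have := hM t t.+1 (leqnSn t); have : (M t.+1 <= M (t + j.+1))%N by apply: hM; lia.
  lia.
 rewrite iterD e; apply: eq_climb => l'; apply: eq_dns => l''.
 by rewrite /gat big_nil mul1r.
move: (hs) => /= /andP[hx hs'].
have ss' : sorted (fun x y => tm x <= tm y)%N s by case: (s) ss => //= y s' /andP[].
have [tx|tx] := eqVneq (tm x) t.
 have := IH (fun l => gobs kx sc u c x m l * h l) hs' ss'; rewrite lvM tx subnn => -> /=.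
 rewrite (climb_late (s' := x :: s)); last first.
  by move=> t' ht' l'; rewrite /gat big_cons tx ltn_eqF.
 apply: eq_climb => l'; apply: eq_dns => l''.
 by rewrite /gat big_cons tx eqxx; ring.
have hall : all (fun x => t.+1 <= tm x <= t.+1 + j)%N (x :: s).
 have hp : all (fun y => tm x <= tm y)%N s.
  move: ss => /=; rewrite path_sortedE; first lia.
  by move=> a b d; apply: leq_trans.
 apply/andP; split; first by move: hx tx; lia.
 have : all (predI (fun y => t <= tm y <= t + j.+1)%N (fun y => tm x <= tm y)%N) s by rewrite all_predI hs'.
 by apply: sub_all => y /andP[/= h1 h2]; lia.
have := IHj t.+1 (x :: s) (iter (M t.+1 - M t) dn h).
have hall' := hall; rewrite addSnnS in hall'.
rewrite addSnnS Mt => /(_ erefl hall' ss l) e.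
have hlt : (t.+1 <= tm x)%N by move: hall => /andP[/andP[]].
have -> : (lev (x :: s) - M t = (lev (x :: s) - M t.+1) + (M t.+1 - M t))%N.
 rewrite /= lvM; have := hM t t.+1 (leqnSn t); have := hM _ _ hlt; lia.
rewrite iterD; apply: (etrans e); apply: eq_climb => l'; apply: eq_dns => l''.
rewrite gat_late ?mul1r //; apply: sub_all hall => y; lia.
Qed.

Theorem total_climb s j l : {homo M : a b / (a <= b)%N} -> M (1 + j) = N.+1 ->
 all (fun x => 1 <= tm x <= 1 + j)%N s -> sorted (fun x y => tm x <= tm y)%N s ->
 total (state s l) = wt l * climb (sh l) s 1 j (@dimK K) (sg l).
move=> hM Mn hs ss; rewrite total_pair pair_state; congr (_ * _).
rewrite -pull_climb //; apply: eq_pull => l'; by rewrite dns_dim.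
Qed.
End Pull.

(** * Coefficient bounds and summability *)

Section Bounds.
Variables (K : numFieldType) (N Q : nat).
Notation A := {mpoly K[N.+1]}.

Lemma ff_bound (x : K) k (B : nat) : `|x| <= B%:R -> `|ff x k| <= (B + k)%:R ^+ k.
move=> h; rewrite normr_prod -[X in _ <= _ ^+ X]card_ord -prodr_const.
apply: ler_prod => j _; rewrite normr_ge0.
apply: le_trans (ler_normB _ _) _; rewrite natrD normr_nat; apply: lerD => //.
by rewrite ler_nat ltnW.
Qed.

Lemma iota1_pow i m : eqm Q.+1 ((1 + Y K N i) ^+ m * iota1 K N Q i ^+ m) 1.
rewrite -exprMn iota1E; elim: m => [|m IH]; first by rewrite expr0; apply: eqm_refl.
rewrite exprS -[X in eqm _ _ X]mulr1; apply: eqmM => //.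
rewrite /eqm addrAC subrr add0r; apply: vanishN; rewrite -{1}[Q.+1]muln1; apply: vanish_exp.
by apply: vanishN; apply: vanish_Y.
Qed.

(** Giving the variables above level [M] the exponent [m - m = 0] changes nothing up to the order of
    the truncated inverse, so one estimate in all [N.+1] variables serves every level. *)
Lemma mono_full M m a : (M <= N.+1)%N ->
 eqm Q.+1 (mono K N Q M m a) (mono K N Q N.+1 m (fun j => if (j < M)%N then a j else m)).
move=> hM; rewrite /mono.
pose g j := T K N Q m j (if (j < M)%N then a j else m).
have -> : \prod_(j < N.+1) T K N Q m j (if (j < M)%N then a j else m) =
 (\prod_(j < M) T K N Q m j (a j)) * \prod_(M <= j < N.+1) g j.
 rewrite -(big_mkord xpredT g) (big_cat_nat (n := M)) //=; congr (_ * _).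
 by rewrite big_mkord; bigr => j _; rewrite /g ltn_ord.
rewrite -[X in eqm _ X _]mulr1; apply: eqmMl; apply: eqm_sym.
rewrite big_nat; elim/big_rec: _ => [|j p /andP[hj _] hp]; first exact: eqm_refl.
rewrite -[X in eqm _ _ X]mulr1; apply: eqmM => //.
by rewrite /g ltnNge hj /T mulrC; apply: iota1_pow.
Qed.

Lemma mk_first (mu : 'X_{1..N.+1}) : mk (first N N.+1) [seq mu (inord j) | j <- iota 0 N.+1] = mu.
have gen k n : (k + n = N.+1)%N ->
 mk (map inord (iota k n)) [seq mu (inord j) | j <- iota k n] =
 [multinom (if (k <= (i : 'I_N.+1))%N then mu i else 0%N) | i < N.+1].
 elim: n k => [|n IH] k kn /=.
  apply/mnmP => i; rewrite mnm0E mnmE ifF; have := ltn_ord i; lia.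
 rewrite IH; last lia.
 apply/mnmP => i; rewrite mnmDE mulmnE !mnmE.
 have [->|ik] := eqVneq i (inord k).
  rewrite inordK; last lia.
  by rewrite leqnn ltnn addn0 mul1n.
 rewrite mul0n.
 have : (i : nat) != k.
  by apply: contraNneq ik => <-; rewrite inord_val.
 by move=> /negPf ik'; rewrite [(k <= i)%N]leq_eqVlt eq_sym ik'.
by rewrite gen //; apply/mnmP => i; rewrite mnmE.
Qed.

(** Up to division by factorials, which are at least 1, a coefficient is a jet, and the jets of a
    monomial are products of falling factorials of its exponents. For fixed [mu] and [N] the bound
    is polynomial in [B]. *)
Lemma mono_coef_bound M m a (mu : 'X_{1..N.+1}) (B : nat) : (M <= N.+1)%N -> (mdeg mu <= Q)%N ->
 (forall j, (j < M)%N -> `|(a j)%:R - m%:R : K| <= B%:R) ->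
 `|(mono K N Q M m a)@_mu| <= ((B + mdeg mu).+1)%:R ^+ (mdeg mu * N.+1).
move=> hM hmu ha.
rewrite (eqm_coef (mono_full m a hM)) //.
set a' := fun j => _.
set s := [seq mu (inord j) | j <- iota 0 N.+1].
have ss : size s = N.+1 by rewrite size_map size_iota.
have hd : sumn s = mdeg mu.
 rewrite sumnE big_map mdegE.
 have := big_mkord xpredT (fun j => mu (inord j)) (n := N.+1) (op := addn) (idx := 0%N).
 rewrite /index_iota => ->; bigr => j _; by rewrite inord_val.
have e := djet_scoef (mono K N Q N.+1 m a') (s := s).
rewrite ss leqnn /scoef ss mk_first in e; have {}e := e isT.
have szj k r : size (jetidx k r) = sumn r.
 by elim: r k => //= b r IH k; rewrite size_cat size_nseq IH.
have alj k r : (k + size r <= N.+1)%N -> all (fun i => i < N.+1)%N (jetidx k r).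
 elim: r k => //= b r IH k hk; rewrite all_cat all_nseq IH; last lia.
 lia.
rewrite djet_mono // in e; last 2 first.
- by apply: alj; rewrite ss.
- by rewrite szj hd.
set c := (\prod_(a0 <- s) a0`!)%N in e.
have c0 : (0 < c)%N by apply: prodn_gt0 => i; apply: fact_gt0.
have h1 : `|(mono K N Q N.+1 m a')@_mu| <= `|(mono K N Q N.+1 m a')@_mu *+ c|.
 rewrite normrMn -[leLHS]mulr1n; exact: ler_wpMn2l.
apply: le_trans h1 _; rewrite -e normr_prod.
have -> : ((B + mdeg mu).+1)%:R ^+ (mdeg mu * N.+1) = \prod_(j < N.+1) ((B + mdeg mu).+1)%:R ^+ mdeg mu :> K.
 by rewrite prodr_const card_ord exprM.
apply: ler_prod => j _; rewrite normr_ge0.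
set k := count_mem _ _.
have kd : (k <= mdeg mu)%N by rewrite -hd -(szj 0%N) count_size.
have haj : `|(a' j)%:R - m%:R : K| <= B%:R.
 by rewrite /a'; case: ltnP => hj; [apply: ha|rewrite subrr normr0].
apply: le_trans (ff_bound k haj) _.
apply: (@le_trans _ _ (((B + mdeg mu).+1)%:R ^+ k)).
 by apply: lerXn2r; rewrite ?nnegrE // ler_nat; lia.
by apply: ler_weXn2l; rewrite // ler1n.
Qed.
End Bounds.

Section Summable.
Variables (K : numFieldType) (N Q D : nat) (La : Type) (ok : La -> Prop) (S : (La -> K) -> K -> Prop).
Variables (sh : La -> nat) (sg : La -> seq nat) (wt : La -> K) (Bd : La -> nat).
Hypothesis DQ : (D <= Q)%N.
Hypothesis wt0 : forall l, ok l -> 0 <= wt l.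
Hypothesis sg_ok : forall l, ok l -> size (sg l) = N.+1 /\ sdec (sg l).
Variables (lo hi : La -> nat).
Hypothesis sg_rg : forall l, ok l -> rg (lo l) (hi l) (sg l).
Hypothesis rgBd : forall l a, ok l -> (lo l <= a <= hi l)%N -> `|a%:R - (sh l)%:R : K| <= (Bd l)%:R.
Hypothesis S_dom : forall f (C : nat) p,
 (forall l, ok l -> `|f l| <= wt l * dimK K (sg l) * (C * (Bd l).+1 ^ p)%:R) -> exists v, S f v.
Variables (X : Type) (lv kx : X -> nat) (sc : X -> nat -> K) (u : K) (c : X -> K).
Hypothesis archi : forall x : K, 0 <= x -> exists n : nat, x <= n%:R.
Notation state := (state N sh sg wt lv kx sc u c).
Notation lev := (lev N lv).
Notation pair := (@pair K).

Definition rgst lo hi (st : wstate K) := all (fun x => rg lo hi x.2) st.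
(** Total mass weighted by dimension. Descending preserves it, since the dimensions of the rows
    below add up to that of the row. *)
Definition absst (st : wstate K) : K := \sum_(x <- st) `|x.1| * dimK K x.2.

Lemma rgst_down l h st : rgst l h st -> rgst l h (down st).
move=> /allP hs; apply/allP => y /flattenP [t /mapP[x hx ->] /mapP [ms hms ->]].
exact: below_rg hms (hs x hx).
Qed.
Lemma rgst_obs l h g st : rgst l h (obs g st) = rgst l h st.
by rewrite /rgst all_map. Qed.

Lemma absst_down st : absst (down st) = absst st.
rewrite /absst big_flatten big_map; bigr => x _.
by rewrite big_map /= -mulr_sumr -/(dn (@dimK K) x.2) dn_dim.
Qed.
Lemma absst_downs j st : absst (iter j (@down K) st) = absst st.
by elim: j => //= j IH; rewrite absst_down. Qed.

(** Growth at most polynomial in the size of the signature: the class that the domination hypothesis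
    on [S] can handle. *)
Definition polyb (g : La -> seq nat -> K) (M : nat) := exists (C p : nat), forall l a, ok l ->
 size a = M -> rg (lo l) (hi l) a -> `|g l a| <= (C * (Bd l).+1 ^ p)%:R.

Lemma polyb_le (C p C' p' b : nat) : (C <= C')%N -> (p <= p')%N -> (C * b.+1 ^ p)%:R <= (C' * b.+1 ^ p')%:R :> K.
by move=> h1 h2; rewrite ler_nat leq_mul // leq_pexp2l. Qed.

Lemma polybD g g' M : polyb g M -> polyb g' M -> polyb (fun l a => g l a + g' l a) M.
move=> [C [p h]] [C' [p' h']]; exists (C + C')%N, (maxn p p') => l a hl sa ra.
apply: le_trans (ler_normD _ _) _; rewrite mulnDl natrD; apply: lerD.
 by apply: le_trans (h _ _ hl sa ra) _; apply: polyb_le => //; apply: leq_maxl.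
by apply: le_trans (h' _ _ hl sa ra) _; apply: polyb_le => //; apply: leq_maxr.
Qed.

Lemma polyb_const (x : K) M : polyb (fun _ _ => x) M.
have [n hn] := archi (normr_ge0 x); exists n, 0%N => l a _ _ _.
by rewrite muln1.
Qed.

Lemma polybM g g' M : polyb g M -> polyb g' M -> polyb (fun l a => g l a * g' l a) M.
move=> [C [p h]] [C' [p' h']]; exists (C * C')%N, (p + p')%N => l a hl sa ra.
by rewrite normrM expnD mulnACA natrM; apply: ler_pM => //; [apply: h|apply: h'].
Qed.

Lemma polyb_sum (I : Type) (r : seq I) (g : I -> La -> seq nat -> K) M :
 (forall i, polyb (g i) M) -> polyb (fun l a => \sum_(i <- r) g i l a) M.
move=> h; elim: r => [|i r [C [p IH]]].
 by exists 0%N, 0%N => l a _ _ _; rewrite big_nil normr0.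
have [C' [p' h']] := polybD (h i) (ex_intro _ C (ex_intro _ p IH)).
by exists C', p' => l a hl sa ra; rewrite big_cons; apply: h'.
Qed.

Lemma polyb_pff k M : polyb (fun l a => pff K (sh l) a k) M.
exists (M * k.+1 ^ k)%N, k => l a hl sa ra.
apply: le_trans (ler_norm_sum _ _ _) _.
apply: (@le_trans _ _ (\sum_(b <- a) ((Bd l + k)%:R ^+ k : K))).
 rewrite big_seq big_seq; apply: ler_sum => b hb.
 by apply: ff_bound; apply: rgBd => //; move: ra => /allP; apply.
rewrite big_const_seq count_predT sa iter_addr addr0 -natrX -mulrnA ler_nat mulnC -mulnA leq_mul2l -expnMn; apply/orP; right; apply: leq_exp2r_le; nia.
Qed.

Lemma polyb_gobs x M : polyb (fun l a => gobs kx sc u c x (sh l) a) M.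
apply: polybD; last exact: polyb_const.
apply: polybM; first exact: polyb_const.
apply: (@polyb_sum _ _ (fun (j : 'I_(kx x).+1) l a => sc x j * pff K (sh l) a j)) => j.
by apply: polybM; [apply: polyb_const|apply: polyb_pff].
Qed.

Lemma rgst_state s l : ok l -> lvok N lv s -> rgst (lo l) (hi l) (state s l).
move=> hl; elim: s => [_|x s IH /andP[_ hs]]; first by rewrite /= sg_rg.
by rewrite rgst_obs; elim: (lev s - lv x)%N => [|j IHj]; [apply: IH|apply: rgst_down].
Qed.

Lemma absst_obs_poly M g (st : La -> wstate K) : polyb g M -> (forall l, ok l -> wfst M (st l)) ->
 (forall l, ok l -> rgst (lo l) (hi l) (st l)) ->
 (exists C p : nat, forall l, ok l -> absst (st l) <= wt l * dimK K (sg l) * (C * (Bd l).+1 ^ p)%:R) ->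
 exists C p : nat, forall l, ok l -> absst (obs (g l) (st l)) <= wt l * dimK K (sg l) * (C * (Bd l).+1 ^ p)%:R.
move=> [C [p hg]] hw hr [C' [p' hst]]; exists (C * C')%N, (p + p')%N => l hl.
apply: (@le_trans _ _ ((C * (Bd l).+1 ^ p)%:R * absst (st l))).
 rewrite /absst big_map mulr_sumr big_seq big_seq; apply: ler_sum => x hx.
 have /andP[/eqP sx _] := allP (hw l hl) x hx.
 rewrite normrM mulrA; apply: ler_wpM2r; first exact: ler0n.
 by rewrite mulrC ler_wpM2r // hg //; apply: (allP (hr l hl) x hx).
rewrite expnD mulnACA [in leRHS]natrM mulrCA; apply: ler_wpM2l; first exact: ler0n.
exact: hst.
Qed.

Lemma absst_state s : lvok N lv s -> exists C p : nat, forall l, ok l ->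
 absst (state s l) <= wt l * dimK K (sg l) * (C * (Bd l).+1 ^ p)%:R.
elim: s => [_|x s IH /andP[hx hs]].
 exists 1%N, 0%N => l hl; rewrite /absst big_seq1 mulr1.
 by rewrite ger0_norm // wt0.
have wd l : ok l -> wfst (lv x) (iter (lev s - lv x) (@down K) (state s l)).
 by move=> hl; rewrite -{1}(subKn hx); apply: iter_down (leq_subr _ _) _; apply: (wf_state (ok := ok)).
apply: (absst_obs_poly (polyb_gobs x (lv x)) wd).
 move=> l hl; elim: (lev s - lv x)%N => [|j IHj]; [exact: rgst_state|exact: rgst_down].
have [C [p h]] := IH hs; exists C, p => l hl; rewrite absst_downs; exact: h.
Qed.

Lemma GS_coef_bound M (mu : 'X_{1..N.+1}) st l : (M <= N.+1)%N -> (mdeg mu <= Q)%N -> ok l ->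
 wfst M st -> rgst (lo l) (hi l) st ->
 `|(GS N Q M (sh l) st)@_mu| <= absst st * ((Bd l + mdeg mu).+1)%:R ^+ (mdeg mu * N.+1).
move=> hM hmu hl hw hr; rewrite raddf_sum; apply: le_trans (ler_norm_sum _ _ _) _.
rewrite mulr_suml big_seq big_seq; apply: ler_sum => x hx /=.
have /andP[/eqP sx dx] := allP hw x hx; have rx := allP hr x hx.
rewrite mcoeffZ normrM -mulrA; apply: ler_wpM2l => //.
rewrite raddf_sum; apply: le_trans (ler_norm_sum _ _ _) _.
apply: (@le_trans _ _ (\sum_(w <- gts M x.2) ((Bd l + mdeg mu).+1)%:R ^+ (mdeg mu * N.+1))).
 rewrite big_seq big_seq; apply: ler_sum => w hw'.
 apply: mono_coef_bound => // j hj; apply: rgBd => //.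
 by have := gts_rg sx rx hw' => /allP; apply; apply: mem_nth; rewrite (size_gts hw').
by rewrite big_const_seq iter_addr addr0 /dimK /dimn sx mulr_natl.
Qed.

Theorem summable_dom : summable N S D Q sh sg wt lv kx sc u c.
move=> s x j mu /andP[hx hs] hmu.
have wd l : ok l -> wfst (lv x) (iter (lev s - lv x) (@down K) (state s l)).
 by move=> hl; rewrite -{1}(subKn hx); apply: iter_down (leq_subr _ _) _; apply: (wf_state (ok := ok)).
have rd l : ok l -> rgst (lo l) (hi l) (iter (lev s - lv x) (@down K) (state s l)).
 by move=> hl; elim: (lev s - lv x)%N => [|i IHi]; [exact: rgst_state|exact: rgst_down].
have [C [p h]] : exists C p : nat, forall l, ok l ->
  absst (obs (fun a => pff K (sh l) a j) (iter (lev s - lv x) (@down K) (state s l))) <= wt l * dimK K (sg l) * (C * (Bd l).+1 ^ p)%:R.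
 apply: (absst_obs_poly (polyb_pff j (lv x)) wd rd).
 have [C [p h]] := absst_state hs; exists C, p => l hl; rewrite absst_downs; exact: h.
have hM : (lv x <= N.+1)%N by apply: leq_trans hx (lvok_lev hs).
apply: (S_dom (C := C * (mdeg mu).+1 ^ (mdeg mu * N.+1)) (p := p + mdeg mu * N.+1)) => l hl.
apply: le_trans (GS_coef_bound hM (leq_trans hmu DQ) hl _ _) _; [by rewrite wf_obs; apply: wd|by rewrite rgst_obs; apply: rd|].
apply: (@le_trans _ _ ((wt l * dimK K (sg l) * (C * (Bd l).+1 ^ p)%:R) * ((Bd l + mdeg mu).+1)%:R ^+ (mdeg mu * N.+1))).
 by apply: ler_wpM2r; [apply: exprn_ge0|apply: h].
rewrite -mulrA; apply: ler_wpM2l; first by apply: mulr_ge0; [apply: wt0|].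
rewrite -natrX -natrM ler_nat expnD mulnACA leq_mul2l -expnMn; apply/orP; right.
apply: leq_exp2r_le; nia.
Qed.
End Summable.

(** * The limit of the joint moments in algebraic form *)

Section HopLimit.
Variables (K : numFieldType) (D0 : nat).
Notation D := D0.+2.
Variable cv : (nat -> K) -> K -> Prop.
Hypothesis hcv : limit_rel cv.
Hypothesis cv_uniq : forall u a b, cv u a -> cv u b -> a = b.
Variables (u w : nat -> K).
Hypothesis uw : forall N, u N * w N = 1.
Hypothesis cvu : cv u 0.
Variable f0 : forall N, {mpoly K[N.+1]}.
Variables (lam : 'I_D -> K) (beta : 'I_D -> 'I_D -> K).
Hypothesis beta_sym : forall a b, beta a b = beta b a.
Let p N := logt D (f0 N).
Hypothesis h1 : forall b : 'I_D, cv (fun N => u N * scoef (p N) [:: b.+1]) (lam b).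
Hypothesis h2 : forall a b : 'I_D, cv (fun N => scoef (p N) [:: a.+1; b.+1]) (beta a b).
Hypothesis h3 : forall s, (2 < size s)%N -> all (leq 1) s -> cv (fun N => scoef (p N) s) 0.
Variables (X : Type) (lv : nat -> X -> nat) (kx : X -> nat) (sc : X -> nat -> K) (alpha : X -> K).
Hypothesis kx0 : forall x, (0 < kx x)%N.
Hypothesis sc1 : forall x, sc x (kx x) = 1.
Hypothesis cva : forall x, cv (fun N => u N * (lv N x)%:R) (alpha x).

(** The expectation of a single observable, from the same recursion without centring. *)
Definition centre N (x : X) : K := (hop D (lv N) kx sc (u N) (f0 N) (fun=> 0) [:: x])@_0.

Lemma hop_cen N s : hop D (lv N) kx sc (u N) (f0 N) (centre N) s =
 foldr (fun x h => cen u w (logl1 (D0 := D0) u p) (logL2 D0 p) (fun N => (lv N x)%:R) (fun j : 'I_(kx x).+1 => sc x j) N h) 1 s.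
have E : LLN D (f0 N) = Lseq w (logl1 (D0 := D0) u p) (logL2 D0 p) N by exact: LL_Lseq.
elim: s => [|x s IH]; first by [].
rewrite [hop _ _ _ _ _ _ _ _]/= IH /centre [hop _ _ _ _ _ _ _ [:: x]]/= scale0r subr0 E /=.
have eC : ((lv N x)%:R : {mpoly K[D]}) = ((lv N x)%:R : K)%:MP by rewrite mpolyC_nat.
by rewrite eC.
Qed.

Theorem hop_limit s : cv (fun N => (hop D (lv N) kx sc (u N) (f0 N) (centre N) s)@_0)
 ((foldr (Op (fun x => limlin lam beta (alpha x) (kx x)) (fun x => psi (alpha x) lam (kx x))) 1 s)@_0).
have hl : forall b, cv ((logl1 (D0 := D0) u p)^~ b) (lam b) by [].
have h := cvB_chain hcv cv_uniq uw cvu beta_sym hl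
 (cvB_logL2 hcv h2 h3)
 (sc := fun x j => sc x j) s cva kx0 sc1.
by apply: (lim_ext hcv) (h 0%MM) => N; rewrite hop_cen.
Qed.
End HopLimit.

(** * The covariance as a polynomial in Taylor coefficients *)

Section Covariance.
Variables (K : numFieldType) (lam : nat -> K) (beta : nat -> nat -> K).

Definition Wpow (D : nat) (alpha : K) (k : nat) : {poly K} := Wp alpha (fun b : 'I_D => lam b) ^+ k.
(** The coefficient of degree [n] with the series cut at [n] itself, hence a number that does not
    depend on the order [D] chosen for a particular moment. *)
Definition wco alpha k n : K := (Wpow n alpha k)`_n.
Definition psin alpha k b : K := if (b < k)%N then wco alpha k (k.-1 - b) *+ b.+1 else 0.
(** The annihilation part of the first observable contracted with the linear form of the second. The
    [wco] term comes from the Vandermonde product and will match [1/(z-w)^2]; the [beta] term comes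
    from the logarithm and will match [G_rho]. *)
Definition covK a1 k1 a2 k2 : K :=
 \sum_(b < k1) psin a1 k1 b * (wco a2 k2 (b.+1 + k2) + \sum_(b' < k2) psin a2 k2 b' * beta b' b).

Lemma Lam_coef D n : (n < D)%N -> (Lam (fun b : 'I_D => lam b))`_n = lam n *+ n.+1.
move=> h; rewrite coef_sum (bigD1 (Ordinal h)) //= coefZ coefXn eqxx mulr1 big1 ?addr0 // => b hb.
rewrite coefZ coefXn; case: eqP => [e|]; last by rewrite mulr0.
by case/negP: hb; apply/eqP; apply: val_inj.
Qed.

Lemma Wpow_coef D D' alpha k n : (n <= D)%N -> (n <= D')%N -> (Wpow D alpha k)`_n = (Wpow D' alpha k)`_n.
have base d d' i : (i <= d)%N -> (i <= d')%N ->
  (Wp alpha (fun b : 'I_d => lam b))`_i = (Wp alpha (fun b : 'I_d' => lam b))`_i.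
 move=> h h'; rewrite !coefM; bigr => j _; congr _.
 rewrite !coefD !coefXM; congr _; case: (i - j)%N (leq_subr j i) => //= m hm.
 by rewrite !Lam_coef //; lia.
rewrite /Wpow; elim: k n => [|k IH] n h h'; first by [].
rewrite !exprS !coefM; bigr => j _; rewrite (base D D') ?IH //; have := ltn_ord j; lia.
Qed.

Lemma wcoE D alpha k n : (n <= D)%N -> (Wpow D alpha k)`_n = wco alpha k n.
by move=> h; apply: Wpow_coef. Qed.

Lemma psinE D alpha k b : (0 < k <= D)%N -> psi alpha (fun b : 'I_D => lam b) k b = psin alpha k b.
case: k => // k h; rewrite /psi /psin coefXnM ltnS.
case: leqP => h2; last by rewrite mul0rn.
by congr (_ *+ _); apply: wcoE; lia.
Qed.

Lemma sum_psin D k alpha (F : nat -> K) : (k <= D)%N ->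
 \sum_(b < D) psin alpha k b * F b = \sum_(b < k) psin alpha k b * F b.
move=> h; rewrite (big_ord_widen _ (fun b => psin alpha k b * F b) h) [RHS]big_mkcond.
by bigr => b _; rewrite /psin; case: ltnP => // _; rewrite mul0r.
Qed.

Lemma ccE D a1 k1 a2 k2 : (0 < k1)%N -> (0 < k2)%N -> (k1 + k2 <= D)%N ->
 \sum_(b < D) psi a1 (fun b : 'I_D => lam b) k1 b *
   limlin (fun b : 'I_D => lam b) (fun a b : 'I_D => beta a b) a2 k2 b = covK a1 k1 a2 k2.
move=> k10 k20 h.
have hk1 : (0 < k1 <= D)%N by lia.
under eq_bigr => b _ do rewrite (psinE _ _ hk1).
pose F b := (Wpow D a2 k2)`_(b.+1 + k2) + \sum_(b' < k2) psin a2 k2 b' * beta b' b.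
have -> : \sum_(b < D) psin a1 k1 b * limlin (fun b : 'I_D => lam b) (fun a b : 'I_D => beta a b) a2 k2 b =
  \sum_(b < D) psin a1 k1 b * F b.
 bigr => b _; congr (_ * (_ + _)).
 rewrite -(@sum_psin D k2 a2 (fun b' => beta b' b)); last lia.
 by bigr => b' _; rewrite psinE //; lia.
rewrite sum_psin; last lia.
bigr => b _; congr (_ * (_ + _)); apply: wcoE; have := ltn_ord b; lia.
Qed.

End Covariance.

End Germs.

(** * Unordered sums of real numbers *)

Module Sums.
Import Reals ZArith List Lia Lra ClassicalEpsilon FunctionalExtensionality Permutation.
Import Coquelicot.Coquelicot Defs ListNotations.
Open Scope R_scope.

Lemma eq_dec_cl {T} (x y : T) : {x = y} + {x <> y}.
apply excluded_middle_informative. Qed.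

Section Sums.
Context {T : Type}.
Implicit Types (F : list T) (f g : T -> R) (P : T -> Prop).

Lemma sumR_ext F f g : (forall x, In x F -> f x = g x) -> sumR F f = sumR F g.
induction F; simpl; intros H; [easy|]. rewrite H, IHF; auto. Qed.
Lemma sumR_plus F f g : sumR F (fun x => f x + g x) = sumR F f + sumR F g.
induction F; simpl; [lra|]. lra. Qed.
Lemma sumR_scal F c f : sumR F (fun x => c * f x) = c * sumR F f.
induction F; simpl; [lra|]. lra. Qed.
Lemma sumR_app F F' f : sumR (F ++ F') f = sumR F f + sumR F' f.
induction F; simpl; [lra|]. lra. Qed.
Lemma sumR_le F f g : (forall x, In x F -> f x <= g x) -> sumR F f <= sumR F g.
induction F; simpl; intros H; [lra|]. apply Rplus_le_compat; auto. Qed.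
Lemma sumR_ge0 F f : (forall x, In x F -> 0 <= f x) -> 0 <= sumR F f.
induction F; simpl; intros H; [lra|]. apply Rplus_le_le_0_compat; auto. Qed.
Lemma sumR_zero F : sumR F (fun _ => 0) = 0.
induction F; simpl; lra. Qed.
Lemma sumR_perm F F' f : Permutation F F' -> sumR F f = sumR F' f.
induction 1; simpl; lra. Qed.

Lemma sumR_incl F F' f : NoDup F -> incl F F' -> (forall x, In x F' -> 0 <= f x) -> sumR F f <= sumR F' f.
revert F'; induction F as [|a F IH]; intros F' nd hi h0.
- now apply sumR_ge0.
- inversion nd; subst.
 destruct (in_split a F') as [l1 [l2 e]]; [apply hi; now left|]. subst F'.
 rewrite (sumR_perm (l1 ++ a :: l2) (a :: (l1 ++ l2))) by (symmetry; apply Permutation_middle). apply Rplus_le_compat_l. apply IH; auto.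
 + intros x hx. assert (hx' : In x (l1 ++ a :: l2)) by (apply hi; now right).
  apply in_app_iff in hx'. apply in_app_iff. destruct hx' as [h|[h|h]]; auto. subst; contradiction.
 + intros x hx; apply h0. apply in_app_iff in hx. apply in_app_iff. simpl. tauto.
Qed.

Lemma union_ex P F F' : List.Forall P F -> List.Forall P F' ->
 exists G, NoDup G /\ List.Forall P G /\ incl F G /\ incl F' G.
intros h h'. exists (nodup eq_dec_cl (F ++ F')). repeat split.
- apply NoDup_nodup.
- apply Forall_forall; intros x hx. apply nodup_In in hx. apply in_app_iff in hx.
 rewrite Forall_forall in h, h'. destruct hx; auto.
- intros x hx. apply nodup_In. apply in_app_iff; auto.
- intros x hx. apply nodup_In. apply in_app_iff; auto.
Qed.

Lemma hs_uniq P f a b : has_sum_on P f a -> has_sum_on P f b -> a = b.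
intros ha hb. destruct (Req_dec a b) as [e|ne]; [easy|].
assert (he : 0 < Rabs (a - b) / 2) by (assert (0 < Rabs (a - b)) by (apply Rabs_pos_lt; lra); lra).
destruct (ha _ he) as [F [nF [pF hF]]]. destruct (hb _ he) as [F' [nF' [pF' hF']]].
destruct (union_ex P F F' pF pF') as [G [nG [pG [i1 i2]]]].
specialize (hF G nG pG i1). specialize (hF' G nG pG i2).
assert (Rabs (a - b) <= Rabs (sumR G f - a) + Rabs (sumR G f - b)).
{ replace (a - b) with (- (sumR G f - a) + (sumR G f - b)) by ring.
 eapply Rle_trans; [apply Rabs_triang|]. rewrite Rabs_Ropp. lra. }
lra.
Qed.

Lemma hs_ext P f g a : (forall x, P x -> f x = g x) -> has_sum_on P f a -> has_sum_on P g a.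
intros h ha e he. destruct (ha e he) as [F [nF [pF hF]]]. exists F; repeat split; auto.
intros F1 n1 p1 i1. rewrite <- (sumR_ext F1 f); auto.
rewrite Forall_forall in p1; auto.
Qed.

Lemma hs_plus P f g a b : has_sum_on P f a -> has_sum_on P g b -> has_sum_on P (fun x => f x + g x) (a + b).
intros ha hb e he. assert (he2 : 0 < e / 2) by lra.
destruct (ha _ he2) as [F [nF [pF hF]]]. destruct (hb _ he2) as [F' [nF' [pF' hF']]].
destruct (union_ex P F F' pF pF') as [G [nG [pG [i1 i2]]]].
exists G; repeat split; auto. intros F1 n1 p1 j1.
specialize (hF F1 n1 p1 (incl_tran i1 j1)). specialize (hF' F1 n1 p1 (incl_tran i2 j1)).
rewrite sumR_plus. replace (_ + _ - _) with ((sumR F1 f - a) + (sumR F1 g - b)) by ring.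
eapply Rle_lt_trans; [apply Rabs_triang|]. lra.
Qed.

Lemma hs_zero P : has_sum_on P (fun _ => 0) 0.
exists nil. repeat split; try constructor.
intros F _ _ _. rewrite sumR_zero, Rminus_diag, Rabs_R0; auto.
Qed.

Lemma hs_scal P c f a : has_sum_on P f a -> has_sum_on P (fun x => c * f x) (c * a).
intros ha. destruct (Req_dec c 0) as [->|nc].
{ rewrite Rmult_0_l. apply (hs_ext P (fun _ => 0)); [intros; ring|apply hs_zero]. }
intros e he. assert (hc : 0 < Rabs c) by now apply Rabs_pos_lt.
destruct (ha (e / Rabs c)) as [F [nF [pF hF]]]; [now apply Rdiv_lt_0_compat|].
exists F; repeat split; auto. intros F1 n1 p1 i1. specialize (hF F1 n1 p1 i1).
rewrite sumR_scal. replace (_ - _) with (c * (sumR F1 f - a)) by ring. rewrite Rabs_mult.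
apply (Rmult_lt_compat_l _ _ _ hc) in hF. replace (Rabs c * (e / Rabs c)) with e in hF by (field; lra). auto.
Qed.

Lemma hs_opp P f a : has_sum_on P f a -> has_sum_on P (fun x => - f x) (- a).
intros h. replace (- a) with ((-1) * a) by ring.
apply (hs_ext P (fun x => (-1) * f x)); [intros; ring|]. now apply hs_scal.
Qed.

Lemma hs_bound P f v F : (forall x, P x -> 0 <= f x) -> has_sum_on P f v ->
 NoDup F -> List.Forall P F -> sumR F f <= v.
intros h0 hv nF pF. apply Rnot_lt_le; intro lt.
destruct (hv (sumR F f - v)) as [F0 [n0 [p0 h]]]; [lra|].
destruct (union_ex P F F0 pF p0) as [G [nG [pG [i1 i2]]]].
specialize (h G nG pG i2).
assert (sumR F f <= sumR G f).
{ apply sumR_incl; auto. rewrite Forall_forall in pG; auto. }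
apply Rabs_def2 in h. lra.
Qed.

Lemma hs_sup P f v : (forall x, P x -> 0 <= f x) ->
 (forall F, NoDup F -> List.Forall P F -> sumR F f <= v) ->
 (forall e, 0 < e -> exists F, NoDup F /\ List.Forall P F /\ v - e < sumR F f) ->
 has_sum_on P f v.
intros h0 hu hl e he. destruct (hl e he) as [F [nF [pF hF]]]. exists F; repeat split; auto.
intros F1 n1 p1 i1. specialize (hu F1 n1 p1).
assert (sumR F f <= sumR F1 f).
{ apply sumR_incl; auto. rewrite Forall_forall in p1; auto. }
apply Rabs_def1; lra.
Qed.

Lemma hs_nonneg_ex P f B : (forall x, P x -> 0 <= f x) ->
 (forall F, NoDup F -> List.Forall P F -> sumR F f <= B) -> exists v, has_sum_on P f v.
intros h0 hB.
destruct (completeness (fun s => exists F, NoDup F /\ List.Forall P F /\ s = sumR F f)) as [v [hu hl]].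
- exists B. intros s [F [nF [pF ->]]]. auto.
- exists 0, nil. repeat split; constructor.
- exists v. apply hs_sup; auto.
 + intros F nF pF. apply hu. exists F; auto.
 + intros e he. apply NNPP. intro hn.
  assert (v <= v - e); [|lra]. apply hl. intros s [F [nF [pF ->]]].
  apply Rnot_lt_le. intro lt. apply hn. exists F; auto.
Qed.

(** The positive and the negative part are both dominated, so each has bounded finite sums and
    therefore a sum. *)
Lemma hs_dom P f g w : (forall x, P x -> Rabs (f x) <= g x) -> has_sum_on P g w -> exists v, has_sum_on P f v.
intros h hw.
assert (pos : forall h', (forall x, P x -> 0 <= h' x <= g x) -> exists v, has_sum_on P h' v).
{ intros h' hh. apply (hs_nonneg_ex P h' w); [apply hh; auto|].
 intros F nF pF. apply Rle_trans with (sumR F g).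
 - apply sumR_le. intros x hx. apply hh. rewrite Forall_forall in pF; auto.
 - apply (hs_bound P g w); auto. intros x px. specialize (hh x px). lra. }
destruct (pos (fun x => Rmax (f x) 0)) as [v1 h1].
{ intros x px. specialize (h x px). split; [apply Rmax_r|]. apply Rmax_lub; [|pose proof (Rabs_pos (f x)); lra].
 pose proof (Rle_abs (f x)); lra. }
destruct (pos (fun x => Rmax (- f x) 0)) as [v2 h2].
{ intros x px. specialize (h x px). split; [apply Rmax_r|]. apply Rmax_lub; [|pose proof (Rabs_pos (f x)); lra].
 pose proof (Rle_abs (- f x)). rewrite Rabs_Ropp in H; lra. }
exists (v1 + - v2). apply (hs_ext P (fun x => Rmax (f x) 0 + - Rmax (- f x) 0)).
- intros x _. unfold Rmax. destruct Rle_dec, Rle_dec; lra.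
- apply hs_plus; auto. now apply hs_opp.
Qed.

Lemma hs_le P f g a b : (forall x, P x -> f x <= g x) -> has_sum_on P f a -> has_sum_on P g b -> a <= b.
intros h ha hb.
assert (hd : has_sum_on P (fun x => g x + - f x) (b + - a)) by (apply hs_plus; auto; now apply hs_opp).
assert (0 <= b + - a); [|lra].
change 0 with (sumR nil (fun x => g x + - f x)).
apply (hs_bound P _ _ nil) in hd; auto; [|constructor].
intros x px; specialize (h x px); lra.
Qed.

Lemma sum_on_eq P f v : has_sum_on P f v -> sum_on P f = v.
intros h. apply (hs_uniq P f); auto. unfold sum_on. apply epsilon_spec. now exists v.
Qed.
End Sums.

(** * Summation by finite fibres *)

Section Fibres.
Context {T U : Type} (P : U -> Prop) (Q : T -> Prop) (L : U -> list T).
Hypothesis ndL : forall u, P u -> NoDup (L u).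
Hypothesis QL : forall u, P u -> List.Forall Q (L u).
Hypothesis disj : forall u u' t, P u -> P u' -> In t (L u) -> In t (L u') -> u = u'.

Lemma sumR_concat (Us : list U) (g : T -> R) : sumR (concat (map L Us)) g = sumR Us (fun u => sumR (L u) g).
induction Us; simpl; [easy|]. rewrite sumR_app, IHUs; auto. Qed.

Lemma NoDup_fibres Us : NoDup Us -> List.Forall P Us -> NoDup (concat (map L Us)).
induction Us as [|u Us IH]; intros n p; [constructor|].
inversion n; inversion p; subst. apply NoDup_app; auto.
intros t ht hc. apply in_concat in hc. destruct hc as [l [hl htl]].
apply in_map_iff in hl. destruct hl as [u' [<- hu']].
assert (u = u'). { apply (disj u u' t); auto. rewrite Forall_forall in H6; auto. }
subst; contradiction.
Qed.

Lemma fibre_list g : (forall t, Q t -> g t <> 0 -> exists u, P u /\ In t (L u)) ->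
 forall F, List.Forall Q F -> exists Us, NoDup Us /\ List.Forall P Us /\
  (forall t, In t F -> g t <> 0 -> In t (concat (map L Us))).
intros cov F. induction F as [|t F IH]; intros q.
- exists nil; repeat split; try constructor. easy.
- inversion q. destruct (IH H2) as [Us [n [p h]]].
 destruct (Req_dec (g t) 0) as [e|ne].
 + exists Us; repeat split; auto. intros t' [->|] nz; [lra|auto].
 + destruct (cov t H1 ne) as [u [pu hu]].
  destruct (in_dec eq_dec_cl u Us) as [hin|].
  * exists Us; repeat split; auto. intros t' [->|] nz; auto.
   apply in_concat. exists (L u); split; auto. now apply in_map.
  * exists (u :: Us); repeat split; auto.
   { now constructor. }
   intros t' [->|] nz; apply in_app_iff; auto.
Qed.

(** All nonzero terms lie in fibres. A finite list is therefore bounded by finitely many fibres, and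
    finitely many fibres form a finite list, so the suprema of finite sums agree. *)
Lemma hs_fibres_pos g v : (forall t, Q t -> 0 <= g t) ->
 (forall t, Q t -> g t <> 0 -> exists u, P u /\ In t (L u)) ->
 has_sum_on P (fun u => sumR (L u) g) v -> has_sum_on Q g v.
intros g0 cov hv.
assert (f0 : forall u, P u -> 0 <= sumR (L u) g).
{ intros u pu. apply sumR_ge0. specialize (QL u). rewrite Forall_forall in QL; auto. }
assert (Qc : forall Us, List.Forall P Us -> List.Forall Q (concat (map L Us))).
{ intros Us p. apply Forall_forall. intros t hc. apply in_concat in hc. destruct hc as [l [hl htl]].
 apply in_map_iff in hl. destruct hl as [u' [<- hu']].
 rewrite Forall_forall in p. specialize (QL u' (p u' hu')). rewrite Forall_forall in QL; auto. }
apply hs_sup; auto.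
- intros F n q. destruct (fibre_list g cov F q) as [Us [nU [pU hU]]].
 apply Rle_trans with (sumR (concat (map L Us)) g).
 + set (nz := fun t => if Req_EM_T (g t) 0 then false else true).
  assert (e : sumR F g = sumR (filter nz F) g).
  { clear -nz. induction F as [|lra]; simpl; auto.
   unfold nz at 1. destruct Req_EM_T as [e|e]; simpl; lra. }
  rewrite e. apply sumR_incl.
  * now apply NoDup_filter.
  * intros t ht. apply filter_In in ht. destruct ht as [ht hz]. apply hU; auto.
   unfold nz in hz. destruct Req_EM_T; easy. specialize (Qc Us pU). rewrite Forall_forall in Qc; auto.
 + rewrite sumR_concat. apply (hs_bound P); auto.
- intros e he. destruct (hv e he) as [Us [nU [pU hU]]].
 exists (concat (map L Us)). repeat split; auto.
 + now apply NoDup_fibres.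
 + rewrite sumR_concat. specialize (hU Us nU pU (incl_refl _)). apply Rabs_def2 in hU. lra.
Qed.

(** Absolute summability over the fibres makes the positive and the negative part summable, and the
    nonnegative case applies to each. *)
Theorem hs_fibres g v w : (forall t, Q t -> g t <> 0 -> exists u, P u /\ In t (L u)) ->
 has_sum_on P (fun u => sumR (L u) (fun t => Rabs (g t))) w ->
 has_sum_on P (fun u => sumR (L u) g) v -> has_sum_on Q g v.
intros cov hw hv.
set (gp := fun t => Rmax (g t) 0). set (gm := fun t => Rmax (- g t) 0).
assert (part : forall h, (forall t, 0 <= h t <= Rabs (g t)) -> exists a, has_sum_on P (fun u => sumR (L u) h) a /\ has_sum_on Q h a).
{ intros h hh. destruct (hs_dom P (fun u => sumR (L u) h) (fun u => sumR (L u) (fun t => Rabs (g t))) w) as [a ha]; auto.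
 - intros u pu. rewrite Rabs_pos_eq; [|apply sumR_ge0; intros; apply hh].
  apply sumR_le. intros; apply hh.
 - exists a; split; auto. apply hs_fibres_pos; auto; [intros; apply hh|].
  intros t qt nz. apply cov; auto. intro e. specialize (hh t). rewrite e, Rabs_R0 in hh. lra. }
destruct (part gp) as [a [h1 h2]].
{ intros t. split; [apply Rmax_r|]. apply Rmax_lub; [apply Rle_abs|apply Rabs_pos]. }
destruct (part gm) as [b [h3 h4]].
{ intros t. split; [apply Rmax_r|]. apply Rmax_lub; [|apply Rabs_pos]. rewrite <- Rabs_Ropp. apply Rle_abs. }
assert (dec : forall t, gp t + - gm t = g t).
{ intros t. unfold gp, gm, Rmax. destruct Rle_dec, Rle_dec; lra. }
assert (v = a + - b).
{ apply (hs_uniq P (fun u => sumR (L u) g)); auto.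
 apply (hs_ext P (fun u => sumR (L u) gp + - sumR (L u) gm)).
 - intros u _. replace (- sumR (L u) gm) with ((-1) * sumR (L u) gm) by ring.
  rewrite <- sumR_scal, <- sumR_plus. apply sumR_ext. intros t _. rewrite <- dec. ring.
 - apply hs_plus; auto. now apply hs_opp. }
subst v. apply (hs_ext Q (fun t => gp t + - gm t)); auto.
apply hs_plus; auto. now apply hs_opp.
Qed.
End Fibres.

Ltac cmod_tri := eapply Rle_trans; [apply Cmod_triangle|].

(** * Unordered sums of complex numbers *)

Section ComplexSums.
Context {T : Type}.
Implicit Types (P : T -> Prop) (f g : T -> C).

Definition hsC P f (v : C) : Prop :=
 has_sum_on P (fun x => Re (f x)) (Re v) /\ has_sum_on P (fun x => Im (f x)) (Im v).

Lemma hsC_uniq P f a b : hsC P f a -> hsC P f b -> a = b.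
intros [h1 h2] [h3 h4]. apply injective_projections; eapply hs_uniq; eauto.
Qed.
Lemma hsC_ext P f g a : (forall x, P x -> f x = g x) -> hsC P f a -> hsC P g a.
intros h [h1 h2]; split; [apply (hs_ext P (fun x => Re (f x)))|apply (hs_ext P (fun x => Im (f x)))]; auto;
 intros x px; rewrite h; auto.
Qed.
Lemma hsC_plus P f g a b : hsC P f a -> hsC P g b -> hsC P (fun x => f x + g x)%C (a + b)%C.
intros [h1 h2] [h3 h4]; split; now apply hs_plus. Qed.
Lemma hsC_scal P c f a : hsC P f a -> hsC P (fun x => c * f x)%C (c * a)%C.
intros [h1 h2]; split; simpl.
- apply (hs_ext P (fun x => Re c * Re (f x) + - (Im c * Im (f x)))); [intros; unfold Re, Im; ring|].
 apply hs_plus; [|apply hs_opp]; now apply hs_scal.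
- apply (hs_ext P (fun x => Re c * Im (f x) + (Im c * Re (f x)))); [intros; unfold Re, Im; ring|].
 apply hs_plus; now apply hs_scal.
Qed.
Lemma hsC_RtoC P (f : T -> R) v : has_sum_on P f v -> hsC P (fun x => RtoC (f x)) (RtoC v).
split; auto. apply hs_zero. Qed.

Lemma Re_le_Cmod (z : C) : Rabs (Re z) <= Cmod z.
eapply Rle_trans; [|apply Rmax_Cmod]. apply Rmax_l. Qed.
Lemma Im_le_Cmod (z : C) : Rabs (Im z) <= Cmod z.
eapply Rle_trans; [|apply Rmax_Cmod]. apply Rmax_r. Qed.

Lemma hsC_dom P f (g : T -> R) w : (forall x, P x -> Cmod (f x) <= g x) -> has_sum_on P g w ->
 exists v, hsC P f v.
intros h hw.
destruct (hs_dom P (fun x => Re (f x)) g w) as [a ha]; auto.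
{ intros x px. eapply Rle_trans; [apply Re_le_Cmod|auto]. }
destruct (hs_dom P (fun x => Im (f x)) g w) as [b hb]; auto.
{ intros x px. eapply Rle_trans; [apply Im_le_Cmod|auto]. }
exists (a, b). split; auto.
Qed.

(** Pair with [Cconj v]: the real part of [Cconj v * v] is the square of [Cmod v], and inequalities
    between real terms can be summed. *)
Lemma hsC_bound P f (g : T -> R) v w : (forall x, P x -> Cmod (f x) <= g x) -> hsC P f v -> has_sum_on P g w ->
 Cmod v <= w.
intros h hv hw.
assert (w0 : 0 <= w).
{ apply (hs_le P (fun _ => 0) g); auto; [|apply hs_zero]. intros x px. eapply Rle_trans; [apply Cmod_ge_0|auto]. }
destruct (Req_dec (Cmod v) 0) as [e|ne]; [lra|].
assert (hc := hsC_scal P (Cconj v) f v hv). destruct hc as [hc _].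
assert (Cmod v * Cmod v <= Cmod v * w).
{ replace (Cmod v * Cmod v) with (Re (Cconj v * v)%C).
 - apply (hs_le P (fun x => Re (Cconj v * f x)%C) (fun x => Cmod v * g x)); auto; [|now apply hs_scal].
  intros x px. eapply Rle_trans; [apply Rle_abs|]. eapply Rle_trans; [apply Re_le_Cmod|].
  rewrite Cmod_mult, Cmod_conj. apply Rmult_le_compat_l; [apply Cmod_ge_0|auto].
 - replace (Cmod v * Cmod v) with (Cmod v ^ 2) by ring. rewrite Cmod2_alt. unfold Re, Im; simpl. ring. }
apply Rmult_le_reg_l with (Cmod v); auto. pose proof (Cmod_ge_0 v). lra.
Qed.

Lemma sumC_Re F f : Re (sumC F f) = sumR F (fun x => Re (f x)).
induction F; simpl; auto. unfold Re in *. now rewrite IHF. Qed.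
Lemma sumC_Im F f : Im (sumC F f) = sumR F (fun x => Im (f x)).
induction F; simpl; auto. unfold Im in *. now rewrite IHF. Qed.
Lemma sumC_ext F f g : (forall x, In x F -> f x = g x) -> sumC F f = sumC F g.
induction F; simpl; intros H; [easy|]. rewrite H, IHF; auto. Qed.
Lemma sumC_plus F f g : sumC F (fun x => f x + g x)%C = (sumC F f + sumC F g)%C.
induction F; simpl; [ring|]. rewrite IHF; ring. Qed.
Lemma sumC_scal F c f : sumC F (fun x => c * f x)%C = (c * sumC F f)%C.
induction F; simpl; [ring|]. rewrite IHF; ring. Qed.
Lemma Cmod_sumC F f : Cmod (sumC F f) <= sumR F (fun x => Cmod (f x)).
induction F; simpl; [rewrite Cmod_0; lra|]. cmod_tri. lra. Qed.
Lemma sumC_RtoC F (f : T -> R) : sumC F (fun x => RtoC (f x)) = RtoC (sumR F f).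
induction F; simpl; [easy|]. now rewrite IHF, RtoC_plus. Qed.

Lemma hsC_net P f v :
 (forall eps, 0 < eps -> exists F0, NoDup F0 /\ List.Forall P F0 /\
   forall F1, NoDup F1 -> List.Forall P F1 -> incl F0 F1 -> Cmod (sumC F1 f - v) < eps) -> hsC P f v.
intros h; split; intros e he; destruct (h e he) as [F [n [p hF]]]; exists F; repeat split; auto;
 intros F1 n1 p1 i1; specialize (hF F1 n1 p1 i1).
- eapply Rle_lt_trans; [|apply hF]. rewrite <- sumC_Re. eapply Rle_trans; [|apply Re_le_Cmod]. right. f_equal.
- eapply Rle_lt_trans; [|apply hF]. rewrite <- sumC_Im. eapply Rle_trans; [|apply Im_le_Cmod]. right. f_equal.
Qed.
End ComplexSums.

(** * Complex derivatives, integer powers and the exponential *)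

Notation C_is_derive := (@is_derive C_AbsRing C_NormedModule).

Definition cder (f : C -> C) (z l : C) := forall eps, 0 < eps -> exists d, 0 < d /\
 forall h, Cmod h < d -> Cmod (f (z + h) - f z - h * l)%C <= eps * Cmod h.

Lemma cder_is_derive f z l : cder f z l -> C_is_derive f z l.
split.
- apply is_linear_scal_l.
- intros x hx. apply (is_filter_lim_locally_unique (K:=C_AbsRing) (V:=AbsRing_NormedModule C_AbsRing)) in hx. subst x.
 intros eps. destruct (H eps (cond_pos eps)) as [d [d0 hd]].
 exists (mkposreal _ d0). intros y hy.
 replace (f y) with (f (z + (y - z))%C) by (f_equal; ring). auto.
Qed.

Lemma C_is_derive_quad (f : C -> C) (z l : C) (M d : R) : 0 < d ->
 (forall h, Cmod h < d -> Cmod (f (z + h) - f z - h * l)%C <= M * (Cmod h * Cmod h)) ->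
 C_is_derive f z l.
intros d0 H. apply cder_is_derive. intros e e0. assert (m0 := Rabs_pos M). assert (m1 := Rle_abs M).
exists (Rmin d (e / (Rabs M + 1))). split; [apply Rmin_glb_lt; auto; apply Rdiv_lt_0_compat; lra|]. intros h hh.
assert (h1 : Cmod h * (Rabs M + 1) < e) by (apply Rlt_div_r; [lra|]; eapply Rlt_le_trans; [exact hh|apply Rmin_r]).
eapply Rle_trans; [apply H; eapply Rlt_le_trans; [exact hh|apply Rmin_l]|]. pose proof (Cmod_ge_0 h). nra.
Qed.

Lemma C_derive_unique (f : C -> C) z l l' : C_is_derive f z l -> C_is_derive f z l' -> l = l'.
intros h1 h2. now rewrite <- (is_C_derive_unique f z l), <- (is_C_derive_unique f z l'). Qed.

Lemma Cmod_Rabs z : Cmod z <= Rabs (Re z) + Rabs (Im z).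
replace z with (RtoC (Re z) + Ci * RtoC (Im z))%C at 1 by (destruct z; unfold Ci, Cmult, Cplus; simpl; f_equal; ring).
cmod_tri. rewrite Cmod_mult, !Cmod_R.
replace (Cmod Ci) with 1; [lra|]. unfold Cmod. simpl. now rewrite Rmult_0_l, Rplus_0_l, !Rmult_1_r, sqrt_1.
Qed.

Lemma C_locally (v : C) e : 0 < e -> locally (T := C_NormedModule) v (fun y => Cmod (y - v)%C < e).
intros e0. apply (locally_le_locally_norm (K := C_AbsRing) (V := C_NormedModule)). exists (mkposreal e e0). now intros y hy. Qed.

Lemma cpart_eq i f x l : C_is_derive (fun z => f (upd x i z)) (x i) l -> cpart i f x = l.
intros h. apply (C_derive_unique (fun z => f (upd x i z)) (x i)); auto.
unfold cpart. apply epsilon_spec. now exists l.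
Qed.

Lemma Cpowz_nat x n : Cpowz x (Z.of_nat n) = Cpow x n.
destruct n; [easy|]. simpl Z.of_nat. now rewrite <- (Nat2Z.id (S n)). Qed.
Lemma Cpowz_neg x n : Cpowz x (- Z.of_nat n) = Cinv (Cpow x n).
destruct n.
- simpl. rewrite <- RtoC_inv, Rinv_1; auto.
- unfold Cpowz. simpl Z.opp. cbv iota beta.
 assert (e : Pos.to_nat (PosDef.Pos.of_succ_nat n) = S n) by apply SuccNat2Pos.id_succ. now rewrite e.
Qed.

Lemma Cpowz_succ x e : x <> RtoC 0 -> Cpowz x (e + 1) = (x * Cpowz x e)%C.
intros nz. destruct (Z_lt_le_dec e 0) as [h|h].
- destruct (Z_of_nat_complete (- e - 1)) as [n hn]; [lia|].
 replace e with (- Z.of_nat (S n))%Z by lia. rewrite Cpowz_neg.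
 replace (- Z.of_nat (S n) + 1)%Z with (- Z.of_nat n)%Z by lia. rewrite Cpowz_neg.
 simpl Cpow. field. split; auto. now apply Cpow_nz.
- destruct (Z_of_nat_complete e) as [n ->]; [lia|].
 replace (Z.of_nat n + 1)%Z with (Z.of_nat (S n)) by lia. rewrite !Cpowz_nat. reflexivity.
Qed.

Lemma Cpowz_0 x : Cpowz x 0 = RtoC 1. reflexivity. Qed.
Lemma Cpowz_1 e : Cpowz (RtoC 1) e = RtoC 1.
assert (h : forall n, Cpow (RtoC 1) n = RtoC 1) by (induction n; simpl; [easy|rewrite IHn; ring]).
destruct (Z_lt_le_dec e 0).
- destruct (Z_of_nat_complete (- e)) as [n hn]; [lia|]. replace e with (- Z.of_nat n)%Z by lia.
 rewrite Cpowz_neg, h. rewrite <- RtoC_inv, Rinv_1; auto.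
- destruct (Z_of_nat_complete e) as [n ->]; [lia|]. rewrite Cpowz_nat; auto.
Qed.

Lemma Z_ind2 (P : Z -> Prop) : P 0%Z -> (forall e, P e <-> P (e + 1)%Z) -> forall e, P e.
apply Z.bi_induction. intros x y ->. tauto. Qed.
Lemma Cpowz_add z p q : z <> RtoC 0 -> Cpowz z (p + q) = (Cpowz z p * Cpowz z q)%C.
intros z0. revert q. apply Z_ind2; [rewrite Z.add_0_r; simpl; ring|]. intros e.
rewrite Z.add_assoc, !Cpowz_succ by auto. split; [intros ->; ring|]. intros h.
apply (f_equal (Cmult (Cinv z))) in h. rewrite Cmult_assoc, Cinv_l, Cmult_1_l in h by auto. rewrite h. field. auto.
Qed.

Definition annul (R1 : R) (x : C) := Cmod x <= R1 /\ / R1 <= Cmod x.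

Lemma annul_nz R1 x : 0 < R1 -> annul R1 x -> x <> RtoC 0.
intros h [_ h2] e. subst. rewrite Cmod_0 in h2. assert (0 < / R1) by now apply Rinv_0_lt_compat. lra.
Qed.

Lemma Cmod_Cpow x n : Cmod (Cpow x n) = Cmod x ^ n.
induction n; simpl; [apply Cmod_1|]. now rewrite Cmod_mult, IHn. Qed.

Lemma Cmod_Cpowz R1 x e : 0 < R1 -> annul R1 x -> Cmod (Cpowz x e) <= R1 ^ Z.abs_nat e.
intros r0 [h1 h2]. destruct (Z_lt_le_dec e 0).
- destruct (Z_of_nat_complete (- e)) as [n hn]; [lia|]. replace e with (- Z.of_nat n)%Z by lia.
 rewrite Cpowz_neg. replace (Z.abs_nat (- Z.of_nat n)) with n by lia.
 rewrite Cmod_inv, Cmod_Cpow.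
 + assert (p : 0 < Cmod x) by (eapply Rlt_le_trans; [apply Rinv_0_lt_compat; apply r0|auto]).
  rewrite <- pow_inv. apply pow_incr. split; [apply Rlt_le, Rinv_0_lt_compat; auto|].
  rewrite <- Rinv_inv. apply Rinv_le_contravar; auto. now apply Rinv_0_lt_compat.
 + apply Cpow_nz. eapply annul_nz; [apply r0|split; auto].
- destruct (Z_of_nat_complete e) as [n ->]; [lia|]. rewrite Cpowz_nat.
 replace (Z.abs_nat (Z.of_nat n)) with n by lia. rewrite Cmod_Cpow.
 apply pow_incr. split; [apply Cmod_ge_0|auto].
Qed.

(** The second-order Taylor remainder of the integer power. *)
Definition quad (z h : C) (e : Z) : C := (Cpowz (z + h) e - Cpowz z e - h * (RtoC (IZR e) * Cpowz z (e - 1)))%C.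

Lemma quad_succ z h e : z <> RtoC 0 -> (z + h)%C <> RtoC 0 ->
 quad z h (e + 1) = ((z + h) * quad z h e + h * h * (RtoC (IZR e) * Cpowz z (e - 1)))%C.
intros n1 n2. unfold quad. rewrite !Cpowz_succ by auto. replace (e + 1 - 1)%Z with e%Z by lia.
replace (Cpowz z e) with (Cpowz z (e - 1 + 1)) by (f_equal; lia).
rewrite Cpowz_succ by auto. rewrite plus_IZR, RtoC_plus. ring.
Qed.

(** Induction in both directions from exponent 0 by [quad_succ], dividing by [z + h] on the way
    down; the annulus bounds both [z + h] and its inverse by [R1]. *)
Lemma quad_bound R1 z h e : 1 <= R1 -> annul R1 z -> annul R1 (z + h)%C ->
 Cmod (quad z h e) <= Cmod h * Cmod h * ((INR (Z.abs_nat e) + 1) ^ 2 * R1 ^ (Z.abs_nat e + 2)).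
intros r1 a1 a2. assert (r0 : 0 < R1) by lra.
assert (n1 := annul_nz _ _ r0 a1). assert (n2 := annul_nz _ _ r0 a2). destruct a2 as [a2 a3].
set (H := Cmod h * Cmod h). assert (hH : 0 <= H) by (unfold H; nra).
assert (pw : forall n, 1 <= R1 ^ n) by (intros; now apply pow_R1_Rle).
assert (T : forall e' n, (Z.abs_nat e' <= S n)%nat -> (Z.abs_nat (e' - 1) <= n + 2)%nat ->
 Cmod (h * h * (RtoC (IZR e') * Cpowz z (e' - 1)))%C <= H * ((INR n + 1) * R1 ^ (n + 2))).
{ intros e' n l1 l2. rewrite !Cmod_mult, Cmod_R. apply Rmult_le_compat_l; auto.
 apply Rmult_le_compat; [apply Rabs_pos|apply Cmod_ge_0| |].
 - rewrite <- abs_IZR, <- S_INR, INR_IZR_INZ. apply IZR_le. lia.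
 - eapply Rle_trans; [apply (Cmod_Cpowz R1); auto|apply Rle_pow; auto]. }
assert (main : forall n, Cmod (quad z h (Z.of_nat n)) <= H * ((INR n + 1) ^ 2 * R1 ^ (n + 2)) /\
 Cmod (quad z h (- Z.of_nat n)) <= H * ((INR n + 1) ^ 2 * R1 ^ (n + 2))).
{ induction n as [|n [I1 I2]].
 - assert (q0 : quad z h 0 = RtoC 0) by (unfold quad; rewrite !Cpowz_0; ring).
  simpl Z.of_nat. simpl Z.opp. rewrite q0, Cmod_0. pose proof (pw (0 + 2)%nat). simpl INR. nra.
 - set (B := (INR n + 1) * R1 ^ (n + 2)) in *. pose proof (pos_INR n). pose proof (pw (n + 2)%nat).
  assert (step : forall v, v <= H * ((INR n + 1) ^ 2 * R1 ^ (n + 2)) -> R1 * (v + H * B) <= H * ((INR (S n) + 1) ^ 2 * R1 ^ (S n + 2))).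
  { intros v hv. rewrite S_INR. simpl Nat.add. simpl (R1 ^ S _). assert (0 <= H * (R1 * R1 ^ (n + 2))) by (apply Rmult_le_pos; nra).
   unfold B. nra. }
  split.
  + eapply Rle_trans; [|apply (step _ I1)]. replace (Z.of_nat (S n)) with (Z.of_nat n + 1)%Z by lia. rewrite quad_succ by auto.
   cmod_tri. rewrite Cmod_mult. assert (t := T (Z.of_nat n) n ltac:(lia) ltac:(lia)). fold B in t.
   pose proof (Cmod_ge_0 (quad z h (Z.of_nat n))). assert (0 <= H * B) by (unfold B; nra). nra.
  + eapply Rle_trans; [|apply (step _ I2)]. assert (q := quad_succ z h (- Z.of_nat (S n)) n1 n2).
   replace (- Z.of_nat (S n) + 1)%Z with (- Z.of_nat n)%Z in q by lia.
   assert (t := T (- Z.of_nat (S n))%Z n ltac:(lia) ltac:(lia)). fold B in t. set (Y := (h * h * _)%C) in *.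
   replace (quad z h (- Z.of_nat (S n))) with (Cinv (z + h) * (quad z h (- Z.of_nat n) + - Y))%C by (rewrite q; field; auto).
   rewrite Cmod_mult, Cmod_inv by auto. apply Rmult_le_compat; try apply Cmod_ge_0; [left; now apply Rinv_0_lt_compat, Cmod_gt_0| |].
   * rewrite <- Rinv_inv. apply Rinv_le_contravar; auto. now apply Rinv_0_lt_compat.
   * cmod_tri. rewrite Cmod_opp. lra. }
destruct (Z_le_gt_dec 0 e) as [he|he].
- replace e with (Z.of_nat (Z.abs_nat e)) at 1 by lia. apply main.
- replace e with (- Z.of_nat (Z.abs_nat e))%Z at 1 by lia. apply main.
Qed.

(** One factor [n + 1] is absorbed by [sqrt q ^ n] through Bernoulli's inequality, the other [k] by
    the induction hypothesis at [sqrt q]. *)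
Lemma poly_exp k q : 1 < q -> exists K, 0 < K /\ forall n, (INR n + 1) ^ k <= K * q ^ n.
revert q; induction k; intros q hq.
- exists 1; split; [lra|]. intros n. assert (1 <= q ^ n) by (apply pow_R1_Rle; lra). lra.
- assert (hs : 1 < sqrt q) by (rewrite <- sqrt_1; apply sqrt_lt_1; lra).
 destruct (IHk _ hs) as [K [K0 hK]].
 set (d := sqrt q - 1) in *. assert (d0 : 0 < d) by (unfold d; lra).
 exists (K * (/ d + 1)). assert (di : 0 < / d) by now apply Rinv_0_lt_compat. split; [nra|].
 intros n.
 assert (b : INR n + 1 <= (/ d + 1) * sqrt q ^ n).
 { assert (h : 1 + INR n * d <= sqrt q ^ n).
  { replace (sqrt q) with (1 + d) by (unfold d; ring). induction n; [simpl; lra|].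
   rewrite S_INR. simpl pow. pose proof (pos_INR n). nra. }
  assert (INR n = / d * (INR n * d)) by (field; lra).
  assert (1 <= sqrt q ^ n) by (apply pow_R1_Rle; lra). pose proof pos_INR. nra. }
 simpl pow. replace (q ^ n) with (sqrt q ^ n * sqrt q ^ n).
 + specialize (hK n). pose proof (pos_INR n). assert (0 <= (INR n + 1) ^ k) by (apply pow_le; lra).
  replace (K * (/ d + 1) * (sqrt q ^ n * sqrt q ^ n)) with (((/ d + 1) * sqrt q ^ n) * (K * sqrt q ^ n)) by ring.
  apply Rmult_le_compat; lra.
 + rewrite <- Rpow_mult_distr, sqrt_sqrt; lra.
Qed.

Lemma C_derive_toA (f : C -> C) (z l : C) : C_is_derive f z l ->
 @is_derive C_AbsRing (AbsRing_NormedModule C_AbsRing) f z l.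
intros [_ h]. split; [apply is_linear_scal_l|auto]. Qed.
Lemma C_derive_ofA (f : C -> C) (z l : C) :
 @is_derive C_AbsRing (AbsRing_NormedModule C_AbsRing) f z l -> C_is_derive f z l.
intros [_ h]. split; [apply is_linear_scal_l|auto]. Qed.

Lemma C_derive_mult f g z l m : C_is_derive f z l -> C_is_derive g z m ->
 C_is_derive (fun x => f x * g x)%C z (l * g z + f z * m)%C.
intros h1 h2. apply C_derive_ofA.
exact (is_derive_mult (K := C_AbsRing) f g z l m (C_derive_toA _ _ _ h1) (C_derive_toA _ _ _ h2) Cmult_comm).
Qed.
Lemma C_derive_plus f g z l m : C_is_derive f z l -> C_is_derive g z m ->
 C_is_derive (fun x => f x + g x)%C z (l + m)%C.
intros h1 h2. exact (is_derive_plus (K := C_AbsRing) (V := C_NormedModule) f g z l m h1 h2). Qed.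
Lemma C_derive_const (c z : C) : C_is_derive (fun _ => c) z (RtoC 0).
exact (is_derive_const (K := C_AbsRing) (V := C_NormedModule) c z). Qed.
Lemma C_derive_comp f g z l m : C_is_derive f (g z) l -> C_is_derive g z m ->
 C_is_derive (fun x => f (g x)) z (m * l)%C.
intros h1 h2. exact (is_derive_comp (K := C_AbsRing) (V := C_NormedModule) f g z l m h1 (C_derive_toA _ _ _ h2)). Qed.

Lemma C_derive_inv z : z <> RtoC 0 -> C_is_derive Cinv z (- (Cinv z * Cinv z))%C.
intros nz. set (m := Cmod z). assert (m0 : 0 < m) by now apply Cmod_gt_0.
apply (C_is_derive_quad _ _ _ (/ (m * m * (m / 2))) (m / 2)); [lra|]. intros h hh.
assert (hz : m / 2 <= Cmod (z + h)%C).
{ assert (t := Cmod_triangle (z + h) (- h)). replace (z + h + - h)%C with z in t by ring. rewrite Cmod_opp in t. fold m in t. lra. }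
assert (n2 : (z + h)%C <> RtoC 0) by (apply Cmod_gt_0; lra).
replace (/ (z + h) - / z - h * - (/ z * / z))%C with (/ (z * z * (z + h)) * (h * h))%C by (field; auto).
rewrite Cmod_mult, Cmod_inv, !Cmod_mult by (repeat apply Cmult_neq_0; auto). fold m.
apply Rmult_le_compat_r; [pose proof Cmod_ge_0; nra|]. assert (0 < m * m) by nra.
apply Rinv_le_contravar; [nra|]. apply Rmult_le_compat_l; lra.
Qed.

Lemma Cexp_plus a b : Cexp (a + b)%C = (Cexp a * Cexp b)%C.
unfold Cexp. destruct a as [a1 a2], b as [b1 b2]. simpl. rewrite exp_plus, cos_plus, sin_plus.
unfold Cmult; simpl. f_equal; ring.
Qed.
Lemma Cexp_0 : Cexp (RtoC 0) = RtoC 1.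
unfold Cexp; simpl. rewrite exp_0, cos_0, sin_0. unfold Cmult, RtoC; simpl. f_equal; ring. Qed.
Lemma Cexp_nz z : Cexp z <> RtoC 0.
intros h. assert (e : (Cexp z * Cexp (- z))%C = RtoC 1).
{ rewrite <- Cexp_plus. replace (z + - z)%C with (RtoC 0) by ring. apply Cexp_0. }
rewrite h in e. injection e. lra.
Qed.

Lemma Cexp_der0 : cder Cexp (RtoC 0) (RtoC 1).
(* The errors are at most nine times [e * m]: 1 from [exp], 3 from the product with the error of
   [cos], 1 from [sin], and 4 from the product of the two increments, where [m <= e] is used. *)
intros eps e0. set (e := Rmin (eps / 9) 1).
assert (ep : 0 < e) by (apply Rmin_glb_lt; lra).
assert (ea : e <= eps / 9) by apply Rmin_l. assert (eb : e <= 1) by apply Rmin_r.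
assert (lin : forall f l, is_derive f 0 l -> locally (0 : R) (fun a => Rabs (f a - f 0 - (a - 0) * l) <= e * Rabs (a - 0))).
{ intros f l [_ h]. exact (h 0 (fun P hP => hP) (mkposreal _ ep)). }
assert (dE := lin exp _ (is_derive_exp 0)). assert (dC := lin cos _ (proj2 (is_derive_Reals _ _ _) (derivable_pt_lim_cos 0))).
assert (dS := lin sin _ (proj2 (is_derive_Reals _ _ _) (derivable_pt_lim_sin 0))).
destruct (filter_and _ _ dE (filter_and _ _ dC dS)) as [d hd].
assert (dp := cond_pos d). exists (Rmin d e). split; [now apply Rmin_glb_lt|]. intros h hh.
assert (m1 := Rmin_l d e). assert (m2 := Rmin_r d e). set (m := Cmod h) in *.
assert (near : forall a, Rabs a <= m -> Rabs (exp a - exp 0 - (a - 0) * exp 0) <= e * Rabs (a - 0) /\ Rabs (cos a - cos 0 - (a - 0) * - sin 0) <= e * Rabs (a - 0) /\ Rabs (sin a - sin 0 - (a - 0) * cos 0) <= e * Rabs (a - 0)).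
{ intros a ha. apply hd. change (Rabs (a - 0) < d). rewrite Rminus_0_r. lra. }
clear dE dC dS hd lin. rewrite exp_0, cos_0, sin_0 in near.
rewrite Cexp_0. destruct h as [a b].
assert (ha : Rabs a <= m) by apply (Re_le_Cmod (a, b)). assert (hb : Rabs b <= m) by apply (Im_le_Cmod (a, b)).
destruct (near a ha) as [h1 _]. destruct (near b hb) as [_ [h2 h3]]. replace (a - 0) with a in h1 by ring. replace (b - 0) with b in h2, h3 by ring.
set (A := exp a - 1 - a * 1) in *. set (B := cos b - 1 - b * - 0) in *. set (S := sin b - 0 - b * 1) in *.
assert (hA : Rabs A <= e * m) by nra. assert (hB : Rabs B <= e * m) by nra. assert (hS : Rabs S <= e * m) by nra.
assert (eX : (Cexp (RtoC 0 + (a, b)) - RtoC 1 - (a, b) * RtoC 1)%C = (A + (1 + (a + A)) * B, S + (a + A) * (b + S))).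
{ unfold A, B, S, RtoC, Cminus, Cmult, Cplus, Copp; simpl. rewrite !Rplus_0_l. f_equal; ring. }
rewrite eX. eapply Rle_trans; [apply Cmod_Rabs|]. simpl.
assert (m0 : 0 <= m) by apply Cmod_ge_0. assert (em : e * m <= m) by nra.
assert (t1 := Rabs_triang a A). assert (t2 := Rabs_triang b S).
assert (t3 := Rabs_triang 1 (a + A)). rewrite Rabs_R1 in t3.
assert (Rabs ((1 + (a + A)) * B) <= 3 * (e * m)). { rewrite Rabs_mult. apply Rmult_le_compat; auto using Rabs_pos. lra. }
assert (Rabs ((a + A) * (b + S)) <= (2 * m) * (2 * m)). { rewrite Rabs_mult. apply Rmult_le_compat; auto using Rabs_pos; lra. }
assert (t4 := Rabs_triang A ((1 + (a + A)) * B)). assert (t5 := Rabs_triang S ((a + A) * (b + S))).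
nra.
Qed.

Lemma Cexp_derive w : C_is_derive Cexp w (Cexp w).
apply cder_is_derive. intros eps e0.
assert (ne := Cexp_nz w). assert (mp := proj1 (Cmod_gt_0 _) ne).
destruct (Cexp_der0 (eps / Cmod (Cexp w))) as [d [d0 hd]]; [now apply Rdiv_lt_0_compat|].
exists d; split; auto. intros h hh. specialize (hd h hh).
rewrite Cexp_0 in hd. replace (RtoC 0 + h)%C with h in hd by ring.
rewrite Cexp_plus. replace (Cexp w * Cexp h - Cexp w - h * Cexp w)%C with (Cexp w * (Cexp h - RtoC 1 - h * RtoC 1))%C by ring.
rewrite Cmod_mult. apply Rmult_le_compat_l with (r := Cmod (Cexp w)) in hd; [|lra].
replace (Cmod (Cexp w) * (eps / Cmod (Cexp w) * Cmod h)) with (eps * Cmod h) in hd by (field; lra). auto.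
Qed.

Lemma upd_same x i : upd x i (x i) = x.
apply functional_extensionality; intro j. unfold upd. destruct (Nat.eqb_spec j i); auto. Qed.

(** * Iterated partial derivatives of functions of several complex variables *)

Fixpoint splitsL {T} (s : list T) : list (list T * list T) :=
 match s with
 | [] => [([], [])]
 | x :: s' => map (fun p => (x :: fst p, snd p)) (splitsL s') ++ map (fun p => (fst p, x :: snd p)) (splitsL s')
 end.

Lemma splitsL_spec {T} (s : list T) p : In p (splitsL s) ->
 (length (fst p) + length (snd p) = length s)%nat /\ incl (fst p) s /\ incl (snd p) s.
revert p; induction s as [|x s IH]; intros p hp.
- destruct hp as [<-|[]]. repeat split; apply incl_nil_l.
- apply in_app_iff in hp. destruct hp as [hp|hp]; apply in_map_iff in hp; destruct hp as [q [<- hq]];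
  destruct (IH q) as [h1 [h2 h3]]; simpl in *; intuition.
Qed.

Section Smooth.
Variables (N : nat) (r : R).
Implicit Types (f g : (nat -> C) -> C) (x : nat -> C).

Lemma upd_ball x i z : ballN N r x -> (i < N)%nat -> Cmod (z - RtoC 1)%C < r -> ballN N r (upd x i z).
intros [h1 h2] hi hz. split; intros j hj; unfold upd; destruct (Nat.eqb_spec j i); auto; lia.
Qed.

Definition sdiff i f x := exists l, C_is_derive (fun z => f (upd x i z)) (x i) l.

Lemma cpart_spec i f x : sdiff i f x -> C_is_derive (fun z => f (upd x i z)) (x i) (cpart i f x).
intros [l h]. rewrite (cpart_eq i f x l); auto. Qed.

Lemma slice_ext i f g x l : (forall y, ballN N r y -> f y = g y) -> ballN N r x -> (i < N)%nat ->
 C_is_derive (fun z => f (upd x i z)) (x i) l -> C_is_derive (fun z => g (upd x i z)) (x i) l.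
intros h hx hi. apply is_derive_ext_loc.
assert (d0 : 0 < r - Cmod (x i - RtoC 1)%C) by (destruct hx as [hx _]; specialize (hx i hi); lra).
exists (mkposreal _ d0). intros z hz. change (Cmod (z - x i)%C < r - Cmod (x i - RtoC 1)%C) in hz.
apply h. apply upd_ball; auto.
replace (z - RtoC 1)%C with ((z - x i) + (x i - RtoC 1))%C by ring.
eapply Rle_lt_trans; [apply Cmod_triangle|]. lra.
Qed.

Lemma cpart_ext i f g : (forall y, ballN N r y -> f y = g y) -> (i < N)%nat ->
 forall x, ballN N r x -> sdiff i f x -> cpart i f x = cpart i g x.
symmetry. apply cpart_eq. apply (slice_ext i f); auto. now apply cpart_spec.
Qed.

(** Existence of all partial derivatives up to order [n] on the ball, phrased through [cpart] so
    that derivatives inherit it with [n] lowered by one. *)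
Fixpoint Dn (n : nat) f : Prop :=
 match n with
 | O => True
 | S n' => forall i, (i < N)%nat -> (forall x, ballN N r x -> sdiff i f x) /\ Dn n' (cpart i f)
 end.

Lemma Dn_ext n f g : (forall y, ballN N r y -> f y = g y) -> Dn n f -> Dn n g.
revert f g; induction n as [|n IH]; intros f g h hf; auto.
intros i hi. destruct (hf i hi) as [h1 h2]. split.
- intros x hx. destruct (h1 x hx) as [l hl]. exists l. apply (slice_ext i f); auto.
- apply (IH (cpart i f)); auto. intros y hy. apply cpart_ext; auto.
Qed.

Lemma Dn_S n f : Dn (S n) f -> Dn n f.
revert f; induction n as [|]; intros f h; [exact I|].
intros i hi. destruct (h i hi) as [h1 h2]. auto.
Qed.
Lemma Dn_le n m f : (n <= m)%nat -> Dn m f -> Dn n f.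
induction 1; auto. intros h. apply IHle. now apply Dn_S. Qed.

Lemma Dn_plus n f g : Dn n f -> Dn n g -> Dn n (fun x => f x + g x)%C.
revert f g; induction n as [|]; intros f g hf hg; auto.
intros i hi. destruct (hf i hi) as [f1 f2]. destruct (hg i hi) as [g1 g2].
assert (dd : forall x, ballN N r x -> C_is_derive (fun z => f (upd x i z) + g (upd x i z))%C (x i) (cpart i f x + cpart i g x)%C).
{ intros x hx. apply C_derive_plus; apply cpart_spec; auto. }
split; [intros x hx; eexists; apply (dd x hx)|].
apply (Dn_ext n (fun x => cpart i f x + cpart i g x)%C); auto. symmetry. apply cpart_eq. auto.
Qed.

Lemma cpart_mult i f g x : sdiff i f x -> sdiff i g x ->
 C_is_derive (fun z => f (upd x i z) * g (upd x i z))%C (x i) (cpart i f x * g x + f x * cpart i g x)%C.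
intros hf hg. assert (h := C_derive_mult _ _ _ _ _ (cpart_spec _ _ _ hf) (cpart_spec _ _ _ hg)).
cbv beta in h. rewrite upd_same in h. exact h.
Qed.

Lemma Dn_mult n f g : Dn n f -> Dn n g -> Dn n (fun x => f x * g x)%C.
revert f g; induction n as [|n IH]; intros f g hf hg; [auto|].
intros i hi. destruct (hf i hi) as [f1 f2]. destruct (hg i hi) as [g1 g2].
split; [eexists; apply cpart_mult; auto|].
apply (Dn_ext n (fun x => cpart i f x * g x + f x * cpart i g x)%C). symmetry. apply cpart_eq. apply cpart_mult; auto.
- apply Dn_plus; apply IH; auto; now apply Dn_S.
Qed.

Lemma Dn_const n c : Dn n (fun _ => c).
revert c; induction n as [|]; intros c; [exact I|]. split; [eexists; apply C_derive_const|].
apply (Dn_ext n (fun _ => RtoC 0)); auto. symmetry. apply cpart_eq. apply C_derive_const.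
Qed.

(** Induction on [n]: in the derivative of [1/f] the function [1/f] occurs only to the order already
    treated. *)
Lemma Dn_inv n f : (forall x, ballN N r x -> f x <> RtoC 0) -> Dn n f -> Dn n (fun x => Cinv (f x)).
intros nz. induction n as [|n IH]; intros hf; [auto|].
assert (hi' := IH (Dn_S _ _ hf)).
intros i hi. destruct (hf i hi) as [f1 f2].
assert (dd : forall x, ballN N r x -> C_is_derive (fun z => Cinv (f (upd x i z))) (x i) (cpart i f x * (- (Cinv (f x) * Cinv (f x))))%C).
{ intros x hx. apply (C_derive_comp Cinv (fun z => f (upd x i z))); [|now apply cpart_spec, f1].
 rewrite upd_same. now apply C_derive_inv, nz. }
split; [intros x hx; eexists; apply (dd x hx)|].
apply (Dn_ext n (fun x => cpart i f x * (RtoC (-1) * (Cinv (f x) * Cinv (f x))))%C).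
- intros y hy. rewrite (cpart_eq _ _ _ _ (dd y hy)). replace (RtoC (-1)) with (- RtoC 1)%C by (rewrite <- RtoC_opp; f_equal). ring.
- apply Dn_mult; auto. apply Dn_mult; [apply Dn_const|]. now apply Dn_mult.
Qed.

Lemma dpart_rcons t j f : dpart (t ++ [j]) f = dpart t (cpart j f).
induction t; simpl; auto. now rewrite IHt. Qed.

Lemma Dn_dpart t k f : List.Forall (fun i => (i < N)%nat) t -> Dn (length t + k) f -> Dn k (dpart t f).
revert f; induction t as [|j t IH] using rev_ind; intros f ht h; auto.
rewrite dpart_rcons. apply Forall_app in ht. destruct ht as [h1 h2]. inversion h2.
apply IH; auto. rewrite length_app in h. simpl in h. replace (length t + 1 + k)%nat with (S (length t + k)) in h by lia.
apply h; auto.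
Qed.

Lemma dpart_ext t f g : List.Forall (fun i => (i < N)%nat) t -> Dn (length t) f ->
 (forall y, ballN N r y -> f y = g y) -> forall x, ballN N r x -> dpart t f x = dpart t g x.
intros ht hd h. induction t as [|lra]; intros x hx; auto.
inversion ht.
assert (hd' : Dn (length t) f) by now apply Dn_S.
apply cpart_ext; auto.
assert (h1 : Dn 1 (dpart t f)) by (apply Dn_dpart; auto; now rewrite Nat.add_1_r).
apply h1; auto.
Qed.

Lemma sdiff_sum i (I : Type) (s : list I) (F : I -> (nat -> C) -> C) x :
 (forall a, In a s -> sdiff i (F a) x) ->
 C_is_derive (fun z => sumC s (fun a => F a (upd x i z))) (x i) (sumC s (fun a => cpart i (F a) x)).
induction s as [|]; simpl; intros h; [apply C_derive_const|].
apply C_derive_plus; [apply cpart_spec; auto|auto].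
Qed.

Lemma sumC_app {I} (s t : list I) (f : I -> C) : sumC (s ++ t) f = (sumC s f + sumC t f)%C.
induction s; simpl; [ring|]. rewrite IHs; ring. Qed.
Lemma sumC_map {I J} (s : list I) (g : I -> J) (f : J -> C) : sumC (map g s) f = sumC s (fun i => f (g i)).
induction s; simpl; auto. now rewrite IHs. Qed.

Theorem dpart_mult t f g : List.Forall (fun i => (i < N)%nat) t -> Dn (length t) f -> Dn (length t) g ->
 forall x, ballN N r x -> dpart t (fun y => f y * g y)%C x =
  sumC (splitsL t) (fun p => dpart (fst p) f x * dpart (snd p) g x)%C.
induction t as [|i t IH]; intros ht hf hg x hx.
- simpl. ring.
- inversion ht.
 assert (IH' := IH H2 (Dn_S _ _ hf) (Dn_S _ _ hg)).
 assert (sd : forall p, In p (splitsL t) -> sdiff i (dpart (fst p) f) x /\ sdiff i (dpart (snd p) g) x).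
 { intros p hp. destruct (splitsL_spec t p hp) as [h1 [h2 h3]].
  rewrite Forall_forall in H2.
  assert (hh : forall u k, incl u t -> (length u <= length t)%nat -> Dn (S (length t)) k -> sdiff i (dpart u k) x).
  { intros u k h4 h5 h6. assert (hk : Dn 1 (dpart u k)); [|apply hk; auto].
   apply Dn_dpart; [apply Forall_forall; auto|]. apply (Dn_le _ (S (length t))); auto; lia. }
  split; apply hh; auto; lia. }
 simpl dpart. cbn [splitsL]. rewrite sumC_app, !sumC_map.   rewrite <- sumC_plus.
 assert (dd : C_is_derive (fun z => sumC (splitsL t) (fun p => dpart (fst p) f (upd x i z) * dpart (snd p) g (upd x i z))%C) (x i)
   (sumC (splitsL t) (fun p => cpart i (fun y => dpart (fst p) f y * dpart (snd p) g y)%C x))).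
 { apply (sdiff_sum i _ (splitsL t) (fun p y => dpart (fst p) f y * dpart (snd p) g y)%C x).
  intros p hp. destruct (sd p hp). eexists. apply cpart_mult; auto. }
 rewrite (cpart_eq i _ x _ (slice_ext i (fun y => sumC (splitsL t) (fun p => dpart (fst p) f y * dpart (snd p) g y)%C) _ x _
   (fun y hy => eq_sym (IH' y hy)) hx H1 dd)).
 apply sumC_ext. intros p hp. destruct (sd p hp). apply cpart_eq. apply cpart_mult; auto.
Qed.

Section Log.
Variables (L F : (nat -> C) -> C).
Hypothesis FL : forall x, ballN N r x -> Cexp (L x) = F x.
Hypothesis L1 : forall i x, (i < N)%nat -> ballN N r x -> sdiff i L x.

Lemma cpart_log i x : (i < N)%nat -> ballN N r x -> (F x * cpart i L x)%C = cpart i F x.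
intros hi hx. symmetry. apply cpart_eq.
apply (slice_ext i (fun y => Cexp (L y))); auto. rewrite Cmult_comm.
apply (C_derive_comp Cexp (fun z => L (upd x i z))); [|now apply cpart_spec, L1].
rewrite upd_same, <- (FL x hx). apply Cexp_derive.
Qed.

Lemma F_nz x : ballN N r x -> F x <> RtoC 0.
intros hx. rewrite <- FL; auto. apply Cexp_nz. Qed.

(** The logarithm is known only through [Cexp L = F] and its first partial derivatives; its higher
    regularity is read off from [d_j L = d_j F / F]. *)
Lemma Dn_cpart_log n j : (j < N)%nat -> Dn (S n) F -> Dn n (cpart j L).
intros hj hF. apply (Dn_ext n (fun x => cpart j F x * Cinv (F x))%C).
- intros y hy. rewrite <- (cpart_log j y hj hy). field. now apply F_nz.
- apply Dn_mult; [apply hF; auto|]. apply Dn_inv; [apply F_nz|]. now apply Dn_S.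
Qed.

(** Leibniz for [F * d_j L = d_j F]. The index [j] is appended on the right because [dpart] applies
    its last index first. *)
Theorem dpart_log t j : List.Forall (fun i => (i < N)%nat) t -> (j < N)%nat -> Dn (S (length t)) F ->
 forall x, ballN N r x ->
 sumC (splitsL t) (fun p => dpart (fst p) F x * dpart (snd p ++ [j]) L x)%C = dpart (t ++ [j]) F x.
intros ht hj hF x hx. rewrite dpart_rcons.
assert (hL := Dn_cpart_log (length t) j hj hF). assert (hF' := Dn_S _ _ hF).
rewrite (sumC_ext _ _ (fun p => dpart (fst p) F x * dpart (snd p) (cpart j L) x)%C) by (intros; now rewrite dpart_rcons).
rewrite <- dpart_mult; auto.
apply dpart_ext; auto; [now apply Dn_mult|]. intros y hy. now apply cpart_log.
Qed.
End Log.
End Smooth.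

(** * Series of Laurent polynomials and termwise differentiation *)

Definition lmon : Type := (R * (nat -> Z))%type.
Definition lval (N : nat) (p : list lmon) (x : nat -> C) : C :=
 sumC p (fun m => RtoC (fst m) * prodC (seq 0 N) (fun j => Cpowz (x j) (snd m j)))%C.
Definition ldiff1 (i : nat) (m : lmon) : lmon :=
 (fst m * IZR (snd m i), fun j => if Nat.eqb j i then (snd m j - 1)%Z else snd m j).
Definition ldiff (i : nat) (p : list lmon) : list lmon := map (ldiff1 i) p.
Fixpoint ldiffs (idx : list nat) (p : list lmon) : list lmon :=
 match idx with [] => p | i :: idx' => ldiff i (ldiffs idx' p) end.
(** A majorant on the product of the annuli [1/R1 <= |x_j| <= R1]. *)
Definition nrm (N : nat) (R1 : R) (p : list lmon) : R :=
 sumR p (fun m => Rabs (fst m) * prodR (seq 0 N) (fun j => R1 ^ Z.abs_nat (snd m j))).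

Lemma prodC_app {I} (s t : list I) (f : I -> C) : prodC (s ++ t) f = (prodC s f * prodC t f)%C.
induction s; simpl; [ring|]. rewrite IHs; ring. Qed.
Lemma prodR_app {I} (s t : list I) (f : I -> R) : prodR (s ++ t) f = prodR s f * prodR t f.
induction s; simpl; [ring|]. rewrite IHs; ring. Qed.
Lemma prodC_ext {I} (s : list I) (f g : I -> C) : (forall x, In x s -> f x = g x) -> prodC s f = prodC s g.
induction s; simpl; intros h; auto. rewrite h, IHs; auto. Qed.
Lemma prodR_le {I} (s : list I) (f g : I -> R) : (forall x, In x s -> 0 <= f x <= g x) -> 0 <= prodR s f <= prodR s g.
induction s; simpl; intros h; [lra|]. destruct IHs as [h1 h2]; [auto|]. destruct (h a (or_introl eq_refl)).
split; [nra|]. apply Rmult_le_compat; auto.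
Qed.
Lemma Cmod_prodC {I} (s : list I) (f : I -> C) : Cmod (prodC s f) = prodR s (fun i => Cmod (f i)).
induction s; simpl; [apply Cmod_1|]. now rewrite Cmod_mult, IHs. Qed.

Lemma seq_pick N i : (i < N)%nat -> exists l, ~ In i l /\ (forall j, In j l -> (j < N)%nat) /\
 (forall g : nat -> C, prodC (seq 0 N) g = (g i * prodC l g)%C) /\
 (forall g : nat -> R, prodR (seq 0 N) g = g i * prodR l g).
intros hi. assert (hin : In i (seq 0 N)) by (apply in_seq; lia).
destruct (in_split i _ hin) as [l1 [l2 e]]. exists (l1 ++ l2).
assert (nd : NoDup (seq 0 N)) by apply seq_NoDup. rewrite e in nd.
repeat split.
- now apply NoDup_remove_2 in nd.
- intros j hj. assert (hj' : In j (seq 0 N)). { rewrite e. apply in_app_iff in hj. apply in_app_iff. simpl. tauto. }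
 apply in_seq in hj'. lia.
- intros g. rewrite e, !prodC_app. simpl. ring.
- intros g. rewrite e, !prodR_app. simpl. ring.
Qed.

Lemma quad_const R1 R2 : 1 <= R1 -> R1 < R2 -> exists K, 0 < K /\
 forall n, (INR n + 1) ^ 2 * R1 ^ (n + 2) <= K * R2 ^ n.
intros r1 r2. assert (hq : 1 < R2 / R1) by (apply Rmult_lt_reg_r with R1; [lra|]; unfold Rdiv; rewrite Rmult_assoc, Rinv_l; lra).
destruct (poly_exp 2 _ hq) as [K [K0 hK]]. exists (K * R1 ^ 2). split; [apply Rmult_lt_0_compat; auto; apply pow_lt; lra|].
intros n. specialize hK.
assert (e : R2 ^ n = (R2 / R1) ^ n * R1 ^ n) by (rewrite <- Rpow_mult_distr; f_equal; field; lra).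
rewrite e, pow_add. assert (0 < R1 ^ n) by (apply pow_lt; lra).
replace (K * R1 ^ 2 * ((R2 / R1) ^ n * R1 ^ n)) with ((K * (R2 / R1) ^ n) * (R1 ^ n * R1 ^ 2)) by ring.
apply Rmult_le_compat_r; [nra|auto].
Qed.

Lemma pow_mono_base a b n : 1 <= a -> a <= b -> 0 <= a ^ n <= b ^ n.
split; [apply pow_le; lra|]. apply pow_incr; lra. Qed.

(** Differentiation multiplies by the exponent and lowers it by one; passing from radius [R1] to
    [R2] absorbs this with one constant [K] for all monomials. *)
Lemma nrm_diff N R1 R2 K i p : (i < N)%nat -> 1 <= R1 -> R1 < R2 ->
 (forall n, (INR n + 1) ^ 2 * R1 ^ (n + 2) <= K * R2 ^ n) ->
 nrm N R1 (ldiff i p) <= K * nrm N R2 p.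
intros hi r1 r2 hK.
destruct (seq_pick N i hi) as [l [nl [hl [_ hpr]]]].
induction p as [|m p IH]; [simpl; lra|]. simpl. rewrite Rmult_plus_distr_l. apply Rplus_le_compat; auto. destruct m as [c e]. simpl. rewrite !hpr, Nat.eqb_refl, Rabs_mult.
set (n := Z.abs_nat (e i)).
assert (e1 : Rabs (IZR (e i)) = INR n).
{ unfold n. rewrite <- abs_IZR, INR_IZR_INZ. f_equal. lia. }
assert (h1 : INR n * R1 ^ Z.abs_nat (e i - 1) <= K * R2 ^ n).
{ eapply Rle_trans; [|auto]. pose proof pos_INR. apply Rmult_le_compat; auto; [apply pow_le; lra|nra|].
 apply Rle_pow; auto. lia. }
assert (h2 : 0 <= prodR l (fun j => R1 ^ Z.abs_nat (if Nat.eqb j i then (e j - 1)%Z else e j)) <= prodR l (fun j => R2 ^ Z.abs_nat (e j))).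
{ apply prodR_le. intros j hj. destruct (Nat.eqb_spec j i); [subst; contradiction|]. apply pow_mono_base; lra. }
rewrite e1. pose proof Rabs_pos. pose proof pos_INR.
replace (Rabs c * INR n * (R1 ^ Z.abs_nat (e i - 1) * prodR l (fun j => R1 ^ Z.abs_nat (if Nat.eqb j i then (e j - 1)%Z else e j))))
 with (Rabs c * ((INR n * R1 ^ Z.abs_nat (e i - 1)) * prodR l (fun j => R1 ^ Z.abs_nat (if Nat.eqb j i then (e j - 1)%Z else e j)))) by ring.
replace (K * (Rabs c * (R2 ^ n * prodR l (fun j => R2 ^ Z.abs_nat (e j)))))
 with (Rabs c * ((K * R2 ^ n) * prodR l (fun j => R2 ^ Z.abs_nat (e j)))) by ring.
apply Rmult_le_compat_l; auto. apply Rmult_le_compat; try apply h2; auto.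
apply Rmult_le_pos; auto. apply pow_le; lra.
Qed.

Lemma lval_quad N R1 R2 K i p x h : (i < N)%nat -> 1 <= R1 -> R1 < R2 ->
 (forall n, (INR n + 1) ^ 2 * R1 ^ (n + 2) <= K * R2 ^ n) ->
 (forall j, (j < N)%nat -> annul R1 (x j)) -> annul R1 (x i + h)%C ->
 Cmod (lval N p (upd x i (x i + h)) - lval N p x - h * lval N (ldiff i p) x)%C <= Cmod h * Cmod h * (K * nrm N R2 p).
intros hi r1 r2 hK ax axh.
destruct (seq_pick N i hi) as [l [nl [hl [hpc hpr]]]].
induction p as [|m p IH].
- simpl. replace (RtoC 0 - RtoC 0 - h * RtoC 0)%C with (RtoC 0) by ring. rewrite Cmod_0. lra.
- simpl. destruct m as [c e]. simpl fst; simpl snd.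
 match type of IH with Cmod (?a - ?b - h * ?d)%C <= _ => set (A := a) in *; set (B := b) in *; set (D := d) in * end.
 rewrite !hpc. set (q1 := prodC l (fun j => Cpowz (x j) (e j))).
 assert (e1 : prodC l (fun j => Cpowz (upd x i (x i + h)%C j) (e j)) = q1).
 { apply prodC_ext. intros j hj. unfold upd. destruct (Nat.eqb_spec j i); [subst; contradiction|auto]. }
 assert (e2 : prodC l (fun j => Cpowz (x j) (if Nat.eqb j i then (e j - 1)%Z else e j)) = q1).
 { apply prodC_ext. intros j hj. destruct (Nat.eqb_spec j i); [subst; contradiction|auto]. }
 rewrite e1, e2. unfold upd at 1. rewrite !Nat.eqb_refl, RtoC_mult.
 match goal with |- Cmod ?X <= _ => replace X with ((RtoC c * q1 * quad (x i) h (e i)) + (A - B - h * D))%C by (unfold quad; ring) end.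
 cmod_tri. rewrite !Rmult_plus_distr_l. apply Rplus_le_compat; auto.
 rewrite !Cmod_mult, Cmod_R.
 assert (hq : Cmod q1 <= prodR l (fun j => R2 ^ Z.abs_nat (e j))).
 { unfold q1. rewrite Cmod_prodC. apply prodR_le. split; [apply Cmod_ge_0|].
  eapply Rle_trans; [apply Cmod_Cpowz; auto; lra|]. apply pow_mono_base; lra. }
 assert (hb := quad_bound R1 (x i) h (e i) r1 (ax i hi) axh). pose proof Rabs_pos.
 set (HH := Cmod h * Cmod h) in *. assert (0 <= HH) by (unfold HH; nra).
 assert (hb2 : Cmod (quad (x i) h (e i)) <= HH * (K * R2 ^ Z.abs_nat (e i))).
 { eapply Rle_trans; [apply hb|]. apply Rmult_le_compat_l; auto. }
 rewrite hpr.
 replace (HH * (K * (Rabs c * (R2 ^ Z.abs_nat (e i) * prodR l (fun j => R2 ^ Z.abs_nat (e j))))))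
  with (Rabs c * prodR l (fun j => R2 ^ Z.abs_nat (e j)) * (HH * (K * R2 ^ Z.abs_nat (e i)))) by ring.
 apply Rmult_le_compat; auto; try apply Cmod_ge_0.
 + apply Rmult_le_pos; auto; apply Cmod_ge_0.
 + apply Rmult_le_compat_l; auto.
Qed.

Lemma lval_bound N R1 p x : 0 < R1 -> (forall j, (j < N)%nat -> annul R1 (x j)) -> Cmod (lval N p x) <= nrm N R1 p.
intros r1 ax. eapply Rle_trans; [apply Cmod_sumC|]. apply sumR_le. intros m _.
rewrite Cmod_mult, Cmod_R, Cmod_prodC. apply Rmult_le_compat_l; [apply Rabs_pos|].
apply prodR_le. intros j hj. apply in_seq in hj. split; [apply Cmod_ge_0|]. apply Cmod_Cpowz; auto. apply ax; lia.
Qed.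

Lemma nrm_ge0 N R1 p : 0 <= R1 -> 0 <= nrm N R1 p.
intros h. apply sumR_ge0. intros m _. apply Rmult_le_pos; [apply Rabs_pos|].
assert (hh := prodR_le (seq 0 N) (fun j => R1 ^ Z.abs_nat (snd m j)) (fun j => R1 ^ Z.abs_nat (snd m j))).
apply hh. split; [now apply pow_le|lra].
Qed.

Section Family.
Context {T : Type} (Pd : T -> Prop) (N : nat) (r R1 : R).
Hypothesis r0 : 0 < r < 1.
Hypothesis R1a : 1 + r <= R1.
Hypothesis R1b : / R1 <= 1 - r.

Definition repr (f : (nat -> C) -> C) (p : T -> list lmon) :=
 forall x, ballN N r x -> hsC Pd (fun t => lval N (p t) x) (f x).
Definition Sm (R2 : R) (p : T -> list lmon) := exists v, has_sum_on Pd (fun t => nrm N R2 (p t)) v.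

Lemma ball_annul x j : ballN N r x -> (j < N)%nat -> annul R1 (x j).
intros [hx _] hj. specialize (hx j hj). split.
- replace (x j) with (RtoC 1 + (x j - RtoC 1))%C by ring. cmod_tri. rewrite Cmod_1. lra.
- assert (1 <= Cmod (x j) + Cmod (x j - RtoC 1)%C); [|lra].
 rewrite <- Cmod_1 at 1. replace (RtoC 1) with (x j + - (x j - RtoC 1))%C at 1 by ring.
 cmod_tri. rewrite Cmod_opp; lra.
Qed.

Lemma Sm_diff R2 R3 i p : (i < N)%nat -> 1 <= R3 -> R3 < R2 -> Sm R2 p -> Sm R3 (fun t => ldiff i (p t)).
intros hi h1 h2 [v hv]. destruct (quad_const R3 R2 h1 h2) as [K [K0 hK]].
apply (hs_dom Pd _ (fun t => K * nrm N R2 (p t)) (K * v)); [|now apply hs_scal].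
intros t _. rewrite Rabs_pos_eq by (apply nrm_ge0; lra). now apply nrm_diff.
Qed.

(** The quadratic remainders are dominated by the summable majorants at radius [R2], so the series
    is differentiated termwise without any Cauchy formula. *)
Lemma repr_diff R2 i f p : (i < N)%nat -> R1 < R2 -> Sm R2 p -> repr f p ->
 (forall x, ballN N r x -> sdiff i f x) /\ repr (cpart i f) (fun t => ldiff i (p t)).
intros hi h2 hS hf.
assert (r1 : 1 <= R1) by lra.
assert (key : forall x, ballN N r x -> exists l, C_is_derive (fun z => f (upd x i z)) (x i) l /\
  hsC Pd (fun t => lval N (ldiff i (p t)) x) l).
{ intros x hx.
 destruct (Sm_diff R2 R1 i p hi r1 h2 hS) as [w hw].
 destruct (hsC_dom Pd (fun t => lval N (ldiff i (p t)) x) (fun t => nrm N R1 (ldiff i (p t))) w) as [l hl]; auto.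
 { intros t _. apply lval_bound; [lra|]. intros; now apply ball_annul. }
 exists l. split; auto.
 destruct (quad_const R1 R2 r1 h2) as [K [K0 hK]]. destruct hS as [v hv].
 assert (d0 : 0 < r - Cmod (x i - RtoC 1)%C) by (destruct hx as [hx _]; specialize (hx i hi); lra).
 apply (C_is_derive_quad _ _ _ (K * v) (r - Cmod (x i - RtoC 1)%C)); auto.
 intros h hh.
 assert (hb : ballN N r (upd x i (x i + h)%C)).
 { apply upd_ball; auto. replace (x i + h - RtoC 1)%C with (h + (x i - RtoC 1))%C by ring.
  eapply Rle_lt_trans; [apply Cmod_triangle|]. lra. }
 rewrite upd_same, Rmult_comm.
 apply (hsC_bound Pd (fun t => lval N (p t) (upd x i (x i + h)) - lval N (p t) x - h * lval N (ldiff i (p t)) x)%C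
  (fun t => Cmod h * Cmod h * (K * nrm N R2 (p t)))).
 - intros t _. apply (lval_quad N R1 R2); auto.
  + intros; now apply ball_annul.
  + assert (a := ball_annul _ i hb). unfold upd in a. rewrite Nat.eqb_refl in a. auto.
 - apply (hsC_ext Pd (fun t => (lval N (p t) (upd x i (x i + h)) + RtoC (-1) * lval N (p t) x) + (- h) * lval N (ldiff i (p t)) x)%C).
  { intros t _. replace (RtoC (-1)) with (- RtoC 1)%C by (rewrite <- RtoC_opp; f_equal). ring. }
  replace (f (upd x i (x i + h)) - f x - h * l)%C with (f (upd x i (x i + h)) + RtoC (-1) * f x + (- h) * l)%C
   by (replace (RtoC (-1)) with (- RtoC 1)%C by (rewrite <- RtoC_opp; f_equal); ring).
  apply hsC_plus; [apply hsC_plus|]; try apply hsC_scal; auto.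
 - apply hs_scal. now apply hs_scal. }
split.
- intros x hx. destruct (key x hx) as [l [hl _]]. now exists l.
- intros x hx. destruct (key x hx) as [l [hl hs]]. now rewrite (cpart_eq i f x l).
Qed.

Lemma repr_Dn n : forall R2 f p, R1 < R2 -> Sm R2 p -> repr f p -> Dn N r n f.
induction n as [|n IH]; intros R2 f p h2 hS hf; [exact I|].
intros i hi. destruct (repr_diff R2 i f p hi h2 hS hf) as [h3 h4]. split; auto.
(* Each derivative spends half of the remaining gap between the radii. *)
apply (IH ((R1 + R2) / 2) _ (fun t => ldiff i (p t))); [lra| |auto].
apply (Sm_diff R2); auto; lra.
Qed.

Lemma repr_dpart R2 f p idx : List.Forall (fun i => (i < N)%nat) idx -> R1 < R2 -> Sm R2 p -> repr f p ->
 repr (dpart idx f) (fun t => ldiffs idx (p t)).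
intros hidx h2 hS hf.
assert (h : repr (dpart idx f) (fun t => ldiffs idx (p t)) /\ exists R3, R1 < R3 /\ Sm R3 (fun t => ldiffs idx (p t))).
{ induction idx as [|i idx IH]; [split; auto; exists R2; auto|].
 inversion hidx. destruct (IH H2) as [h3 [R3 [h4 h5]]]. split.
 - now apply (repr_diff R3).
 - exists ((R1 + R3) / 2). split; [lra|]. apply (Sm_diff R3); auto; lra. }
apply h.
Qed.
End Family.

Lemma lval_ones N p : lval N p ones = RtoC (sumR p fst).
rewrite <- sumC_RtoC. apply sumC_ext. intros m _.
assert (e : prodC (seq 0 N) (fun j => Cpowz (ones j) (snd m j)) = RtoC 1).
{ induction seq; simpl; auto. rewrite IHl. rewrite Cpowz_1. ring. }
rewrite e. ring.
Qed.

(** * The value of a Schur function as a limit *)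

Definition nearF (N : nat) (x : nat -> C) (P : (nat -> C) -> Prop) := exists d, 0 < d /\
 forall y, (forall i, (i < N)%nat -> Cmod (y i - x i)%C < d) -> P y.
Instance nearF_filter N x : Filter (nearF N x).
split.
- exists 1. split; [lra|auto].
- intros P Q [d [d0 hP]] [e [e0 hQ]]. exists (Rmin d e). split; [now apply Rmin_glb_lt|].
 intros y hy. split; [apply hP|apply hQ]; intros i hi; (eapply Rlt_le_trans; [now apply hy|]); [apply Rmin_l|apply Rmin_r].
- intros P Q h [d [d0 hP]]. exists d. auto.
Qed.
Definition ccont N (f : (nat -> C) -> C) x := filterlim f (nearF N x) (locally (T := AbsRing_UniformSpace C_AbsRing) (f x)).

Lemma ccont_const N c x : ccont N (fun _ => c) x.
exact (filterlim_const (U := AbsRing_UniformSpace C_AbsRing) c). Qed.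
Lemma ccont_plus N f g x : ccont N f x -> ccont N g x -> ccont N (fun y => f y + g y)%C x.
intros hf hg. exact (filterlim_comp_2 f g Cplus hf hg (filterlim_plus (V := AbsRing_NormedModule C_AbsRing) (f x) (g x))). Qed.
Lemma ccont_mult N f g x : ccont N f x -> ccont N g x -> ccont N (fun y => f y * g y)%C x.
intros hf hg. exact (filterlim_comp_2 f g Cmult hf hg (filterlim_mult (K := C_AbsRing) (f x) (g x))). Qed.

Lemma ccont_powz N i e x : (i < N)%nat -> x i <> RtoC 0 -> ccont N (fun y => Cpowz (y i) e) x.
intros hi nz.
assert (h : forall n, ccont N (fun y => Cpow (y i) n) x).
{ induction n as [|]; [apply ccont_const|]. apply (ccont_mult N (fun y => y i) (fun y => Cpow (y i) n)); auto.
 intros P [d hd].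
 exists d. split; [apply cond_pos|]. intros y hy. apply hd. now apply hy. }
destruct e as [|p|p]; [apply ccont_const|apply h|].
apply (filterlim_comp _ _ _ (fun y : nat -> C => Cpow (y i) (Pos.to_nat p)) Cinv _ _ _ (h _)).
apply (ex_derive_continuous (K := C_AbsRing) (V := AbsRing_NormedModule C_AbsRing) Cinv).
eexists. apply C_derive_toA, C_derive_inv. now apply Cpow_nz.
Qed.

Lemma lval_cont N p x : (forall i, (i < N)%nat -> x i <> RtoC 0) -> forall e, 0 < e -> exists d, 0 < d /\
 forall y, (forall i, (i < N)%nat -> Cmod (y i - x i)%C < d) -> Cmod (lval N p y - lval N p x)%C < e.
intros nz e e0. assert (h : ccont N (lval N p) x); [|apply (h (fun y => Cmod (y - lval N p x)%C < e)); now exists (mkposreal e e0)]. induction p as [|m p IH]; [apply ccont_const|].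
apply ccont_plus; auto. apply ccont_mult; [apply ccont_const|].
assert (h : forall s, (forall j, In j s -> (j < N)%nat) -> ccont N (fun y => prodC s (fun j => Cpowz (y j) (snd m j))) x).
{ induction s as [|j s IHs]; simpl; intros hs; [apply ccont_const|].
 apply (ccont_mult N (fun y => Cpowz (y j) (snd m j))); [apply ccont_powz; auto|auto]. }
apply h. intros j hj. apply in_seq in hj. lia.
Qed.

Lemma avoid (bad : list R) : exists d, 0 < d /\ forall t, 0 < t < d -> ~ In t bad.
induction bad as [|b bad [d [d0 h]]]; [exists 1; split; [lra|auto]|].
destruct (Rlt_dec 0 b).
- exists (Rmin d b). split; [now apply Rmin_glb_lt|]. intros t ht [->|].
 + pose proof (Rmin_r d t). lra.
 + apply (h t); auto. pose proof (Rmin_l d b). lra.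
- exists d; split; auto. intros t ht [->|]; [lra|]. now apply (h t).
Qed.

(** Move along [x_i + t (i+1)]: a coordinate vanishes or two coordinates meet for finitely many [t]
    only. *)
Lemma generic_points N (x : nat -> C) d : 0 < d -> exists y : nat -> C,
 (forall i, (i < N)%nat -> Cmod (y i - x i)%C < d) /\ (forall i, (i < N)%nat -> y i <> RtoC 0) /\
 (forall i j, (i < j < N)%nat -> y i <> y j).
intros d0.
set (bad := map (fun i => - Re (x i) / INR (S i)) (seq 0 N) ++
 flat_map (fun i => map (fun j => (Re (x i) - Re (x j)) / (INR j - INR i)) (seq 0 N)) (seq 0 N)).
destruct (avoid bad) as [e [e0 he]].
set (t := Rmin e (d / INR (S N)) / 2).
assert (SN : 0 < INR (S N)) by (apply lt_0_INR; lia).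
assert (tp : 0 < Rmin e (d / INR (S N))) by (apply Rmin_glb_lt; auto; now apply Rdiv_lt_0_compat).
assert (ht : 0 < t < e). { unfold t. pose proof (Rmin_l e (d / INR (S N))). lra. }
assert (ht2 : t * INR (S N) < d).
{ assert (t < d / INR (S N)) by (unfold t; pose proof (Rmin_r e (d / INR (S N))); lra).
 apply Rmult_lt_compat_r with (r := INR (S N)) in H; auto.
 replace (d / INR (S N) * INR (S N)) with d in H by (field; lra). auto. }
specialize (he t ht).
exists (fun i => x i + RtoC (t * INR (S i)))%C. repeat split.
- intros i hi. replace (x i + RtoC (t * INR (S i)) - x i)%C with (RtoC (t * INR (S i))) by ring.
 assert (0 < INR (S i)) by (apply lt_0_INR; lia).
 assert (INR (S i) <= INR (S N)) by (apply le_INR; lia).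
 rewrite Cmod_R, Rabs_pos_eq by nra. nra.
- intros i hi e1. apply he. apply in_app_iff. left. apply in_map_iff. exists i. split; [|apply in_seq; lia].
 apply (f_equal Re) in e1. unfold Re in *; cbn [fst RtoC Cplus] in e1.
 assert (0 < INR (S i)) by (apply lt_0_INR; lia).
 apply Rmult_eq_reg_r with (INR (S i)); [|lra]. unfold Rdiv. rewrite Rmult_assoc, Rinv_l; lra.
- intros i j hij e1. apply he. apply in_app_iff. right. apply in_flat_map. exists i. split; [apply in_seq; lia|].
 apply in_map_iff. exists j. split; [|apply in_seq; lia].
 apply (f_equal Re) in e1. unfold Re in *; cbn [fst RtoC Cplus] in e1. rewrite !S_INR in e1.
 assert (INR i < INR j) by (apply lt_INR; lia).
 apply Rmult_eq_reg_r with (INR j - INR i); [|lra]. unfold Rdiv. rewrite Rmult_assoc, Rinv_l; lra.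
Qed.

(** Admissible points lie arbitrarily near [x], so at most one value can be the limit chosen by
    [epsilon]. *)
Lemma schur_eq l x v : (forall e, 0 < e -> exists d, 0 < d /\ forall y,
  (forall i, (i < length l)%nat -> Cmod (y i - x i)%C < d) ->
  (forall i, (i < length l)%nat -> y i <> RtoC 0) ->
  (forall i j, (i < j < length l)%nat -> y i <> y j) -> Cmod (schur_ratio l y - v)%C < e) -> schur l x = v.
intros hv. assert (hs : schur_lim l x (schur l x)) by (unfold schur; apply epsilon_spec; now exists v).
apply NNPP. intro ne.
assert (hp : 0 < Cmod (schur l x - v)%C).
{ apply Cmod_gt_0. intro e. apply ne. replace (schur l x) with ((schur l x - v) + v)%C by ring. rewrite e. ring. }
assert (e2 : 0 < Cmod (schur l x - v)%C / 2) by lra.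
destruct (hv _ e2) as [d1 [p1 h1]]. destruct (hs _ e2) as [d2 [p2 h2]].
destruct (generic_points (length l) x (Rmin d1 d2)) as [y [y1 [y2 y3]]]; [now apply Rmin_glb_lt|].
assert (k1 : Cmod (schur_ratio l y - v)%C < Cmod (schur l x - v)%C / 2).
{ apply h1; auto. intros i hi. eapply Rlt_le_trans; [auto|apply Rmin_l]. }
assert (k2 : Cmod (schur_ratio l y - schur l x)%C < Cmod (schur l x - v)%C / 2).
{ apply h2; auto. intros i hi. eapply Rlt_le_trans; [auto|apply Rmin_r]. }
assert (Cmod (schur l x - v)%C <= Cmod (schur_ratio l y - v)%C + Cmod (schur_ratio l y - schur l x)%C); [|lra].
replace (schur l x - v)%C with ((schur_ratio l y - v) + - (schur_ratio l y - schur l x))%C by ring.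
cmod_tri. rewrite Cmod_opp. lra.
Qed.

Lemma Rabs_inv_sub1 s r : 0 < s < r -> Rabs (/ (1 + s) - 1) < r.
intros h. replace (/ (1 + s) - 1) with (- (s * / (1 + s))) by (field; lra).
assert (0 < / (1 + s) <= 1).
{ split; [apply Rinv_0_lt_compat; lra|]. rewrite <- Rinv_1. apply Rinv_le_contravar; lra. }
rewrite Rabs_Ropp, Rabs_pos_eq; nra.
Qed.

(** Take [R2 = 1 + ln q / (n+1)], so that [R2^n <= exp(n ln q / (n+1)) <= q]. [R1] is the midpoint
    of 1 and [R2], and [r] keeps the disc about 1 inside the annulus of [R1]. *)
Lemma radii n (q rmax : R) : 1 < q -> 0 < rmax -> exists R2 R1 r : R,
 (0 < r < 1 /\ r <= rmax /\ 1 + r <= R1 /\ / R1 <= 1 - r /\ R1 < R2 /\ 1 < R2) /\ R2 ^ n <= q.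
intros hq hr. set (dl := ln q / INR (S n)).
assert (hn : 0 < INR (S n)) by (apply lt_0_INR; lia).
assert (lq : 0 < ln q) by (rewrite <- ln_1; apply ln_increasing; lra).
assert (d0 : 0 < dl) by (apply Rdiv_lt_0_compat; lra).
set (R1 := 1 + dl / 2).
set (r := Rmin rmax (dl / 2 / R1)).
assert (i0 : 0 < / R1 < 1).
{ split; [apply Rinv_0_lt_compat; unfold R1; lra|]. rewrite <- Rinv_1. apply Rinv_lt_contravar; unfold R1; lra. }
assert (e1 : dl / 2 / R1 = 1 - / R1) by (unfold R1; field; lra).
assert (r0 : 0 < r) by (apply Rmin_glb_lt; lra).
assert (ra : r <= rmax) by apply Rmin_l. assert (rb : r <= 1 - / R1) by (rewrite <- e1; apply Rmin_r).
assert (1 - / R1 <= R1 - 1).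
{ assert (R1 * / R1 = 1) by (apply Rinv_r; unfold R1; lra). nra. }
exists (1 + dl), R1, r. repeat split; try (unfold R1 in *; lra).
assert (h : forall m, (1 + dl) ^ m <= exp (INR m * dl)).
{ induction m; [rewrite Rmult_0_l, exp_0; lra|]. rewrite S_INR, Rmult_plus_distr_r, exp_plus, Rmult_1_l. simpl.
 rewrite Rmult_comm. apply Rmult_le_compat; auto; [apply pow_le; lra|lra|]. pose proof (exp_ineq1 dl). lra. }
eapply Rle_trans; [auto|].
replace q with (exp (INR (S n) * dl)) at 1.
- apply Rlt_le, exp_increasing. rewrite S_INR. nra.
- unfold dl. replace (INR (S n) * (ln q / INR (S n))) with (ln q) by (field; lra). apply exp_ln; lra.
Qed.

(** * Invariance of the Wick sum under permutations *)

Section Wick.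
Context {X : Type} (x0 : X).

Fixpoint sel (l : list X) : list (X * list X) :=
 match l with [] => [] | a :: l' => (a, l') :: map (fun p => (fst p, a :: snd p)) (sel l') end.

Lemma sumR_map {A B} (g : A -> B) (s : list A) (f : B -> R) : sumR (map g s) f = sumR s (fun a => f (g a)).
induction s; simpl; auto. now rewrite IHs. Qed.

Lemma sumR_cons {A} (a : A) s (f : A -> R) : sumR (a :: s) f = f a + sumR s f.
reflexivity. Qed.

Lemma sel_length l p : In p (sel l) -> length l = S (length (snd p)).
revert p; induction l as [|a l IH]; simpl; intros p; [easy|]. intros [<-|h]; auto.
apply in_map_iff in h. destruct h as [q [<- hq]]. now rewrite (IH q).
Qed.

Lemma sel_nth l (f : X -> list X -> R) :
 sumR (seq 0 (length l)) (fun j => f (nth j l x0) (remove_nth j l)) = sumR (sel l) (fun p => f (fst p) (snd p)).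
revert f; induction l as [|a l IH]; intros f; auto. simpl. f_equal.
rewrite <- seq_shift, !sumR_map. exact (IH (fun b r => f b (a :: r))).
Qed.

Lemma sel_swap l (f : X -> X -> list X -> R) :
 sumR (sel l) (fun p => sumR (sel (snd p)) (fun q => f (fst p) (fst q) (snd q))) =
 sumR (sel l) (fun p => sumR (sel (snd p)) (fun q => f (fst q) (fst p) (snd q))).
revert f; induction l as [|a l IH]; intros f; simpl; auto.
rewrite !sumR_map. simpl.
rewrite (sumR_ext (sel l) (fun p => f (fst p) a (snd p) + sumR (map (fun p0 => (fst p0, a :: snd p0)) (sel (snd p))) (fun q => f (fst p) (fst q) (snd q)))
 (fun p => f (fst p) a (snd p) + sumR (sel (snd p)) (fun q => f (fst p) (fst q) (a :: snd q)))) by (intros; rewrite sumR_map; reflexivity).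
rewrite (sumR_ext (sel l) (fun p => f a (fst p) (snd p) + sumR (map (fun p0 => (fst p0, a :: snd p0)) (sel (snd p))) (fun q => f (fst q) (fst p) (snd q)))
 (fun p => f a (fst p) (snd p) + sumR (sel (snd p)) (fun q => f (fst q) (fst p) (a :: snd q)))) by (intros; rewrite sumR_map; reflexivity).
rewrite !sumR_plus, (IH (fun b c q => f b c (a :: q))). ring.
Qed.

Lemma sel_perm l l' (f : X -> list X -> R) :
 (forall b r r', (length r < length l)%nat -> Permutation r r' -> f b r = f b r') ->
 Permutation l l' -> sumR (sel l) (fun p => f (fst p) (snd p)) = sumR (sel l') (fun p => f (fst p) (snd p)).
intros hf h. revert f hf. induction h; intros f hf; simpl; auto.
- rewrite !sumR_map. rewrite (hf x l l') by (auto). f_equal.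
 apply (IHh (fun b r => f b (x :: r))). intros; apply hf; simpl; auto; lia.
- rewrite !sumR_map. simpl.
 rewrite (sumR_ext (sel l) (fun x1 => f (fst x1) (y :: x :: snd x1)) (fun x1 => f (fst x1) (x :: y :: snd x1))); [ring|].
 intros p hp. apply sel_length in hp. apply hf; [simpl; lia|apply perm_swap].
- rewrite IHh1; auto. apply IHh2. rewrite <- (Permutation_length h1). auto.
Qed.
End Wick.

Section WickPerm.
Variable cv : nat * nat -> nat * nat -> R.
Hypothesis sym : forall x y, cv x y = cv y x.

Lemma wick_cons x l : wick cv (x :: l) = sumR (sel l) (fun p => cv x (fst p) * wick cv (snd p)).
assert (cons : forall n x l, wick_aux (S n) cv (x :: l) = sumR (sel l) (fun p => cv x (fst p) * wick_aux n cv (snd p))).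
{ intros n y s. apply (sel_nth (0%nat, 0%nat) s (fun b r => cv y b * wick_aux n cv r)). }
assert (fu : forall m k l, (length l <= m)%nat -> (length l <= k)%nat -> wick_aux m cv l = wick_aux k cv l).
{ induction m as [|]; intros [|k] [|y s] h1 h2; simpl length in *; try lia; auto.
 rewrite !cons. apply sumR_ext. intros p hp. apply sel_length in hp. f_equal. apply IHm; lia. }
unfold wick at 1. simpl length. rewrite cons. apply sumR_ext. intros p hp. apply sel_length in hp. f_equal. apply fu; lia.
Qed.

(** For a swap of the two heads: either they are paired together, where the symmetry of [cv] is
    used, or with two other elements, and this double sum is symmetric by [sel_swap]. The induction
    on the length takes care of the shorter lists. *)
Theorem wick_perm l l' : Permutation l l' -> wick cv l = wick cv l'.
enough (H : forall n l l', (length l <= n)%nat -> Permutation l l' -> wick cv l = wick cv l') by now apply (H (length l)).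
clear l l'. induction n as [|n IH]; intros l l' hl h.
- destruct l; [|simpl in hl; lia]. apply Permutation_nil in h. now subst.
- revert hl. induction h; intros hl; auto; simpl in hl.
 + rewrite !wick_cons. apply (sel_perm l l' (fun b r => cv x b * wick cv r)); auto.
  intros b r r' hr hp. f_equal. apply IH; auto; lia.
 + rewrite !wick_cons. cbn [sel]. rewrite !sumR_cons, !sumR_map. cbn [fst snd]. rewrite sym. f_equal.
  transitivity (sumR (sel l) (fun p => sumR (sel (snd p)) (fun q => cv y (fst p) * cv x (fst q) * wick cv (snd q)))).
  { apply sumR_ext. intros p _. rewrite wick_cons, <- sumR_scal. apply sumR_ext; intros; ring. }
  rewrite (sel_swap l (fun b c q => cv y b * cv x c * wick cv q)).
  apply sumR_ext. intros p _. rewrite wick_cons, <- sumR_scal. apply sumR_ext; intros; ring.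
 + rewrite IHh1; auto. apply IHh2. now rewrite <- (Permutation_length h1).
Qed.
End WickPerm.

(** * Circle integrals and iterated circle integrals *)

Definition cpt (r t : R) : C := (RtoC r * (cos t, sin t))%C.
(** Stated with [is_RInt], so that integrability is part of the claim; the total function
    [circle_int] would hide it. *)
Definition cint (r : R) (g : C -> C) (v : C) : Prop :=
 is_RInt (fun t => Re (g (cpt r t) * (Ci * cpt r t))%C) 0 (2 * PI) (Re v) /\
 is_RInt (fun t => Im (g (cpt r t) * (Ci * cpt r t))%C) 0 (2 * PI) (Im v).

Lemma Cmod_cpt r t : 0 <= r -> Cmod (cpt r t) = r.
intros h. unfold cpt. rewrite Cmod_mult, Cmod_R, Rabs_pos_eq by auto.
assert (e : Cmod (cos t, sin t) = 1).
{ unfold Cmod. change (fst (cos t, sin t)) with (cos t). change (snd (cos t, sin t)) with (sin t).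
 replace (cos t ^ 2 + sin t ^ 2) with 1; [apply sqrt_1|]. generalize (sin2_cos2 t); unfold Rsqr; lra. }
rewrite e; ring.
Qed.

Lemma rint_ext f g a b u v : is_RInt f a b u -> (forall t : R, f t = g t :> R) -> u = v -> is_RInt g a b v.
intros h e <-. eapply is_RInt_ext; [|exact h]. intros; apply e. Qed.
Lemma rint_lin f g a b u v x y : is_RInt f a b u -> is_RInt g a b v ->
 is_RInt (fun t => x * f t + y * g t) a b (x * u + y * v).
intros h1 h2. exact (is_RInt_plus _ _ _ _ _ _ (is_RInt_scal _ _ _ x _ h1) (is_RInt_scal _ _ _ y _ h2)). Qed.

Lemma cint_eq r g v : cint r g v -> circle_int r g = v.
intros [h1 h2]. unfold circle_int, CRInt. unfold cpt in h1, h2.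
rewrite (is_RInt_unique _ _ _ _ h1), (is_RInt_unique _ _ _ _ h2).
destruct v; unfold RtoC, Ci, Cplus; simpl. f_equal; ring.
Qed.

Lemma cint_ext r g h v : 0 <= r -> (forall z, Cmod z = r -> g z = h z) -> cint r g v -> cint r h v.
intros hr e [h1 h2].
split; [apply (rint_ext _ _ _ _ _ _ h1)|apply (rint_ext _ _ _ _ _ _ h2)]; auto; intros t; now rewrite e by now apply Cmod_cpt.
Qed.

Lemma cint_plus r g h v w : cint r g v -> cint r h w -> cint r (fun z => g z + h z)%C (v + w)%C.
intros [h1 h2] [h3 h4]. split.
- apply (rint_ext _ _ _ _ _ _ (rint_lin _ _ _ _ _ _ 1 1 h1 h3)); intros; unfold Re; simpl; ring.
- apply (rint_ext _ _ _ _ _ _ (rint_lin _ _ _ _ _ _ 1 1 h2 h4)); intros; unfold Im; simpl; ring.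
Qed.

Lemma cint_scal r c g v : cint r g v -> cint r (fun z => c * g z)%C (c * v)%C.
intros [h1 h2]. split.
- apply (rint_ext _ _ _ _ _ _ (rint_lin _ _ _ _ _ _ (Re c) (- Im c) h1 h2)); intros; unfold Re, Im; simpl; ring.
- apply (rint_ext _ _ _ _ _ _ (rint_lin _ _ _ _ _ _ (Im c) (Re c) h1 h2)); intros; unfold Re, Im; simpl; ring.
Qed.

Lemma cos_sin_int (p : Z) : cos (IZR p * (2 * PI)) = 1 /\ sin (IZR p * (2 * PI)) = 0.
revert p. apply Z_ind2; [rewrite Rmult_0_l, cos_0, sin_0; lra|]. intros e.
rewrite plus_IZR, Rmult_plus_distr_r, Rmult_1_l, cos_plus, sin_plus, cos_2PI, sin_2PI.
lra.
Qed.

Lemma trig_int (p : Z) :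
 is_RInt (fun t => cos (IZR p * t)) 0 (2 * PI) (if Z.eq_dec p 0 then 2 * PI else 0) /\
 is_RInt (fun t => sin (IZR p * t)) 0 (2 * PI) 0.
destruct Z.eq_dec as [->|hp].
- split.
 + apply (rint_ext _ _ _ _ _ _ (is_RInt_const 0 (2 * PI) (1 : R))).
  * intros t. rewrite Rmult_0_l. now rewrite cos_0.
  * unfold scal; simpl; unfold mult; simpl. ring.
 + apply (rint_ext _ _ _ _ _ _ (is_RInt_const 0 (2 * PI) (0 : R))).
  * intros t. rewrite Rmult_0_l. now rewrite sin_0.
  * unfold scal; simpl; unfold mult; simpl. ring.
- assert (np : IZR p <> 0) by (now apply not_0_IZR).
 destruct (cos_sin_int p) as [hc hs]. split.
 + apply (rint_ext (fun t => cos (IZR p * t)) _ _ _ (minus (sin (IZR p * (2 * PI)) / IZR p) (sin (IZR p * 0) / IZR p))); auto.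
  * apply (is_RInt_derive (fun t => sin (IZR p * t) / IZR p)).
   -- intros x _. auto_derive; auto. field; auto.
   -- intros x _. apply (ex_derive_continuous (fun t => cos (IZR p * t))). auto_derive; auto.
  * rewrite hs, Rmult_0_r, sin_0. unfold minus, plus, opp; simpl. field; auto.
 + apply (rint_ext (fun t => sin (IZR p * t)) _ _ _ (minus (- cos (IZR p * (2 * PI)) / IZR p) (- cos (IZR p * 0) / IZR p))); auto.
  * apply (is_RInt_derive (fun t => - cos (IZR p * t) / IZR p)).
   -- intros x _. auto_derive; auto. field; auto.
   -- intros x _. apply (ex_derive_continuous (fun t => sin (IZR p * t))). auto_derive; auto.
  * rewrite hc, Rmult_0_r, cos_0. unfold minus, plus, opp; simpl. field; auto.
Qed.

Lemma cpt_powz r t p : 0 < r -> Cpowz (cpt r t) p = (RtoC (powerRZ r p) * (cos (IZR p * t), sin (IZR p * t)))%C.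
intros r0. assert (nz : cpt r t <> RtoC 0) by (apply Cmod_gt_0; rewrite Cmod_cpt; lra).
revert p. apply Z_ind2; [simpl; rewrite Rmult_0_l, cos_0, sin_0; unfold RtoC, Cmult; simpl; f_equal; ring|]. intros e.
rewrite Cpowz_succ by auto.
replace (RtoC (powerRZ r (e + 1)) * (cos (IZR (e + 1) * t), sin (IZR (e + 1) * t)))%C with
 (cpt r t * (RtoC (powerRZ r e) * (cos (IZR e * t), sin (IZR e * t))))%C.
- split; [now intros ->|]. intros h. apply (f_equal (Cmult (Cinv (cpt r t)))) in h.
 rewrite !Cmult_assoc, Cinv_l, !Cmult_1_l in h; auto.
- rewrite powerRZ_add by lra. rewrite plus_IZR, Rmult_plus_distr_r, Rmult_1_l, cos_plus, sin_plus.
 unfold RtoC, Cmult; simpl. f_equal; ring.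
Qed.

Lemma cint_powz r p : 0 < r ->
 cint r (fun z => Cpowz z p) (if Z.eq_dec p (-1) then RtoC (2 * PI) * Ci else RtoC 0)%C.
intros r0. destruct (trig_int (p + 1)) as [hc hs].
assert (e : forall t, (Cpowz (cpt r t) p * (Ci * cpt r t))%C =
  (RtoC (powerRZ r (p + 1)) * (Ropp (sin (IZR (p + 1) * t)), cos (IZR (p + 1) * t)))%C).
{ intros t. rewrite cpt_powz by auto.
 rewrite powerRZ_add by lra. rewrite plus_IZR, Rmult_plus_distr_r, Rmult_1_l, cos_plus, sin_plus.
 unfold RtoC, Ci, Cmult; simpl. f_equal; ring. }
split.
- apply (rint_ext _ _ _ _ _ _ (rint_lin _ _ _ _ _ _ (- powerRZ r (p + 1)) 0 hs hs)).
 + intros t. rewrite e. simpl. ring.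
 + destruct (Z.eq_dec p (-1)); simpl; ring.
- apply (rint_ext _ _ _ _ _ _ (rint_lin _ _ _ _ _ _ (powerRZ r (p + 1)) 0 hc hs)).
 + intros t. rewrite e. simpl. ring.
 + destruct (Z.eq_dec p (-1)) as [->|]; destruct Z.eq_dec; try lia; simpl; ring.
Qed.

Lemma cint_zero r : cint r (fun _ => RtoC 0) (RtoC 0).
split; (eapply rint_ext; [exact (is_RInt_const 0 (2 * PI) (0 : R))| |]); intros; unfold Re, Im, RtoC, Cmult, scal; simpl;
 unfold mult; simpl; ring.
Qed.

Lemma Cmod_Ci : Cmod Ci = 1.
unfold Cmod, Ci. cbn [fst snd]. replace (0 ^ 2 + 1 ^ 2) with 1 by ring. apply sqrt_1. Qed.

(** The constant is twice the sharp one, because real and imaginary parts are estimated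
    separately. *)
Lemma cint_bound r g v B : 0 <= r -> (forall z, Cmod z = r -> Cmod (g z) <= B) -> cint r g v -> Cmod v <= 4 * PI * r * B.
intros hr hB [h1 h2]. assert (P := PI_RGT_0).
assert (b : forall t, Cmod (g (cpt r t) * (Ci * cpt r t))%C <= B * r).
{ intros t. rewrite !Cmod_mult, Cmod_cpt by auto. rewrite Cmod_Ci.
 rewrite Rmult_1_l. apply Rmult_le_compat_r; auto. apply hB. now apply Cmod_cpt. }
assert (k : forall f u, (forall t, Rabs (f t) <= B * r) -> is_RInt f 0 (2 * PI) u -> Rabs u <= 2 * PI * (B * r)).
{ intros f u hf hu. assert (h := norm_RInt_le f (fun _ => B * r) 0 (2 * PI) u (scal (2 * PI - 0) (B * r)) ltac:(lra) (fun x _ => hf x) hu (is_RInt_const _ _ _)).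
 unfold scal in h; simpl in h; unfold mult in h. unfold norm in h; simpl in h. unfold abs in h; simpl in h. lra. }
assert (k1 := k _ _ (fun t => Rle_trans _ _ _ (Re_le_Cmod _) (b t)) h1).
assert (k2 := k _ _ (fun t => Rle_trans _ _ _ (Im_le_Cmod _) (b t)) h2).
assert (k3 := Cmod_Rabs v). lra.
Qed.

Lemma RInt_lim (f : nat -> R -> R) g a b h : (forall M, is_RInt (f M) a b (h M)) ->
 (forall e, 0 < e -> exists N, forall M, (N <= M)%nat -> forall t, Rabs (f M t - g t) < e) ->
 exists I, is_RInt g a b I.
intros hf hu.
destruct (filterlim_RInt (V := R_CompleteNormedModule) f a b eventually _ g h hf) as [I [_ hI]]; [|now exists I].
intros P [e he]. destruct (hu e (cond_pos e)) as [N hN]. exists N. intros M hM. apply he. intros t. apply hN; auto.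
Qed.

Lemma cint_lim r (f : nat -> C -> C) g v : 0 <= r -> (forall M, cint r (f M) (v M)) ->
 (forall e, 0 < e -> exists N, forall M, (N <= M)%nat -> forall z, Cmod z = r -> Cmod (f M z - g z)%C < e) ->
 exists I, cint r g I.
intros hr hf hu.
assert (k : forall e, 0 < e -> exists N, forall M, (N <= M)%nat -> forall t,
  Cmod (f M (cpt r t) * (Ci * cpt r t) - g (cpt r t) * (Ci * cpt r t))%C < e).
{ intros e e0. destruct (hu (e / (r + 1))) as [N hN]; [apply Rdiv_lt_0_compat; lra|]. exists N. intros M hM t.
 replace (f M (cpt r t) * (Ci * cpt r t) - g (cpt r t) * (Ci * cpt r t))%C with ((f M (cpt r t) - g (cpt r t)) * (Ci * cpt r t))%C by ring.
 rewrite !Cmod_mult, Cmod_cpt by auto. rewrite Cmod_Ci.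
 specialize (hN M hM (cpt r t) (Cmod_cpt r t hr)). set (q := Cmod _) in *.
 assert (q * (r + 1) < e). { apply (Rmult_lt_compat_r (r + 1)) in hN; [|lra]. unfold Rdiv in hN. rewrite Rmult_assoc, Rinv_l in hN; lra. }
 assert (0 <= q) by apply Cmod_ge_0. nra. }
destruct (RInt_lim (fun M t => Re (f M (cpt r t) * (Ci * cpt r t))%C) (fun t => Re (g (cpt r t) * (Ci * cpt r t))%C) _ _ _ (fun M => proj1 (hf M))) as [I1 h1].
{ intros e e0. destruct (k e e0) as [N hN]. exists N. intros M hM t. eapply Rle_lt_trans; [|apply (hN M hM t)]. eapply Rle_trans; [|apply Re_le_Cmod]. right. f_equal. }
destruct (RInt_lim (fun M t => Im (f M (cpt r t) * (Ci * cpt r t))%C) (fun t => Im (g (cpt r t) * (Ci * cpt r t))%C) _ _ _ (fun M => proj2 (hf M))) as [I2 h2].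
{ intros e e0. destruct (k e e0) as [N hN]. exists N. intros M hM t. eapply Rle_lt_trans; [|apply (hN M hM t)].
 eapply Rle_trans; [|apply Im_le_Cmod]. right. f_equal. }
exists (I1, I2). split; assumption.
Qed.

Definition dcint (e1 e2 : R) (h : C -> C -> C) (v : C) : Prop :=
 exists I : C -> C, (forall z, Cmod z = e1 -> cint e2 (h z) (I z)) /\ cint e1 I v.

Lemma dcint_eq e1 e2 h v : 0 <= e1 -> dcint e1 e2 h v -> circle_int e1 (fun z => circle_int e2 (h z)) = v.
intros h1 [I [hI hv]]. apply cint_eq. apply (cint_ext e1 I); auto. symmetry. now apply cint_eq, hI.
Qed.

Lemma dcint_ext e1 e2 g h v : 0 <= e1 -> 0 <= e2 -> (forall z w, Cmod z = e1 -> Cmod w = e2 -> g z w = h z w) ->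
 dcint e1 e2 g v -> dcint e1 e2 h v.
intros h1 h2 e [I [hI hv]]. exists I. split; auto. intros z hz. apply (cint_ext e2 (g z)); auto.
Qed.

Lemma dcint_plus e1 e2 g h v w : dcint e1 e2 g v -> dcint e1 e2 h w -> dcint e1 e2 (fun z w => g z w + h z w)%C (v + w)%C.
intros [I [h1 h2]] [J [h3 h4]]. exists (fun z => I z + J z)%C. split; [|now apply cint_plus].
intros z hz. apply cint_plus; auto.
Qed.

Lemma dcint_zero e1 e2 : dcint e1 e2 (fun _ _ => RtoC 0) (RtoC 0).
exists (fun _ => RtoC 0). split; intros; apply cint_zero. Qed.

Lemma dcint_mono e1 e2 c p q : 0 < e1 -> 0 < e2 ->
 dcint e1 e2 (fun z w => c * (Cpowz z p * Cpowz w q))%C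
  (if Z.eq_dec p (-1) then if Z.eq_dec q (-1) then c * Cpow (RtoC 2 * RtoC PI * Ci) 2 else RtoC 0 else RtoC 0)%C.
intros h1 h2.
exists (fun z => (c * (if Z.eq_dec q (-1) then RtoC (2 * PI) * Ci else RtoC 0)) * Cpowz z p)%C. split.
- intros z hz. apply (cint_ext e2 (fun w => (c * Cpowz z p) * Cpowz w q)%C); [lra|intros; ring|].
 replace (c * (if Z.eq_dec q (-1) then RtoC (2 * PI) * Ci else RtoC 0) * Cpowz z p)%C with
  ((c * Cpowz z p) * (if Z.eq_dec q (-1) then RtoC (2 * PI) * Ci else RtoC 0))%C by ring.
 apply cint_scal. now apply cint_powz.
- assert (h := cint_scal e1 (c * (if Z.eq_dec q (-1) then RtoC (2 * PI) * Ci else RtoC 0))%C _ _ (cint_powz e1 p h1)).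
 match goal with |- cint _ _ ?v => match type of h with cint _ _ ?w => replace v with w; auto end end.
 destruct Z.eq_dec, Z.eq_dec; rewrite ?RtoC_mult; ring.
Qed.

Definition unif (e1 e2 : R) (u : nat -> C -> C -> C) (g : C -> C -> C) : Prop :=
 forall e, 0 < e -> exists N, forall M, (N <= M)%nat -> forall z w, Cmod z = e1 -> Cmod w = e2 -> Cmod (u M z w - g z w)%C < e.
Definition bnd (e1 e2 : R) (g : C -> C -> C) : Prop :=
 exists B, forall z w, Cmod z = e1 -> Cmod w = e2 -> Cmod (g z w) <= B.

(** The inner integrals converge uniformly in [z], so their limit is integrable over the outer
    circle; the outer values are all [V], hence so is the limit. *)
Theorem dcint_lim e1 e2 u g (V : C) : 0 <= e1 -> 0 <= e2 -> (exists M0, forall M, (M0 <= M)%nat -> dcint e1 e2 (u M) V) ->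
 unif e1 e2 u g -> dcint e1 e2 g V.
intros h1 h2 [M0 hd] hu.
set (u' := fun M => u (M + M0)%nat).
assert (hd' : forall M, dcint e1 e2 (u' M) V) by (intros M; apply hd; lia).
set (I := fun M => epsilon (inhabits (fun _ : C => RtoC 0)) (fun I => (forall z, Cmod z = e1 -> cint e2 (u' M z) (I z)) /\ cint e1 I V)).
assert (hI : forall M, (forall z, Cmod z = e1 -> cint e2 (u' M z) (I M z)) /\ cint e1 (I M) V).
{ intros M. apply epsilon_spec. apply hd'. }
assert (hu' : unif e1 e2 u' g).
{ intros e e0. destruct (hu e e0) as [N hN]. exists N. intros M hM. apply hN. lia. }
set (J := fun z => circle_int e2 (g z)).
assert (hJ : forall z, Cmod z = e1 -> cint e2 (g z) (J z)).
{ intros z hz. destruct (cint_lim e2 (fun M => u' M z) (g z) (fun M => I M z) h2) as [j hj].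
 - intros M. now apply hI.
 - intros e e0. destruct (hu' e e0) as [N hN]. exists N. intros M hM w hw. now apply hN.
 - unfold J. now rewrite (cint_eq e2 (g z) j). }
assert (dI : forall e, 0 < e -> exists N, forall M, (N <= M)%nat -> forall z, Cmod z = e1 -> Cmod (I M z - J z)%C < e).
{ intros e e0. assert (P := PI_RGT_0).
 assert (c0 : 0 < 4 * PI * e2 + 1) by nra.
 destruct (hu' (e / (4 * PI * e2 + 1))) as [N hN]; [now apply Rdiv_lt_0_compat|]. exists N. intros M hM z hz.
 set (B := e / (4 * PI * e2 + 1)) in *.
 assert (hc : cint e2 (fun w => u' M z w + RtoC (-1) * g z w)%C (I M z + RtoC (-1) * J z)%C).
 { apply cint_plus; [now apply hI|]. apply cint_scal. now apply hJ. }
 replace (I M z - J z)%C with (I M z + RtoC (-1) * J z)%C by ring.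
 assert (hb := cint_bound e2 (fun w => u' M z w + RtoC (-1) * g z w)%C (I M z + RtoC (-1) * J z)%C B h2).
 eapply Rle_lt_trans; [apply hb; [|auto]|].
 - intros w hw. replace (u' M z w + RtoC (-1) * g z w)%C with (u' M z w - g z w)%C by ring. left. now apply hN.
 - assert (B * (4 * PI * e2 + 1) = e) by (unfold B; field; lra). nra. }
destruct (cint_lim e1 I J (fun _ => V) h1 (fun M => proj2 (hI M)) dI) as [v hv].
assert (ev : v = V).
{ assert (hs : forall e, 0 < e -> Cmod (V - v)%C <= 4 * PI * e1 * e).
 { intros e e0. destruct (dI e e0) as [N hN].
  assert (hc : cint e1 (fun z => I N z + RtoC (-1) * J z)%C (V + RtoC (-1) * v)%C).
  { apply cint_plus; [now apply hI|]. now apply cint_scal. }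
  replace (V - v)%C with (V + RtoC (-1) * v)%C by ring.
  apply (cint_bound e1 (fun z => I N z + RtoC (-1) * J z)%C _ e h1); auto.
  intros z hz. replace (I N z + RtoC (-1) * J z)%C with (I N z - J z)%C by ring. left. auto. }
 assert (P := PI_RGT_0). assert (q0 := Cmod_ge_0 (V - v)%C).
 destruct (Req_dec (Cmod (V - v)%C) 0) as [h|h].
 - apply Cmod_eq_0 in h. replace v with (V - (V - v))%C by ring. rewrite h. ring.
 - assert (p1 : 0 < 4 * PI * e1 + 1) by nra.
  assert (h3 := hs (Cmod (V - v)%C / (2 * (4 * PI * e1 + 1)))). set (q := Cmod (V - v)%C) in *. specialize h3.
  set (x := q / (2 * (4 * PI * e1 + 1))) in *. assert (x * (2 * (4 * PI * e1 + 1)) = q) by (unfold x; field; lra). nra. }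
subst v. exists J. auto.
Qed.

Lemma unif_const e1 e2 g : unif e1 e2 (fun _ => g) g.
exists 0%nat. intros M _ z w _ _. replace (g z w - g z w)%C with (RtoC 0) by ring. now rewrite Cmod_0. Qed.

Lemma unif_plus e1 e2 u v g h : unif e1 e2 u g -> unif e1 e2 v h -> unif e1 e2 (fun M z w => u M z w + v M z w)%C (fun z w => g z w + h z w)%C.
intros h1 h2 e e0. destruct (h1 (e / 2)) as [N1 k1]; [lra|]. destruct (h2 (e / 2)) as [N2 k2]; [lra|].
exists (N1 + N2)%nat. intros M hM z w hz hw.
replace (u M z w + v M z w - (g z w + h z w))%C with ((u M z w - g z w) + (v M z w - h z w))%C by ring.
eapply Rle_lt_trans; [apply Cmod_triangle|]. specialize (k1 M ltac:(lia) z w hz hw). specialize (k2 M ltac:(lia) z w hz hw). lra.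
Qed.

Lemma unif_mult e1 e2 u v g h : bnd e1 e2 g -> bnd e1 e2 h -> unif e1 e2 u g -> unif e1 e2 v h ->
 unif e1 e2 (fun M z w => u M z w * v M z w)%C (fun z w => g z w * h z w)%C.
intros [B1 b1] [B2 b2] h1 h2 e e0.
set (A := Rabs B1 + Rabs B2 + 1). assert (pa := Rabs_pos B1). assert (pb := Rabs_pos B2).
assert (ea : B1 <= Rabs B1) by apply Rle_abs. assert (eb : B2 <= Rabs B2) by apply Rle_abs.
set (d := Rmin 1 (e / (2 * A))). assert (A1 : 1 <= A) by (unfold A; lra).
assert (d0 : 0 < d) by (apply Rmin_glb_lt; [lra|apply Rdiv_lt_0_compat; lra]).
assert (d1 : d <= 1) by apply Rmin_l. assert (d2 : d <= e / (2 * A)) by apply Rmin_r.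
destruct (h1 d d0) as [N1 k1]. destruct (h2 d d0) as [N2 k2].
exists (N1 + N2)%nat. intros M hM z w hz hw.
specialize (k1 M ltac:(lia) z w hz hw). specialize (k2 M ltac:(lia) z w hz hw). specialize (b1 z w hz). specialize (b2 z w hz).
replace (u M z w * v M z w - g z w * h z w)%C with ((u M z w - g z w) * (v M z w - h z w) + (g z w * (v M z w - h z w) + (u M z w - g z w) * h z w))%C by ring.
set (x := (u M z w - g z w)%C) in *. set (y := (v M z w - h z w)%C) in *.
assert (t := Cmod_triangle (x * y) (g z w * y + x * h z w)). assert (t' := Cmod_triangle (g z w * y) (x * h z w)).
rewrite !Cmod_mult in *. assert (x0 := Cmod_ge_0 x). assert (y0 := Cmod_ge_0 y).
assert (dA : d * A <= e / 2). { replace (e / 2) with (e / (2 * A) * A) by (field; lra). apply Rmult_le_compat_r; lra. }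
assert (Cmod x * Cmod y <= d * 1) by (apply Rmult_le_compat; lra).
unfold A in dA. nra.
Qed.

Lemma bnd_mult e1 e2 g h : bnd e1 e2 g -> bnd e1 e2 h -> bnd e1 e2 (fun z w => g z w * h z w)%C.
intros [B1 b1] [B2 b2]. exists (B1 * B2). intros z w hz hw. rewrite Cmod_mult.
apply Rmult_le_compat; auto; apply Cmod_ge_0.
Qed.
Lemma bnd_plus e1 e2 g h : bnd e1 e2 g -> bnd e1 e2 h -> bnd e1 e2 (fun z w => g z w + h z w)%C.
intros [B1 b1] [B2 b2]. exists (B1 + B2). intros z w hz hw. specialize (b1 z w hz). specialize (b2 z w hz).
cmod_tri. lra.
Qed.
Lemma bnd_pow e1 e2 g k : bnd e1 e2 g -> bnd e1 e2 (fun z w => Cpow (g z w) k).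
intros h. induction k as [|]; [exists 1; intros; simpl; rewrite Cmod_1; lra|]. now apply (bnd_mult e1 e2 g (fun z w => Cpow (g z w) k)).
Qed.
Lemma unif_pow e1 e2 u g k : bnd e1 e2 g -> unif e1 e2 u g -> unif e1 e2 (fun M z w => Cpow (u M z w) k) (fun z w => Cpow (g z w) k).
intros b h. induction k as [|]; [apply (unif_const e1 e2 (fun _ _ => RtoC 1))|].
apply (unif_mult e1 e2 u (fun M z w => Cpow (u M z w) k) g (fun z w => Cpow (g z w) k)); auto. now apply bnd_pow.
Qed.

(** * Uniform approximation of the integrand by Laurent polynomials *)

Lemma csum_tail (a : nat -> C) B : (forall j, Cmod (a j) <= B / 2 ^ j) ->
 forall M, Cmod (Csum_series a - sumC (seq 0 M) a)%C <= 2 * B / 2 ^ M.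
intros ha M.
assert (B0 : 0 <= B). { specialize (ha 0%nat). simpl in ha. unfold Rdiv in ha. rewrite Rinv_1 in ha. pose proof (Cmod_ge_0 (a 0%nat)). lra. }
assert (p2 : forall j, 0 < / 2 ^ j) by (intros; apply Rinv_0_lt_compat, pow_lt; lra).
assert (ex : ex_series a).
{ apply (ex_series_le (V := C_CompleteNormedModule) a (fun j => B * (/ 2) ^ j)).
 - intros n. rewrite pow_inv. apply ha.
 - apply (ex_series_scal (V := R_NormedModule) B). apply ex_series_geom. rewrite Rabs_pos_eq; lra. }
assert (hv : is_series a (Csum_series a)) by (unfold Csum_series; apply epsilon_spec; exact ex).
assert (tail : forall n m, Cmod (sumC (seq m n) a) <= 2 * B / 2 ^ m - 2 * B / 2 ^ (m + n)).
{ induction n as [|n IH]; intros m.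
 - simpl. rewrite Cmod_0, Nat.add_0_r. lra.
 - simpl. cmod_tri. specialize (IH (S m)). specialize (ha m).
  replace (m + S n)%nat with (S m + n)%nat by lia.
  assert (e : 2 * B / 2 ^ S m = B / 2 ^ m) by (simpl; field; apply pow_nonzero; lra). unfold Rdiv in *. rewrite Rmult_assoc. change fold_right with (sumC seq). nra. }
assert (sn : forall n, sum_n a n = sumC (seq 0 (S n)) a).
{ induction n as [|n IH]; [rewrite sum_O; simpl; ring|]. rewrite sum_Sn, IH, (seq_S (S n)), sumC_app. simpl.
 change plus with Cplus. ring. }
apply Rnot_lt_le. intros hlt.
set (e := Cmod (Csum_series a - sumC (seq 0 M) a)%C - 2 * B / 2 ^ M) in *.
assert (e0 : 0 < e) by (unfold e; lra).
destruct (hv _ (C_locally _ _ e0)) as [N hN].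
specialize (hN (N + M)%nat ltac:(lia)). rewrite sn in hN.
replace (S (N + M)) with (M + S N)%nat in hN by lia. rewrite seq_app, sumC_app in hN.
specialize (tail (S N) (0 + M)%nat).
set (S1 := sumC (seq 0 M) a) in *. set (S2 := sumC (seq (0 + M) (S N)) a) in *. set (v := Csum_series a) in *.
assert (t : Cmod (v - S1)%C <= Cmod (S1 + S2 - v)%C + Cmod S2).
{ replace (v - S1)%C with (- (S1 + S2 - v) + S2)%C by ring. cmod_tri. rewrite Cmod_opp. lra. }
simpl in tail. assert (0 <= 2 * B / 2 ^ (M + S N)). { unfold Rdiv. apply Rmult_le_pos; [lra|]. left. apply p2. }
unfold e in hN. lra.
Qed.

Lemma ex_series_bounded (a : nat -> C) : ex_series a -> exists B, forall j, Cmod (a j) <= B.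
intros [v hv].
destruct (hv _ (C_locally v 1 Rlt_0_1)) as [N hN].
assert (fin : forall n, exists B, forall j, (j <= n)%nat -> Cmod (a j) <= B).
{ induction n as [|n [B hB]]; [exists (Cmod (a 0%nat)); intros j hj; replace j with 0%nat by lia; lra|].
 exists (Rmax B (Cmod (a (S n)))). intros j hj. destruct (Nat.eq_dec j (S n)) as [->|]; [apply Rmax_r|].
 eapply Rle_trans; [apply hB; lia|apply Rmax_l]. }
destruct (fin N) as [B hB]. exists (Rmax B 2). intros j.
destruct (le_lt_dec j N) as [h|h]; [eapply Rle_trans; [auto|apply Rmax_l]|].
destruct j as [|j]; [lia|].
assert (h1 := hN j ltac:(lia)). assert (h2 := hN (S j) ltac:(lia)). rewrite sum_Sn in h2.
replace (a (S j)) with ((sum_n a j + a (S j) - v) - (sum_n a j - v))%C by ring.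
cmod_tri. rewrite Cmod_opp. eapply Rle_trans; [|apply Rmax_r]. apply Rplus_le_compat; left; assumption.
Qed.

Lemma term_le_Series (a : nat -> R) j : (forall i, 0 <= a i) -> ex_series a -> a j <= Series a.
intros ha ex. apply Series_correct in ex.
apply Rle_trans with (sum_n a j).
- destruct j as [|j]; [rewrite sum_O; lra|]. rewrite sum_Sn. unfold plus; simpl.
 assert (0 <= sum_n a j); [|lra]. induction j as [|]; [rewrite sum_O; auto|]. rewrite sum_Sn. unfold plus; simpl. specialize (ha (S j)). lra.
- apply (is_lim_seq_incr_compare (sum_n a) (Series a)); [auto|]. intros n. rewrite sum_Sn. unfold plus; simpl. specialize (ha (S n)). lra.
Qed.

Lemma pow_ratio x y j : 0 <= x -> 2 * x <= y -> x ^ j <= y ^ j / 2 ^ j.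
intros h1 h2. assert (e : y ^ j / 2 ^ j = (y / 2) ^ j). { unfold Rdiv. now rewrite Rpow_mult_distr, pow_inv. }
rewrite e. apply pow_incr. lra.
Qed.

(** Convergence at the point [1 + r/2] bounds the terms there, and shrinking the radius to [r/4]
    gains the factor [2^(-j)]. *)
Lemma Fterm_bound c r : 0 < r -> (forall x : C, Cmod (x - RtoC 1) < r -> ex_series (Fterm c x)) ->
 exists B, forall z j, Cmod z <= r / 4 -> Cmod (Fterm c (RtoC 1 + z)%C j) <= B / 2 ^ j.
intros r0 h. destruct (ex_series_bounded (Fterm c (RtoC 1 + RtoC (r / 2))%C)) as [B hB].
{ apply h. replace (RtoC 1 + RtoC (r / 2) - RtoC 1)%C with (RtoC (r / 2)) by ring. rewrite Cmod_R, Rabs_pos_eq; lra. }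
exists B. intros z j hz. specialize (hB j). unfold Fterm in *.
replace (RtoC 1 + RtoC (r / 2) - RtoC 1)%C with (RtoC (r / 2)) in hB by ring.
replace (RtoC 1 + z - RtoC 1)%C with z by ring. rewrite Cmod_mult, Cmod_Cpow in *. rewrite (Cmod_R (r / 2)), Rabs_pos_eq in hB by lra.
set (q := Cmod (RtoC _)) in *. assert (q0 : 0 <= q) by apply Cmod_ge_0.
assert (p := pow_ratio (Cmod z) (r / 2) j (Cmod_ge_0 z) ltac:(lra)).
apply Rle_trans with (q * ((r / 2) ^ j / 2 ^ j)); [now apply Rmult_le_compat_l|].
unfold Rdiv. rewrite <- Rmult_assoc. apply Rmult_le_compat_r; auto. left. apply Rinv_0_lt_compat, pow_lt; lra.
Qed.

Lemma Gterm_bound d r : 0 < r -> (forall x y : C,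
    Cmod (x - RtoC 1) < r -> Cmod (y - RtoC 1) < r ->
    (forall j, ex_series (fun l => Cmod (Gterm d x y j l))) /\
    ex_series (fun j => Series (fun l => Cmod (Gterm d x y j l)))) ->
 exists B, forall z w j l, Cmod z <= r / 4 -> Cmod w <= r / 4 ->
  Cmod (Gterm d (RtoC 1 + z)%C (RtoC 1 + w)%C j l) <= B / 2 ^ j / 2 ^ l.
intros r0 h. set (y := (RtoC 1 + RtoC (r / 2))%C).
assert (ey : (y - RtoC 1)%C = RtoC (r / 2)) by (unfold y; ring).
assert (hy : Cmod (y - RtoC 1)%C < r) by (rewrite ey, Cmod_R, Rabs_pos_eq; lra).
destruct (h y y hy hy) as [h1 h2].
set (B := Series (fun j => Series (fun l => Cmod (Gterm d y y j l)))).
exists B. intros z w j l hz hw.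
assert (hB : Cmod (Gterm d y y j l) <= B).
{ eapply Rle_trans; [apply (term_le_Series (fun l => Cmod (Gterm d y y j l)) l); [intros; apply Cmod_ge_0|auto]|].
 apply (term_le_Series (fun j => Series (fun l => Cmod (Gterm d y y j l))) j); auto.
 intros i. eapply Rle_trans; [|apply (term_le_Series (fun l => Cmod (Gterm d y y i l)) 0%nat); [intros; apply Cmod_ge_0|auto]]. apply Cmod_ge_0. }
clearbody B. unfold Gterm in *. rewrite ey in hB. replace (RtoC 1 + z - RtoC 1)%C with z by ring. replace (RtoC 1 + w - RtoC 1)%C with w by ring.
rewrite !Cmod_mult, !Cmod_Cpow in *. rewrite (Cmod_R (r / 2)), Rabs_pos_eq in hB by lra.
set (q := Cmod (RtoC _)) in *. assert (q0 : 0 <= q) by apply Cmod_ge_0.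
assert (p := pow_ratio (Cmod z) (r / 2) j (Cmod_ge_0 z) ltac:(lra)).
assert (p' := pow_ratio (Cmod w) (r / 2) l (Cmod_ge_0 w) ltac:(lra)).
assert (z0 : 0 <= Cmod z ^ j) by (apply pow_le, Cmod_ge_0). assert (w0 : 0 <= Cmod w ^ l) by (apply pow_le, Cmod_ge_0).
apply Rle_trans with (q * ((r / 2) ^ j / 2 ^ j) * ((r / 2) ^ l / 2 ^ l)).
- apply Rmult_le_compat; auto; [apply Rmult_le_pos; auto|]. apply Rmult_le_compat_l; auto.
- apply Rle_trans with (q * (r / 2) ^ j * (r / 2) ^ l * (/ 2 ^ j * / 2 ^ l)); [right; unfold Rdiv; ring|].
 apply Rle_trans with (B * (/ 2 ^ j * / 2 ^ l)); [|right; unfold Rdiv; ring].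
 apply Rmult_le_compat_r; auto. left. apply Rmult_lt_0_compat; apply Rinv_0_lt_compat, pow_lt; lra.
Qed.

Lemma half_pow_small B e : 0 < e -> exists N, forall M, (N <= M)%nat -> B / 2 ^ M < e.
intros e0. destruct (pow_lt_1_zero (/ 2) ltac:(rewrite Rabs_pos_eq; lra) (e / (Rabs B + 1))) as [N hN].
{ apply Rdiv_lt_0_compat; auto. pose proof (Rabs_pos B); lra. }
exists N. intros M hM. specialize (hN M hM). rewrite pow_inv in hN. assert (p : 0 < / 2 ^ M) by (apply Rinv_0_lt_compat, pow_lt; lra).
rewrite Rabs_pos_eq in hN by lra. pose proof (Rabs_pos B). pose proof (Rle_abs B).
assert (k : / 2 ^ M * (Rabs B + 1) < e). { apply (Rmult_lt_compat_r (Rabs B + 1)) in hN; [|lra]. unfold Rdiv in hN. rewrite Rmult_assoc, Rinv_l in hN; lra. }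
unfold Rdiv. nra.
Qed.

Lemma sumR_geom K n : 0 <= K -> forall m, sumR (seq m n) (fun j => K / 2 ^ j) <= 2 * K / 2 ^ m.
intros K0. induction n as [|n IH]; intros m; simpl. apply Rmult_le_pos; [lra|]. left. apply Rinv_0_lt_compat, pow_lt; lra.
- specialize (IH (S m)). change fold_right with (sumR seq (fun j => K / 2 ^ j)).
 assert (e : 2 * K / 2 ^ S m = K / 2 ^ m) by (simpl; field; apply pow_nonzero; lra). nra.
Qed.

Definition GM d M z w : C := sumC (seq 0 M) (fun j => sumC (seq 0 M) (fun l => Gterm d (RtoC 1 + z)%C (RtoC 1 + w)%C j l)).
(** Partial sums of [1/(z-w)^2 = sum_m (m+1) z^m w^(-m-2)], an expansion valid for [|z| < |w|]: here
    the nesting of the contours enters. *)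
Definition QM M z w : C := sumC (seq 0 M) (fun m => (RtoC (INR (S m)) * (Cpowz z (Z.of_nat m) * Cpowz w (- Z.of_nat (m + 2))))%C).

Lemma G_unif d B e1 e2 : 0 <= B -> (forall z w j l, Cmod z = e1 -> Cmod w = e2 -> Cmod (Gterm d (RtoC 1 + z)%C (RtoC 1 + w)%C j l) <= B / 2 ^ j / 2 ^ l) ->
 unif e1 e2 (GM d) (fun z w => G_rho d (RtoC 1 + z)%C (RtoC 1 + w)%C) /\ bnd e1 e2 (fun z w => G_rho d (RtoC 1 + z)%C (RtoC 1 + w)%C).
intros B0 hB.
assert (p2 : forall j, 0 < / 2 ^ j) by (intros; apply Rinv_0_lt_compat, pow_lt; lra).
assert (key : forall M z w, Cmod z = e1 -> Cmod w = e2 -> Cmod (G_rho d (RtoC 1 + z) (RtoC 1 + w) - GM d M z w)%C <= 8 * B / 2 ^ M).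
{ intros M z w hz hw. unfold G_rho, GM. set (g := fun j l => Gterm d (RtoC 1 + z)%C (RtoC 1 + w)%C j l).
 set (A := fun j => Csum_series (g j)).
 assert (t1 : forall j N, Cmod (A j - sumC (seq 0 N) (g j))%C <= 2 * (B / 2 ^ j) / 2 ^ N).
 { intros j N. apply csum_tail. intros l. now apply hB. }
 assert (t2 : forall j, Cmod (A j) <= 2 * B / 2 ^ j).
 { intros j. specialize (t1 j 0%nat). simpl in t1. replace (A j) with (A j - RtoC 0)%C by ring. unfold Rdiv in *. rewrite Rinv_1 in t1. lra. }
 assert (t3 := csum_tail A (2 * B) t2 M).
 set (Y := sumC (seq 0 M) (fun j => sumC (seq 0 M) (g j))).
 match goal with |- Cmod ?x <= _ => replace x with
  ((Csum_series A - sumC (seq 0 M) A) + sumC (seq 0 M) (fun j => A j + RtoC (-1) * sumC (seq 0 M) (g j)))%C;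
  [|rewrite sumC_plus, sumC_scal; fold Y; ring] end.
 cmod_tri.
 assert (t4 : Cmod (sumC (seq 0 M) (fun j => A j + RtoC (-1) * sumC (seq 0 M) (g j)))%C <= 2 * (2 * B / 2 ^ M) / 2 ^ 0).
 { eapply Rle_trans; [apply Cmod_sumC|]. eapply Rle_trans; [|apply sumR_geom].
  - apply sumR_le. intros j _. replace (A j + RtoC (-1) * sumC (seq 0 M) (g j))%C with (A j - sumC (seq 0 M) (g j))%C by ring.
   eapply Rle_trans; [auto|]. right. unfold Rdiv; ring.
  - apply Rmult_le_pos; [lra|]. left; apply p2. }
 unfold Rdiv in *. lra. }
split.
- intros e e0. destruct (half_pow_small (8 * B) e e0) as [N hN]. exists N. intros M hM z w hz hw.
 specialize (key M z w hz). specialize (hN M hM).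
 replace (GM d M z w - G_rho d (RtoC 1 + z) (RtoC 1 + w))%C with (- (G_rho d (RtoC 1 + z) (RtoC 1 + w) - GM d M z w))%C by ring.
 rewrite Cmod_opp. lra.
- exists (8 * B). intros z w hz hw. specialize (key 0%nat z w hz). unfold GM in key. simpl in key.
 replace (G_rho d (RtoC 1 + z) (RtoC 1 + w))%C with (G_rho d (RtoC 1 + z) (RtoC 1 + w) - RtoC 0)%C by ring. lra.
Qed.

Lemma F_unif c B r : (forall z j, Cmod z = r -> Cmod (Fterm c (RtoC 1 + z)%C j) <= B / 2 ^ j) ->
 (forall e, 0 < e -> exists N, forall M, (N <= M)%nat -> forall z, Cmod z = r ->
   Cmod (sumC (seq 0 M) (Fterm c (RtoC 1 + z)) - F_rho c (RtoC 1 + z))%C < e) /\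
 (forall z, Cmod z = r -> Cmod (F_rho c (RtoC 1 + z)%C) <= 2 * B).
intros hB. split.
- intros e e0. destruct (half_pow_small (2 * B) e e0) as [N hN]. exists N. intros M hM z hz.
 assert (k := csum_tail _ B (fun j => hB z j hz) M). specialize (hN M hM). unfold F_rho.
 rewrite <- Cmod_opp. match goal with |- Cmod ?x < _ => replace x with (Csum_series (Fterm c (RtoC 1 + z)) - sumC (seq 0 M) (Fterm c (RtoC 1 + z)))%C by ring end. lra.
- intros z hz. assert (k := csum_tail _ B (fun j => hB z j hz) 0%nat). simpl in k.
 unfold F_rho. replace (Csum_series (Fterm c (RtoC 1 + z))) with (Csum_series (Fterm c (RtoC 1 + z)) - RtoC 0)%C by ring. lra.
Qed.

Lemma geom2_id (t : C) M : ((RtoC 1 - t) * (RtoC 1 - t) * sumC (seq 0 M) (fun m => RtoC (INR (S m)) * Cpow t m))%C =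
 (RtoC 1 - RtoC (INR (S M)) * Cpow t M + RtoC (INR M) * (t * Cpow t M))%C.
induction M as [|M IH]; [simpl; ring|].
rewrite seq_S, sumC_app, Cmult_plus_distr_l, IH. unfold sumC. cbn [fold_right]. rewrite Nat.add_0_l, !S_INR, !RtoC_plus.
cbn [Cpow]. ring.
Qed.

Lemma Q_unif e1 : 0 < e1 -> unif e1 (2 * e1) QM (fun z w => Cinv (Cpow (z - w) 2)) /\ bnd e1 (2 * e1) (fun z w => Cinv (Cpow (z - w) 2)).
intros h1.
assert (dist : forall z w, Cmod z = e1 -> Cmod w = 2 * e1 -> e1 <= Cmod (z - w)%C).
{ intros z w hz hw. assert (t := Cmod_triangle (w - z) z). replace (w - z + z)%C with w in t by ring.
 replace (z - w)%C with (- (w - z))%C by ring. rewrite Cmod_opp. lra. }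
assert (nz : forall z w, Cmod z = e1 -> Cmod w = 2 * e1 -> (z - w)%C <> RtoC 0).
{ intros z w hz hw e. assert (t := dist z w hz). rewrite e, Cmod_0 in t. lra. }
assert (nw : forall w, Cmod w = 2 * e1 -> w <> RtoC 0). { intros w hw ->. rewrite Cmod_0 in hw. lra. }
split.
(* On the circles [|z/w| = 1/2], so the remainder has size [(M+1) 2^(-M)]; the bound of [M + 1] by a
   multiple of [(3/2)^M] turns this into a multiple of [(3/4)^M]. *)
- destruct (poly_exp 1 (3 / 2) ltac:(lra)) as [K [K0 hK]].
 assert (key : forall M z w, Cmod z = e1 -> Cmod w = 2 * e1 ->
   Cmod (QM M z w - Cinv (Cpow (z - w) 2))%C <= (2 * K / (e1 * e1)) * (3 / 4) ^ M).
 { intros M z w hz hw. assert (w0 := nw w hw). assert (zw := nz z w hz hw).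
  set (t := (z * Cinv w)%C).
  assert (et : Cmod t = / 2). { unfold t. rewrite Cmod_mult, Cmod_inv by auto. rewrite hz, hw. field. lra. }
  assert (eQ : QM M z w = (Cinv (w * w) * sumC (seq 0 M) (fun m => RtoC (INR (S m)) * Cpow t m))%C).
  { unfold QM. rewrite <- sumC_scal. apply sumC_ext. intros m _. rewrite Cpowz_nat, Cpowz_neg. unfold t.
   rewrite Cpow_mult_l, Cpow_inv by auto.
   rewrite Cpow_add_r. field. split; auto. now apply Cpow_nz. }
  assert (ezw : (z - w)%C = (- (w * (RtoC 1 - t)))%C) by (unfold t; field; auto).
  assert (t1 : (RtoC 1 - t)%C <> RtoC 0). { intros e. rewrite e in ezw. apply zw. rewrite ezw. ring. }
  assert (g := geom2_id t M). rewrite eQ. set (s := sumC _ _) in *.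
  assert (ed : (Cinv (w * w) * s - Cinv (Cpow (z - w) 2))%C = (Cinv ((z - w) * (z - w)) * (RtoC (INR M) * (t * Cpow t M) - RtoC (INR (S M)) * Cpow t M))%C).
  { replace (RtoC (INR M) * (t * Cpow t M) - RtoC (INR (S M)) * Cpow t M)%C with ((RtoC 1 - t) * (RtoC 1 - t) * s - RtoC 1)%C by (rewrite g; ring).
   rewrite ezw. field. auto. }
  rewrite ed, Cmod_mult, Cmod_inv by (now apply Cmult_neq_0). rewrite Cmod_mult.
  assert (dz := dist z w hz). specialize (hK M).
  set (q := Cmod (z - w)%C) in *.
  assert (b1 : / (q * q) <= / (e1 * e1)). { apply Rinv_le_contravar; nra. }
  assert (b2 : Cmod (RtoC (INR M) * (t * Cpow t M) - RtoC (INR (S M)) * Cpow t M)%C <= 2 * K * (3 / 4) ^ M).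
  { cmod_tri. rewrite Cmod_opp, !Cmod_mult, Cmod_Cpow, et, !Cmod_R, !Rabs_pos_eq by apply pos_INR.
   rewrite S_INR. assert (m0 := pos_INR M). assert (p : 0 < (/ 2) ^ M) by (apply pow_lt; lra).
   replace ((3 / 4) ^ M) with ((3 / 2) ^ M * (/ 2) ^ M) by (rewrite <- Rpow_mult_distr; f_equal; lra). nra. }
  apply Rle_trans with (/ (e1 * e1) * (2 * K * (3 / 4) ^ M)).
  - apply Rmult_le_compat; auto; [|apply Cmod_ge_0]. left. apply Rinv_0_lt_compat. nra.
  - right. unfold Rdiv. ring. }
 intros e e0. assert (c0 : 0 < 2 * K / (e1 * e1)) by (apply Rdiv_lt_0_compat; nra).
 destruct (pow_lt_1_zero (3 / 4) ltac:(rewrite Rabs_pos_eq; lra) (e / (2 * K / (e1 * e1)))) as [N hN]; [now apply Rdiv_lt_0_compat|].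
 exists N. intros M hM z w hz hw. specialize (hN M). specialize (key M z w hz hw).
 rewrite Rabs_pos_eq in hN by (apply pow_le; lra). eapply Rle_lt_trans; [exact key|]. set (X := 2 * K / (e1 * e1)) in *.
 apply (Rmult_lt_compat_l X) in hN; auto. replace (X * (e / X)) with e in hN by (field; lra). exact hN.
- exists (/ (e1 * e1)). intros z w hz hw. simpl Cpow. rewrite Cmult_1_r, Cmod_inv by (apply Cmult_neq_0; now apply nz). rewrite Cmod_mult. assert (t := dist z w hz).
 apply Rinv_le_contravar; nra.
Qed.

Definition UM c al M z : C := (Cinv z + RtoC 1 + (RtoC 1 + z) * sumC (seq 0 M) (Fterm c (RtoC 1 + z)) / RtoC al)%C.

Lemma U_unif c B r al : 0 < r -> (forall z j, Cmod z = r -> Cmod (Fterm c (RtoC 1 + z)%C j) <= B / 2 ^ j) ->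
 (forall e, 0 < e -> exists N, forall M, (N <= M)%nat -> forall z, Cmod z = r ->
   Cmod (UM c al M z - (Cinv z + RtoC 1 + (RtoC 1 + z) * F_rho c (RtoC 1 + z) / RtoC al))%C < e) /\
 (exists A, forall z, Cmod z = r -> Cmod (Cinv z + RtoC 1 + (RtoC 1 + z) * F_rho c (RtoC 1 + z) / RtoC al)%C <= A).
intros r0 hB. destruct (F_unif c B r hB) as [h1 h2].
set (q := Cmod (Cinv (RtoC al))). assert (q0 : 0 <= q) by apply Cmod_ge_0.
assert (bz : forall z, Cmod z = r -> Cmod (RtoC 1 + z)%C <= 1 + r).
{ intros z hz. cmod_tri. rewrite Cmod_1. lra. }
split.
- intros e e0. assert (c0 : 0 < (1 + r) * (q + 1)) by (apply Rmult_lt_0_compat; lra).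
 destruct (h1 (e / ((1 + r) * (q + 1)))) as [N hN]; [now apply Rdiv_lt_0_compat|].
 exists N. intros M hM z hz. specialize (hN M hM z). specialize (bz z). unfold UM.
 set (f := sumC _ _) in *. set (g := F_rho _ _) in *.
 replace (Cinv z + RtoC 1 + (RtoC 1 + z) * f / RtoC al - (Cinv z + RtoC 1 + (RtoC 1 + z) * g / RtoC al))%C with ((RtoC 1 + z) * Cinv (RtoC al) * (f - g))%C by (unfold Cdiv; ring).
 rewrite !Cmod_mult. fold q. set (x := Cmod (f - g)%C) in *. assert (x0 : 0 <= x) by apply Cmod_ge_0.
 apply Rle_lt_trans with ((1 + r) * (q + 1) * x).
 + apply Rmult_le_compat_r; auto. apply Rmult_le_compat; try lra. apply Cmod_ge_0.
 + apply (Rmult_lt_compat_l ((1 + r) * (q + 1))) in hN; auto. eapply Rlt_le_trans; [exact hN|]. right. field. lra.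
- exists (/ r + 1 + (1 + r) * (2 * B) * q). intros z hz. specialize bz. specialize h2.
 assert (z0 : z <> RtoC 0) by (intros ->; rewrite Cmod_0 in hz; lra).
 cmod_tri. apply Rplus_le_compat.
 + cmod_tri. rewrite Cmod_1, Cmod_inv, hz by auto. lra.
 + unfold Cdiv. rewrite !Cmod_mult. apply Rmult_le_compat_r; auto. apply Rmult_le_compat; auto; apply Cmod_ge_0.
Qed.

(* The contour integral may be computed with truncated series, whose integrands are Laurent polynomials. *)
Theorem contour_truncated c d a1 k1 a2 k2 :
 (exists r, 0 < r /\ forall x : C, Cmod (x - RtoC 1) < r -> ex_series (Fterm c x)) ->
 (exists r, 0 < r /\ forall x y : C,
    Cmod (x - RtoC 1) < r -> Cmod (y - RtoC 1) < r ->
    (forall j, ex_series (fun l => Cmod (Gterm d x y j l))) /\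
    ex_series (fun j => Series (fun l => Cmod (Gterm d x y j l)))) ->
 exists e0, 0 < e0 /\ forall eps, 0 < eps < e0 -> forall V,
  (exists M0, forall M, (M0 <= M)%nat -> dcint eps (2 * eps)
    (fun z w => Cpow (UM c a1 M z) k1 * Cpow (UM c a2 M w) k2 * (GM d M z w + QM M z w))%C V) ->
  circle_int eps (fun z => circle_int (2 * eps) (fun w =>
    Cpow (Cinv z + RtoC 1 + (RtoC 1 + z) * F_rho c (RtoC 1 + z) / RtoC a1) k1 *
    Cpow (Cinv w + RtoC 1 + (RtoC 1 + w) * F_rho c (RtoC 1 + w) / RtoC a2) k2 *
    Q_rho d z w))%C = V.
intros [r [r0 hF]] [s [s0 hG]].
destruct (Fterm_bound c r r0 hF) as [B hB]. destruct (Gterm_bound d s s0 hG) as [B' hB'].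
(* The larger circle has radius [2 * eps], which is then below [r/4] and [s/4], the range of the
   term bounds. *)
exists (Rmin (r / 8) (s / 8)). split; [apply Rmin_glb_lt; lra|]. intros eps [e1 e2] V hV.
assert (m1 := Rmin_l (r / 8) (s / 8)). assert (m2 := Rmin_r (r / 8) (s / 8)).
assert (B0 : 0 <= B').
{ specialize (hB' (RtoC 0) (RtoC 0) 0%nat 0%nat ltac:(rewrite Cmod_0; lra) ltac:(rewrite Cmod_0; lra)).
 simpl in hB'. unfold Rdiv in hB'. rewrite Rinv_1, !Rmult_1_r in hB'. eapply Rle_trans; [apply Cmod_ge_0|exact hB']. }
destruct (U_unif c B eps a1 e1) as [u1 [A1 b1]]; [intros; apply hB; lra|].
destruct (U_unif c B (2 * eps) a2 ltac:(lra)) as [u2 [A2 b2]]; [intros; apply hB; lra|].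
destruct (G_unif d B' eps (2 * eps) B0) as [u3 b3]; [intros; apply hB'; lra|].
destruct (Q_unif eps e1) as [u4 b4].
refine (dcint_eq eps (2 * eps) (fun z w => _) V (Rlt_le _ _ e1) _).
refine (dcint_lim eps (2 * eps) _ (fun z w => _) V ltac:(lra) ltac:(lra) hV _).
apply (unif_mult eps (2 * eps) (fun M z w => Cpow (UM c a1 M z) k1 * Cpow (UM c a2 M w) k2)%C (fun M z w => GM d M z w + QM M z w)%C
 (fun z w => Cpow (Cinv z + RtoC 1 + (RtoC 1 + z) * F_rho c (RtoC 1 + z) / RtoC a1) k1 *
    Cpow (Cinv w + RtoC 1 + (RtoC 1 + w) * F_rho c (RtoC 1 + w) / RtoC a2) k2)%C (fun z w => Q_rho d z w)).
- apply (bnd_mult eps (2 * eps) (fun z w => Cpow _ k1) (fun z w => Cpow _ k2)).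
 + apply (bnd_pow eps (2 * eps) (fun z w => _)). exists A1. intros. now apply b1.
 + apply (bnd_pow eps (2 * eps) (fun z w => _)). exists A2. intros. now apply b2.
- now apply (bnd_plus eps (2 * eps) (fun z w => _) (fun z w => _)).
- apply (unif_mult eps (2 * eps) (fun M z w => Cpow (UM c a1 M z) k1) (fun M z w => Cpow (UM c a2 M w) k2) (fun z w => Cpow _ k1) (fun z w => Cpow _ k2)).
 + apply (bnd_pow eps (2 * eps) (fun z w => _)). exists A1. intros. now apply b1.
 + apply (bnd_pow eps (2 * eps) (fun z w => _)). exists A2. intros. now apply b2.
 + apply (unif_pow eps (2 * eps) (fun M z w => _) (fun z w => _)).
  * exists A1. intros. now apply b1.
  * intros e e0. destruct (u1 e e0) as [N hN]. exists N. intros. now apply hN.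
 + apply (unif_pow eps (2 * eps) (fun M z w => _) (fun z w => _)).
  * exists A2. intros. now apply b2.
  * intros e e0. destruct (u2 e e0) as [N hN]. exists N. intros. now apply hN.
- now apply (unif_plus eps (2 * eps) (GM d) QM (fun z w => G_rho d (RtoC 1 + z)%C (RtoC 1 + w)%C) (fun z w => Cinv (Cpow (z - w) 2))).
Qed.

End Sums.

(** * The complex numbers as a ring of the algebraic library *)

Module Moments.
Import Reals ZArith List Lia Lra ClassicalEpsilon Permutation Coquelicot.Coquelicot Defs.
Import structures all_boot all_order all_algebra fingroup perm Rstruct mpoly.
Import mathcomp.algebra_tactics.ring mathcomp.algebra_tactics.lra mathcomp.zify.zify.
Import Order.TTheory GRing.Theory Num.Theory Sums Germs.
Set Implicit Arguments. Unset Strict Implicit. Unset Printing Implicit Defensive.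
Local Open Scope ring_scope.
Delimit Scope R_scope with coqR.
Delimit Scope Z_scope with coqZ.

HB.instance Definition _ := Choice.copy C (R * R)%type.
HB.instance Definition _ := GRing.isZmodule.Build C
 (fun x y z => Cplus_assoc x y z) Cplus_comm Cplus_0_l (fun x => etrans (Cplus_comm _ _) (Cplus_opp_r x)).
Lemma C1_neq0 : RtoC 1 != 0 :> C.
by apply/eqP => h; have := f_equal fst h => /R1_neq_R0. Qed.
HB.instance Definition _ := GRing.Zmodule_isComNzRing.Build C
 (fun x y z => Cmult_assoc x y z) Cmult_comm Cmult_1_l (fun x y z => Cmult_plus_distr_r x y z) C1_neq0.

Lemma CplusE (x y : C) : Cplus x y = x + y. by []. Qed.
Lemma CmultE (x y : C) : Cmult x y = x * y. by []. Qed.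
Lemma CminusE (x y : C) : Cminus x y = x - y. by []. Qed.
Lemma CpowE (x : C) n : Cpow x n = x ^+ n.
by elim: n => [|n IH] //=; rewrite IH exprS. Qed.

Lemma seqE a n : List.seq a n = iota a n.
by []. Qed.
Lemma sumC_big (I : Type) (s : seq I) (f : I -> C) : sumC s f = \sum_(i <- s) f i.
by elim: s => [|i s IH]; rewrite ?big_nil ?big_cons //= IH. Qed.
Lemma prodC_big (I : Type) (s : seq I) (f : I -> C) : prodC s f = \prod_(i <- s) f i.
by elim: s => [|i s IH]; rewrite ?big_nil ?big_cons //= IH. Qed.
Lemma sumR_big (I : Type) (s : seq I) (f : I -> R) : sumR s f = \sum_(i <- s) f i.
by elim: s => [|i s IH]; rewrite ?big_nil ?big_cons //= IH. Qed.
Lemma prodR_big (I : Type) (s : seq I) (f : I -> R) : prodR s f = \prod_(i <- s) f i.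
by elim: s => [|i s IH]; rewrite ?big_nil ?big_cons //= IH. Qed.
Lemma prodC_ord n (f : nat -> C) : prodC (List.seq 0 n) f = \prod_(i < n) f i.
by rewrite prodC_big -(big_mkord xpredT) /index_iota subn0. Qed.
Lemma sumC_ord n (f : nat -> C) : sumC (List.seq 0 n) f = \sum_(i < n) f i.
by rewrite sumC_big -(big_mkord xpredT) /index_iota subn0. Qed.

Lemma sgnC j : RtoC ((-1) ^ j)%coqR = (-1) ^+ j :> C.
elim: j => [|j IH] //=; rewrite exprS RtoC_mult IH; congr (_ * _).
by rewrite -[RHS]/(Copp (RtoC 1)) -RtoC_opp.
Qed.

Lemma det_mx n (M : nat -> nat -> C) : det n M = \det (\matrix_(i < n, j < n) M i j).
elim: n M => [|n IH] M; first by rewrite det_mx00.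
rewrite /= -/sumCn /sumCn sumC_ord (expand_det_row _ ord0); bigr => j _.
rewrite mxE sgnC IH !CmultE [_ * M 0%N j]mulrC -mulrA; congr (_ * (_ * _)).
congr (\det _); apply/matrixP => i k; rewrite !mxE /minor0.
have -> : (if (Nat.ltb k j) then (k : nat) else S k) = lift j k.
 rewrite /= /bump; case: Nat.ltb_spec0 => h.
  lia.
 lia.
by [].
Qed.

(** * Schur functions as Laurent polynomials *)

Definition natsig (m : nat) (l : list Z) : seq nat :=
 [seq Z.to_nat (List.nth j l 0%coqZ + Z.of_nat (length l) - Z.of_nat j.+1 + Z.of_nat m)%coqZ | j <- iota 0 (length l)].
Definition pat (m M : nat) (ns : seq nat) : list lmon :=
 [seq (1%coqR, fun j => (Z.of_nat (nth 0%N w j) - Z.of_nat m)%coqZ) | w <- gts M ns].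

(** The shift [m] makes all shifted parts natural numbers, so that signatures with negative parts
    fit the combinatorics of [gts]; [pat] takes the shift back in the exponents. *)
Definition shifted (m : nat) (l : list Z) := forall j, (j < length l)%coq_nat ->
 (0 <= List.nth j l 0 + Z.of_nat (length l) - Z.of_nat j.+1 + Z.of_nat m)%coqZ.

Lemma shifted_ex l : exists m0, forall m, (m0 <= m)%N -> shifted m l.
have : exists m0 : nat, forall j, (j < length l)%coq_nat -> (- Z.of_nat m0 <= List.nth j l 0)%coqZ.
 elim: l => [|a l [m0 h]]; first by exists 0%N => j /= hj; lia.
 exists (m0 + Z.abs_nat a)%N => -[|j] /= hj; first lia.
 have := h j ltac:(lia); lia.
move=> [m0 h]; exists m0 => m hm j hj; have := h j hj; lia.
Qed.

Lemma size_natsig m l : size (natsig m l) = length l.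
by rewrite size_map size_iota. Qed.

Lemma nth_natsig m l j : shifted m l -> (j < length l)%N ->
 Z.of_nat (nth 0%N (natsig m l) j) = (List.nth j l 0 + Z.of_nat (length l) - Z.of_nat j.+1 + Z.of_nat m)%coqZ.
move=> h hj; rewrite (nth_map 0%N) ?size_iota // nth_iota // Z2Nat.id //; apply: h; lia.
Qed.

Lemma natsig_sdec M m l : isGT M l -> shifted m l -> sdec (natsig m l).
move=> [hl hd] hs; apply: sdecP => j; rewrite size_natsig => hj.
have h1 := nth_natsig hs hj; have h2 := nth_natsig hs (ltnW hj).
have h3 : (List.nth (S j) l 0 <= List.nth j l 0)%coqZ by apply: hd; lia.
lia.
Qed.

Lemma lval_gts m M ns (x : nat -> C) (xi : nat -> C) : (forall j, (j < M)%N -> x j * xi j = 1) ->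
 lval M (pat m M ns) x = (\prod_(j < M) xi j ^+ m) * gtsum x M ns.
move=> hx; rewrite /lval sumC_big big_map mulr_sumr; bigr => w _.
rewrite Cmult_1_l prodC_ord -big_split; bigr => j _.
have xnz : x j <> RtoC 0.
 by move=> e; have := hx j (ltn_ord j); rewrite e mul0r => /esym/eqP; rewrite (negPf (oner_neq0 _)).
have key a b : Cpowz (x j) (Z.of_nat a - Z.of_nat b)%coqZ = xi j ^+ b * x j ^+ a.
 elim: b => [|b IH]; first by rewrite Z.sub_0_r Cpowz_nat CpowE mul1r.
 have e := Cpowz_succ (x j) (Z.of_nat a - Z.of_nat b.+1)%coqZ xnz.
 have e2 : (Z.of_nat a - Z.of_nat b.+1 + 1 = Z.of_nat a - Z.of_nat b)%coqZ by lia.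
 rewrite e2 IH in e.
 by rewrite exprS -mulrA e mulrA [xi j * _]mulrC hx // mul1r.
exact: key.
Qed.

(** The factors [y_i^(-m)] come out of the rows of the alternant; what remains is the bialternant
    formula, divided by the nonzero Vandermonde product. *)
Lemma schur_ratio_lval M m l (y : nat -> C) : isGT M l -> shifted m l ->
 (forall i, (i < M)%N -> y i <> RtoC 0) -> (forall i j, (i < j < M)%N -> y i <> y j) ->
 schur_ratio l y = lval M (pat m M (natsig m l)) y.
move=> hl hs hnz hd; have [len _] := hl.
rewrite /schur_ratio len det_mx.
pose yi j := Cinv (y j).
have hyi j : (j < M)%N -> y j * yi j = 1 by move=> hj; apply: Cinv_r; apply: hnz.
rewrite (lval_gts _ _ hyi).
have -> : \det (\matrix_(i < M, j < M) Cpowz (y i) (List.nth j l 0 + Z.of_nat M - Z.of_nat (S j))%coqZ) =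
  (\prod_(j < M) yi j ^+ m) * altdet y M (natsig m l).
 have -> : (\matrix_(i < M, j < M) Cpowz (y i) (List.nth j l 0 + Z.of_nat M - Z.of_nat (S j))%coqZ) =
   diag_mx (\row_(i < M) yi i ^+ m) *m \matrix_(i < M, j < M) y i ^+ nth 0%N (natsig m l) j.
  apply/matrixP => i j; rewrite mul_diag_mx !mxE.
  have hj : (j < length l)%N by rewrite len.
  have e := nth_natsig hs hj.
  have -> : (List.nth j l 0 + Z.of_nat M - Z.of_nat (S j) = Z.of_nat (nth 0%N (natsig m l) j) - Z.of_nat m)%coqZ by lia.
  (* The case of one variable and one part of [lval_gts] is the conversion of a single integer
     power. *)
  have h1 := @lval_gts m 1 [:: nth 0%N (natsig m l) j] (fun=> y i) (fun=> yi i) (fun _ _ => hyi i (ltn_ord i)).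
  move: h1; rewrite /= /gtsum big_ord1 big_seq1 big_ord1.
  by rewrite Cmult_1_r Cmult_1_l !Cplus_0_r !subn0 ?addn0.
 rewrite det_mulmx det_diag; congr (_ * _); by bigr => j _; rewrite mxE.
have -> : prodC (List.seq 0 M) (fun i => prodC (List.seq (S i) (M - S i)) (fun j => Cminus (y i) (y j))) =
  \prod_(i < M) \prod_(j < M | (i < j)%N) (y i - y j).
 rewrite prodC_ord; bigr => i _; rewrite prodC_big.
 by rewrite (big_nat_widenl _ 0) // big_mkord.
rewrite -gtsum_altdet ?size_natsig //; last exact: natsig_sdec hl hs.
set V := \prod_(i < M) \prod_(j < M | (i < j)%N) (y i - y j); have Vnz : V <> RtoC 0.
 move=> e; suff : V != 0 by rewrite e eqxx.
 rewrite /V; elim/big_ind: _ => [|a b ha hb|i _]; first exact: oner_neq0.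
  by apply/eqP; apply: Cmult_neq_0; apply/eqP.
 elim/big_ind: _ => [|a b ha hb|j ij]; first exact: oner_neq0.
  by apply/eqP; apply: Cmult_neq_0; apply/eqP.
 by rewrite subr_eq0; apply/eqP; apply: hd; rewrite ij ltn_ord.
rewrite /Cdiv CmultE -mulrA; congr (_ * _).
by rewrite mulrC mulrA -[Cinv V * V]/(Cmult _ _) Cinv_l // mul1r.
Qed.

Lemma RtoC_is_zmod_morphism : zmod_morphism RtoC.
by move=> x y; rewrite -[RHS]/(Cminus _ _) -RtoC_minus. Qed.
Lemma RtoC_is_monoid_morphism : monoid_morphism RtoC.
by split=> // x y; rewrite -[RHS]/(Cmult _ _) -RtoC_mult. Qed.
HB.instance Definition _ := GRing.isZmodMorphism.Build R C RtoC RtoC_is_zmod_morphism.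
HB.instance Definition _ := GRing.isMonoidMorphism.Build R C RtoC RtoC_is_monoid_morphism.

Lemma RtoC_inj_ (x y : R) : RtoC x = RtoC y -> x = y. by case. Qed.

(** Near [x] the ratio coincides with the Laurent polynomial at all admissible points, and the
    latter is continuous at points with nonzero coordinates. *)
Lemma schurE M m l x : isGT M l -> shifted m l -> (forall i, (i < M)%N -> x i <> RtoC 0) ->
 schur l x = lval M (pat m M (natsig m l)) x.
move=> hl hs hx; have [len _] := hl; apply: schur_eq => e he; rewrite len.
have hx' : forall i, (i < M)%coq_nat -> x i <> RtoC 0 by move=> i hi; apply: hx; lia.
have [d [d0 hd]] := lval_cont M (pat m M (natsig m l)) x hx' e he.
exists d; split=> // y hy hnz hdist.
rewrite (schur_ratio_lval hl hs); first exact: hd.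
 by move=> i hi; apply: hnz; lia.
by move=> i j hij; apply: hdist; lia.
Qed.

Lemma sum_pat m M ns : sumR (pat m M ns) fst = (size (gts M ns))%:R.
rewrite /pat.
by elim: gts => [|w s IH]; rewrite ?big_nil ?big_cons //= IH -natr1 addrC.
Qed.

Lemma ones_nz i : ones i <> RtoC 0.
by rewrite /ones => /RtoC_inj_ /R1_neq_R0. Qed.

Lemma schur_ones M m l : isGT M l -> shifted m l -> schur l ones = RtoC (dimn (natsig m l))%:R.
move=> hl hs; rewrite (schurE hl hs) => [|i _]; last exact: ones_nz.
by rewrite lval_ones sum_pat /dimn size_natsig; case: hl => ->.
Qed.

Lemma gtsum_RtoC (xr : nat -> R) M ns : gtsum (fun j => RtoC (xr j)) M ns = RtoC (gtsum xr M ns).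
rewrite rmorph_sum; bigr => w _; rewrite rmorph_prod; bigr => j _.
by rewrite rmorphXn.
Qed.

Lemma lval_real m M ns (xr : nat -> R) : (forall j, (j < M)%N -> 0 < xr j) ->
 lval M (pat m M ns) (fun j => RtoC (xr j)) = RtoC ((\prod_(j < M) (xr j)^-1 ^+ m) * gtsum xr M ns).
move=> hx; rewrite (@lval_gts _ _ _ _ (fun j => RtoC (xr j)^-1)) => [|j hj].
 by rewrite gtsum_RtoC rmorphM rmorph_prod; congr (_ * _); bigr => j _; rewrite rmorphXn.
by rewrite -rmorphM mulfV // gt_eqF // hx.
Qed.

Lemma lval_pad m k j ns (x : nat -> C) : size ns = (k + j)%N -> (forall i, (i < k)%N -> x i <> RtoC 0) ->
 lval (k + j) (pat m (k + j) ns) (pad k x) = \sum_(ms <- desc j ns) lval k (pat m k ms) x.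
move=> sn hx; pose xi i := if (i < k)%N then Cinv (x i) else 1.
have padE i : pad k x i = if (i < k)%N then x i else 1.
 by rewrite /pad; case: Nat.ltb_spec0 => h; case: ifP => h' //; lia.
have hxi i : pad k x i * xi i = 1.
 by rewrite padE /xi; case: ifP => h; [apply: Cinv_r; apply: hx|rewrite mul1r].
rewrite (lval_gts _ _ (fun i _ => hxi i)) gtsum_pad // => [|i hi]; last first.
 by rewrite padE; case: ifP => // h; lia.
have -> : \prod_(i < k + j) xi i ^+ m = \prod_(i < k) Cinv (x i) ^+ m.
 rewrite big_split_ord /= [X in _ * X]big1 ?mulr1 => [|i _]; last by rewrite /xi ltnNge leq_addr expr1n.
 by bigr => i _; rewrite /xi ltn_ord.
rewrite mulr_sumr; bigr => ms _.
rewrite (@lval_gts _ _ _ _ (fun i => Cinv (x i))) => [|i hi]; last by apply: Cinv_r; apply: hx.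
by congr (_ * _); apply: gtsum_ext => i hi; rewrite padE hi.
Qed.

Lemma below_shift d l : below (map (addn d) l) = map (map (addn d)) (below l).
have rs l0 : ranges (map (addn d) l0) = map (map (addn d)) (ranges l0).
 elim: l0 => [|a [|b l0] IH] //.
 rewrite -[ranges (map _ (a :: b :: l0))]/(iota (d + b) (d + a - (d + b)) :: ranges (map (addn d) (b :: l0))) IH.
 by rewrite subnDl iotaDl.
rewrite /below rs; elim: ranges => //= r rs' ->.
elim: r => //= a r IH; rewrite map_cat; congr (_ ++ _); last exact: IH.
by rewrite -!map_comp.
Qed.

Lemma desc_shift d j l : desc j (map (addn d) l) = map (map (addn d)) (desc j l).
elim: j => [|j IH] //; rewrite !descSr IH map_flatten -!map_comp; congr flatten.
by apply: eq_map => s; apply: below_shift.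
Qed.

Lemma dimn_shift d l : dimn (map (addn d) l) = dimn l.
move: {-1}(size l) (erefl (size l)) => n; elim: n l => [|n IH] l sl.
 by rewrite (size0nil sl).
rewrite -dimn_below -dimn_below below_shift big_map; apply: eq_big_seq => ms hms.
by apply: IH; rewrite (size_below hms) sl.
Qed.

Lemma shiftedW m d l : shifted m l -> shifted (m + d) l.
by move=> h j hj; have := h j hj; lia. Qed.

Lemma natsig_shift m d l : shifted m l -> natsig (m + d) l = map (addn d) (natsig m l).
move=> h; apply: (@eq_from_nth _ 0%N) => [|i]; rewrite ?size_map // size_iota => hi.
rewrite (nth_map 0%N) ?size_natsig //.
have h1 := nth_natsig h hi; have h2 := nth_natsig (shiftedW (d := d) h) hi.
lia.
Qed.

Lemma natsig_inj m l l' : shifted m l -> shifted m l' -> natsig m l = natsig m l' -> l = l'.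
move=> h h' e; have len : length l = length l' by rewrite -(size_natsig m) e size_natsig.
apply: (nth_ext _ _ 0%coqZ 0%coqZ) => // j hj.
have hj1 : (j < length l)%N by lia. have hj2 : (j < length l')%N by lia.
have h1 := nth_natsig h hj1; have h2 := nth_natsig h' hj2; rewrite e in h1; lia.
Qed.

Definition unsig (m : nat) (ns : seq nat) : list Z :=
 [seq (Z.of_nat (nth 0%N ns j) - Z.of_nat (size ns) + Z.of_nat j.+1 - Z.of_nat m)%coqZ | j <- iota 0 (size ns)].

Lemma lengthE (T : Type) (s : seq T) : length s = size s. by []. Qed.

Lemma nthE (j : nat) (l : list Z) : List.nth j l 0%coqZ = nth 0%coqZ l j.
by elim: l j => [|a l IH] [|j] //=. Qed.

Lemma nth_unsig m ns j : (j < size ns)%N ->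
 List.nth j (unsig m ns) 0%coqZ = (Z.of_nat (nth 0%N ns j) - Z.of_nat (size ns) + Z.of_nat j.+1 - Z.of_nat m)%coqZ.
by move=> h; rewrite nthE (nth_map 0%N) ?size_iota // nth_iota. Qed.

Lemma unsig_isGT m M ns : size ns = M -> sdec ns -> isGT M (unsig m ns).
move=> sn dn; split; first by rewrite lengthE size_map size_iota.
move=> i hi; rewrite !nth_unsig; try lia.
have := sdec_nth (i := i) (j := i.+1) dn; rewrite sn.
lia.
Qed.

Lemma unsig_shifted m ns : shifted m (unsig m ns).
move=> j; rewrite lengthE size_map size_iota => hj; rewrite nth_unsig; lia.
Qed.

Lemma unsigK m ns : natsig m (unsig m ns) = ns.
have len : length (unsig m ns) = size ns by rewrite lengthE size_map size_iota.
apply: (@eq_from_nth _ 0%N) => [|i]; rewrite size_natsig len // => hi.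
apply: Nat2Z.inj; have h := nth_natsig (j := i) (@unsig_shifted m ns); rewrite len in h.
by rewrite h // nth_unsig; lia.
Qed.

Lemma natsigK m l : shifted m l -> unsig m (natsig m l) = l.
by move=> h; apply: (natsig_inj (@unsig_shifted _ _) h); rewrite unsigK.
Qed.

Lemma ratio_RtoC (p c g d : R) : d != 0 ->
 Cmult (Cmult (RtoC p) (RtoC (c * g))) (Cinv (RtoC d)) = RtoC (c * (p / d * g)).
move=> d0; have e : Cinv (RtoC d) = RtoC d^-1 by rewrite -RtoC_inv; apply/eqP.
rewrite e -[LHS]/(RtoC p * RtoC (c * g) * RtoC d^-1) -!rmorphM; congr RtoC.
have gen (K : comNzRingType) (a b x y : K) : a * (b * x) * y = b * (a * y * x) by ring.
exact: gen.
Qed.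

(** * The transition coefficients *)

Section Kernel.
Variable pr : nat -> nat -> list Z -> list Z -> R.
Hypothesis Hpr : pr_spec pr.

(** At positive points the defining identity is a linear relation between Schur polynomials; their
    independence identifies [pr] with the multiplicity of [mu] among the descendants, rescaled by
    dimensions. The shift must be large enough for all signatures in the support supplied by
    [pr_spec]. *)
Lemma pr_value_big k1 k2 l mu : (k2 <= k1)%N -> isGT k1 l -> isGT k2 mu -> exists m0, forall m, (m0 <= m)%N ->
 shifted m l -> shifted m mu ->
 pr k1 k2 l mu = (count_mem (natsig m mu) (desc (k1 - k2) (natsig m l)))%:R * (dimn (natsig m mu))%:R / (dimn (natsig m l))%:R.
move=> hk hl hmu.
have hk' : (k2 <= k1)%coq_nat by lia.
have [S [nS [pS [h0 hS]]]] := Hpr hk' hl.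
have [m0 hm0] : exists m0, forall m, (m0 <= m)%N -> forall nu, List.In nu S -> shifted m nu.
 elim: (S) => [|a S' [m0 IH]]; first by exists 0%N.
 have [m1 h1] := shifted_ex a; exists (m0 + m1)%N => m hm nu [<-|]; first by apply: h1; lia.
 by apply: IH => //; lia.
exists m0 => m hm hsl hsmu.
have hSm := hm0 m hm.
have pS' : forall nu, List.In nu S -> isGT k2 nu by move/Forall_forall: pS.
set ds := desc (k1 - k2) (natsig m l); set mS := map (natsig m) S.
have dsd := natsig_sdec hl hsl.
have hds ms : ms \in ds -> size ms = k2 /\ sdec ms.
 move=> hms; have hrg : rg 0 (\sum_(a <- natsig m l) a) (natsig m l).
  by apply/allP => a ha; rewrite (big_rem a) //= leq_addr.
 have [h1 h2 _] := desc_spec hms dsd hrg.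
 by rewrite h1 size_natsig; case: hl => -> _; rewrite subKn.
have hmS ms : ms \in mS -> exists2 nu, List.In nu S & ms = natsig m nu.
 by rewrite /mS; elim: (S) => //= b S' IH; rewrite inE => /predU1P[->|/IH[nu]]; [exists b; [left|]|exists nu; [right|]].
have inmS nu : List.In nu S -> natsig m nu \in mS.
 by rewrite /mS; elim: (S) => //= b S' IH [->|/IH]; rewrite inE ?eqxx // => ->; rewrite orbT.
have umS : uniq mS.
 move: nS hSm; rewrite /mS; elim: (S) => //= b S' IH /NoDup_cons_iff[hb hn] hs.
 rewrite IH => [||nu hnu] //; last by apply: hs; right.
 rewrite andbT; apply/negP => hin.
 have [nu hnu e] : exists2 nu, List.In nu S' & natsig m b = natsig m nu.
  by elim: (S') hin => //= q S3 IH3; rewrite inE => /predU1P[->|/IH3[nu]]; [exists q; [left|]|exists nu; [right|]].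
 by apply: hb; rewrite (natsig_inj _ _ e) //; apply: hs; [left|right].
set dl : R := (dimn (natsig m l))%:R.
have dl0 : dl != 0 by rewrite pnatr_eq0 -lt0n dimn_gt0.
pose p ms := pr k1 k2 l (unsig m ms) / (dimn ms)%:R.
pose a ms : R := p ms - (count_mem ms ds)%:R / dl.
pose ls := undup (mS ++ ds).
have lsok ms : ms \in ls -> size ms = k2 /\ sdec ms.
 rewrite mem_undup mem_cat => /orP[/hmS[nu hnu ->]|]; last exact: hds.
 have g := pS' nu hnu; split; first by rewrite size_natsig; case: g.
 exact: natsig_sdec g (hSm nu hnu).
have p0 ms : ms \in ls -> ms \notin mS -> p ms = 0.
 move=> /lsok[h1 h2] h3; rewrite /p h0 ?mul0r //; first exact: unsig_isGT.
 by move=> hin; case/negP: h3; rewrite -(unsigK m ms) inmS.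
have az : forall ms, ms \in ls -> a ms = 0.
 apply: (@gtsum_indep _ k2 ls a (undup_uniq _) lsok) => x hx.
 have hxnz i : (i < k2)%coq_nat -> RtoC (x i) <> RtoC 0.
  by move=> hi /RtoC_inj_ e; have := hx i ltac:(lia); rewrite e ltxx.
 have hxnz' i : (i < k2)%N -> RtoC (x i) <> RtoC 0 by move=> hi; apply: hxnz; lia.
 have := hS (fun i => RtoC (x i)) hxnz.
 have padnz i : (i < k1)%N -> pad k2 (fun i => RtoC (x i)) i <> RtoC 0.
  move=> _; rewrite /pad; case: Nat.ltb_spec0 => hi; first exact: hxnz.
  exact: ones_nz.
 rewrite (schurE hl hsl padnz) (schur_ones hl hsl).
 have -> : lval k1 (pat m k1 (natsig m l)) (pad k2 (fun i => RtoC (x i))) = \sum_(ms <- ds) RtoC ((\prod_(j < k2) (x j)^-1 ^+ m) * gtsum x k2 ms).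
  rewrite -{1 2}(subnKC hk) lval_pad ?subnKC //; last by rewrite size_natsig; case: hl.
  by bigr => ms _; rewrite lval_real.
 have -> : sumC S (fun nu => Cdiv (Cmult (RtoC (pr k1 k2 l nu)) (schur nu (fun i => RtoC (x i)))) (schur nu ones)) =
   \sum_(ms <- mS) RtoC ((\prod_(j < k2) (x j)^-1 ^+ m) * (p ms * gtsum x k2 ms)).
  rewrite big_map -sumC_big; apply: sumC_ext => nu hnu.
  have g := pS' nu hnu; have s := hSm nu hnu.
  rewrite (schurE g s hxnz') (schur_ones g s) lval_real // /p natsigK //.
  have d0 : (dimn (natsig m nu))%:R != 0 :> R by rewrite pnatr_eq0 -lt0n dimn_gt0 // (natsig_sdec g).
  exact: ratio_RtoC.
 have einv : Cinv (RtoC dl) = RtoC dl^-1 by rewrite -RtoC_inv; apply/eqP.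
 rewrite -!rmorph_sum /Cdiv einv -[X in X = _]/(RtoC _ * RtoC _) -rmorphM => /RtoC_inj_.
 rewrite -!mulr_sumr -mulrA => /mulfI e.
 have {}e := e ltac:(by apply/prodf_neq0 => j _; rewrite expf_neq0 // invr_eq0 gt_eqF // hx).
 under eq_bigr => ms _ do rewrite mulrBl.
 rewrite sumrB; apply/eqP; rewrite subr_eq0; apply/eqP.
 transitivity (\sum_(ms <- mS) p ms * gtsum x k2 ms).
  rewrite (bigID (mem mS)) /= [X in _ + X]big_seq_cond [X in _ + X]big1 ?addr0 => [|ms /andP[h1 h2]]; last by rewrite p0 ?mul0r.
  rewrite -big_filter; apply: perm_big; apply: uniq_perm; rewrite ?filter_uniq ?undup_uniq // => ms.
  by rewrite mem_filter mem_undup mem_cat; case: (ms \in mS).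
 rewrite -e mulr_suml [RHS](eq_bigr (fun ms => \sum_(d <- ds | d == ms) gtsum x k2 d / dl)) => [|ms _]; last first.
  rewrite -big_filter (eq_big_seq (fun=> gtsum x k2 ms / dl)); last by move=> d; rewrite mem_filter => /andP[/eqP->].
  rewrite big_const_seq count_predT size_filter iter_addr; ring.
 under [RHS]eq_bigr => ms _ do rewrite big_mkcond.
 rewrite exchange_big; apply: eq_big_seq => d hd.
 have hin : d \in ls by rewrite mem_undup mem_cat hd orbT.
 rewrite (bigD1_seq _ hin (undup_uniq _)) /= eqxx big1 ?addr0 // => ms.
 by rewrite eq_sym => /negPf->.
set nm := natsig m mu.
have dm0 : (dimn nm)%:R != 0 :> R by rewrite pnatr_eq0 -lt0n dimn_gt0 // (natsig_sdec hmu).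
have : a nm = 0.
 have [/az//|] := boolP (nm \in ls); rewrite mem_undup mem_cat negb_or => /andP[h1 h2].
 rewrite /a /p natsigK // h0 ?(count_memPn h2) ?mul0r ?subrr //.
 by move=> /inmS; apply/negP.
rewrite /a /p natsigK // => /eqP; rewrite subr_eq0 => /eqP e.
by rewrite -[LHS](divfK dm0) e; ring.
Qed.

(** A common shift of all parts preserves multiplicities and dimensions, so the restriction to large
    [m] disappears. *)
Theorem pr_value k1 k2 l mu m : (k2 <= k1)%N -> isGT k1 l -> isGT k2 mu -> shifted m l -> shifted m mu ->
 pr k1 k2 l mu = (count_mem (natsig m mu) (desc (k1 - k2) (natsig m l)))%:R * (dimn (natsig m mu))%:R / (dimn (natsig m l))%:R.
move=> hk hl hmu hs hs'; have [m0 h] := pr_value_big hk hl hmu.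
rewrite (h (m + m0)%N (leq_addl _ _) (shiftedW (d := _) hs) (shiftedW (d := _) hs')) !natsig_shift // !dimn_shift desc_shift count_map; congr (_%:R * _ / _).
apply: eq_count => s; apply: inj_eq; apply: inj_map; exact: addnI.
Qed.

(** The parts of a reachable [mu] are bounded below by those of the source, so the same shift [m]
    serves it; a larger auxiliary shift [m + d] is used to see this. *)
Theorem pr_support k1 k2 l mu m : (k2 <= k1)%N -> isGT k1 l -> isGT k2 mu -> shifted m l ->
 pr k1 k2 l mu <> 0 -> shifted m mu /\ natsig m mu \in desc (k1 - k2) (natsig m l).
move=> hk hl hmu hs hp.
suff hsm : shifted m mu.
 split=> //; apply/negPn/negP => hn; apply: hp.
 by rewrite (pr_value hk hl hmu hs hsm) (count_memPn hn) !mul0r.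
have [d hd] := shifted_ex mu.
have hs1 := shiftedW (d := d) hs; have hs2 : shifted (m + d) mu by apply: hd; lia.
have hin : natsig (m + d) mu \in desc (k1 - k2) (natsig (m + d) l).
 apply/negPn/negP => hn; apply: hp.
 by rewrite (pr_value hk hl hmu hs1 hs2) (count_memPn hn) !mul0r.
have dsd := natsig_sdec hl hs1.
have hrg : rg d (\sum_(a <- natsig (m + d) l) a) (natsig (m + d) l).
 apply/allP => a ha; rewrite (big_rem a) //= leq_addr andbT.
 by move: ha; rewrite natsig_shift // => /mapP[b _ ->]; apply: leq_addr.
have [h1 h2 h3] := desc_spec hin dsd hrg.
move=> j hj; have hj' : (j < length mu)%N by lia.
have := rg_nth h3 (j := j); rewrite size_natsig => /(_ hj') /andP[h4 _].
have := nth_natsig hs2 hj'; lia.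
Qed.
End Kernel.

Lemma RltP_ (x y : R) : x < y -> (x < y)%coqR. by move/RltP. Qed.

(** * Size of a signature and exponential moments *)

Definition amp (l : list Z) : nat := foldr (fun z a => maxn (Z.abs_nat z) a) 0%N l.

Lemma amp_nth l j : (Z.abs_nat (List.nth j l 0%coqZ) <= amp l)%N.
by elim: l j => [|a l IH] [|j] //=; rewrite leq_max ?leqnn // IH orbT. Qed.

Lemma amp_le l B : (forall j, (j < length l)%N -> (Z.abs_nat (List.nth j l 0%coqZ) <= B)%N) -> (amp l <= B)%N.
elim: l => [|a l IH] // h; rewrite geq_max (h 0%N) //=.
by apply: IH => j hj; apply: (h j.+1).
Qed.

Lemma amp_shifted l : shifted (amp l) l.
by move=> j hj; have := amp_nth l j; lia. Qed.

Lemma isGT_le M l i j : isGT M l -> (i <= j < M)%N -> (List.nth j l 0 <= List.nth i l 0)%coqZ.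
move=> [_ h]; elim: j => [|j IH] hij; first by rewrite (_ : i = 0%N); lia.
have [e|ne] := eqVneq i j.+1; first by rewrite e; lia.
have h2 := h j ltac:(lia); lia.
Qed.

Lemma amp_GT M l : isGT M.+1 l -> Z.of_nat (amp l) = List.nth 0 l 0%coqZ \/ Z.of_nat (amp l) = (- List.nth M l 0)%coqZ.
move=> hl; have [len _] := hl.
have h1 := amp_nth l 0; have h2 := amp_nth l M.
have h3 : (amp l <= maxn (Z.abs_nat (List.nth 0 l 0%coqZ)) (Z.abs_nat (List.nth M l 0%coqZ)))%N.
 apply: amp_le => j; rewrite len => hj.
 have := @isGT_le _ l 0 j hl ltac:(lia); have := @isGT_le _ l j M hl ltac:(lia); lia.
have := @isGT_le _ l 0 M hl ltac:(lia); lia.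
Qed.

Definition sgn_ (l : list Z) : seq nat := natsig (amp l) l.
Notation sg := sgn_.

Lemma size_sg l : size (sg l) = length l. exact: size_natsig. Qed.
Lemma sg_sdec M l : isGT M l -> sdec (sg l).
by move=> h; apply: natsig_sdec h (@amp_shifted l). Qed.
Lemma sg_ends M l : isGT M.+1 l -> let v i := nth 0%N (sg l) i in let w i := List.nth i l 0%coqZ in
 [/\ Z.of_nat (v 0%N) = (w 0%N + Z.of_nat (amp l + M))%coqZ, Z.of_nat (v M) = (w M + Z.of_nat (amp l))%coqZ,
  (Z.abs_nat (w 0%N) <= amp l)%N & (Z.abs_nat (w M) <= amp l)%N].
move=> [len _]; split; try exact: amp_nth.
 have := @nth_natsig (amp l) l 0 (@amp_shifted l) ltac:(rewrite len); rewrite -/(sg l); lia.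
have := @nth_natsig (amp l) l M (@amp_shifted l) ltac:(rewrite len); rewrite -/(sg l); lia.
Qed.
Lemma sg_rg M l : isGT M.+1 l -> rg (nth 0%N (sg l) M) (nth 0%N (sg l) 0) (sg l).
move=> hl; have sd := sg_sdec hl; have [len _] := hl; apply/all_nthP => j; rewrite size_sg => hj.
apply/andP; split.
 have [->//|ne] := eqVneq j M; apply: ltnW; apply: (sdec_nth sd); rewrite size_sg; lia.
have [->//|ne] := eqVneq j 0%N; apply: ltnW; apply: (sdec_nth sd); rewrite size_sg; lia.
Qed.

Lemma sg_amp M l a : isGT M.+1 l -> (nth 0%N (sg l) M <= a <= nth 0%N (sg l) 0)%N ->
 `|a%:R - (amp l)%:R : R| <= (amp l + M)%:R.
move=> /sg_ends[h0 h1 a0 a1] ha.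
have hb : (a <= amp l + (amp l + M))%N /\ (amp l <= a + (amp l + M))%N by split; lia.
case: hb => hb1 hb2; rewrite ler_norml; apply/andP; split.
 by rewrite lerBrDl lerBlDr -natrD ler_nat.
by rewrite lerBlDl -natrD ler_nat.
Qed.

Lemma mem_prodseq rs ms : size ms = size rs -> (forall j, (j < size rs)%N -> nth 0%N ms j \in nth [::] rs j) ->
 ms \in prodseq rs.
elim: rs ms => [|r rs IH] [|a ms] // [e] h.
apply/allpairsP; exists (a, ms); split => //; first exact: (h 0%N).
by apply: IH => // j hj; apply: (h j.+1).
Qed.

Lemma mem_below l ms : size ms = (size l).-1 ->
 (forall j, (j.+1 < size l)%N -> (nth 0 l j.+1 <= nth 0 ms j < nth 0 l j)%N) -> ms \in below l.
move=> sm h; apply: mem_prodseq; rewrite size_ranges // => j hj.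
have hj' : (j.+1 < size l)%N by lia.
rewrite nth_ranges // mem_iota; have := h j hj'; lia.
Qed.

Lemma desc_bot l j : sdec l -> (j < size l)%N -> drop j l \in desc j l.
move=> hl; elim: j => [|j IH] hj; first by rewrite drop0 inE.
apply/flatten_mapP; exists (drop j l); first by apply: IH; lia.
apply: mem_below; rewrite ?size_drop; first lia.
move=> i hi; rewrite !nth_drop addSnnS leqnn; apply: sdec_nth; lia.
Qed.

(** The largest descendant: the first parts are lowered by one at each level. With the smallest one
    of [desc_bot] it bounds from below a Schur function in one free variable. *)
Lemma desc_top l j : sdec l -> (j < size l)%N -> exists ms : seq nat, [/\ ms \in desc j l, size ms = (size l - j)%N & nth 0%N ms 0 = (nth 0%N l 0 - j)%N].
move=> hl; elim: j => [|j IH] hj; first by exists l; rewrite inE !subn0.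
have [|ms [h1 h2 h3]] := IH; first lia.
have hrg : rg 0 (\sum_(a <- l) a) l by apply/allP => a ha; rewrite (big_rem a) //= leq_addr.
have [_ sdm _] := desc_spec h1 hl hrg.
exists [seq (nth 0%N ms i).-1 | i <- iota 0 (size ms).-1]; split.
apply/flatten_mapP; exists ms => //.
 apply: mem_below => [|i hi]; first by rewrite size_map size_iota.
 have hi' : (i < (size ms).-1)%N by lia.
 rewrite (nth_map 0%N) ?size_iota ?nth_iota ?add0n //.
 have := @sdec_nth ms i i.+1 sdm; lia.
- rewrite size_map size_iota; lia.
- have s0 : (0 < (size ms).-1)%N by lia.
 rewrite (nth_map 0%N) ?size_iota ?nth_iota // add0n; lia.
Qed.

Lemma size_prodseq_le rs B : all (fun r : seq nat => size r <= B)%N rs -> (size (prodseq rs) <= B ^ size rs)%N.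
elim: rs => [|r rs IH] //= /andP[h1 h2]; rewrite size_allpairs expnS.
by apply: leq_mul => //; apply: IH.
Qed.

(** A pattern has at most the square of [size l] entries, and each takes at most [hi - lo + 1]
    values. *)
Lemma dimn_le lo hi l : sdec l -> rg lo hi l -> (dimn l <= (hi - lo).+1 ^ (size l * size l))%N.
move: {-1}(size l) (erefl (size l)) => n; elim: n l => [|n IH] l sl sd hl.
 by rewrite (size0nil sl).
rewrite -dimn_below.
apply: (@leq_trans (\sum_(ms <- below l) (hi - lo).+1 ^ (n * n))%N).
 rewrite big_seq big_seq; apply: leq_sum => ms hms; apply: IH.
 - by rewrite (size_below hms) sl.
 - exact: below_sdec hms.
 - exact: below_rg hms hl.
rewrite big_const_seq iter_addn_0.
apply: (@leq_trans ((hi - lo).+1 ^ (n * n) * (hi - lo).+1 ^ n)%N); last by rewrite -expnD leq_pexp2l; lia.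
rewrite leq_mul2l; apply/orP; right.
have -> : n = size (ranges l) by rewrite size_ranges sl.
apply: size_prodseq_le; apply/(all_nthP [::]) => j; rewrite size_ranges sl => hj.
rewrite nth_ranges ?sl // size_iota.
have h1 := @rg_nth lo hi l j hl ltac:(lia); have h2 := @rg_nth lo hi l j.+1 hl ltac:(lia); lia.
Qed.

Section Weights.
Variables (M : nat) (rho : list Z -> R).
Hypothesis Hrho : is_prob_GT M.+1 rho.
Variable F : (nat -> C) -> C.
Hypothesis HF : is_SGF M.+1 rho F.
Notation ok := (isGT M.+1).
(** Mass divided by dimension: the generating function is the sum of these weights times
    unnormalised Schur functions. *)
Definition wt (l : list Z) : R := rho l / (dimn (sg l))%:R.

Lemma dimR_gt0 l : ok l -> 0 < (dimn (sg l))%:R :> R.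
by move=> hl; rewrite ltr0n dimn_gt0 // (sg_sdec hl). Qed.

Lemma wt_ge0 l : ok l -> 0 <= wt l.
move=> hl; rewrite divr_ge0 //.
by apply/RleP; apply: (proj1 Hrho).
Qed.

Lemma schur_ratioE l x : ok l -> (forall i, (i < M.+1)%N -> x i <> RtoC 0) ->
 Cdiv (Cmult (RtoC (rho l)) (schur l x)) (schur l ones) = RtoC (wt l) * lval M.+1 (pat (amp l) M.+1 (sg l)) x.
move=> hl hx; have hs := @amp_shifted l.
rewrite (schurE hl hs hx) (schur_ones hl hs) -/sg.
have d0 := lt0r_neq0 (dimR_gt0 hl).
rewrite /Cdiv -RtoC_inv; last by apply/eqP.
by rewrite rmorphM; exact: mulrAC.
Qed.

Definition xpt (t : R) : nat -> C := pad 1 (fun=> RtoC t).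
Definition Vt (t : R) (l : list Z) : R := \sum_(ms <- desc M (sg l)) t^-1 ^+ amp l * t ^+ nth 0%N ms 0.

Lemma xpt_nz t i : 0 < t -> xpt t i <> RtoC 0.
move=> t0; rewrite /xpt /pad; case: ifP => _ /RtoC_inj_ e; last exact: R1_neq_R0.
by rewrite e ltxx in t0.
Qed.

Lemma lval_xpt t l : 0 < t -> ok l -> lval M.+1 (pat (amp l) M.+1 (sg l)) (xpt t) = RtoC (Vt t l).
move=> t0 hl; have [len _] := hl.
have ss : size (sg l) = (1 + M)%N by rewrite size_sg.
rewrite -[M.+1]/(1 + M)%N lval_pad // => [|i _]; last first.
 by move=> /RtoC_inj_ e; rewrite e ltxx in t0.
rewrite rmorph_sum; apply: eq_big_seq => ms hms.
rewrite lval_real => [|] //; rewrite big_ord1; congr RtoC.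
have [s1 _ _] := desc_spec hms (sg_sdec hl) (sg_rg hl).
case: ms s1 {hms} => [|a [|]]; rewrite ss addnK // => _.
by rewrite /gtsum /= big_seq1 big_ord1 !subn0 addn0.
Qed.

Lemma Vt_ge t l a : 0 < t -> (exists2 ms : seq nat, is_true (ms \in desc M (sg l)) & nth 0%N ms 0 = a) ->
 t^-1 ^+ amp l * t ^+ a <= Vt t l.
move=> t0 [ms hms <-]; rewrite /Vt (big_rem ms) //= lerDl; apply: sumr_ge0 => m _.
by apply: mulr_ge0; apply: exprn_ge0; rewrite ?invr_ge0 ltW.
Qed.

(** Either the first part equals [amp l] and the largest descendant contributes [t^(amp l)], or the
    last part equals [- amp l] and the smallest one does so at [1/t]. *)
Lemma amp_Vt t l : 1 < t -> ok l -> t ^+ amp l <= Vt t l + Vt t^-1 l.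
move=> t1 hl; have t0 : 0 < t by apply: lt_trans.
have [len _] := hl; have sd := sg_sdec hl.
have ss : (M < size (sg l))%N by rewrite size_sg len.
have ge0 u : 0 < u -> 0 <= Vt u l.
 by move=> u0; apply: sumr_ge0 => m _; apply: mulr_ge0; apply: exprn_ge0; rewrite ?invr_ge0 ltW.
have [h0 h1 _ _] := sg_ends hl.
case: (amp_GT hl) => e.
 have [ms [m1 m2 m3]] := desc_top sd ss.
 apply: (@le_trans _ _ (Vt t l)); last by rewrite lerDl; apply: ge0; rewrite invr_gt0.
 have e2 : nth 0%N ms 0 = (amp l + amp l)%N by rewrite m3; lia.
 have := @Vt_ge t l _ t0 (ex_intro2 _ _ ms m1 e2).
 by rewrite exprD mulrA -exprMn mulVf ?gt_eqF // expr1n mul1r.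
apply: (@le_trans _ _ (Vt t^-1 l)); last by rewrite lerDr; apply: ge0.
have t0' : 0 < t^-1 by rewrite invr_gt0.
have e2 : nth 0%N (drop M (sg l)) 0 = 0%N by rewrite nth_drop addn0; lia.
have := @Vt_ge t^-1 l _ t0' (ex_intro2 _ _ (drop M (sg l)) (desc_bot sd ss) e2).
by rewrite invrK mulr1.
Qed.

Lemma nearN_xpt r t : (0 < r)%coqR -> (Rabs (t - 1) < r)%coqR -> nearN M.+1 r (xpt t).
move=> r0 h i _; rewrite /xpt /pad; case: ifP => _.
 by rewrite -RtoC_minus Cmod_R.
by rewrite -RtoC_minus Rminus_diag Cmod_R Rabs_R0.
Qed.

(** At [(t,1,...,1)] and [(1/t,1,...,1)] the generating function has nonnegative terms; its
    convergence at both points dominates [wt l * q ^+ amp l] with [q = t], by [amp_Vt]. *)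
Theorem sum_exp : exists q : R, 1 < q /\ exists v, has_sum_on ok (fun l => wt l * q ^+ amp l) v.
have [r [r0 hr]] := HF.
have key t : 0 < t -> (Rabs (t - 1) < r)%coqR -> has_sum_on ok (fun l => wt l * Vt t l) (Complex.Re (F (xpt t))).
 move=> t0 ht.
 have h : hsC ok (fun l => Cdiv (Cmult (RtoC (rho l)) (schur l (xpt t))) (schur l ones)) (F (xpt t)).
  apply: hsC_net => e he; have [F0 [n0 [p0 h]]] := hr e he; exists F0; split=> //; split=> // F1 n1 p1 i1.
  exact: h (nearN_xpt r0 ht).
 apply: (hs_ext _ _ _ _ _ (proj1 h)) => l hl.
 rewrite schur_ratioE // => [|i _]; last exact: xpt_nz.
 by rewrite lval_xpt // -rmorphM.
(* Chosen so that both [1 + s] and its inverse lie within [r] of 1. *)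
pose s := (Rmin r 1 / 2)%coqR; pose t := (1 + s)%coqR.
have s0 : (0 < s)%coqR by rewrite /s; have := Rmin_glb_lt r 1 0 r0 Rlt_0_1; Lra.lra.
have sr : (s < r)%coqR by rewrite /s; have := Rmin_l r 1; Lra.lra.
have t1 : 1 < t by apply/RltP; rewrite /t -[GRing.one _]/1%coqR; Lra.lra.
have t0 : 0 < t by apply: lt_trans.
exists t; split=> //.
have h1 := key t t0 ltac:(rewrite /t Rabs_pos_eq; Lra.lra).
have h2 : has_sum_on ok (fun l => wt l * Vt t^-1 l) (Complex.Re (F (xpt t^-1))).
 apply: key; first by rewrite invr_gt0.
 rewrite -RinvE.
 by apply: Rabs_inv_sub1.
have := hs_plus _ _ _ _ _ h1 h2; set w := Rplus _ _ => hw.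
apply: (hs_dom _ _ _ w _ hw) => l hl; apply/RleP.
have w0 := wt_ge0 hl.
rewrite RabsE ger0_norm; last by rewrite mulr_ge0 // exprn_ge0 // ltW.
by rewrite -[leRHS]/(wt l * Vt t l + wt l * Vt t^-1 l) -mulrDr; apply: ler_wpM2l => //; apply: amp_Vt.
Qed.

(** Of the growth [q = t * t], one factor [t ^+ amp l] absorbs the dimension and the polynomial; the
    other is left to the caller, and termwise differentiation will consume it. *)
Theorem sum_dom_exp : exists t : R, 1 < t /\ forall (f : list Z -> R) (C0 p : nat),
 (forall l, ok l -> `|f l| <= wt l * dimK R (sg l) * ((C0 * (amp l + M).+1 ^ p)%:R * t ^+ amp l)) ->
 exists v, has_sum_on ok f v.
have [q [q1 [v hv]]] := sum_exp.
pose t := Num.sqrt q; have t2 : t * t = q by rewrite -expr2 sqr_sqrtr // ltW // (lt_trans _ q1).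
have t1 : 1 < t by rewrite -sqrtr1 ltr_sqrt // (lt_trans _ q1).
exists t; split=> // f C0 p h.
have [K [K0 hK]] := poly_exp ((M.+1 * M.+1) + p) t (RltP_ t1).
pose c : R := C0%:R * (2 * M + 2)%:R ^+ (M.+1 * M.+1) * M.+1%:R ^+ p * K.
have hc := hs_scal _ c _ _ hv.
apply: (hs_dom _ _ _ _ _ hc) => l hl; apply/RleP.
apply: (le_trans (h l hl)); rewrite -[leRHS]/(c * (wt l * q ^+ amp l)) -mulrA [leRHS]mulrCA.
apply: ler_wpM2l; first exact: wt_ge0.
have [len _] := hl.
have hd : (dimn (sg l) <= ((2 * M + 2) * (amp l).+1) ^ (M.+1 * M.+1))%N.
 apply: (leq_trans (dimn_le (sg_sdec hl) (sg_rg hl))); rewrite size_sg len leq_exp2r //.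
 have [h0 h1 a0 a1] := sg_ends hl; nia.
have hp : ((amp l + M).+1 ^ p <= (M.+1 * (amp l).+1) ^ p)%N by apply: leq_exp2r_le; nia.
have ta : 0 <= t ^+ amp l by rewrite exprn_ge0 // sqrtr_ge0.
apply: (@le_trans _ _ ((((2 * M + 2) * (amp l).+1) ^ (M.+1 * M.+1))%:R * ((C0 * (M.+1 * (amp l).+1) ^ p)%:R * t ^+ amp l))).
 apply: ler_pM => //; first by rewrite mulr_ge0.
  by rewrite ler_nat.
 by apply: ler_wpM2r => //; rewrite ler_nat leq_mul2l hp orbT.
have hk : ((amp l).+1%:R : R) ^+ (M.+1 * M.+1 + p) <= K * t ^+ amp l.
 have := hK (amp l); rewrite -S_INR INRE RpowE => /RleP; by rewrite RpowE.
rewrite -t2 exprMn !natrM !natrX !natrM !exprMn.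
have gen (a b d e x y z w : R) : z * w <= e * y -> 0 <= a * b * d -> 0 <= y ->
  a * z * (b * (d * w) * y) <= b * a * d * e * (y * y).
 move=> h1 h2 h3; have -> : a * z * (b * (d * w) * y) = a * b * d * (z * w) * y by ring.
 have -> : b * a * d * e * (y * y) = a * b * d * (e * y) * y by ring.
 by apply: ler_wpM2r => //; apply: ler_wpM2l.
apply: gen; [by []|by rewrite -exprD| |by []].
by rewrite !mulr_ge0 ?exprn_ge0.
Qed.

Theorem sum_dom (f : list Z -> R) (C0 p : nat) :
 (forall l, ok l -> `|f l| <= wt l * dimK R (sg l) * (C0 * (amp l + M).+1 ^ p)%:R) -> exists v, has_sum_on ok f v.
have [t [t1 h]] := sum_dom_exp => hf; apply: (h f C0 p) => l hl; apply: (le_trans (hf l hl)).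
apply: ler_wpM2l; first by rewrite mulr_ge0 ?wt_ge0.
by rewrite ler_peMr // exprn_ege1 // ltW.
Qed.
End Weights.

(** * The germ of the generating function and of its logarithm *)

Lemma ldiffs_map idx p : ldiffs idx p = [seq foldr ldiff1 m idx | m <- p].
elim: idx => [|i idx IH] /=; first by rewrite map_id.
by rewrite IH /ldiff -[List.map _ _]/([seq ldiff1 i m | m <- [seq foldr ldiff1 m idx | m <- p]]) -map_comp.
Qed.

Lemma foldr_ldiff1 n (m : lmon) idx : all (fun i => i < n)%N idx ->
 (foldr ldiff1 m idx).1 = m.1 * \prod_(j < n) ff (IZR (m.2 j)) (count_mem (j : nat) idx) /\
 forall j, (foldr ldiff1 m idx).2 j = (m.2 j - Z.of_nat (count_mem j idx))%coqZ.
elim: idx => [|i idx IH] /= => [_|/andP[hi /IH[h1 h2]]].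
 split; last by move=> j; lia.
 by rewrite big1 ?mulr1 // => j _; rewrite /ff big_ord0.
split; last first.
 move=> j; rewrite h2; case: Nat.eqb_spec => [->|ne]; first by rewrite eqxx Nat2Z.inj_succ Z.sub_add_distr.
 by case: eqP => [e|_]; [lia|].
rewrite h1 RmultE -mulrA; congr (_ * _).
rewrite (bigD1 (Ordinal hi)) //= [RHS](bigD1 (Ordinal hi)) //= eqxx ffS h2 mulrAC; congr (_ * _ * _).
 by rewrite minus_IZR -INR_IZR_INZ INRE.
by bigr => j; rewrite -val_eqE eq_sym => /negPf->.
Qed.

Lemma IZR_sub_nat a m : IZR (Z.of_nat a - Z.of_nat m)%coqZ = a%:R - m%:R :> R.
by rewrite minus_IZR -!INR_IZR_INZ !INRE. Qed.

(** Singles out the splitting with everything in the second component; all others have a strictly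
    shorter one, so the recursion for logarithmic jets is well founded. *)
Lemma splits_last (T : Type) (s : seq T) : exists r : seq (seq T * seq T), splits s = rcons r ([::], s) /\
 forall P : seq T * seq T -> Prop, (forall p, (size p.2 < size s)%N -> P p) -> forall p, List.In p r -> P p.
elim: s => [|x s [r [e h]]]; first by exists [::].
exists ([seq (x :: p.1, p.2) | p <- splits s] ++ [seq (p.1, x :: p.2) | p <- r]); split.
 by rewrite /= {2}e map_rcons rcons_cat.
move=> P hP p /List.in_app_iff [/List.in_map_iff[q [<- hq]]|/List.in_map_iff[q [<- hq]]]; apply: hP => /=.
 move: hq; rewrite e -cats1 => /List.in_app_iff [hq|[<-|//]] //.
 exact: (h (fun q => size q.2 < (size s).+1)%N (fun q hq => ltnW hq)).
exact: (h (fun q => size q.2 < size s)%N).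
Qed.

Lemma splitsLE (T : Type) (s : seq T) : splitsL s = splits s.
by []. Qed.

Section Germ.
Variables (N D Q : nat) (rho : list Z -> R) (F : (nat -> C) -> C).
Hypothesis DQ : (D <= Q)%N.
Hypothesis Hrho : is_prob_GT N.+1 rho.
Hypothesis HF : is_SGF N.+1 rho F.
Notation ok := (isGT N.+1).
Notation wt := (wt rho).
Notation S := (has_sum_on ok).

(** The terms of the generating function as Laurent polynomials, for the analytic side; [G] holds
    the same terms as truncated germs. *)
Definition pfam (l : list Z) : list lmon := [seq (wt l, m.2) | m <- pat (amp l) N.+1 (sg l)].
Definition G (l : list Z) : {mpoly R[N.+1]} := wt l *: TS R N Q N.+1 (amp l) (sg l).

Lemma lval_pfam l x : lval N.+1 (pfam l) x = RtoC (wt l) * lval N.+1 (pat (amp l) N.+1 (sg l)) x.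
rewrite /lval !sumC_big !big_map mulr_sumr; bigr => w _.
by rewrite Cmult_1_l.
Qed.

Lemma repr_pfam : exists r0, (0 < r0)%coqR /\ forall r, (0 < r < 1)%coqR -> (r <= r0)%coqR -> repr ok N.+1 r F pfam.
have [r0 [r00 hr]] := HF; exists r0; split=> // r hr1 hr0 x [hx hx'].
apply: hsC_net => e he; have [F0 [n0 [p0 h]]] := hr e he; exists F0; split=> //; split=> // F1 n1 p1 i1.
have hxx : nearN N.+1 r0 x by move=> i hi; apply: Rlt_le_trans (hx i hi) hr0.
have := h F1 n1 p1 i1 x hxx.
rewrite (sumC_ext F1 _ (fun l => lval N.+1 (pfam l) x)) // => l hl.
have hl' : ok l by move/List.Forall_forall: p1; apply.
rewrite (@schur_ratioE N) ?lval_pfam // => i hi e0.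
have := hx i ltac:(lia); rewrite e0 -RtoC_minus Cmod_R Rminus_0_l Rabs_Ropp Rabs_R1; Lra.lra.
Qed.

Lemma gts_amp l w j : ok l -> w \in gts N.+1 (sg l) -> (j < N.+1)%N ->
 (nth 0%N (sg l) N <= nth 0%N w j <= nth 0%N (sg l) 0)%N.
move=> hl hw hj; have [len _] := hl.
have ss : size (sg l) = N.+1 by rewrite size_sg.
have := gts_rg ss (sg_rg hl) hw => /allP; apply.
by apply: mem_nth; rewrite (size_gts hw).
Qed.

Lemma nrm_pfam t l : 1 <= t -> ok l -> nrm N.+1 t (pfam l) <= wt l * dimK R (sg l) * (t ^+ N.+1) ^+ (amp l + N).
move=> t1 hl; have [len _] := hl; rewrite /nrm sumR_big /pfam -map_comp big_map.
rewrite (eq_bigr (fun w : seq nat => wt l * prodR (List.seq 0 N.+1) (fun j => (t ^ Z.abs_nat (Z.of_nat (nth 0%N w j) - Z.of_nat (amp l)))%coqR))); last first.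
 by move=> w _; rewrite RabsE ger0_norm // (wt_ge0 Hrho).
rewrite -mulr_sumr -mulrA; apply: ler_wpM2l; first exact: (wt_ge0 Hrho).
have -> : dimK R (sg l) = \sum_(w <- gts N.+1 (sg l)) 1.
 by rewrite big_const_seq iter_addr addr0 /dimK /dimn size_sg len.
rewrite mulr_suml big_seq big_seq; apply: ler_sum => w hw; rewrite mul1r prodR_big.
have -> : (t ^+ N.+1) ^+ (amp l + N) = \prod_(j <- List.seq 0 N.+1) t ^+ (amp l + N).
 by rewrite big_const_seq count_predT seqE size_iota -exprM mulnC exprM; elim: N.+1 => //= n <-; rewrite exprS.
rewrite seqE big_seq big_seq; apply: ler_prod => j; rewrite mem_iota => /andP[_ hj].
rewrite RpowE exprn_ge0 ?(le_trans _ t1) //=; apply: ler_weXn2l => //.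
have [h0 h1 a0 a1] := sg_ends hl.
by have := gts_amp (j := j) hl hw hj; lia.
Qed.

(** An exponent of a pattern differs from [amp l] by at most [amp l + N], so the [N.+1] variables
    cost the power [amp l + N] of [R2 ^+ N.+1], which has to stay below the spare factor [t]. *)
Lemma Sm_pfam : exists t, 1 < t /\ forall R2 : R, 1 < R2 -> R2 ^+ N.+1 <= t -> Sm ok N.+1 R2 pfam.
have [t [t1 h]] := sum_dom_exp Hrho HF; exists t; split=> // R2 r1 r2.
have t0 : 0 <= t ^+ N by rewrite exprn_ge0 // ltW // (lt_trans _ t1).
pose c := Num.bound (t ^+ N).
apply: (h _ c 0%N) => l hl.
have n0 : 0 <= nrm N.+1 R2 (pfam l).
 by apply/RleP; apply: nrm_ge0; apply/RleP; rewrite ltW // (lt_trans _ r1).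
rewrite ger0_norm //; apply: (le_trans (nrm_pfam (ltW r1) hl)).
apply: ler_wpM2l; first by rewrite mulr_ge0 ?(wt_ge0 Hrho).
rewrite muln1; apply: (@le_trans _ _ (t ^+ (amp l + N))).
 by apply: lerXn2r => //; rewrite nnegrE ?exprn_ge0 // ltW ?(lt_trans _ r1) // (lt_trans _ t1).
rewrite addnC exprD; apply: ler_wpM2r; first by rewrite exprn_ge0 // ltW // (lt_trans _ t1).
by apply: ltW; have := archi_boundP t0.
Qed.

Lemma djet_G idx l : ok l -> all (fun i => i < N.+1)%N idx -> (size idx <= Q)%N ->
 djet idx (G l) = sumR (ldiffs idx (pfam l)) fst.
move=> hl hi hs; rewrite sumR_big ldiffs_map big_map /pfam -map_comp big_map.
have dD p q : djet idx (p + q : {mpoly R[N.+1]}) = djet idx p + djet idx q.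
 by rewrite /djet -[p]scale1r foldr_dY_linear !scale1r mcoeffD.
have d0 : djet idx (0 : {mpoly R[N.+1]}) = 0.
 by apply: (addrI (djet idx (0 : {mpoly R[N.+1]}))); rewrite -dD !addr0.
have dz c p : djet idx (c *: p : {mpoly R[N.+1]}) = c * djet idx p.
 by rewrite -[c *: p]addr0 /djet foldr_dY_linear mcoeffD mcoeffZ -/(djet idx 0) d0 addr0.
rewrite dz.
have -> : djet idx (\sum_(w <- gts N.+1 (sg l)) mono R N Q N.+1 (amp l) (nth 0%N w)) =
  \sum_(w <- gts N.+1 (sg l)) djet idx (mono R N Q N.+1 (amp l) (nth 0%N w)).
 by elim: gts => [|w s IH]; rewrite ?big_nil ?big_cons // dD IH.
rewrite mulr_sumr; bigr => w _.
rewrite djet_mono // (proj1 (foldr_ldiff1 _ hi)); congr (_ * _).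
by bigr => j _; rewrite IZR_sub_nat.
Qed.

Lemma G_coef_bound l mu : ok l -> (mdeg mu <= Q)%N ->
 `|(G l)@_mu| <= wt l * dimK R (sg l) * ((mdeg mu).+1 ^ (mdeg mu * N.+1) * (amp l + N).+1 ^ (mdeg mu * N.+1))%:R.
move=> hl hmu; have [len _] := hl.
have h := @GS_coef_bound R N Q _ ok amp (fun l => amp l + N)%N (fun l => nth 0%N (sg l) N) (fun l => nth 0%N (sg l) 0)
 (fun l a hl => @sg_amp N l a hl) N.+1 mu [:: (wt l, sg l)] l (leqnn _) hmu hl.
move: h; rewrite /GS /absst !big_seq1 /= size_sg len eqxx (sg_sdec hl) (sg_rg hl) => /(_ isT isT) h.
apply: (le_trans h); rewrite ger0_norm ?(wt_ge0 Hrho) //; apply: ler_wpM2l.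
 by rewrite mulr_ge0 ?(wt_ge0 Hrho).
by rewrite -natrX ler_nat -expnMn; apply: leq_exp2r_le; nia.
Qed.

Lemma rep_jets idx d f : (size idx <= d)%N -> rep S d.+1 G f ->
 rep S (d.+1 - size idx) (fun l => foldr (@dY R N) (G l) idx) (foldr (@dY R N) f idx).
move=> hs h; elim: idx hs => [|i idx IH] hs; first by [].
apply: (rep_op (@hs_ext _ ok) (@hs_plus _ ok) (@hs_scal _ ok) (hs_zero ok) (T := @dY R N i) _ (IH (ltnW hs))) => p hp.
have := foldr_dY_vanish (idx := [:: i]) hp; rewrite -subnDA addn1; exact.
Qed.

Lemma all_Forall n idx : all (fun i => i < n)%N idx -> List.Forall (fun i => (i < n)%coq_nat) idx.
by elim: idx => [|i s IH]; [|case/andP=> h1 h2; constructor; [lia|apply: IH]]. Qed.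

Lemma incl_all n (s s' : seq nat) : all (fun i => i < n)%N s -> List.incl s' s -> all (fun i => i < n)%N s'.
move=> /allP h hi; elim: s' hi => //= a s' IH hi; apply/andP; split.
 apply: h; have : List.In a s by apply: hi; left.
 by elim: (s) => //= b r IHr [->|/IHr]; rewrite inE ?eqxx // => ->; rewrite orbT.
by apply: IH => b hb; apply: hi; right.
Qed.

(** Both logarithms obey the same recursion. The terms with a shorter list on the logarithm agree by
    induction, and the remaining one has coefficient [F(1,...,1) = 1]. *)
Lemma germ_log_step (f0 : {mpoly R[N.+1]}) (L : (nat -> C) -> C) r idx j :
 all (fun i => i < N.+1)%N (rcons idx j) -> (size idx < D)%N -> ballN N.+1 r ones ->
 (forall x, ballN N.+1 r x -> Cexp (L x) = F x) ->
 (forall i x, (i < N.+1)%coq_nat -> ballN N.+1 r x -> sdiff i L x) ->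
 Dn N.+1 r (size idx).+1 F ->
 (forall idx, all (fun i => i < N.+1)%N idx -> (size idx <= D)%N -> dpart idx F ones = RtoC (djet idx f0)) ->
 f0@_0 = 1 ->
 (forall s, (size s < size idx)%N -> all (fun i => i < N.+1)%N (rcons s j) ->
  dpart (rcons s j) L ones = RtoC (djet (rcons s j) (logt D f0))) ->
 dpart (rcons idx j) L ones = RtoC (djet (rcons idx j) (logt D f0)).
rewrite all_rcons => /andP[hj hall] hs b1 hE sd hD hF f01 IH.
have hj' : (j < N.+1)%coq_nat by lia.
have hv : vanish 1 (f0 - 1).
 by move=> m; rewrite ltnS leqn0 mdeg_eq0 => /eqP->; rewrite mcoeffB mcoeff1 eqxx f01 subrr.
have e1 := dpart_log N.+1 r L F hE sd idx j (all_Forall hall) hj' hD ones b1.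
have e2 := djet_log (D := D) j hv hs.
have er s : s ++ [:: j] = rcons s j by rewrite cats1.
rewrite -[app idx _]/(idx ++ [:: j]) er hF ?size_rcons ?all_rcons ?hj // -e2 in e1.
have [p [ep hp]] := splits_last idx.
rewrite splitsLE ep -cats1 big_cat big_seq1 in e1.
rewrite -/(app p) sumC_app /= in e1.
have e3 : sumC p (fun q => Cmult (dpart q.1 F ones) (dpart (app q.2 [:: j]) L ones)) =
  RtoC (\sum_(q <- p) djet q.1 f0 * djet (rcons q.2 j) (logt D f0)).
 rewrite rmorph_sum -sumC_big; apply: sumC_ext => q hq.
 have [s1 [s2 s3]] : (length q.1 + length q.2 = length idx)%coq_nat /\ List.incl q.1 idx /\ List.incl q.2 idx.
  apply: splitsL_spec; rewrite splitsLE ep -cats1; apply/List.in_app_iff; by left.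
 have hq2 : (size q.2 < size idx)%N by apply: (hp (fun q => size q.2 < size idx)%N).
 rewrite -[app _ _]/(q.2 ++ [:: j]) er IH ?all_rcons ?hj ?(incl_all hall) //.
 have hq1 : (size q.1 <= D)%N by rewrite -!lengthE; move: hs; rewrite -lengthE; lia.
 rewrite hF ?(incl_all hall) //.
 by rewrite rmorphM.
rewrite e3 rmorphD in e1.
have f1 : dpart [::] F ones = RtoC 1 by rewrite hF // /djet f01.
rewrite -/(dpart [::] F) f1 Cmult_1_l Cplus_0_r in e1.
have := addrI _ e1; rewrite -[app _ _]/(idx ++ [:: j]) er => ->.
by rewrite /djet f01 mul1r.
Qed.

Lemma good_radius (rm : R) : (0 < rm)%coqR -> exists R2 R1 r, [/\ (0 < r < 1)%coqR, (r <= rm)%coqR, (1 + r <= R1)%coqR,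
 (/ R1 <= 1 - r)%coqR & [/\ (R1 < R2)%coqR, Sm ok N.+1 R2 pfam, repr ok N.+1 r F pfam & ballN N.+1 r ones]].
move=> rm0; have [r0 [r00 hrep]] := repr_pfam; have [t [t1 hSm]] := Sm_pfam.
have [R2 [R1 [r [[a1 [a2 [a3 [a4 [a5 a6]]]]] a7]]]] := radii N.+1 t (Rmin r0 rm) (RltP_ t1) (Rmin_glb_lt _ _ _ r00 rm0).
exists R2, R1, r; split=> //; first exact: Rle_trans a2 (Rmin_r _ _); split=> //.
- by apply: hSm; [apply/RltP|rewrite -RpowE; apply/RleP].
- exact: hrep r a1 (Rle_trans _ _ _ a2 (Rmin_l _ _)).
- by split=> // i _; rewrite /Cminus Cplus_opp_r Cmod_0; case: a1.
Qed.

(** The expected germ is symmetric because each term is, its constant term is the total mass 1, and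
    its jets are those of [F] because both are the same termwise sums. *)
Theorem germ_ex : exists f0 : {mpoly R[N.+1]}, [/\ rep S D.+1 G f0, f0 \is symmetric, f0@_0 = 1 &
 forall idx, all (fun i => i < N.+1)%N idx -> (size idx <= D)%N ->
  dpart idx F ones = RtoC (djet idx f0)].
have [f hf] : exists f, rep S D.+1 G f.
 apply: rep_ex => m hm; apply: (sum_dom Hrho HF) => l hl; apply: G_coef_bound => //.
 lia.
pose f0 := truncp D.+1 f.
have hf0 : rep S D.+1 G f0.
 by move=> m hm; rewrite truncpE hm; apply: hf.
have f0s : f0 \is symmetric.
 apply: truncp_sym => s m hm.
 have h1 := hf m hm; have h2 := hf [multinom m (s i) | i < N.+1] ltac:(by rewrite mdeg_mperm).
 rewrite mcoeff_sym; apply: hs_uniq h2 _; apply: hs_ext h1 => l hl.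
 have [len _] := hl.
 have /issymP/(_ s) e : G l \is symmetric.
  by apply: rpredZ; apply: TS_symmetric; [rewrite size_sg|exact: sg_sdec hl].
 by rewrite -{1}e mcoeff_sym.
have f01 : f0@_0 = 1.
 apply: hs_uniq; last exact: (proj2 Hrho).
 apply: hs_ext (hf0 0%MM _) => [l hl|]; last by rewrite mdeg0.
 have [len _] := hl.
 rewrite mcoeffZ TS0; have -> : (size (gts N.+1 (sg l)))%:R = (dimn (sg l))%:R :> R by rewrite /dimn size_sg len.
 by rewrite divfK // gt_eqF // (dimR_gt0 hl).
exists f0; split=> // idx hidx hs.
have [R2 [R1 [r [a1 _ a3 a4 [a5 sm hr b1]]]]] := good_radius Rlt_0_1; have hF := all_Forall hidx.
have h := repr_dpart ok N.+1 r R1 a1 a3 a4 R2 F pfam idx hF a5 sm hr ones b1.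
have h2 := rep_jets (d := D) hs hf0 (m := 0%MM).
rewrite mdeg0 subn_gt0 in h2; have {}h2 := h2 hs.
have h3 : hsC ok (fun l => RtoC (sumR (ldiffs idx (pfam l)) fst)) (RtoC (djet idx f0)).
 apply: hsC_RtoC; apply: hs_ext h2 => l hl; rewrite -djet_G //; exact: leq_trans DQ.
apply: hsC_uniq h _; apply: hsC_ext h3 => l _; by rewrite lval_ones.
Qed.

Theorem germ_log (L : (nat -> C) -> C) rL : (0 < rL)%coqR -> holo_on N.+1 rL L ->
 (forall x, ballN N.+1 rL x -> Cexp (L x) = F x) ->
 exists f0 : {mpoly R[N.+1]}, [/\ rep S D.+1 G f0, f0 \is symmetric, f0@_0 = 1 &
 forall idx j, all (fun i => i < N.+1)%N (rcons idx j) -> (size idx < D)%N ->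
  dpart (rcons idx j) L ones = RtoC (djet (rcons idx j) (logt D f0))].
move=> rL0 hL hE; have [f0 [h1 h2 h3 hF]] := germ_ex; exists f0; split=> //.
have [R2 [R1 [r [a1 a2 a3 a4 [a5 sm hr b1]]]]] := good_radius rL0.
have hb x : ballN N.+1 r x -> ballN N.+1 rL x.
 by move=> [c1 c2]; split=> // i hi; apply: Rlt_le_trans (c1 i hi) a2.
have hEr x : ballN N.+1 r x -> Cexp (L x) = F x by move=> hx; apply: hE; apply: hb.
have sd i x : (i < N.+1)%coq_nat -> ballN N.+1 r x -> sdiff i L x.
 by move=> hi hx; have [_] := hL x (hb x hx); apply.
move=> idx j; move: {2}(size idx) (leqnn (size idx)) => n; elim: n idx => [|n IH] idx hn hall hs.
 move: hn; rewrite leqn0 size_eq0 => /eqP e; move: hall hs; rewrite e => {e idx} hall hs.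
 exact: (germ_log_step hall hs b1 hEr sd (repr_Dn ok N.+1 r R1 a1 a3 a4 1 R2 F pfam a5 sm hr) hF h3).
apply: (germ_log_step hall hs b1 hEr sd (repr_Dn ok N.+1 r R1 a1 a3 a4 (size idx).+1 R2 F pfam a5 sm hr) hF h3) => p h h'.
by apply: IH => //; lia.
Qed.
End Germ.

Local Notation lev := Defs.lev.
Local Notation X := (nat * nat)%type.

(** * Power sums in terms of falling powers *)

Fixpoint st2 (k j : nat) : nat :=
 match k, j with
 | 0, 0 => 1
 | k'.+1, j'.+1 => j'.+1 * st2 k' j'.+1 + st2 k' j'
 | _, _ => 0
 end%N.

Lemma st2_gt k j : (k < j)%N -> st2 k j = 0%N.
elim: k j => [|k IH] [|j] //= h; rewrite !IH ?muln0 //; exact: leq_trans.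
Qed.

Lemma st2_diag k : st2 k k = 1%N.
by elim: k => //= k ->; rewrite st2_gt // muln0. Qed.

(** The numbers [st2] are the Stirling numbers of the second kind; their recursion reflects
    [x * ff x j = ff x j.+1 + j * ff x j]. *)
Lemma pow_ff (K : comNzRingType) (x : K) k : x ^+ k = \sum_(j < k.+1) (st2 k j)%:R * ff x j.
elim: k => [|k IH]; first by rewrite big_ord_recl big_ord0 /ff big_ord0 mul1r addr0.
have step j : x * ff x j = ff x j.+1 + j%:R * ff x j by rewrite /ff big_ord_recr /= -/(ff x); move: ff => y; ring.
rewrite exprS IH mulr_sumr (eq_bigr (fun j : 'I_k.+1 => (st2 k j)%:R * ff x j.+1 + (j * st2 k j)%:R * ff x j)); last first.
 by move=> j _; rewrite mulrCA step mulrDr natrM; congr _; rewrite mulrA [_%:R * j%:R]mulrC.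
rewrite big_split /= [X in _ + X]big_ord_recl mul0r add0r [RHS]big_ord_recl mul0r add0r.
have -> : \sum_(i < k) (bump 0 i * st2 k (bump 0 i))%:R * ff x (bump 0 i) = \sum_(i < k.+1) (i.+1 * st2 k i.+1)%:R * ff x i.+1 :> K.
 by rewrite big_ord_recr /= st2_gt // muln0 mul0r addr0.
by rewrite -big_split /=; bigr => j _; rewrite -mulrDl -natrD addnC.
Qed.

Lemma psum_pff k m l : shifted m l -> psum k l = \sum_(j < k.+1) (st2 k j)%:R * pff R m (natsig m l) j.
move=> hs.
have -> : psum k l = \sum_(a <- natsig m l) (a%:R - m%:R) ^+ k.
 rewrite /psum sumR_big big_map -/(length l); apply: eq_big_seq => i.
 rewrite mem_iota => /andP[_ hi]; rewrite RpowE; congr (_ ^+ _).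
 have h := nth_natsig hs hi; have e := congr1 IZR h.
 rewrite (nth_map 0%N) ?size_iota // nth_iota // in e.
 rewrite plus_IZR minus_IZR plus_IZR -!INR_IZR_INZ in e.
 by rewrite -!INRE; symmetry; apply/eqP; rewrite subr_eq; apply/eqP.
rewrite (eq_bigr _ (fun a _ => pow_ff _ k)) exchange_big; bigr => j _.
by rewrite mulr_sumr.
Qed.

Lemma In_mem (T : eqType) (x : T) (s : seq T) : List.In x s <-> x \in s.
elim: s => //= a s IH; rewrite inE; split; first by case=> [->|/IH->]; rewrite ?eqxx ?orbT.
by case/predU1P => [->|/IH]; [left|right].
Qed.

Lemma uniq_NoDup (T : eqType) (s : seq T) : uniq s -> NoDup s.
elim: s => [_|a s IH /andP[h1 h2]]; constructor; last exact: IH.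
by move/In_mem => h; rewrite h in h1.
Qed.

Lemma uniq_flatten_map (T U : eqType) (u : seq T) (f : T -> seq U) (g : U -> T) : uniq u ->
 (forall x, x \in u -> uniq (f x)) -> (forall x c, x \in u -> c \in f x -> g c = x) -> uniq (flatten (map f u)).
elim: u => //= x u IH /andP[hx hu] h1 h2; rewrite cat_uniq h1 ?inE ?eqxx //= IH // ?andbT; first last.
- by move=> y c hy; apply: h2; rewrite inE hy orbT.
- by move=> y hy; apply: h1; rewrite inE hy orbT.
apply/hasPn => c /flatten_mapP[y hy hc]; apply/negP => hc'.
have e1 := h2 x c ltac:(by rewrite inE eqxx) hc'; have e2 := h2 y c ltac:(by rewrite inE hy orbT) hc.
by move: hx; rewrite -e1 e2 hy.
Qed.

(** * Chains of signatures through all levels *)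

Section Chains.
Variable Mf : nat -> nat.
Hypothesis Mf_mono : {homo Mf : a b / (a <= b)%N}.

(** [undup] lists each chain once; multiplicities are carried by [prv], as in the transition
    coefficients. *)
Fixpoint chn (t : nat) (nu : seq nat) : seq (seq (seq nat)) :=
 if t is t'.+1 then
  map (rcons^~ nu) (flatten (map (chn t') (undup (desc (Mf t'.+2 - Mf t'.+1) nu))))
 else [:: [:: nu]].

Lemma desc_ok j nu ms : ms \in desc j nu -> sdec nu -> size ms = (size nu - j)%N /\ sdec ms.
move=> h hd; have hrg : rg 0 (\sum_(a <- nu) a) nu.
 by apply/allP => a ha; rewrite (big_rem a) //= leq_addr.
by have [] := desc_spec h hd hrg.
Qed.

Lemma desc_lvl t nu ms : ms \in desc (Mf t.+2 - Mf t.+1) nu -> size nu = Mf t.+2 -> sdec nu -> size ms = Mf t.+1 /\ sdec ms.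
by move=> h hs hd; have [-> ?] := desc_ok h hd; rewrite hs subKn //; apply: Mf_mono. Qed.

Lemma chn_spec t nu c : size nu = Mf t.+1 -> sdec nu -> c \in chn t nu ->
 [/\ size c = t.+1, nth [::] c t = nu & forall i, (i <= t)%N -> size (nth [::] c i) = Mf i.+1 /\ sdec (nth [::] c i)].
elim: t nu c => [|t IH] nu c hs hd.
 by rewrite inE => /eqP->; split=> // -[|i].
move=> /mapP[c' /flatten_mapP[ms]]; rewrite mem_undup => hms hc' ->.
have [s1 d1] := desc_lvl hms hs hd; have [h1 h2 h3] := IH _ _ s1 d1 hc'.
split; first by rewrite size_rcons h1.
 by rewrite nth_rcons h1 ltnn eqxx.
move=> i hi; rewrite nth_rcons h1; case: ltnP => h4; first exact: h3.
have -> : i = t.+1 by lia.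
by rewrite eqxx.
Qed.

Lemma chn_uniq t nu : size nu = Mf t.+1 -> sdec nu -> uniq (chn t nu).
elim: t nu => [|t IH] nu hs hd //=; rewrite map_inj_uniq; last by move=> x y /rcons_inj[].
apply: (uniq_flatten_map (g := fun c => nth [::] c t)); first exact: undup_uniq.
 by move=> ms; rewrite mem_undup => h; have [? ?] := desc_lvl h hs hd; apply: IH.
by move=> ms c; rewrite mem_undup => h hc; have [s1 d1] := desc_lvl h hs hd; have [_ -> _] := chn_spec s1 d1 hc.
Qed.

Lemma mem_chn t (c : seq (seq nat)) : size c = t.+1 ->
 (forall i, (i < t)%N -> nth [::] c i \in desc (Mf i.+2 - Mf i.+1) (nth [::] c i.+1)) -> c \in chn t (nth [::] c t).
elim: t c => [|t IH] c; first by case: c => [|a [|]] // _ _; rewrite inE.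
case/lastP: c => // c nu; rewrite size_rcons => -[sc] h.
rewrite nth_rcons sc ltnn eqxx; apply/mapP; exists c => //.
apply/flatten_mapP; exists (nth [::] c t).
 by rewrite mem_undup; have := h t (ltnSn t); rewrite !nth_rcons sc ltnSn ltnn eqxx.
apply: IH => // i hi; have := h i (ltnW hi); rewrite !nth_rcons sc.
by rewrite (ltn_trans hi) // ltnS hi.
Qed.

Definition prv (i : nat) (nu ms : seq nat) : R :=
 (count_mem ms (desc (Mf i.+2 - Mf i.+1) nu))%:R * (dimn ms)%:R / (dimn nu)%:R.

Fixpoint WW (g : nat -> seq nat -> R) (t : nat) (nu : seq nat) : R :=
 if t is t'.+1 then g t.+1 nu * \sum_(ms <- desc (Mf t'.+2 - Mf t'.+1) nu) WW g t' ms
 else g 1%N nu * (dimn nu)%:R.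

Lemma sum_undup (T : eqType) (d : seq T) (f : T -> R) :
 \sum_(x <- undup d) (count_mem x d)%:R * f x = \sum_(x <- d) f x.
have := @big_undup_iterop_count R 0 +%R T d xpredT f.
move=> <-; bigr => x _; exact: mulr_natl.
Qed.

(** The dimensions in the transition factors telescope: that of the lowest row is part of [WW], that
    of the top row remains as divisor. *)
Lemma sum_chn g t nu : sdec nu ->
 \sum_(c <- chn t nu) (\prod_(i < t) prv i (nth [::] c i.+1) (nth [::] c i)) * \prod_(i < t.+1) g i.+1 (nth [::] c i)
 = WW g t nu / (dimn nu)%:R.
move: {2}(size nu) (erefl (size nu)) => sz.
elim: t nu sz => [|t IH] nu sz hsz hd.
 by rewrite big_seq1 big_ord0 big_ord1 mul1r mulfK // pnatr_eq0 -lt0n dimn_gt0.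
have szc s ms c : c \in chn s ms -> size c = s.+1 /\ nth [::] c s = ms.
 elim: s ms c => [|s IHs] ms c; first by rewrite inE => /eqP->.
 move=> /mapP[c' /flatten_mapP[ms' _ /IHs[h1 h2]] ->]; rewrite size_rcons.
 by rewrite nth_rcons h1 ltnn eqxx.
rewrite /= big_map big_flatten big_map.
set d := desc _ _.
have -> : WW g t.+1 nu / (dimn nu)%:R = \sum_(ms <- undup d) (count_mem ms d)%:R * (g t.+2 nu * WW g t ms / (dimn nu)%:R).
 by rewrite sum_undup -mulr_suml -mulr_sumr.
apply: eq_big_seq => ms; rewrite mem_undup => hms.
have [_ dms] := desc_ok hms hd.
have dn0 : (dimn ms)%:R != 0 :> R by rewrite pnatr_eq0 -lt0n dimn_gt0.
have := IH ms _ erefl dms; set X := (X in X = _) => e.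
transitivity (prv t nu ms * g t.+2 nu * X).
 rewrite mulr_sumr; apply: eq_big_seq => c hc; have [sc ec] := szc _ _ _ hc.
 rewrite big_ord_recr big_ord_recr /= !nth_rcons sc ltnSn ltnn eqxx ec.
 rewrite (eq_bigr (fun i : 'I_t => prv i (nth [::] c i.+1) (nth [::] c i))) => [|i _]; last first.
  by rewrite !nth_rcons sc !ltnS ltn_ord ltnW.
 rewrite (eq_bigr (fun i : 'I_t.+1 => g i.+1 (nth [::] c i))) => [|i _]; last first.
  by rewrite !nth_rcons sc ltn_ord.
 by rewrite mulrACA mulrC.
have gen (x y z w b : R) : z != 0 -> x * z / y * b * (w / z) = x * (b * w / y).
 by move=> z0; rewrite -[in RHS](divfK z0 w); move: w y^-1 => w' y'; ring.
rewrite e; exact: gen.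
Qed.

Lemma WW_climb (X : Type) (kx : X -> nat) sc (u : R) c (tm : X -> nat) m s t nu :
 WW (fun i => gat kx sc u c tm m i s) t nu = climb kx sc u c Mf tm m s 1 t (dimK R) nu.
pose g i := gat kx sc u c tm m i s.
pose H t := iteri t (fun t h => iter (Mf t.+2 - Mf t.+1) (@dn R) (fun l => g t.+1 l * h l)) (dimK R).
have e1 i l : WW g i l = g i.+1 l * H i l.
 elim: i l => [|i IH] l //=; congr (_ * _); rewrite dn_desc; bigr => ms _; exact: IH.
have e2 j i l : climb kx sc u c Mf tm m s i.+1 j (H i) l = g (i + j).+1 l * H (i + j)%N l.
 elim: j i l => [|j IH] i l; first by rewrite addn0.
 by rewrite addnS -addSn -IH.
by rewrite e1.
Qed.
End Chains.

(** * Tuples over a fixed top signature *)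

Section Tuples.
Variables (n' N : nat) (a : nat -> R) (rho : nat -> list Z -> R) (pr : nat -> nat -> list Z -> list Z -> R).
Notation n := n'.+1.
Hypothesis Hpr : pr_spec pr.
Variable Mf : nat -> nat.
Hypothesis Mf_mono : {homo Mf : a b / (a <= b)%N}.
Hypothesis MfE : forall t, (1 <= t <= n)%N -> lvl a N.+1 t = Mf t.
Hypothesis Mfn : Mf n = N.+1.
Notation ok := (isGT N.+1).
Notation prb := (tuple_prob n a N.+1 rho pr).

(** The finite list that contains all tuples with top [l] and nonzero probability; see
    [fib_cover]. *)
Definition fib (l : list Z) : list (list (list Z)) := [seq map (unsig (amp l)) c | c <- chn Mf n' (sg l)].

Lemma subS1 i : (i.+1 - 1)%coq_nat = i. lia. Qed.

Lemma levE c m i : (i < size c)%N -> lev (map (unsig m) c) i.+1 = unsig m (nth [::] c i).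
rewrite /lev subS1; elim: c i => [|x c IH] [|i] //= h; exact: IH.
Qed.

Lemma sg_top l : ok l -> size (sg l) = Mf n /\ sdec (sg l).
by move=> hl; have [len _] := hl; rewrite size_sg Mfn; split=> //; apply: sg_sdec hl. Qed.

Lemma fib_spec l c : ok l -> c \in chn Mf n' (sg l) ->
 [/\ valid_tuple n a N.+1 (map (unsig (amp l)) c), lev (map (unsig (amp l)) c) n = l &
  prb (map (unsig (amp l)) c) = rho N.+1 l * \prod_(i < n') prv Mf i (nth [::] c i.+1) (nth [::] c i)].
move=> hl hc; have [s1 d1] := sg_top hl; have [h1 h2 h3] := chn_spec Mf_mono s1 d1 hc.
have gt i : (i < n)%N -> isGT (Mf i.+1) (unsig (amp l) (nth [::] c i)).
 by move=> hi; have [? ?] := h3 i hi; apply: unsig_isGT.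
have top : lev (map (unsig (amp l)) c) n = l by rewrite levE ?h1 // h2 natsigK //; apply: amp_shifted.
split=> //.
 split; first by rewrite lengthE size_map.
 move=> [|t] ht; first by exfalso; lia.
 have ht' : (t < n)%N by lia.
 by rewrite levE ?h1 // MfE; [apply: gt|].
rewrite /tuple_prob top; congr (_ * _).
rewrite subS1 prodR_big seqE -[1%N]addn0 iotaDl big_map.
have -> : iota 0 n' = index_iota 0 n' by rewrite /index_iota subn0.
rewrite big_mkord; bigr => i _.
rewrite !levE ?h1; try (have := ltn_ord i; lia).
have hi := ltn_ord i.
rewrite !MfE; try lia.
have hk : (Mf i.+1 <= Mf i.+2)%N by apply: Mf_mono.
have g1 := gt i.+1 ltac:(lia); have g2 := gt i ltac:(lia).
by rewrite (pr_value Hpr hk g1 g2 (@unsig_shifted _ _) (@unsig_shifted _ _)) !unsigK.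
Qed.

Lemma fib_cover Lam : valid_tuple n a N.+1 Lam -> prb Lam <> 0 -> ok (lev Lam n) /\ List.In Lam (fib (lev Lam n)).
move=> [hlen hv] hp.
have hok t : (1 <= t <= n)%N -> isGT (Mf t) (lev Lam t) by move=> ht; rewrite -MfE //; apply: hv; lia.
have hl : ok (lev Lam n) by rewrite -Mfn; apply: hok; rewrite ltnSn.
split=> //; set l := lev Lam n; set m := amp l.
have hpr i : (i < n')%N -> pr (Mf i.+2) (Mf i.+1) (lev Lam i.+2) (lev Lam i.+1) <> 0.
 move=> hi h0; apply: hp; rewrite /tuple_prob subS1 prodR_big.
 rewrite (big_rem i.+1) /=; last by rewrite mem_iota.
 by rewrite !MfE; [rewrite h0 mul0r; apply: Rmult_0_r|lia|].
(* Going down from the top, each level is a descendant of the one above, and [pr_support] carries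
   the same shift [m] along. *)
have key j : (j <= n')%N -> shifted m (lev Lam (n - j)) /\
  forall i, (n' - j <= i < n')%N -> natsig m (lev Lam i.+1) \in desc (Mf i.+2 - Mf i.+1) (natsig m (lev Lam i.+2)).
 elim: j => [|j IH] hj; first by rewrite subn0; split; [apply: amp_shifted|lia].
 have [hs hd] := IH (ltnW hj).
 have [i ei] : exists i, (n' - j = i.+1)%N by exists (n' - j).-1; lia.
 have e1 : (n - j = i.+2)%N by lia. have e2 : (n - j.+1 = i.+1)%N by lia.
 rewrite e1 in hs; rewrite e2.
 have [s1 d1] := pr_support Hpr (Mf_mono (leqnSn i.+1)) (hok i.+2 ltac:(lia)) (hok i.+1 ltac:(lia)) hs (hpr i ltac:(lia)).
 split=> // i' hi'; have [->//|ne] := eqVneq i' i.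
 by apply: hd; lia.
have hsh t : (1 <= t <= n)%N -> shifted m (lev Lam t).
 by move=> ht; have [h _] := key (n - t)%N ltac:(lia); move: h; have -> : (n - (n - t) = t)%N by lia.
pose c := map (natsig m) Lam.
have sc : size c = n by rewrite size_map.
have nc i : (i < n)%N -> nth [::] c i = natsig m (lev Lam i.+1).
 move=> hi; rewrite (nth_map [::]) -?lengthE ?hlen // /lev subS1.
 by elim: (Lam) (i) => [|x s IH] [|k] //=.
have hc : c \in chn Mf n' (sg l).
 rewrite -[sg l]/(natsig m (lev Lam n'.+1)) -nc //; apply: mem_chn => // i hi.
 rewrite !nc; try lia.
 by have [_ h] := key n' (leqnn _); apply: h; lia.
have -> : Lam = map (unsig m) c.
 rewrite -map_comp -[LHS]map_id; apply: List.map_ext_in => x hx /=.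
 have [i [hi <-]] := List.In_nth _ _ [::] hx.
 have ei : List.nth i Lam [::] = lev Lam i.+1 by rewrite /lev subS1.
 rewrite ei natsigK //; apply: hsh; lia.
by apply/List.in_map_iff; exists c; split=> //; apply/In_mem.
Qed.

Lemma fib_NoDup l : ok l -> NoDup (fib l).
move=> hl; have [s1 d1] := sg_top hl.
apply: FinFun.Injective_map_NoDup; last exact: uniq_NoDup (chn_uniq Mf_mono s1 d1).
by move=> x y /(congr1 (map (natsig (amp l)))); rewrite -!map_comp !(eq_map (g := id)) ?map_id // => z /=; rewrite unsigK.
Qed.

Lemma fib_hs (g : list (list Z) -> R) v w :
 has_sum_on ok (fun l => sumR (fib l) (fun Lam => Rabs (prb Lam * g Lam))) w ->
 has_sum_on ok (fun l => sumR (fib l) (fun Lam => prb Lam * g Lam)) v ->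
 has_sum_on (valid_tuple n a N.+1) (fun Lam => prb Lam * g Lam) v.
apply: hs_fibres.
- exact: fib_NoDup.
- move=> l hl; apply/List.Forall_forall => Lam /List.in_map_iff [c [<- /In_mem hc]].
 by have [] := fib_spec hl hc.
- move=> l l' Lam hl hl' /List.in_map_iff [c [e1 /In_mem hc]] /List.in_map_iff [c' [e2 /In_mem hc']].
 have [_ h _] := fib_spec hl hc; have [_ h' _] := fib_spec hl' hc'.
 by rewrite -h -h'; congr lev; exact: (etrans e1 (esym e2)).
- move=> Lam hv hg; exists (lev Lam n); apply: fib_cover => // e; apply: hg; rewrite e.
 exact: Rmult_0_l.
Qed.

Lemma prod_levels (X : Type) (s : seq X) (tm : X -> nat) (f : X -> R) : all (fun x => 1 <= tm x <= n)%N s ->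
 \prod_(i < n) \prod_(x <- s | tm x == i.+1) f x = \prod_(x <- s) f x.
elim: s => [_|x s IH /andP[hx hs]]; first by rewrite big_nil big1 // => i _; rewrite big_nil.
rewrite big_cons -IH //.
have hi : ((tm x).-1 < n)%N by lia.
rewrite (bigD1 (Ordinal hi)) //= [X in _ = _ * X](bigD1 (Ordinal hi)) //= big_cons.
have -> : tm x == (tm x).-1.+1 by apply/eqP; lia.
rewrite -!mulrA; congr (_ * (_ * _)); bigr => i hi'.
rewrite big_cons; case: eqP => // e; case/eqP: hi'; apply: val_inj => /=; lia.
Qed.

Variable u : R.
Definition lvx (x : X) : nat := Mf x.1.
(** Equal to [x.2] when that is positive; being a successor, it is positive for every pair. *)
Definition kx (x : X) : nat := x.2.-1.+1.
Definition scx (x : X) (j : nat) : R := (st2 (kx x) j)%:R.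
Definition obsX (c : X -> R) (x : X) (Lam : list (list Z)) : R := u ^+ kx x * psum (kx x) (lev Lam x.1) + - c x.
Notation stt := (state N amp sg (wt (rho N.+1)) lvx kx scx u).

Lemma fib_total c (s : seq X) l : is_prob_GT N.+1 (rho N.+1) -> ok l -> all (fun x : X => 1 <= x.1 <= n)%N s ->
 sorted (fun x y : X => x.1 <= y.1)%N s ->
 sumR (fib l) (fun Lam => prb Lam * \prod_(x <- s) obsX c x Lam) = total (stt c s l).
move=> Hrho hl hs hsort.
rewrite (@total_climb R N _ amp sg (wt (rho N.+1)) X lvx kx scx u c Mf (fun x => x.1) (fun x => erefl) s n' l) //.
have [s1 d1] := sg_top hl.
rewrite -WW_climb sumR_big big_map.
set g := (g in WW Mf g _).
have := @sum_chn Mf g n' _ d1; set Y := (Y in Y = _) => eY.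
have -> : wt (rho N.+1) l * WW Mf g n' (sg l) = rho N.+1 l * Y by rewrite eY mulrAC mulrA.
rewrite mulr_sumr; apply: eq_big_seq => c0 hc.
have [_ _ ->] := fib_spec hl hc; rewrite -mulrA; congr (_ * (_ * _)).
rewrite -(prod_levels (tm := fun x => x.1)) //; bigr => i _; bigr => x /eqP ex.
have [h1 _ _] := chn_spec Mf_mono s1 d1 hc.
rewrite /obsX ex levE ?h1 //; congr _.
by rewrite (psum_pff _ (@unsig_shifted (amp l) _)) unsigK.
Qed.
End Tuples.

(** * Joint moments at finite [N] *)

Lemma Q_ex (N D : nat) : exists Q, (D <= Q)%N /\
 forall M, (M <= N.+1)%N -> exists v, VM R N M \is v.-homog /\ (D + v <= Q)%N.
suff H B : (B <= N.+1)%N -> exists Q, (D <= Q)%N /\ forall M, (M <= B)%N -> exists v, VM R N M \is v.-homog /\ (D + v <= Q)%N by exact: H.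
elim: B => [_|B IH hB].
 have [v hv] := VM_homog R (leq0n N.+1); exists (D + v)%N; split; first exact: leq_addr.
 by move=> M; rewrite leqn0 => /eqP->; exists v.
have [Q [hQ h]] := IH (ltnW hB); have [v hv] := VM_homog R hB.
exists (Q + v)%N; split; first exact: leq_trans hQ (leq_addr _ _).
move=> M; rewrite leq_eqVlt => /predU1P[->|hM]; first by exists v; rewrite leq_add2r.
have [v' [h1 h2]] := h M hM; exists v'; split=> //; exact: leq_trans h2 (leq_addr _ _).
Qed.

(** Doubling a word squares its product, which yields a nonnegative majorant that is again a
    moment. *)
Definition dbl (T : Type) (s : seq T) : seq T := flatten [seq [:: x; x] | x <- s].

Lemma prod_dbl (T : Type) (s : seq T) (f : T -> R) : \prod_(x <- dbl s) f x = (\prod_(x <- s) f x) ^+ 2.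
elim: s => [|x s IH]; first by rewrite !big_nil expr1n.
by rewrite !big_cons -/dbl IH mulrA exprMn.
Qed.

Lemma sum_dbl (T : Type) (s : seq T) (f : T -> nat) : (\sum_(x <- dbl s) f x = 2 * \sum_(x <- s) f x)%N.
elim: s => [|x s IH]; first by rewrite !big_nil.
by rewrite /dbl /= !big_cons -/(dbl s); lia.
Qed.

Lemma sorted_dbl (s : seq X) : sorted (fun x y : X => x.1 <= y.1)%N s -> sorted (fun x y : X => x.1 <= y.1)%N (dbl s).
elim: s => [|x [|y s] IH] //; first by rewrite /= leqnn.
rewrite /= => /andP[h1 h2]; have := IH h2.
by rewrite /= !leqnn h1.
Qed.

Lemma all_dbl (T : Type) (P : pred T) (s : seq T) : all P s -> all P (dbl s).
by elim: s => //= x s IH /andP[h /IH h']; rewrite h. Qed.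

Lemma archiR (x : R) : 0 <= x -> exists n : nat, x <= n%:R.
by move=> h; exists (Num.bound x); apply: ltW; apply: archi_boundP. Qed.

Section Moments.
Variables (N D Q : nat) (rho : nat -> list Z -> R) (F : (nat -> C) -> C).
Hypothesis DN : (D <= N.+1)%N.
Hypothesis DQ : (D <= Q)%N.
Hypothesis HQ : forall M, (M <= N.+1)%N -> exists v, VM R N M \is v.-homog /\ (D + v <= Q)%N.
Hypothesis Hrho : is_prob_GT N.+1 (rho N.+1).
Hypothesis HF : is_SGF N.+1 (rho N.+1) F.
Notation ok := (isGT N.+1).
Notation S := (has_sum_on ok).
Variable f0 : {mpoly R[N.+1]}.
Hypothesis f0_rep : rep S D.+1 (G N Q (rho N.+1)) f0.
Hypothesis f0_sym : f0 \is symmetric.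
Hypothesis f01 : f0@_0 = 1.
Variables (n' : nat) (a : nat -> R) (pr : nat -> nat -> list Z -> list Z -> R).
Notation n := n'.+1.
Hypothesis Hpr : pr_spec pr.
Variable Mf : nat -> nat.
Hypothesis Mf_mono : {homo Mf : a b / (a <= b)%N}.
Hypothesis MfE : forall t, (1 <= t <= n)%N -> lvl a N.+1 t = Mf t.
Hypothesis Mfn : Mf n = N.+1.
Variable u : R.
Notation prb := (tuple_prob n a N.+1 rho pr).
Notation lvx := (lvx Mf).
Notation stt := (state N amp sg (wt (rho N.+1)) lvx kx scx u).

Lemma total_sum c (s : seq X) : all (fun x : X => 1 <= x.1 <= n)%N s ->
 sorted (fun x y : X => x.1 <= y.1)%N s -> (\sum_(x <- s) kx x <= D)%N ->
 S (fun l => total (stt c s l)) (hop D lvx kx scx u f0 c s)@_0.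
move=> hs hsort hD.
have sok l : ok l -> size (sg l) = N.+1 /\ sdec (sg l).
 by move=> hl; have [len _] := hl; rewrite size_sg; split=> //; apply: sg_sdec hl.
apply: (state_moment (ok := ok) (@hs_ext _ ok) (@hs_plus _ ok) (@hs_scal _ ok) (hs_zero ok) (@hs_uniq _ ok) DN HQ sok) => //.
- move=> m hm; apply: hs_ext (f0_rep hm) => l _.
 by rewrite /GS big_seq1.
- apply: (@summable_dom R N Q D _ ok S amp sg (wt (rho N.+1)) (fun l => amp l + N)%N DQ (@wt_ge0 N _ Hrho) sok
  (fun l => nth 0%N (sg l) N) (fun l => nth 0%N (sg l) 0)) => //.
 + by move=> l hl; apply: sg_rg.
 apply: sg_amp.
 + by move=> f C p h; apply: (sum_dom Hrho HF h).
 + exact: archiR.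
- elim: s hs hsort {hD} => //= x s IH /andP[hx hs] hsort.
 rewrite IH ?(path_sorted hsort) // andbT.
 case: s hs hsort {IH} => [|y s] /= hs hsort.
  by rewrite -Mfn; apply: Mf_mono; case/andP: hx.
 by apply: Mf_mono; case/andP: hsort.
Qed.

Lemma prb_ge0 l Lam : ok l -> List.In Lam (fib n' Mf l) -> 0 <= prb Lam.
move=> hl /List.in_map_iff [c [<- /In_mem hc]].
have [_ _ ->] := fib_spec rho Hpr Mf_mono MfE Mfn hl hc.
apply: mulr_ge0; first by apply/RleP; apply: (proj1 Hrho).
by apply: prodr_ge0 => i _; rewrite !mulr_ge0 ?invr_ge0.
Qed.

(** Regrouping the tuples by their top signature requires absolute convergence. By [|y| <= 1 + y^2]
    this follows from the moments of the empty and of the doubled word, whence the factor 2 in the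
    degree condition. *)
Theorem tuple_moment c (s : seq X) : all (fun x : X => 1 <= x.1 <= n)%N s ->
 sorted (fun x y : X => x.1 <= y.1)%N s -> (2 * \sum_(x <- s) kx x <= D)%N ->
 has_sum_on (valid_tuple n a N.+1) (fun Lam => prb Lam * \prod_(x <- s) obsX u c x Lam)
  (hop D lvx kx scx u f0 c s)@_0.
move=> hs hsort hD.
have hD1 : (\sum_(x <- s) kx x <= D)%N by lia.
have h1 := total_sum c hs hsort hD1.
have h2 := @total_sum c (dbl s) (all_dbl hs) (sorted_dbl hsort) ltac:(by rewrite sum_dbl).
have h3 := @total_sum c [::] isT isT ltac:(by rewrite big_nil).
have ft c' s' l := @fib_total n' N a rho pr Hpr Mf Mf_mono MfE Mfn u c' s' l Hrho.
have hT := hs_plus _ _ _ _ _ h3 h2; set T := Rplus _ _ in hT.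
have [w hw] : exists w, S (fun l => sumR (fib n' Mf l) (fun Lam => Rabs (prb Lam * \prod_(x <- s) obsX u c x Lam))) w.
 apply: (hs_dom _ _ _ T _ hT) => l hl.
 rewrite Rabs_pos_eq; last by apply: sumR_ge0 => Lam _; apply: Rabs_pos.
 rewrite -(ft c [::] l hl isT isT) -(ft c (dbl s) l hl (all_dbl hs) (sorted_dbl hsort)) -sumR_plus.
 apply: sumR_le => Lam hL; have p0 := prb_ge0 hl hL.
 apply/RleP; rewrite RabsE normrM ger0_norm // big_nil prod_dbl RplusE -mulrDr; apply: ler_wpM2l => //.
 rewrite -real_normK ?num_real //; move: `|_| => y.
 have -> : 1 + y ^+ 2 = y + ((y - 2^-1) ^+ 2 + 3 / 4) by field.
 by rewrite lerDl addr_ge0 ?sqr_ge0 // divr_ge0.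
apply: (fib_hs Hpr Mf_mono MfE Mfn hw).
by apply: hs_ext h1 => l hl; rewrite ft.
Qed.
End Moments.

(** * Limits of Taylor coefficients and of levels *)

Lemma ltR_ (x y : R) : (x < y)%coqR -> x < y. by move/RltP. Qed.
Lemma cvR_evt (u v : nat -> R) a N0 : (forall N, (N0 <= N)%N -> u N = v N) -> Un_cv u a -> Un_cv v a.
move=> h hu e he; have [N1 h1] := hu e he; exists (N0 + N1)%N => m hm.
rewrite -h; [apply: h1|]; lia.
Qed.
Lemma limR : limit_rel Un_cv.
split; [|exact: CV_plus|exact: CV_mult|by move=> u v a h; apply: (cvR_evt (N0 := 0%N)) => N _].
by move=> c e he; exists 0%N => m _; rewrite /Rdist Rminus_diag Rabs_R0.
Qed.

Lemma cv_unscale (k : nat) (v w : nat -> R) l : (0 < k)%N -> (forall N, v N = w N *+ k) -> Un_cv v l -> Un_cv w (l / k%:R).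
move=> k0 h hv; have hk : k%:R != 0 :> R by rewrite pnatr_eq0 -lt0n.
by apply: (lim_ext limR) (lim_mul limR hv (lim_const limR k%:R^-1)) => N; rewrite h -(mulr_natr (w N)) mulfK.
Qed.

(** The algebra uses [N] for a ring in [N.+1] variables, hence the shift of the index. *)
Lemma cv_C_Un U (v : nat -> R) l N0 : cv_C U (RtoC l) -> (forall N, (N0 <= N)%N -> U N.+1 = RtoC (v N)) -> Un_cv v l.
move=> hU h e he; have [N1 h1] := hU e he; exists (N0 + N1)%N => m hm.
have := h1 m.+1 ltac:(lia); rewrite h; last lia.
by rewrite -RtoC_minus Cmod_R.
Qed.

Lemma repeat_nseq (T : Type) (x : T) k : List.repeat x k = nseq k x.
by elim: k => //= k ->. Qed.

Lemma jetidx_size k s : size (jetidx k s) = sumn s.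
by elim: s k => //= a s IH k; rewrite size_cat size_nseq IH. Qed.

Lemma jetidx_all k s : all (fun i => i < k + size s)%N (jetidx k s).
elim: s k => //= a s IH k; rewrite all_cat; apply/andP; split.
 by apply/allP => i /nseqP [-> _]; lia.
by have := IH k.+1; rewrite addSnnS.
Qed.

Lemma jetidx_three s : (2 < size s)%N -> all (leq 1) s -> three_distinct (jetidx 0 s).
case: s => [|[|a] [|[|b] [|[|c] s]]] //= _ _; rewrite ?andbF.
exists 0%N, 1%N, 2%N; split; first by left.
split; first by right; apply/List.in_app_iff; right; left.
split; last by [].
by right; apply/List.in_app_iff; right; right; apply/List.in_app_iff; right; left.
Qed.

Section Scoef.
Variables (N D : nat) (f0 : {mpoly R[N.+1]}) (L : (nat -> C) -> C).
Hypothesis f0_sym : f0 \is symmetric.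
Hypothesis jets : forall idx j, all (fun i => i < N.+1)%N (rcons idx j) -> (size idx < D)%N ->
 dpart (rcons idx j) L ones = RtoC (djet (rcons idx j) (logt D f0)).

Lemma mdeg_mk ks s : size ks = size s -> mdeg (@mk N ks s) = sumn s.
elim: ks s => [|k ks IH] [|a s] //= => [_|[e]]; first by rewrite mdeg0.
by rewrite mdegD mdegMn mdeg1 mul1n IH.
Qed.

Lemma scoef_big s : (D < sumn s)%N -> scoef (logt D f0) s = 0.
move=> h; rewrite /scoef truncpE mdeg_mk ?size_map ?size_iota //.
by rewrite ltnS leqNgt h.
Qed.

Lemma dpart_scoef s : (0 < sumn s <= D)%N -> (size s <= N.+1)%N ->
 dpart (jetidx 0 s) L ones = RtoC (scoef (logt D f0) s *+ (\prod_(a <- s) a`!)).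
move=> /andP[h1 h2] hs; rewrite -djet_scoef //.
have ha := jetidx_all 0 s; have hsz := jetidx_size 0 s.
case/lastP: (jetidx 0 s) ha hsz => [|t j] ha hsz; first by rewrite -hsz in h1.
apply: jets; last by rewrite size_rcons in hsz; lia.
by apply: sub_all ha => i hi; apply: leq_trans hi hs.
Qed.

Lemma scoef_swap a b : (1 <= N)%N -> scoef (logt D f0) [:: a; b] = scoef (logt D f0) [:: b; a].
move=> hN; have h := logt_symmetric D f0_sym.
rewrite (scoef_sym h (ks := [:: inord 1; inord 0])) //=.
 by rewrite /scoef /= addm0 addm0 addmC.
rewrite inE andbT; apply/eqP => /(congr1 val); rewrite /= !inordK //.
Qed.
End Scoef.

Definition lamR (c : nat -> R) (b : nat) : R := c b.+1 / (b.+1)`!%:R.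
Definition betaR (d : nat -> nat -> R) (a b : nat) : R := d a.+1 b.+1 / ((a.+1)`! * (b.+1)`!)%:R.
(** A logarithm truncated at degree [D] has no coefficients beyond it, so the limiting form is cut
    at the same degree. *)
Definition betaD (d : nat -> nat -> R) (D a b : nat) : R := if (a + b + 2 <= D)%N then betaR d a b else 0.

Section Limits.
Variables (L : nat -> (nat -> C) -> C) (c : nat -> R) (d : nat -> nat -> R).
Hypothesis Hc : forall i k, (1 <= k)%coq_nat ->
 cv_C (fun N => Cmult (RtoC (/ INR N)) (dpart (List.repeat i k) (L N) ones)) (RtoC (c k)).
Hypothesis Hd : forall i j k l, i <> j -> (1 <= k)%coq_nat -> (1 <= l)%coq_nat ->
 cv_C (fun N => dpart (List.repeat i k ++ List.repeat j l)%list (L N) ones) (RtoC (d k l)).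
Hypothesis H3 : forall idx, three_distinct idx -> cv_C (fun N => dpart idx (L N) ones) (RtoC 0).
Variables (D : nat) (f0 : forall N, {mpoly R[N.+1]}).
Hypothesis f0_sym : forall N, f0 N \is symmetric.
Hypothesis jets : forall N idx j, all (fun i => i < N.+1)%N (rcons idx j) -> (size idx < D)%N ->
 dpart (rcons idx j) (L N.+1) ones = RtoC (djet (rcons idx j) (logt D (f0 N))).
Notation p N := (logt D (f0 N)).
Definition uN (N : nat) : R := (N.+1%:R)^-1.

Lemma cv_scoef1 b : (b < D)%N -> Un_cv (fun N => uN N * scoef (p N) [:: b.+1]) (lamR c b).
move=> hb; pose v N : R := uN N * scoef (p N) [:: b.+1] *+ (b.+1)`!.
have hv : Un_cv v (c b.+1).
 apply: (cv_C_Un (N0 := 0%N) (Hc 0%N _)); first lia.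
 move=> N _.
 have e : dpart (nseq b.+1 0%N) (L N.+1) ones = RtoC (scoef (p N) [:: b.+1] *+ (b.+1)`!).
  have := @dpart_scoef N D (f0 N) (L N.+1) (f0_sym N) (@jets N) [:: b.+1].
  by rewrite /= addn0 hb => /(_ isT isT); rewrite big_seq1 cats0.
 by rewrite repeat_nseq e -RtoC_mult INRE /v -mulrnAr.
by apply: (cv_unscale (fact_gt0 b.+1) _ hv).
Qed.

Lemma cv_scoef2' a b : (a + b + 2 <= D)%N -> Un_cv (fun N => scoef (p N) [:: a.+1; b.+1]) (betaR d a b).
move=> hb; pose v N : R := scoef (p N) [:: a.+1; b.+1] *+ ((a.+1)`! * (b.+1)`!).
have hv : Un_cv v (d a.+1 b.+1).
 have hh : (1 <= a.+1)%coq_nat by lia. have hh' : (1 <= b.+1)%coq_nat by lia.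
 apply: (cv_C_Un (N0 := 1%N) (@Hd 0%N 1%N _ _ _ hh hh')); first by [].
 move=> N hN; have := @dpart_scoef N D (f0 N) (L N.+1) (f0_sym N) (@jets N) [:: a.+1; b.+1].
 have -> : (0 < sumn [:: a.+1; b.+1] <= D)%N by rewrite /=; lia.
 rewrite big_cons big_seq1 /= cats0 !repeat_nseq; exact.
by apply: cv_unscale; rewrite ?muln_gt0 ?fact_gt0.
Qed.

Lemma cv_scoef2 a b : Un_cv (fun N => scoef (p N) [:: a.+1; b.+1]) (betaD d D a b).
rewrite /betaD; case: ifP => h; first exact: cv_scoef2'.
by apply: (lim_ext limR) (lim_const limR 0) => N; rewrite scoef_big //=; lia.
Qed.

Lemma cv_scoef3 s : (2 < size s)%N -> all (leq 1) s -> Un_cv (fun N => scoef (p N) s) 0.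
move=> hs ha; have [hD|hD] := leqP (sumn s) D; last first.
 by apply: (lim_ext limR) (lim_const limR 0) => N; rewrite scoef_big.
have s0 : (0 < sumn s)%N by case: s hs ha {hD} => [|[|a] s].
pose F := (\prod_(a <- s) a`!)%N; pose v N : R := scoef (p N) s *+ F.
have F0 : F%:R != 0 :> R.
 by rewrite pnatr_eq0 -lt0n /F; elim: (s) => [|a s' IH]; rewrite ?big_nil ?big_cons // muln_gt0 fact_gt0.
have hv : Un_cv v 0.
 apply: (cv_C_Un (N0 := size s) (H3 (jetidx_three hs ha))) => N hN.
 by rewrite (@dpart_scoef N D (f0 N) (L N.+1) (f0_sym N) (@jets N) s _ (leqW hN)) ?s0.
have F0' : (0 < F)%N by rewrite lt0n -(pnatr_eq0 R).
have e0 : 0 = 0 / F%:R :> R by rewrite mul0r.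
exact: (eq_ind_r (Un_cv (fun N => scoef (p N) s)) (cv_unscale F0' (fun N => erefl) hv) e0).
Qed.

(** For [N >= 1] the mixed coefficients of a symmetric germ are symmetric, and the limit inherits
    this. *)
Lemma betaR_symD a b : (a + b + 2 <= D)%N -> betaR d a b = betaR d b a.
move=> h; apply: (UL_sequence _ _ _ (cv_scoef2' h)).
apply: (cvR_evt (N0 := 1%N) _ (cv_scoef2' (a := b) (b := a) _)); last lia.
by move=> N hN; rewrite scoef_swap.
Qed.

Lemma betaD_sym a b : betaD d D a b = betaD d D b a.
by rewrite /betaD [(b + a)%N]addnC; case: ifP => // h; apply: betaR_symD. Qed.
End Limits.

Lemma lvl_bounds (a : nat -> R) N t : 0 <= a t -> (lvl a N t)%:R <= a t * N%:R < (lvl a N t)%:R + 1.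
move=> h; rewrite /lvl; set x := Rmult _ _.
have x0 : (0 <= x)%coqR by apply: Rmult_le_pos; [apply/RleP|apply: pos_INR].
have [h1 h2] := base_Int_part x.
have z0 : (0 <= Int_part x)%coqZ.
 have : (-1 < Int_part x)%coqZ by apply: lt_IZR; Lra.lra.
 lia.
have e : (Z.to_nat (Int_part x))%:R = IZR (Int_part x) :> R by rewrite -INRE INR_IZR_INZ Z2Nat.id.
rewrite -INRE in e; apply/andP; split; [apply/RleP|apply/RltP]; rewrite -?INRE e; first exact: h1.
have hx : (x < IZR (Int_part x) + 1)%coqR by Lra.lra.
exact: hx.
Qed.

Lemma lvl_mono (a : nat -> R) N t t' : 0 <= a t -> a t <= a t' -> (lvl a N t <= lvl a N t')%N.
move=> h0 h; have /andP[h1 _] := lvl_bounds N h0; have /andP[_ h2] := lvl_bounds N (le_trans h0 h).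
rewrite -ltnS -(ltr_nat R) -natr1; apply: le_lt_trans h1 _; apply: le_lt_trans h2.
by apply: ler_wpM2r.
Qed.

Lemma cv_lvl (a : nat -> R) t : 0 <= a t -> Un_cv (fun N => uN N * (lvl a N.+1 t)%:R) (a t).
move=> h e he; have [N0 hN0] := archiR (ltW (ltR_ (Rinv_0_lt_compat _ he))).
exists N0 => m hm; have /andP[h1 h2] := lvl_bounds m.+1 h.
set l := (lvl a m.+1 t)%:R in h1 h2 *.
rewrite /Rdist RabsE; apply/RltP; rewrite distrC.
have -> : a t - uN m * l = uN m * (a t * m.+1%:R - l) by rewrite mulrBr [a t * _]mulrC mulKf // gt_eqF.
rewrite normrM !ger0_norm ?subr_ge0 ?invr_ge0 //.
have e0 : 0 < e by apply/RltP.
apply: (@lt_le_trans _ _ (uN m * 1)); first by rewrite ltr_pM2l ?invr_gt0 // ltrBlDl.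
rewrite mulr1 -[leRHS]invrK lef_pV2 ?posrE ?invr_gt0 //.
apply: le_trans hN0 _; rewrite ler_nat; lia.
Qed.

Lemma cv_uN : Un_cv uN 0.
move=> e he; have [N0 hN0] := archiR (ltW (ltR_ (Rinv_0_lt_compat _ he))).
exists N0 => m hm; rewrite /Rdist Rminus_0_r RabsE; apply/RltP.
have e0 : 0 < e by apply/RltP.
rewrite ger0_norm ?invr_ge0 // -[ltRHS]invrK ltf_pV2 ?posrE ?invr_gt0 //.
apply: le_lt_trans hN0 _; rewrite ltr_nat; lia.
Qed.

Lemma obsX0 u x Lam : obsX u (fun=> 0) x Lam = u ^+ kx x * psum (kx x) (lev Lam x.1).
exact: subr0. Qed.

(** * The limit of the joint moments of the random tuple *)

Section Joint.
Variables (rho : nat -> list Z -> R) (F : nat -> (nat -> C) -> C) (c : nat -> R) (d : nat -> nat -> R)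
 (pr : nat -> nat -> list Z -> list Z -> R) (n' : nat) (a : nat -> R).
Notation n := n'.+1.
Hypothesis Hrho : forall N, is_prob_GT N (rho N).
Hypothesis HF : forall N, is_SGF N (rho N) (F N).
Hypothesis Happ : appropriate F c d.
Hypothesis Hpr : pr_spec pr.
Hypothesis Ha1 : 0 < a 1%N.
Hypothesis Hmono : forall i, (1 <= i < n)%N -> a i <= a i.+1.
Hypothesis Han : a n = 1.

(** Times outside [1..n] are moved to the nearest end, so that levels are monotone and their ratios
    to [N] converge for every index without side conditions. *)
Definition clamp (t : nat) : nat := minn (maxn t 1) n.
Lemma clamp_rg t : (1 <= clamp t <= n)%N. by rewrite /clamp; lia. Qed.
Lemma clamp_id t : (1 <= t <= n)%N -> clamp t = t. by rewrite /clamp; lia. Qed.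

Lemma a_mono i j : (1 <= i)%N -> (i <= j)%N -> (j <= n)%N -> a i <= a j.
move=> hi; elim: j => [|j IH] hij hj; first by have -> : i = 0%N by lia.
move: hij; rewrite leq_eqVlt => /predU1P[->//|hij].
by apply: le_trans (IH hij (ltnW hj)) (Hmono _); lia.
Qed.

Lemma a_ge0 t : (1 <= t <= n)%N -> 0 <= a t.
by move=> ht; apply: le_trans (ltW Ha1) (a_mono _ _ _); lia. Qed.

Definition Mf (N t : nat) : nat := lvl a N.+1 (clamp t).

Lemma Mf_homo N : {homo Mf N : i j / (i <= j)%N}.
move=> i j hij; have hi := clamp_rg i.
by apply: lvl_mono; [apply: a_ge0|apply: a_mono; rewrite /clamp; lia].
Qed.

Lemma Mf_lvl N t : (1 <= t <= n)%N -> lvl a N.+1 t = Mf N t.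
by move=> ht; rewrite /Mf clamp_id. Qed.

Lemma Mf_top N : Mf N n = N.+1.
rewrite -Mf_lvl ?ltnSn //; have /andP[h1 h2] := @lvl_bounds a N.+1 n (a_ge0 (t := n) (ltnSn n)).
rewrite Han mul1r in h1 h2; move: h1 h2; rewrite natr1 ler_nat ltr_nat; lia.
Qed.

Definition germ_ok (L : (nat -> C) -> C) (N D : nat) (f0 : {mpoly R[N.+1]}) := [/\
 exists Q, [/\ (D <= Q)%N, (forall M, (M <= N.+1)%N -> exists v, VM R N M \is v.-homog /\ (D + v <= Q)%N) &
  rep (has_sum_on (isGT N.+1)) D.+1 (G N Q (rho N.+1)) f0],
 f0 \is symmetric, f0@_0 = 1 &
 forall idx j, all (fun i => i < N.+1)%N (rcons idx j) -> (size idx < D)%N ->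
  dpart (rcons idx j) L ones = RtoC (djet (rcons idx j) (logt D f0))].

Lemma germ_ok_ex L N D : (exists r, (0 < r)%coqR /\ holo_on N.+1 r L /\ forall x, ballN N.+1 r x -> Cexp (L x) = F N.+1 x) ->
 exists f0, germ_ok L D (f0 : {mpoly R[N.+1]}).
move=> [r [r0 [h1 h2]]]; have [Q [hQ hv]] := Q_ex N D.
have [f0 [g1 g2 g3 g4]] := germ_log hQ (Hrho N.+1) (HF N.+1) r0 h1 h2.
by exists f0; split=> //; exists Q.
Qed.

Section OneList.
Variable s : seq X.
Hypothesis s_ok : all (fun x : X => 1 <= x.1 <= n)%N s.
Hypothesis s_k : all (fun x : X => 0 < x.2)%N s.
Hypothesis s_sorted : sorted (fun x y : X => x.1 <= y.1)%N s.
(** The factor 2 serves the doubled word in [tuple_moment]. *)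
Definition D0 : nat := (2 * \sum_(x <- s) kx x)%N.
Notation D := D0.+2.
Notation lamD := (fun b : 'I_D => lamR c b).
Notation betaDD := (fun i j : 'I_D => betaD d D i j).
Definition alphaX (x : X) : R := a (clamp x.1).
Definition limval : R :=
 (foldr (Op (fun x : X => limlin lamD betaDD (alphaX x) (kx x)) (fun x => psi (alphaX x) lamD (kx x))) 1 s)@_0.

Lemma joint_limit : exists m : nat -> R,
 (exists N0, forall N, (N0 <= N)%coq_nat ->
   has_sum_on (valid_tuple n a N)
    (fun Lam => Rmult (tuple_prob n a N rho pr Lam) (prodR s (fun tk => Xnorm n a N rho pr (fst tk) (snd tk) Lam))) (m N)) /\
 Un_cv m limval.
have [L [hL [hc [hd [h3 _]]]]] := Happ.
have gex N : {f0 : {mpoly R[N.+1]} | germ_ok (L N.+1) D f0}.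
 by apply: constructive_indefinite_description; apply: germ_ok_ex.
pose f0 N := proj1_sig (gex N).
have hf N : germ_ok (L N.+1) D (f0 N) by exact: proj2_sig (gex N).
have fs N : f0 N \is symmetric by have [] := hf N.
have jets N : forall idx j, all (fun i => i < N.+1)%N (rcons idx j) -> (size idx < D)%N ->
 dpart (rcons idx j) (L N.+1) ones = RtoC (djet (rcons idx j) (logt D (f0 N))) by have [] := hf N.
pose lv N x := lvx (Mf N) x.
pose cen := centre D0 uN f0 lv kx scx.
pose m' N := (hop D (lv N) kx scx (uN N) (f0 N) (cen N) s)@_0.
(* The value at [N = 0] is arbitrary; the algebra starts with one variable. *)
exists (fun N => if N is N'.+1 then m' N' else 0); split; last first.
 have h : Un_cv m' limval.
  apply: (@hop_limit R D0 Un_cv limR UL_sequence uN (fun N => N.+1%:R) _ cv_uN f0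
   lamD betaDD _ _ _ _ X lv kx scx alphaX) => //.
  - by move=> N; rewrite mulVf // pnatr_eq0.
  apply: (betaD_sym hd fs jets).
  - by move=> b; apply: (cv_scoef1 hc fs jets).
  apply: (cv_scoef2 hd fs jets).
  apply: (cv_scoef3 h3 fs jets).
  - by move=> x; rewrite /scx st2_diag.
  - by move=> x; apply: cv_lvl; apply: a_ge0; apply: clamp_rg.
 move=> e he; have [N0 hN0] := h e he; exists N0.+1 => -[|N] hN; first lia.
 by apply: hN0; lia.
exists D.+1 => -[|N] hN; first lia.
have DN : (D <= N.+1)%N by lia.
have [[Q [DQ HQ f0_rep]] f0s f01 _] := hf N.
have tm := @tuple_moment N D Q rho (F N.+1) DN DQ HQ (Hrho N.+1) (HF N.+1) (f0 N) f0_rep f0s f01 n' a pr Hpr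
 (Mf N) (@Mf_homo N) (@Mf_lvl N) (@Mf_top N) (uN N).
have hD : (2 * \sum_(x <- s) kx x <= D)%N by rewrite -/D0 -addn2 leq_addr.
have u0 : uN N != 0 by rewrite invr_eq0 pnatr_eq0.
(* The algebraic centring is the true expectation: it is the first moment of the same observable,
   computed with centring 0. *)
have obsE x Lam : x \in s -> obsX (uN N) (cen N) x Lam = Xnorm n a N.+1 rho pr x.1 x.2 Lam.
 move=> hx; have hk : kx x = x.2 by rewrite /kx prednK //; move/allP: s_k; apply.
 have hx1 : (1 <= x.1 <= n)%N by move/allP: s_ok; apply.
 have := @tm (fun=> 0) [:: x] ltac:(by rewrite /= hx1) isT.
 rewrite big_seq1; have -> : (2 * kx x <= D)%N by apply: leq_trans hD; rewrite leq_mul2l (big_rem x) //= leq_addr.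
 move=> /(_ isT) h.
 have hE : Etup n a N.+1 rho pr (fun L' => psum x.2 (lev L' x.1)) = (uN N ^+ x.2)^-1 * cen N x.
  apply: sum_on_eq; apply: (hs_ext _ _ _ _ _ (hs_scal _ (uN N ^+ x.2)^-1 _ _ h)) => Lam' _.
  rewrite big_seq1 obsX0 hk RmultE mulrCA mulKf // expf_neq0 //.
 have e : Rinv (pow (INR N.+1) x.2) = uN N ^+ x.2 by rewrite RpowE INRE exprVn.
 have gen (u y z : R) : u != 0 -> u * y + - z = u * (y - u^-1 * z) by move=> h0; rewrite mulrBr mulrA mulfV // mul1r.
 by rewrite /obsX /Xnorm hE hk e; apply: gen; rewrite expf_neq0.
apply: (hs_ext _ _ _ _ _ (@tm (cen N) s s_ok s_sorted hD)) => Lam _.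
by rewrite prodR_big; congr (_ * _); apply: eq_big_seq => x hx; apply: obsE.
Qed.
End OneList.

(** The contour formula concerns [t1 <= t2]; the other order is defined by exchange, which leaves
    the symmetry at equal times to be proved. *)
Definition CvX (x y : X) : R :=
 if (x.1 <= y.1)%N then covK (lamR c) (betaR d) (alphaX x) (kx x) (alphaX y) (kx y)
 else covK (lamR c) (betaR d) (alphaX y) (kx y) (alphaX x) (kx x).

Lemma betaR_sym i j : betaR d i j = betaR d j i.
have [L [hL [hc [hd [h3 _]]]]] := Happ.
pose D := (i + j + 2)%N.
have gex N : {f0 : {mpoly R[N.+1]} | germ_ok (L N.+1) D f0}.
 by apply: constructive_indefinite_description; apply: germ_ok_ex.
apply: (@betaR_symD L d hd D (fun N => proj1_sig (gex N)) _ _ i j (leqnn _)) => N.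
 by have [] := proj2_sig (gex N).
by have [_ _ _] := proj2_sig (gex N).
Qed.

Lemma covK_ext (lam : nat -> R) (b1 b2 : nat -> nat -> R) a1 k1 a2 k2 :
 (forall i j, (i < k2)%N -> (j < k1)%N -> b1 i j = b2 i j) -> covK lam b1 a1 k1 a2 k2 = covK lam b2 a1 k1 a2 k2.
move=> h; bigr => b _; congr (_ * (_ + _)); bigr => b' _.
by rewrite h.
Qed.

Lemma remove_nthE (s : seq X) j : remove_nth j s = dropnth j s.
rewrite /remove_nth -[Datatypes.app _ _]/_; congr (_ ++ _).
 by elim: s j => [|x s IH] [|j] //=; rewrite IH.
by elim: s j.+1 => [|x s IH] [|k] //=.
Qed.

Lemma dropnth_subseq (T : eqType) (s : seq T) j : subseq (dropnth j s) s.
by rewrite /dropnth -{3}(cat_take_drop j s); apply: cat_subseq => //; rewrite -addn1 addnC -drop_drop; apply: drop_subseq.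
Qed.

(** The order chosen for the whole word covers every pair in it, so each contraction is the
    order-free [covK]; dropping an element keeps the times sorted. *)
Lemma limval_wick s : sorted (fun x y : X => x.1 <= y.1)%N s ->
 limval s = wick CvX s.
move=> hsort; rewrite /limval.
have hk x y : x \in s -> y \in s -> (kx x + kx y <= (D0 s).+2)%N.
 move=> hx hy; rewrite /D0 mul2n -addnn; apply: (@leq_trans ((\sum_(z <- s) kx z) + \sum_(z <- s) kx z)); last by rewrite -addn2 leq_addr.
 by apply: leq_add; [rewrite (big_rem x)|rewrite (big_rem y)] => //=; rewrite leq_addr.
move: hk; move: (D0 s) => d0; rewrite -/(size s).
suff H fu : forall s, sorted (fun x y : X => x.1 <= y.1)%N s -> (size s <= fu)%N ->
  (forall x y, x \in s -> y \in s -> (kx x + kx y <= d0.+2)%N) ->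
  (foldr (Op (fun x : X => limlin (fun b : 'I_d0.+2 => lamR c b) (fun i j : 'I_d0.+2 => betaD d d0.+2 i j) (alphaX x) (kx x))
   (fun x => psi (alphaX x) (fun b : 'I_d0.+2 => lamR c b) (kx x))) 1 s)@_0 = wick_aux fu CvX s by move=> hk; apply: H.
elim: fu {s hsort} => [|fu IH] [|x s] hsort //= hfu hk; try by rewrite mcoeff1 eqxx.
rewrite -/foldr -/(foldr _ 1 (x :: s)) (ev_ops _ _ (0%N, 0%N)) sumR_big seqE -[iota 0 _]/(iota 0 (size s)) -(subn0 (size s)) -/index_iota big_mkord subn0.
bigr => j _; have hj := ltn_ord j.
have -> : List.nth j s (0%N, 0%N) = nth (0%N, 0%N) s j by elim: (s) (nat_of_ord j) => [|y r IHr] [|i] //=.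
rewrite remove_nthE; set y := nth _ s j; have hy : y \in s by apply: mem_nth.
congr (_ * _).
 have hxy : (x.1 <= y.1)%N.
  have tr : transitive (fun x y : X => x.1 <= y.1)%N by move=> u v w; apply: leq_trans.
  by have /allP := order_path_min tr hsort; apply.
 rewrite /CvX hxy /cc.
 have hkk : (kx x + kx y <= d0.+2)%N by apply: hk; rewrite inE ?eqxx ?hy ?orbT.
 rewrite (ccE (lamR c) (betaD d d0.+2)) //.
 by apply: covK_ext => i k hi hk'; rewrite /betaD; have -> : (i + k + 2 <= d0.+2)%N by lia.
have hsub := dropnth_subseq s j.
have hsz : (size (dropnth j s) < size s)%N.
 rewrite size_cat size_take size_drop hj; lia.
apply: IH.
- have tr : transitive (fun x y : X => x.1 <= y.1)%N by move=> u v w; apply: leq_trans.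
 by apply: (subseq_sorted tr hsub); apply: path_sorted hsort.
- lia.
- by move=> z w hz hw; apply: hk; rewrite inE (mem_subseq hsub) ?orbT.
Qed.

(* Both orders of the two factors have the same expectation, hence the same limit. *)
Lemma CvX_sym x y : CvX x y = CvX y x.
rewrite /CvX; case: ltngtP => // e; rewrite /alphaX e; set t := clamp _.
have ht : (1 <= t <= n)%N := clamp_rg _.
pose s k l : seq X := [:: (t, k.+1); (t, l.+1)].
have ok k l : [/\ all (fun x : X => 1 <= x.1 <= n)%N (s k l), all (fun x : X => 0 < x.2)%N (s k l) & sorted (fun x y : X => x.1 <= y.1)%N (s k l)].
 by rewrite /= ht leqnn.
have J k l : limval (s k l) = covK (lamR c) (betaR d) (a t) k.+1 (a t) l.+1.
 have [_ _ h] := ok k l; rewrite limval_wick // /wick /= /CvX leqnn /alphaX clamp_id //.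
 by rewrite Rmult_1_r Rplus_0_r.
rewrite -!J; move: (x.2.-1) (y.2.-1) => k l.
have [o1 o2 o3] := ok k l; have [m [[N1 h1] l1]] := joint_limit o1 o2 o3.
have [o4 o5 o6] := ok l k; have [m' [[N2 h2] l2]] := joint_limit o4 o5 o6.
apply: (UL_sequence m) => //; apply: (cvR_evt (N0 := (N1 + N2)%N) _ l2) => N hN.
apply: (hs_uniq _ _ _ _ (h2 N _)); first lia.
apply: (hs_ext _ _ _ _ _ (h1 N _)) => [Lam _|]; last lia.
by congr Rmult; rewrite /= !Rmult_1_r Rmult_comm.
Qed.
End Joint.

(** * Evaluation of the contour integral *)

Lemma factE_ j : Factorial.fact j = j`!.
by elim: j => // j IH; rewrite factS -IH. Qed.

Lemma Fterm0 c z j : Fterm c (Cplus (RtoC 1) z) j = RtoC (lamR c j *+ j.+1) * z ^+ j.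
rewrite /Fterm CpowE; congr (RtoC _ * _ ^+ _).
- rewrite INRE factE_ /lamR natrM -(mulr_natr (_ / _)).
 have h1 : (j.+1%:R : R) != 0 by rewrite pnatr_eq0.
 by rewrite invfM mulrA mulrAC mulfVK.
- by rewrite CminusE addrC addKr.
Qed.

Lemma Gterm0 d z w j l : Gterm d (Cplus (RtoC 1) z) (Cplus (RtoC 1) w) j l =
 RtoC (betaR d j l *+ j.+1 *+ l.+1) * (z ^+ j * w ^+ l).
rewrite /Gterm !CpowE !CmultE -mulrA; congr (RtoC _ * (_ ^+ _ * _ ^+ _)).
- rewrite RdivE RmultE !INRE !factE_ /betaR !natrM -(mulr_natr (_ / _)) -(mulr_natr (_ * _)).
 have h1 k : (k.+1%:R : R) != 0 by rewrite pnatr_eq0.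
 have h2 k : (k`!%:R : R) != 0 by rewrite pnatr_eq0 -lt0n fact_gt0.
 move: (h1 j) (h1 l) (h2 j) (h2 l).
 move: (j.+1%:R : R) (l.+1%:R : R) (j`!%:R : R) (l`!%:R : R) d => A B E F G hA hB hE hF; field.
 by rewrite hB hE hF.
- by rewrite CminusE addrC addKr.
- by rewrite CminusE addrC addKr.
Qed.

Lemma Wp_horner c al M (z : C) :
 (map_poly RtoC (Wp al (fun b : 'I_M => lamR c b))).[z] =
 (1 + z) * (RtoC al + z * \sum_(j < M) RtoC (lamR c j *+ j.+1) * z ^+ j).
rewrite rmorphM rmorphD rmorph1 rmorphD rmorphM /= map_polyX map_polyC hornerM !hornerD hornerM hornerX !hornerC; congr (_ * (_ + _ * _)).
rewrite rmorph_sum horner_sum; bigr => j _ /=.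
by rewrite map_polyZ hornerZ map_polyXn hornerXn.
Qed.

Lemma UM_poly c al M z : z <> 0 -> al != 0 ->
 UM c al M z = Cinv z * (RtoC al^-1 * (map_poly RtoC (Wp al (fun b : 'I_M => lamR c b))).[z]).
move=> z0 a0; rewrite /UM Wp_horner sumC_ord.
have -> : \sum_(i < M) Fterm c (Cplus (RtoC 1) z) i = \sum_(j < M) RtoC (lamR c j *+ j.+1) * z ^+ j.
 by bigr => j _; rewrite Fterm0.
set f := \sum_(j < M) _.
rewrite /Cdiv -RtoC_inv; last by move=> h; case/negP: a0; apply/eqP.
rewrite RinvE.
have za : Cinv z * z = 1 by exact: Cinv_l.
have aa : RtoC al^-1 * RtoC al = 1 by rewrite -rmorphM mulVf.
move: (Cinv z) (RtoC al^-1) (RtoC al) za aa => zi ai a' za aa.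
have -> : zi * (ai * ((1 + z) * (a' + z * f))) = (ai * a') * (zi + zi * z) + (zi * z) * ((1 + z) * f * ai) by ring.
by rewrite za aa !mul1r.
Qed.

(** With the series truncated, the factor is the Laurent polynomial [(Wp / (al z))^k]. *)
Lemma UM_pow c al M k z : z <> 0 -> al != 0 ->
 Cpow (UM c al M z) k = \sum_(i < size (Wpow (lamR c) M al k)) RtoC (al^-1 ^+ k * (Wpow (lamR c) M al k)`_i)%R * Cpowz z (Z.of_nat i - Z.of_nat k).
move=> z0 a0; rewrite CpowE UM_poly // !exprMn -horner_exp -!rmorphXn.
rewrite -/Wpow (@horner_coef_wide _ (size (Wpow (lamR c) M al k))); last exact: size_poly.
rewrite !mulr_sumr; bigr => i _.
rewrite coef_map rmorphM /= (Cpowz_add z (Z.of_nat i) (- Z.of_nat k)) // Cpowz_nat Cpowz_neg -Cpow_inv // !CpowE CmultE.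
move: Cinv (z ^+ i) RtoC (RtoC _) => x y u v; ring.
Qed.

Definition kap : C := Cpow (Cmult (Cmult (RtoC 2) (RtoC PI)) Ci) 2.

Lemma dcint_sum (I : Type) (s : seq I) e1 e2 F (v : I -> C) : (forall i, dcint e1 e2 (F i) (v i)) ->
 dcint e1 e2 (fun z w => \sum_(i <- s) F i z w) (\sum_(i <- s) v i).
move=> h; elim: s => [|i s IH].
 rewrite big_nil.
 have -> : (fun z w : C => \sum_(j <- [::]) F j z w) = (fun _ _ => RtoC 0).
  by do 2 apply: FunctionalExtensionality.functional_extensionality => ?; rewrite big_nil.
 exact: dcint_zero.
rewrite big_cons; case: (dcint_plus _ _ _ _ _ _ (h i) IH) => J [h1 h2]; exists J; split=> // z hz.
have -> : (fun w : C => \sum_(j <- (i :: s)) F j z w) = (fun w => Cplus (F i z w) (\sum_(j <- s) F j z w)).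
 by apply: FunctionalExtensionality.functional_extensionality => w; rewrite big_cons.
exact: h1.
Qed.

(** The residue at 0 of [z^e] times the Laurent polynomial with coefficients [p] and lowest exponent
    [-k]. *)
Definition lres (n k : nat) (p : nat -> R) (e : Z) : R :=
 \sum_(i < n) p i *+ (Z.eqb (Z.of_nat i - Z.of_nat k + e) (-1)).

Lemma dcint_fac e1 e2 f h n1 k1 (p : nat -> R) n2 k2 (q : nat -> R) g e e' : (0 < e1)%coqR -> (0 < e2)%coqR ->
 (forall z, Cmod z = e1 -> f z = \sum_(i < n1) RtoC (p i) * Cpowz z (Z.of_nat i - Z.of_nat k1)) ->
 (forall z, Cmod z = e2 -> h z = \sum_(i < n2) RtoC (q i) * Cpowz z (Z.of_nat i - Z.of_nat k2)) ->
 dcint e1 e2 (fun z w => f z * h w * (RtoC g * (Cpowz z e * Cpowz w e'))) (RtoC (g * lres n1 k1 p e * lres n2 k2 q e')%R * kap).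
move=> h1 h2 hf hh.
have nz r z : (0 < r)%coqR -> Cmod z = r -> z <> RtoC 0 by move=> r0 hz zz; move: hz r0; rewrite zz Cmod_0 => <-; exact: Rlt_irrefl.
apply: (@dcint_ext e1 e2 (fun z w => \sum_(i < n1) \sum_(j < n2)
  Cmult (RtoC (g * (p i * q j))%R) (Cmult (Cpowz z (Z.of_nat i - Z.of_nat k1 + e)) (Cpowz w (Z.of_nat j - Z.of_nat k2 + e')))));
 [exact: Rlt_le|exact: Rlt_le| |].
 move=> z w hz hw; rewrite hf // hh // big_distrlr mulr_suml; bigr => i _; rewrite mulr_suml; bigr => j _.
 rewrite (Cpowz_add z _ _ (nz e1 z h1 hz)) (Cpowz_add w _ _ (nz e2 w h2 hw)) !rmorphM /= !CmultE.
 move: Cpowz (Cpowz _) (Cpowz _ _) (Cpowz _) RtoC RtoC (RtoC _) => *; ring.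
have eV : RtoC (g * lres n1 k1 p e * lres n2 k2 q e')%R * kap =
 \sum_(i < n1) \sum_(j < n2) (match Z.eq_dec (Z.of_nat i - Z.of_nat k1 + e) (-1) with left _ =>
   match Z.eq_dec (Z.of_nat j - Z.of_nat k2 + e') (-1) with left _ => Cmult (RtoC (g * (p i * q j))%R) kap | right _ => RtoC 0 end
   | right _ => RtoC 0 end).
 rewrite -mulrA big_distrlr mulr_sumr rmorph_sum mulr_suml; bigr => i _.
 rewrite mulr_sumr rmorph_sum mulr_suml; bigr => j _.
 case: Z.eqb_spec => hi; case: Z.eq_dec => //= _; last by rewrite mul0r mulr0 mul0r.
 case: Z.eqb_spec => hj; case: Z.eq_dec => //= _; last by rewrite mulr0 mulr0 mul0r.
apply: (eq_ind_r (dcint e1 e2 _) _ eV).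
apply: dcint_sum => i; apply: dcint_sum => j; exact: dcint_mono.
Qed.

Lemma lres_nat n k p x : (forall i, (n <= i)%N -> p i = 0) ->
 lres n k p (Z.of_nat x) = if (x < k)%N then p (k.-1 - x)%N else 0.
move=> hp; rewrite /lres; case: ltnP => hx; last first.
 by rewrite big1 // => i _; case: Z.eqb_spec => // h; lia.
have [hn|hn] := ltnP (k.-1 - x) n.
 rewrite (bigD1 (Ordinal hn)) //= big1 ?addr0 => [|i hi].
  by case: Z.eqb_spec => // h; lia.
 case: Z.eqb_spec => // h; case/negP: hi; apply/eqP/val_inj => /=; lia.
rewrite hp // big1 // => i _; case: Z.eqb_spec => // h; have := ltn_ord i; lia.
Qed.

Lemma lres_neg n k p m : (forall i, (n <= i)%N -> p i = 0) ->
 lres n k p (- Z.of_nat (m + 2)%coq_nat) = p (m.+1 + k)%N.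
move=> hp; rewrite /lres; have [hn|hn] := ltnP (m.+1 + k) n.
 rewrite (bigD1 (Ordinal hn) isT) big1 => [|i hi].
  have eo : nat_of_ord (Ordinal hn) = (m.+1 + k)%N by [].
  case: Z.eqb_spec => [_|]; [exact: addr0|lia].
 case: Z.eqb_spec => // h; case/negP: hi; apply/eqP/val_inj => /=; lia.
rewrite hp // big1 // => i _; case: Z.eqb_spec => // h; have := ltn_ord i; lia.
Qed.

Lemma sum_lt (M k : nat) (f : nat -> R) : (k <= M)%N -> \sum_(x < M) (if (x < k)%N then f x else 0) = \sum_(x < k) f x.
by move=> h; rewrite (big_ord_widen M f h) [RHS]big_mkcond. Qed.

(** Iterated residues. Against [z^x w^y] from [G_rho], both pick negative powers and give [psin]
    twice; against [z^m w^(-m-2)], the residue in [w] picks a positive power and gives the [wco]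
    term. For [M >= k1 + k2] all coefficients involved lie below the truncation. *)
Lemma truncated_value c d a1 k1 a2 k2 eps M : (0 < eps)%coqR -> a1 != 0 -> a2 != 0 -> (k1 + k2 <= M)%N ->
 (forall i j, betaR d i j = betaR d j i) ->
 dcint eps (2 * eps)%coqR
  (fun z w => Cmult (Cmult (Cpow (UM c a1 M z) k1) (Cpow (UM c a2 M w) k2)) (Cplus (GM d M z w) (QM M z w)))
  (RtoC (a1^-1 ^+ k1 * a2^-1 ^+ k2 * covK (lamR c) (betaR d) a1 k1 a2 k2)%R * kap).
move=> e0 a10 a20 hM dsym.
have e20 : (0 < 2 * eps)%coqR by apply: Rmult_lt_0_compat => //; exact: Rlt_0_2.
have nz r z : (0 < r)%coqR -> Cmod z = r -> z <> RtoC 0 by move=> r0 hz zz; move: hz r0; rewrite zz Cmod_0 => <-; exact: Rlt_irrefl.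
set P1 := Wpow (lamR c) M a1 k1; set P2 := Wpow (lamR c) M a2 k2.
pose p i := a1^-1 ^+ k1 * P1`_i; pose q i := a2^-1 ^+ k2 * P2`_i.
have hp i : (size P1 <= i)%N -> p i = 0 by move=> h; rewrite /p nth_default // mulr0.
have hq i : (size P2 <= i)%N -> q i = 0 by move=> h; rewrite /q nth_default // mulr0.
have h1 z : Cmod z = eps -> Cpow (UM c a1 M z) k1 = \sum_(i < size P1) RtoC (p i) * Cpowz z (Z.of_nat i - Z.of_nat k1).
 by move=> hz; rewrite UM_pow //; exact: (nz eps).
have h2 z : Cmod z = (2 * eps)%coqR -> Cpow (UM c a2 M z) k2 = \sum_(i < size P2) RtoC (q i) * Cpowz z (Z.of_nat i - Z.of_nat k2).
 by move=> hz; rewrite UM_pow //; exact: (nz (2 * eps)%coqR).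
pose g x y : R := betaR d x y *+ x.+1 *+ y.+1.
have D g' e e' := @dcint_fac eps (2 * eps)%coqR _ _ _ _ _ _ _ _ g' e e' e0 e20 h1 h2.
have DG := dcint_sum (index_enum 'I_M) (fun x : 'I_M => dcint_sum (index_enum 'I_M) (fun y : 'I_M => D (g x y) (Z.of_nat x) (Z.of_nat y))).
have DQ := dcint_sum (index_enum 'I_M) (fun m : 'I_M => D (m.+1%:R) (Z.of_nat m) (- Z.of_nat (m + 2)%coq_nat)%coqZ).
have DD := dcint_plus _ _ _ _ _ _ DG DQ.
move: DD; set V := Cplus _ _ => DD.
have eV : V = RtoC (a1^-1 ^+ k1 * a2^-1 ^+ k2 * covK (lamR c) (betaR d) a1 k1 a2 k2)%R * kap; last first.
 rewrite eV in DD; apply: dcint_ext DD; [exact: Rlt_le|exact: Rlt_le|] => z w hz hw.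
 rewrite !CmultE mulrDr; congr (_ + _).
  rewrite /GM sumC_ord mulr_sumr; bigr => x _; rewrite sumC_ord mulr_sumr; bigr => y _.
  by rewrite Gterm0 !Cpowz_nat !CpowE.
 rewrite /QM sumC_ord mulr_sumr; bigr => m _; by rewrite INRE.
rewrite {DD}/V CplusE.
under eq_bigr => x _ do rewrite -mulr_suml -rmorph_sum.
rewrite -mulr_suml -rmorph_sum -mulr_suml -rmorph_sum -mulrDl -rmorphD; congr (RtoC _ * _).
under eq_bigr => x _ do under eq_bigr => y _ do rewrite !lres_nat //.
under [X in _ + X]eq_bigr => m _ do rewrite lres_nat // lres_neg //.
rewrite mulr_sumr.
transitivity (\sum_(x < M) (if (x < k1)%N then
  (a1^-1 ^+ k1 * a2^-1 ^+ k2) * (psin (lamR c) a1 k1 x * (wco (lamR c) a2 k2 (x.+1 + k2) + \sum_(b' < k2) psin (lamR c) a2 k2 b' * betaR d b' x)) else 0));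
 last by rewrite (@sum_lt M k1 (fun x => (a1^-1 ^+ k1 * a2^-1 ^+ k2) * (psin (lamR c) a1 k1 x * (wco (lamR c) a2 k2 (x.+1 + k2) + \sum_(b' < k2) psin (lamR c) a2 k2 b' * betaR d b' x)))) //; lia.
rewrite -big_split; bigr => x _ /=.
case: ltnP => hx; last by rewrite mulr0 mul0r addr0 big1 // => y _; rewrite mulr0 mul0r.
have e1 : p (k1.-1 - x)%N = a1^-1 ^+ k1 * wco (lamR c) a1 k1 (k1.-1 - x).
 by rewrite /p wcoE //; lia.
have e2 : q (x.+1 + k2)%N = a2^-1 ^+ k2 * wco (lamR c) a2 k2 (x.+1 + k2).
 by rewrite /q wcoE //; lia.
rewrite e1 e2 mulrDr mulrDr addrC; congr (_ + _).
 rewrite /psin hx -(mulr_natr (wco _ _ _ _)).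
 move: wco (wco _ _ _) (a1^-1 ^+ k1) (a2^-1 ^+ k2) (x.+1%:R : R) => *; ring.
transitivity (\sum_(y < M) (if (y < k2)%N then
  a1^-1 ^+ k1 * a2^-1 ^+ k2 * (psin (lamR c) a1 k1 x * (psin (lamR c) a2 k2 y * betaR d y x)) else 0)).
 bigr => y _; case: ltnP => hy; last by rewrite mulr0.
 have -> : q (k2.-1 - y)%N = a2^-1 ^+ k2 * wco (lamR c) a2 k2 (k2.-1 - y).
  by rewrite /q wcoE //; lia.
 rewrite /g /psin hx hy dsym -(mulr_natr (_ *+ _)) -mulr_natr -!(mulr_natr (wco _ _ _ _)).
 move: wco (wco _ _ _) (a1^-1 ^+ k1) (a2^-1 ^+ k2) (x.+1%:R : R) (y.+1%:R : R) betaR => *; ring.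
rewrite (@sum_lt M k2 (fun y => a1^-1 ^+ k1 * a2^-1 ^+ k2 * (psin (lamR c) a1 k1 x * (psin (lamR c) a2 k2 y * betaR d y x)))); last lia.
by rewrite !mulr_sumr.
Qed.

(** The prefactor [a t1 ^ k1 * a t2 ^ k2] cancels the divisors [al] of the two factors, and [kap]
    cancels the two factors [2 pi i] of the residues. *)
Theorem cov_formulaE c d a t1 k1 t2 k2 : a t1 != 0 -> a t2 != 0 -> (forall i j, betaR d i j = betaR d j i) ->
 (exists r, (0 < r)%coqR /\ forall x : C, (Cmod (Cminus x (RtoC 1)) < r)%coqR -> ex_series (Fterm c x)) ->
 (exists r, (0 < r)%coqR /\ forall x y : C,
    (Cmod (Cminus x (RtoC 1)) < r)%coqR -> (Cmod (Cminus y (RtoC 1)) < r)%coqR ->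
    (forall j, ex_series (fun l => Cmod (Gterm d x y j l))) /\
    ex_series (fun j => Series (fun l => Cmod (Gterm d x y j l)))) ->
 exists e0, (0 < e0)%coqR /\ forall eps, (0 < eps < e0)%coqR ->
  RtoC (covK (lamR c) (betaR d) (a t1) k1 (a t2) k2) = cov_formula a c d t1 k1 t2 k2 eps.
move=> h1 h2 dsym hF hG.
have [e0 [e00 he]] := contour_truncated c d (a t1) k1 (a t2) k2 hF hG.
exists e0; split=> // eps [ep1 ep2].
have hM M : (k1 + k2 <= M)%coq_nat -> _ := fun h => @truncated_value c d (a t1) k1 (a t2) k2 eps M ep1 h1 h2 (introT ssrnat.leP h) dsym.
have hv := he eps (conj ep1 ep2) _ (ex_intro _ (k1 + k2)%N hM).
rewrite /cov_formula hv -/kap.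
have kn : kap <> RtoC 0.
 have np := PI_neq0; have n2 : 2%coqR <> 0%coqR by [].
 apply: Cpow_nz; apply: Cmult_neq_0; last by move=> /(f_equal snd); exact: R1_neq_R0.
 by apply: Cmult_neq_0; move=> /RtoC_inj_.
have kk : Cinv kap * kap = 1 by exact: Cinv_l.
rewrite !RpowE.
move: (covK _ _ _ _ _ _) => v.
have i1 : RtoC (a t1 ^+ k1) * RtoC ((a t1)^-1 ^+ k1) = 1 by rewrite -rmorphM -exprMn mulfV // expr1n.
have i2 : RtoC (a t2 ^+ k2) * RtoC ((a t2)^-1 ^+ k2) = 1 by rewrite -rmorphM -exprMn mulfV // expr1n.
transitivity ((RtoC (a t1 ^+ k1) * RtoC (a t2 ^+ k2)) * Cinv kap * ((RtoC ((a t1)^-1 ^+ k1) * RtoC ((a t2)^-1 ^+ k2) * RtoC v) * kap)).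
 have gen (A : comNzRingType) (x y u v' w ki k' : A) : x * u = 1 -> y * v' = 1 -> ki * k' = 1 -> w = x * y * ki * (u * v' * w * k').
  move=> g1 g2 g3; have -> : x * y * ki * (u * v' * w * k') = (x * u) * (y * v') * (ki * k') * w by ring.
  by rewrite g1 g2 g3 !mul1r.
 exact: gen.
by congr _; rewrite !rmorphM.
Qed.

Lemma perm_Permutation (T : eqType) (s t : seq T) : perm_eq s t -> Permutation s t.
elim: s t => [|x s IH] t h; first by move: h; rewrite perm_sym => /perm_nilP ->.
have xt : x \in t by rewrite -(perm_mem h) mem_head.
case/splitPr: xt h => t1 t2; rewrite -/(perm_eq (x :: s) (t1 ++ x :: t2)) perm_sym perm_catC perm_cons perm_catC perm_sym => h.
exact/Permutation_cons_app/IH.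
Qed.

Lemma Forall_all (T : eqType) (P : T -> Prop) (p : pred T) (s : seq T) : (forall x, P x -> p x) -> List.Forall P s -> all p s.
by move=> h; elim=> //= x l hx _ ->; rewrite h. Qed.

Lemma prodR_perm (T : Type) (s t : seq T) (f : T -> R) : Permutation s t -> prodR s f = prodR t f.
elim=> //= [x l l' _ ->|x y l|l l' l'' _ -> _ ->] //.
by rewrite -!Rmult_assoc (Rmult_comm (f x)).
Qed.

(** * Assembly for arbitrary lists of times and degrees *)

Section Main.
Variables (rho : nat -> list Z -> R) (F : nat -> (nat -> C) -> C) (c : nat -> R) (d : nat -> nat -> R)
 (pr : nat -> nat -> list Z -> list Z -> R) (n' : nat) (a : nat -> R).
Notation n := n'.+1.
Hypothesis Hrho : forall N, is_prob_GT N (rho N).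
Hypothesis HF : forall N, is_SGF N (rho N) (F N).
Hypothesis Happ : appropriate F c d.
Hypothesis Hpr : pr_spec pr.
Hypothesis Ha1 : (0 < a 1%N)%coqR.
Hypothesis Hmono : forall i, (1 <= i)%coq_nat /\ (i < n)%coq_nat -> (a i <= a i.+1)%coqR.
Hypothesis Han : a n = 1%coqR.

Lemma Hmono_ i : (1 <= i < n)%N -> a i <= a i.+1.
by move=> h; apply/RleP; apply: Hmono; lia. Qed.

Lemma a_neq0 t : (1 <= t <= n)%N -> a t != 0.
elim: t => // t IH h; rewrite gt_eqF //; elim: t {IH} h => [_|t IH h]; first exact/RltP.
apply: lt_le_trans (Hmono_ _); lia.
Qed.

Lemma CvX_contour t1 k1 t2 k2 : (1 <= t1)%coq_nat -> (t1 <= t2)%coq_nat /\ (t2 <= n)%coq_nat -> (1 <= k1)%coq_nat -> (1 <= k2)%coq_nat ->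
 exists e0, (0 < e0)%coqR /\ forall eps, ((0 < eps)%coqR /\ (eps < e0)%coqR) ->
  RtoC (CvX c d n' a (t1, k1) (t2, k2)) = cov_formula a c d t1 k1 t2 k2 eps.
move=> h1 h2 h3 h4.
have [L [_ [_ [_ [_ [hF hG]]]]]] := Happ.
have [|||e0 [e00 he]] := @cov_formulaE c d a t1 k1 t2 k2 _ _ _ hF hG.
- apply: a_neq0; lia.
- apply: a_neq0; lia.
- exact: betaR_sym Hrho HF Happ.
exists e0; split=> // eps heps; rewrite -he // /CvX /kx /= ifT; last lia.
by rewrite !prednK ?/alphaX /= ?(clamp_id (ltR_ Ha1)) //; lia.
Qed.

Lemma Cv_sym x y : CvX c d n' a x y = CvX c d n' a y x.
exact: CvX_sym Hrho HF Happ Hpr (ltR_ Ha1) Hmono_ Han x y. Qed.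

(** The moment calculus wants increasing times; sorting changes neither the product of observables
    nor, the covariance being symmetric, the Wick sum. *)
Theorem joint_moments (J : seq (nat * nat)) :
 List.Forall (fun tk => ((1 <= fst tk)%coq_nat /\ (fst tk <= n)%coq_nat) /\ (1 <= snd tk)%coq_nat) J ->
 exists m : nat -> R,
  (exists N0, forall N, (N0 <= N)%coq_nat ->
    has_sum_on (valid_tuple n a N)
     (fun Lam => Rmult (tuple_prob n a N rho pr Lam)
      (prodR J (fun tk => Xnorm n a N rho pr (fst tk) (snd tk) Lam))) (m N)) /\
  Un_cv m (wick (CvX c d n' a) J).
move=> hJ; pose s := sort (fun x y : nat * nat => x.1 <= y.1)%N J.
have hs : Permutation s J by apply: perm_Permutation; rewrite perm_sort.
have hall : all (fun x : nat * nat => (1 <= x.1 <= n) && (0 < x.2))%N s.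
 by rewrite all_sort; apply: Forall_all hJ => x; lia.
move: (hall); rewrite all_predI => /andP [s_ok s_k].
have s_sorted : sorted (fun x y : nat * nat => x.1 <= y.1)%N s by apply: sort_sorted => x y; lia.
have [m [[N0 h1] h2]] := joint_limit Hrho HF Happ Hpr (ltR_ Ha1) Hmono_ Han s_ok s_k s_sorted.
exists m; split; last by rewrite -(wick_perm _ Cv_sym _ _ hs) -(limval_wick c d n' (ltR_ Ha1) s_sorted).
exists N0 => N hN; apply: hs_ext (h1 N hN) => Lam _; congr Rmult; exact: prodR_perm.
Qed.
End Main.

End Moments.

Require Import Defs.
From Stdlib Require Import Reals ZArith List.
From Coquelicot Require Import Coquelicot.
Import ListNotations.
Open Scope R_scope.

Theorem mainTheorem2
  (rho : nat -> list Z -> R) (F : nat -> (nat -> C) -> C)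
  (c : nat -> R) (d : nat -> nat -> R)
  (pr : nat -> nat -> list Z -> list Z -> R)
  (n : nat) (a : nat -> R)
  (Hrho : forall N, is_prob_GT N (rho N))
  (HF : forall N, is_SGF N (rho N) (F N))
  (Happ : appropriate F c d)
  (Hpr : pr_spec pr)
  (Hn : (1 <= n)%nat)
  (Ha1 : 0 < a 1%nat)
  (Hmono : forall i, (1 <= i < n)%nat -> a i <= a (S i))
  (Han : a n = 1) :
  exists Cv : nat * nat -> nat * nat -> R,
    (* the limiting covariances, given by the double contour integral *)
    (forall t1 k1 t2 k2, (1 <= t1)%nat -> (t1 <= t2 <= n)%nat ->
       (1 <= k1)%nat -> (1 <= k2)%nat ->
       exists e0, 0 < e0 /\ forall eps, 0 < eps < e0 ->
         RtoC (Cv (t1, k1) (t2, k2)) = cov_formula a c d t1 k1 t2 k2 eps) /\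
    (forall tk1 tk2, Cv tk1 tk2 = Cv tk2 tk1) /\
    (* convergence in the sense of moments to the centered Gaussian vector
       with covariance Cv: every joint moment converges to the Wick sum *)
    (forall J : list (nat * nat),
       List.Forall (fun tk => (1 <= fst tk <= n)%nat /\ (1 <= snd tk)%nat) J ->
       exists m : nat -> R,
         (exists N0, forall N, (N0 <= N)%nat ->
            has_sum_on (valid_tuple n a N)
              (fun Lam => tuple_prob n a N rho pr Lam *
                 prodR J (fun tk => Xnorm n a N rho pr (fst tk) (snd tk) Lam))
              (m N)) /\
         Un_cv m (wick Cv J)).
Proof.
destruct n as [|n']; [inversion Hn|]; exists (Moments.CvX c d n' a).
split; [exact (Moments.CvX_contour Hrho HF Happ Ha1 Hmono)|].
split; [exact (Moments.Cv_sym Hrho HF Happ Hpr Ha1 Hmono Han)|].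
exact (Moments.joint_moments Hrho HF Happ Hpr Ha1 Hmono Han).
Qed.
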